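(* Let $\underline{s}$ be an exponentially bounded external address that is not (pre-)periodic, and let $t>t_{\underline{s}}$ be a real number. Then in the family $\{e^z+\kappa:\kappa\in\mathbb{C}\}$ there exists a unique entire function $e^z+\kappa_{\underline{s},t}$ such that its singular value $\kappa_{\underline{s},t}$ escapes on rays, has potential $t$ and has external address $\underline{s}$. Conversely, every function in the family $\{e^z+\kappa:\kappa\in\mathbb{C}\}$ whose singular value escapes on non-(pre-)periodic rays (that is, escapes on rays with an external address that is not (pre-)periodic) is one of these functions $e^z+\kappa_{\underline{s},t}$.
   Context: For a transcendental entire function $f$ let $I(f)=\{z\in\mathbb{C}: f^n(z)\to\infty \text{ as } n\to\infty\}$ be its escaping set. Ray tail: a continuous curve $\gamma:[0,\infty)\to I(f)$ such that for every $n\ge 0$ the restriction $f^n|_\gamma$ is injective with $\lim_{t\to\infty}f^n(\gamma(t))=\infty$, and $f^n(\gamma(t))\to\infty$ uniformly in $t$ as $n\to\infty$. Dynamic ray: a maximal injective curve $\gamma:(0,\infty)\to I(f)$ such that $\gamma|_{[t,\infty)}$ is a ray tail for every $t>0$. A point $z\in I(f)$ escapes on rays if it belongs to a dynamic ray. External address: let $f(z)=e^z+\kappa$ and let $r\in\mathbb{R}$ be such that the half-plane $\mathbb{H}_r=\{\Re z>r\}$ does not contain the singular value $\kappa$. The path-connected components of $f^{-1}(\mathbb{H}_r)$ are called tracts; $T_n$ ($n\in\mathbb{Z}$) denotes the tract contained in the strip between the lines $\Im z=2\pi(n-1/2)$ and $\Im z=2\pi(n+1/2)$. A point $z$ escaping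 on rays has external address $\underline{s}=(s_0s_1s_2\dots)$, $s_n\in\mathbb{Z}$, if each $f^n(z)$ belongs to a ray tail contained in $T_{s_n}$ near $\infty$ (this does not depend on $r$). In general, an external address is a sequence $\underline{s}=(s_0s_1s_2\dots)$ of integers; it is (pre-)periodic if it is periodic or preperiodic under the shift $(s_0s_1s_2\dots)\mapsto(s_1s_2s_3\dots)$. Let $F:\mathbb{R}^+\to\mathbb{R}^+$, $F(t)=e^t-1$. The sequence $\underline{s}$ is exponentially bounded if there exists $t>0$ such that $s_n/F^n(t)\to 0$ as $n\to\infty$; the infimum of such $t$ is denoted $t_{\underline{s}}$. Potential: if $z$ escapes on rays under $f$ with external address $\underline{s}$, then $t$ is the potential of $z$ if $|f^n(z)-F^n(t)-2\pi i s_n|\to 0$ as $n\to\infty$. *)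

(* Defs.v *)
From Stdlib Require Import Reals ZArith.
From Coquelicot Require Import Coquelicot.
Open Scope R_scope.

(** Curves defined on a subinterval of the real line are total functions
    [R -> C] whose values outside that interval are irrelevant: every condition
    below, including continuity ([continuous_on]), is relative to the interval. *)

Definition Cexp (z : C) : C :=
  (RtoC (exp (Re z)) * (cos (Im z), sin (Im z)))%C.

Definition expmap (kappa z : C) : C := (Cexp z + kappa)%C.

Definition iter (f : C -> C) (n : nat) (z : C) : C := Nat.iter n f z.

Definition escaping (f : C -> C) (z : C) : Prop :=
  is_lim_seq (fun n => Cmod (iter f n z)) p_infty.

Definition injective_on (D : R -> Prop) (g : R -> C) : Prop :=
  forall t u : R, D t -> D u -> g t = g u -> t = u.

(** Injectivity of [f^n] restricted to the curve is injectivity of the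
    composite with the parametrisation; [n = 0] says the curve is injective. *)
Definition is_ray_tail (f : C -> C) (gam : R -> C) : Prop :=
  continuous_on (fun t => 0 <= t) gam /\
  (forall t, 0 <= t -> escaping f (gam t)) /\
  (forall n : nat,
     injective_on (fun t => 0 <= t) (fun t => iter f n (gam t)) /\
     is_lim (fun t => Cmod (iter f n (gam t))) p_infty p_infty) /\
  (forall M : R, exists N : nat, forall (n : nat) (t : R),
     (N <= n)%nat -> 0 <= t -> M < Cmod (iter f n (gam t))).

(** The restriction of [gam] to [[t0, +oo)] is shifted to be based at [0]. *)
Definition is_ray_curve (f : C -> C) (gam : R -> C) : Prop :=
  continuous_on (fun t => 0 < t) gam /\
  injective_on (fun t => 0 < t) gam /\
  (forall t, 0 < t -> escaping f (gam t)) /\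
  (forall t0, 0 < t0 -> is_ray_tail f (fun t => gam (t0 + t))).

Definition on_curve (gam : R -> C) (z : C) : Prop :=
  exists t : R, 0 < t /\ gam t = z.

(** Maximality is with respect to inclusion of the traces. *)
Definition is_dynamic_ray (f : C -> C) (gam : R -> C) : Prop :=
  is_ray_curve f gam /\
  forall del : R -> C, is_ray_curve f del ->
    (forall z, on_curve gam z -> on_curve del z) ->
    (forall z, on_curve del z -> on_curve gam z).

Definition escapes_on_rays (f : C -> C) (z : C) : Prop :=
  escaping f z /\
  exists gam : R -> C, is_dynamic_ray f gam /\ on_curve gam z.

Definition path_connected_in (A : C -> Prop) (z w : C) : Prop :=
  exists p : R -> C,
    continuous_on (fun u => 0 <= u <= 1) p /\
    (forall u, 0 <= u <= 1 -> A (p u)) /\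
    p 0 = z /\ p 1 = w.

Definition is_path_component (A T : C -> Prop) : Prop :=
  exists z0 : C, A z0 /\ forall w : C, T w <-> path_connected_in A z0 w.

Definition half_plane (r : R) (z : C) : Prop := r < Re z.

Definition is_tract (kappa : C) (r : R) (T : C -> Prop) : Prop :=
  is_path_component (fun z => half_plane r (expmap kappa z)) T.

Definition strip (n : Z) (z : C) : Prop :=
  2 * PI * (IZR n - 1 / 2) < Im z < 2 * PI * (IZR n + 1 / 2).

(** [T_n]: when [kappa] is not in [half_plane r], exactly one tract [T] lies in
    [strip n]. *)
Definition tract (kappa : C) (r : R) (n : Z) (z : C) : Prop :=
  exists T : C -> Prop,
    is_tract kappa r T /\ (forall w, T w -> strip n w) /\ T z.

Definition address := nat -> Z.

(** The condition does not depend on the choice of the admissible [r]; it is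
    required for all of them. *)
Definition has_address (kappa z : C) (s : address) : Prop :=
  escapes_on_rays (expmap kappa) z /\
  forall r : R, ~ half_plane r kappa ->
  forall n : nat, exists gam : R -> C,
    is_ray_tail (expmap kappa) gam /\
    (exists u : R, 0 <= u /\ gam u = iter (expmap kappa) n z) /\
    (exists t0 : R, 0 <= t0 /\
       forall t, t0 <= t -> tract kappa r (s n) (gam t)).

(** Includes the periodic addresses ([N = 0]). *)
Definition preperiodic (s : address) : Prop :=
  exists N p : nat, (0 < p)%nat /\
    forall n : nat, s (N + p + n)%nat = s (N + n)%nat.

Definition F (t : R) : R := exp t - 1.

Definition dominates (s : address) (t : R) : Prop :=
  0 < t /\ is_lim_seq (fun n => IZR (s n) / Nat.iter n F t) 0.

Definition exponentially_bounded (s : address) : Prop :=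
  exists t : R, dominates s t.

(** [t_s]; finite exactly when [s] is exponentially bounded. *)
Definition min_potential (s : address) : Rbar := Glb_Rbar (dominates s).

Definition has_potential (kappa z : C) (s : address) (t : R) : Prop :=
  has_address kappa z s /\
  is_lim_seq
    (fun n => Cmod (iter (expmap kappa) n z - RtoC (Nat.iter n F t)
                    - 2 * PI * Ci * IZR (s n))%C) 0.

Definition singular_value_escapes (kappa : C) (s : address) (t : R) : Prop :=
  escapes_on_rays (expmap kappa) kappa /\
  has_potential kappa kappa s t /\
  has_address kappa kappa s.

(* Main.v *)
(* Write [f = exp + k]. Near infinity the ray of address [s] is built by pulling
   [F^n(tau) + 2 pi i s_n] back along logarithms ([G]), which is holomorphic in
   [k]; lifting under [exp] extends it to all potentials above [t_s] as long as
   no image ray hits [k], and a hit would make [s] preperiodic ([Ray_exists]).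
   The parameters with potential [t] are thus the [k] lying on their own ray at
   potential [t], locally the zeros of the holomorphic function
   [f^N(k) - G_N(k, t)]. For large [t] the map [k -> G_0(k, t)] is a contraction,
   so there is exactly one such parameter, and it is a simple zero. A unique simple
   zero can be followed when [t] decreases ([zero_continuation], a form of
   Hurwitz's theorem) as long as the solutions stay bounded.

   Boundedness ([param_bound]) is where the topology of rays is used. If [k] were
   huge, all rays [Gam m] with [m] large are nearly horizontal. One descends in [m]:
   [Gam m] has bounded vertical size provided [Gam (m+1)] does not wind around
   [k], which is prevented by a slit from [k] to infinity obtained as a preimage of
   a half line starting at the first point of the orbit of [k] that leaves a thin
   neighbourhood of the real direction.

   Conversely, along any ray tail the points escape at strictly increasing speeds;
   every point but the slowest is so fast compared to the imaginary parts of the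
   orbit that it has a potential ([tail_potential]), and the tail coincides with the
   ray constructed above at these potentials ([tail_follow]). This identifies the
   dynamic ray through [k], its address and its potential. *)

Require Import Defs.
From Stdlib Require Import Reals ZArith Lra Lia Psatz.
From Stdlib Require Import Classical IndefiniteDescription FunctionalExtensionality.
From Coquelicot Require Import Coquelicot.
Open Scope R_scope.

(** The equation [f^N(k) = G_N(k, t)] has spurious zeros: parameters whose first orbit points follow
    other branches of the logarithm. Branches differ by at least [2 * PI] in modulus while rays and
    orbits move continuously, so the genuine solutions [on_ray] are open and closed among the zeros.
    This is why [zero_continuation] carries the solution set as a predicate beside the function.
    Uniqueness alone would not survive a perturbation, since a double zero may split; simplicity has
    to be transported with it. All rays are built on [[a, oo)] with [b < a], where the entries of
    the address are [O(F^n(b))]. Eventually [F^n(a)] exceeds the fourth power of [F^n(b)], and this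
    slack makes all error terms small, uniformly in the potential. The converse direction finds the
    same slack in the ray itself: below each of its points lies a slower one. *)

(** * The complex exponential and the logarithm on the right half plane *)

Definition twopii (k : Z) : C := (0, 2 * PI * IZR k).

Lemma Cext (z w : C) : Re z = Re w -> Im z = Im w -> z = w.
Proof. destruct z, w; simpl; intros; subst; reflexivity. Qed.

Lemma im_le_Cmod (z : C) : Rabs (Im z) <= Cmod z.
Proof.
  eapply Rle_trans; [|apply Rmax_Cmod]. apply Rmax_r.
Qed.

Lemma Cmod_le_ReIm (z : C) : Cmod z <= Rabs (Re z) + Rabs (Im z).
Proof.
  assert (H := Cmod2_alt z).
  assert (H1 := Rabs_pos (Re z)). assert (H2 := Rabs_pos (Im z)).
  rewrite (pow2_abs (Re z)), (pow2_abs (Im z)) in H || idtac.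
  rewrite <- (pow2_abs (Re z)), <- (pow2_abs (Im z)) in H.
  assert (H3 := Cmod_ge_0 z). nra.
Qed.

Lemma Cmod_sub_sym (a b : C) : Cmod (a - b)%C = Cmod (b - a)%C.
Proof. rewrite <- Cmod_opp. f_equal. ring. Qed.

Lemma Cmod_sub_triangle (a b c : C) : Cmod (a - c)%C <= Cmod (a - b)%C + Cmod (b - c)%C.
Proof. replace (a - c)%C with ((a - b) + (b - c))%C by ring. apply Cmod_triangle. Qed.

Lemma Cmod_le_sub (a b : C) : Cmod a <= Cmod b + Cmod (a - b)%C.
Proof. replace a with (b + (a - b))%C at 1 by ring. apply Cmod_triangle. Qed.

Lemma Cmod_sub_le (a b : C) : Cmod (a - b)%C <= Cmod a + Cmod b.
Proof. unfold Cminus. rewrite <- (Cmod_opp b). apply Cmod_triangle. Qed.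

Lemma Cmod_pos_neq (z : C) : 0 < Cmod z -> z <> 0%C.
Proof. intro; now apply Cmod_gt_0. Qed.

Lemma Csub_eq (a b : C) : (a - b = 0)%C -> a = b.
Proof. intro H. replace a with ((a - b) + b)%C by ring. rewrite H. ring. Qed.

Lemma re_minus (a b : C) : Re (a - b)%C = Re a - Re b.
Proof. unfold Cminus. now rewrite re_plus, re_opp. Qed.
Lemma im_minus (a b : C) : Im (a - b)%C = Im a - Im b.
Proof. reflexivity. Qed.
Lemma im_plus (a b : C) : Im (a + b)%C = Im a + Im b.
Proof. reflexivity. Qed.
Lemma im_scal (r : R) (c : C) : Im (r * c)%C = r * Im c.
Proof. rewrite im_mult. simpl. ring. Qed.

Lemma Cmod_lt_small (z : C) : (forall e, 0 < e -> Cmod z <= e) -> z = 0%C.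
Proof.
  intro H. apply Cmod_eq_0. assert (H0 := Cmod_ge_0 z).
  destruct (Req_dec (Cmod z) 0); auto.
  assert (0 < Cmod z / 2) by lra. specialize (H _ H2). lra.
Qed.

Lemma re_Cexp (z : C) : Re (Cexp z) = exp (Re z) * cos (Im z).
Proof. unfold Cexp. rewrite re_scal_l. reflexivity. Qed.
Lemma im_Cexp (z : C) : Im (Cexp z) = exp (Re z) * sin (Im z).
Proof. unfold Cexp. rewrite im_scal. reflexivity. Qed.

Lemma Cexp_plus (z w : C) : Cexp (z + w)%C = (Cexp z * Cexp w)%C.
Proof.
  apply Cext.
  - rewrite re_mult, !re_Cexp, !im_Cexp, re_plus, im_plus, exp_plus, cos_plus. ring.
  - rewrite im_mult, !re_Cexp, !im_Cexp, re_plus, im_plus, exp_plus, sin_plus. ring.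
Qed.

Lemma Cmod_Cexp (z : C) : Cmod (Cexp z) = exp (Re z).
Proof.
  assert (H := Cmod2_alt (Cexp z)). rewrite re_Cexp, im_Cexp in H.
  assert (H1 := sin2_cos2 (Im z)). unfold Rsqr in H1.
  assert (H2 := exp_pos (Re z)). assert (H3 := Cmod_ge_0 (Cexp z)).
  assert (Cmod (Cexp z) ^ 2 = exp (Re z) ^ 2) by (rewrite H; nra).
  nra.
Qed.

Lemma Cexp_neq_0 (z : C) : Cexp z <> 0%C.
Proof. apply Cmod_pos_neq. rewrite Cmod_Cexp. apply exp_pos. Qed.

Lemma Cexp_minus (z w : C) : Cexp (z - w)%C = (Cexp z / Cexp w)%C.
Proof.
  assert (H : Cexp z = (Cexp (z - w) * Cexp w)%C).
  { rewrite <- Cexp_plus. f_equal. ring. }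
  rewrite H. field. apply Cexp_neq_0.
Qed.

Lemma cos_1_2PI (d : R) : cos d = 1 -> exists k : Z, d = 2 * PI * IZR k.
Proof.
  intro H. assert (H1 : cos d = 1 - 2 * sin (d/2) * sin (d/2)).
  { replace d with (2 * (d / 2)) at 1 by field. apply cos_2a_sin. }
  assert (H2 : sin (d/2) = 0) by nra.
  apply sin_eq_0_0 in H2. destruct H2 as [k Hk]. exists k. lra.
Qed.

Lemma Cexp_eq_1 (z : C) : Cexp z = 1%C -> exists k : Z, z = (twopii k).
Proof.
  intro H. assert (Hm := Cmod_Cexp z). rewrite H, Cmod_1 in Hm.
  assert (Hr : Re z = 0).
  { apply exp_inv. rewrite exp_0. auto. }
  assert (H1 := re_Cexp z). rewrite H in H1. simpl in H1. rewrite Hr, exp_0 in H1.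
  destruct (cos_1_2PI (Im z)) as [k Hk]. lra.
  exists k. apply Cext; auto.
Qed.

Lemma Cexp_inj_mod (z w : C) : Cexp z = Cexp w -> exists k : Z, (z - w)%C = (twopii k).
Proof.
  intro H. apply Cexp_eq_1. rewrite Cexp_minus, H. field. apply Cexp_neq_0.
Qed.

Lemma Cexp_2PI (k : Z) : Cexp (twopii k) = 1%C.
Proof.
  assert (Hs : sin (IZR k * PI) = 0) by (apply sin_eq_0_1; exists k; ring).
  assert (Hc : cos (2 * PI * IZR k) = 1).
  { replace (2 * PI * IZR k) with (2 * (IZR k * PI)) by ring. rewrite cos_2a_sin, Hs. ring. }
  assert (Hs2 : sin (2 * PI * IZR k) = 0).
  { replace (2 * PI * IZR k) with (2 * (IZR k * PI)) by ring. rewrite sin_2a, Hs. ring. }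
  apply Cext; rewrite ?re_Cexp, ?im_Cexp; simpl; rewrite exp_0, ?Hc, ?Hs2; ring.
Qed.

Lemma mvt_bound (f f' : R -> R) (a b B : R) : a <= b ->
  (forall x, a <= x <= b -> is_derive f x (f' x)) ->
  (forall x, a <= x <= b -> Rabs (f' x) <= B) ->
  Rabs (f b - f a) <= B * (b - a).
Proof.
  intros Hab Hd HB.
  destruct (MVT_gen f a b f') as [c [Hc Heq]].
  - rewrite Rmin_left, Rmax_right by lra. intros; apply Hd; lra.
  - rewrite Rmin_left, Rmax_right by lra. intros x Hx.
    apply continuity_pt_filterlim. apply (@ex_derive_continuous R_AbsRing R_NormedModule).
    exists (f' x); apply Hd; lra.
  - rewrite Rmin_left, Rmax_right in Hc by lra.
    rewrite Heq, Rabs_mult, (Rabs_pos_eq (b - a)) by lra.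
    apply Rmult_le_compat_r; [lra|auto].
Qed.

(** Integrating over an interval of length at most 1 does not enlarge a bound, so the bound on the
    third derivative is passed down three times and the factorials are given away. *)
Lemma taylor3 (g g1 g2 g3 : R -> R) (B : R) :
  (forall x, is_derive g x (g1 x)) -> (forall x, is_derive g1 x (g2 x)) ->
  (forall x, is_derive g2 x (g3 x)) -> g 0 = 0 -> g1 0 = 0 -> g2 0 = 0 ->
  (forall x, 0 <= x <= 1 -> Rabs (g3 x) <= B) -> Rabs (g 1) <= B.
Proof.
  intros H1 H2 H3 Z Z1 Z2 HB.
  assert (HB0 : 0 <= B). { eapply Rle_trans; [apply Rabs_pos|apply (HB 0); lra]. }
  assert (A2 : forall x, 0 <= x <= 1 -> Rabs (g2 x) <= B).
  { intros x Hx. assert (H := mvt_bound g2 g3 0 x B). rewrite Z2, Rminus_0_r in H.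
    eapply Rle_trans; [apply H; intros; try apply H3; try apply HB; lra|]. nra. }
  assert (A1 : forall x, 0 <= x <= 1 -> Rabs (g1 x) <= B).
  { intros x Hx. assert (H := mvt_bound g1 g2 0 x B). rewrite Z1, Rminus_0_r in H.
    eapply Rle_trans; [apply H; intros; try apply H2; try apply A2; lra|]. nra. }
  assert (H := mvt_bound g g1 0 1 B). rewrite Z, Rminus_0_r in H.
  eapply Rle_trans; [apply H; intros; try apply H1; try apply A1; lra|]. lra.
Qed.

Lemma exp_le3 (x : R) : x <= 1 -> exp x <= 3.
Proof.
  intro H. eapply Rle_trans; [|apply exp_le_3]. destruct H as [H|H].
  left; now apply exp_increasing. right; now rewrite H.
Qed.

Lemma exp_mono (x y : R) : x <= y -> exp x <= exp y.
Proof. intros [H|H]. left; now apply exp_increasing. right; now rewrite H. Qed.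

Lemma Rabs_mul_le (a b A B : R) : Rabs a <= A -> Rabs b <= B -> Rabs (a * b) <= A * B.
Proof. intros. rewrite Rabs_mult. apply Rmult_le_compat; auto using Rabs_pos. Qed.
Lemma Rabs_plus_le (a b A B : R) : Rabs a <= A -> Rabs b <= B -> Rabs (a + b) <= A + B.
Proof. intros. eapply Rle_trans; [apply Rabs_triang|lra]. Qed.
Lemma Rabs_minus_le (a b A B : R) : Rabs a <= A -> Rabs b <= B -> Rabs (a - b) <= A + B.
Proof. intros. unfold Rminus. apply Rabs_plus_le; auto. now rewrite Rabs_Ropp. Qed.

(** Taylor's formula along the segment from 0 to [w], separately for real and imaginary part. Each
    contributes [24 * m ^ 3], the third derivative being estimated termwise with [exp <= 3] on the
    segment. *)
Lemma Cexp_taylor (w : C) : Cmod w <= 1 ->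
  Cmod (Cexp w - 1 - w - w * w / 2)%C <= 48 * Cmod w ^ 3.
Proof.
  intro Hw.
  set (m := Cmod w) in *. set (al := Re w). set (be := Im w).
  assert (Ha : Rabs al <= m) by apply re_le_Cmod.
  assert (Hb : Rabs be <= m) by apply im_le_Cmod.
  assert (Hm : 0 <= m) by apply Cmod_ge_0.
  assert (HE : forall x y, 0 <= x <= 1 -> Rabs y <= 1 -> Rabs (exp (x * al) * y) <= 3).
  { intros x y Hx Hy. replace 3 with (3 * 1) by ring. apply Rabs_mul_le; auto.
    rewrite Rabs_pos_eq by (left; apply exp_pos). apply exp_le3.
    assert (al <= 1) by (revert Ha; unfold Rabs; destruct Rcase_abs; lra). nra. }
  assert (Hc : forall x, Rabs (cos x) <= 1) by (intro; apply Rabs_le; apply COS_bound).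
  assert (Hs : forall x, Rabs (sin x) <= 1) by (intro; apply Rabs_le; apply SIN_bound).
  assert (Haa : Rabs (al * al - be * be) <= 2 * m ^ 2).
  { eapply Rle_trans; [apply Rabs_minus_le; apply Rabs_mul_le; eassumption|]. simpl; lra. }
  assert (Hab : Rabs (2 * al * be) <= 2 * m ^ 2).
  { rewrite Rmult_assoc, Rabs_mult, (Rabs_pos_eq 2) by lra.
    assert (Rabs (al * be) <= m * m) by (now apply Rabs_mul_le). simpl; lra. }
  assert (HR : Rabs (exp al * cos be - 1 - al - (al * al - be * be) / 2) <= 24 * m ^ 3).
  { pose (g := fun x => exp (x * al) * cos (x * be) - 1 - x * al - x * x * (al * al - be * be) / 2).
    replace (exp al * cos be - 1 - al - (al * al - be * be) / 2) with (g 1)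
      by (unfold g; rewrite !Rmult_1_l; field).
    apply (taylor3 g
      (fun x => al * (exp (x * al) * cos (x * be)) - be * (exp (x * al) * sin (x * be)) - al - x * (al * al - be * be))
      (fun x => (al * al - be * be) * (exp (x * al) * cos (x * be)) - (2 * al * be) * (exp (x * al) * sin (x * be)) - (al * al - be * be))
      (fun x => (al * al - be * be) * (al * (exp (x * al) * cos (x * be)) - be * (exp (x * al) * sin (x * be)))
               - (2 * al * be) * (al * (exp (x * al) * sin (x * be)) + be * (exp (x * al) * cos (x * be))))).
    - intro x. unfold g. auto_derive; auto. field.
    - intro x. auto_derive; auto. ring.
    - intro x. auto_derive; auto. ring.
    - unfold g. rewrite !Rmult_0_l, exp_0, cos_0. field.
    - rewrite !Rmult_0_l, exp_0, cos_0, sin_0. ring.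
    - rewrite !Rmult_0_l, exp_0, cos_0, sin_0. ring.
    - intros x Hx.
      replace (24 * m ^ 3) with ((2 * m ^ 2) * (m * 3 + m * 3) + (2 * m ^ 2) * (m * 3 + m * 3)) by ring.
      apply Rabs_minus_le; apply Rabs_mul_le; auto; [apply Rabs_minus_le|apply Rabs_plus_le];
        apply Rabs_mul_le; auto. }
  assert (HI : Rabs (exp al * sin be - be - (2 * al * be) / 2) <= 24 * m ^ 3).
  { pose (g := fun x => exp (x * al) * sin (x * be) - x * be - x * x * (2 * al * be) / 2).
    replace (exp al * sin be - be - (2 * al * be) / 2) with (g 1)
      by (unfold g; rewrite !Rmult_1_l; field).
    apply (taylor3 g
      (fun x => al * (exp (x * al) * sin (x * be)) + be * (exp (x * al) * cos (x * be)) - be - x * (2 * al * be))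
      (fun x => (al * al - be * be) * (exp (x * al) * sin (x * be)) + (2 * al * be) * (exp (x * al) * cos (x * be)) - (2 * al * be))
      (fun x => (al * al - be * be) * (al * (exp (x * al) * sin (x * be)) + be * (exp (x * al) * cos (x * be)))
               + (2 * al * be) * (al * (exp (x * al) * cos (x * be)) - be * (exp (x * al) * sin (x * be))))).
    - intro x. unfold g. auto_derive; auto. field.
    - intro x. auto_derive; auto. ring.
    - intro x. auto_derive; auto. ring.
    - unfold g. rewrite !Rmult_0_l, exp_0, sin_0. field.
    - rewrite !Rmult_0_l, exp_0, cos_0, sin_0. ring.
    - rewrite !Rmult_0_l, exp_0, cos_0, sin_0. ring.
    - intros x Hx.
      replace (24 * m ^ 3) with ((2 * m ^ 2) * (m * 3 + m * 3) + (2 * m ^ 2) * (m * 3 + m * 3)) by ring.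
      apply Rabs_plus_le; apply Rabs_mul_le; auto; [apply Rabs_plus_le|apply Rabs_minus_le];
        apply Rabs_mul_le; auto. }
  eapply Rle_trans; [apply Cmod_le_ReIm|].
  replace (48 * m ^ 3) with (24 * m ^ 3 + 24 * m ^ 3) by ring.
  apply Rplus_le_compat.
  - replace (Re _) with (exp al * cos be - 1 - al - (al * al - be * be) / 2); auto.
    rewrite !re_minus, re_Cexp. fold al be.
    replace (w * w / 2)%C with (/2 * (w * w))%C
      by (apply Cext; simpl; field).
    rewrite <- RtoC_inv by lra. rewrite re_scal_l, re_mult. fold al be. simpl. field.
  - replace (Im _) with (exp al * sin be - be - (2 * al * be) / 2); auto.
    rewrite !im_minus, im_Cexp. fold al be.
    replace (w * w / 2)%C with (/2 * (w * w))%C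
      by (apply Cext; simpl; field).
    rewrite <- RtoC_inv by lra. rewrite im_scal, im_mult. fold al be. simpl. field.
Qed.

Lemma Cexp_lip (w : C) : Cmod w <= 1 -> Cmod (Cexp w - 1)%C <= 50 * Cmod w.
Proof.
  intro Hw. assert (H := Cexp_taylor w Hw). assert (H0 := Cmod_ge_0 w).
  replace (Cexp w - 1)%C with ((Cexp w - 1 - w - w * w / 2) + (w + w * w / 2))%C by ring.
  eapply Rle_trans; [apply Cmod_triangle|].
  assert (Cmod (w + w * w / 2)%C <= Cmod w + Cmod w * Cmod w / 2).
  { eapply Rle_trans; [apply Cmod_triangle|].
    rewrite Cmod_div, Cmod_mult by (intro E; apply RtoC_inj in E; lra).
    rewrite Cmod_R, Rabs_pos_eq by lra. lra. }
  assert (Cmod w ^ 3 <= Cmod w) by (simpl; nra). nra.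
Qed.

(** Principal branch on the right half plane only: elsewhere the arctangent of the quotient is not
    the argument. *)
Definition Clog (w : C) : C := (ln (Cmod w), atan (Im w / Re w)).

Lemma Cmod_pos_re (w : C) : 0 < Re w -> 0 < Cmod w.
Proof. intro H. assert (H1 := re_le_Cmod w). rewrite Rabs_pos_eq in H1; lra. Qed.

Lemma re_Cmod (w : C) : Re w <= Cmod w.
Proof. eapply Rle_trans; [apply Rle_abs|apply re_le_Cmod]. Qed.

Lemma Cexp_Clog (w : C) : 0 < Re w -> Cexp (Clog w) = w.
Proof.
  intro H. assert (Hm := Cmod_pos_re w H). assert (H2 := Cmod2_alt w).
  assert (Hs : sqrt (1 + (Im w / Re w)²) = Cmod w / Re w).
  { apply sqrt_lem_1.
    - unfold Rsqr. assert (0 <= Im w / Re w * (Im w / Re w)) by apply Rle_0_sqr. lra.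
    - apply Rlt_le, Rdiv_lt_0_compat; auto.
    - unfold Rsqr. field_simplify; try lra. rewrite H2. f_equal. }
  apply Cext; rewrite ?re_Cexp, ?im_Cexp; simpl Re; simpl Im; rewrite exp_ln by auto.
  - rewrite cos_atan, Hs. field. split; lra.
  - rewrite sin_atan, Hs. field. split; lra.
Qed.

Lemma im_Clog (w : C) : - (PI / 2) < Im (Clog w) < PI / 2.
Proof. simpl. generalize (atan_bound (Im w / Re w)). lra. Qed.

Lemma re_Clog (w : C) : Re (Clog w) = ln (Cmod w).
Proof. reflexivity. Qed.

Lemma ln_le_sub (x y : R) : 0 < x -> 0 < y -> ln x - ln y <= (x - y) / y.
Proof.
  intros Hx Hy. rewrite <- ln_div by auto.
  assert (H : 0 < x / y) by (now apply Rdiv_lt_0_compat).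
  assert (H1 := exp_ineq1_le (ln (x / y))). rewrite exp_ln in H1 by auto.
  replace ((x - y) / y) with (x / y - 1) by (field; lra). lra.
Qed.

Lemma div_le_compat (a b c d : R) : 0 <= a -> a <= b -> 0 < d -> d <= c -> a / c <= b / d.
Proof.
  intros. unfold Rdiv. apply Rmult_le_compat; auto.
  - left. apply Rinv_0_lt_compat. lra.
  - apply Rinv_le_contravar; auto.
Qed.

Lemma ln_lip (c x y : R) : 0 < c -> c <= x -> c <= y -> Rabs (ln x - ln y) <= Rabs (x - y) / c.
Proof.
  intros Hc Hx Hy. apply Rabs_le.
  assert (H1 := ln_le_sub x y ltac:(lra) ltac:(lra)).
  assert (H2 := ln_le_sub y x ltac:(lra) ltac:(lra)).
  assert (Hp := Rabs_pos (x - y)).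
  assert (forall z u, 0 < c -> c <= u -> z <= Rabs (x - y) -> z / u <= Rabs (x - y) / c).
  { intros z u _ Hu Hz. destruct (Rle_dec 0 z).
    - apply div_le_compat; lra.
    - apply Rle_trans with 0.
      + unfold Rdiv. assert (0 < / u) by (apply Rinv_0_lt_compat; lra). nra.
      + apply Rdiv_le_0_compat; lra. }
  assert ((x - y) / y <= Rabs (x - y) / c) by (apply H; auto; apply Rle_abs).
  assert ((y - x) / x <= Rabs (x - y) / c).
  { apply H; auto. rewrite Rabs_minus_sym. apply Rle_abs. }
  lra.
Qed.

(** Mean value theorem along the segment from [w'] to [w], which stays in the half plane [Re >= c].
    The derivative of the argument is a cross product divided by the squared modulus, and
    Cauchy-Schwarz bounds the cross product. *)
Lemma atan_quot_lip (c : R) (w w' : C) : 0 < c -> c <= Re w -> c <= Re w' ->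
  Rabs (atan (Im w / Re w) - atan (Im w' / Re w')) <= Cmod (w - w')%C / c.
Proof.
  intros Hc H H'.
  set (u := Re w') in *. set (v := Im w') in *. set (d := Re w - u). set (e := Im w - v).
  pose (f := fun x => atan ((v + x * e) / (u + x * d))).
  assert (Hpos : forall x, 0 <= x <= 1 -> c <= u + x * d).
  { intros x Hx. unfold d. nra. }
  assert (HD : Cmod (w - w')%C ^ 2 = d ^ 2 + e ^ 2).
  { rewrite Cmod2_alt, re_minus, im_minus. reflexivity. }
  assert (HD0 := Cmod_ge_0 (w - w')%C). set (D := Cmod (w - w')%C) in *.
  assert (Hmv := mvt_bound f
    (fun x => (e * (u + x * d) - d * (v + x * e)) / ((u + x * d) ^ 2 + (v + x * e) ^ 2)) 0 1 (D / c)).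
  replace (atan (Im w / Re w)) with (f 1).
  2:{ unfold f, d, e. f_equal. f_equal; ring. }
  replace (atan (v / u)) with (f 0).
  2:{ unfold f. f_equal. f_equal; ring. }
  replace (D / c) with (D / c * (1 - 0)) by ring.
  apply Hmv; [lra| |].
  - intros x Hx. specialize (Hpos x Hx). unfold f. auto_derive.
    + lra.
    + unfold Rsqr. field. assert (0 < (u + x * d) ^ 2) by (apply pow_lt; lra). assert (0 <= (v + x * e) ^ 2) by apply pow2_ge_0. repeat split; simpl in *; lra.
  - intros x Hx. specialize (Hpos x Hx).
    set (p := u + x * d) in *. set (q := v + x * e).
    assert (HR : 0 < sqrt (p ^ 2 + q ^ 2)) by (apply sqrt_lt_R0; nra).
    assert (HR2 : sqrt (p ^ 2 + q ^ 2) * sqrt (p ^ 2 + q ^ 2) = p ^ 2 + q ^ 2) by (apply sqrt_sqrt; nra).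
    set (r := sqrt (p ^ 2 + q ^ 2)) in *.
    rewrite <- HR2.
    assert (Hr : c <= r). { assert (p ^ 2 <= r * r) by nra. nra. }
    assert (Hn : Rabs (e * p - d * q) <= D * r).
    { assert ((e * p - d * q) ^ 2 <= (D * r) ^ 2).
      { replace ((D * r) ^ 2) with (D ^ 2 * (r * r)) by ring. rewrite HD, HR2.
        assert (0 <= (e * q + d * p) ^ 2) by apply pow2_ge_0. nra. }
      apply Rabs_le. assert (0 <= D * r) by nra. split; nra. }
    unfold Rdiv at 1. rewrite Rabs_mult, (Rabs_pos_eq (/ (r * r))).
    2:{ left. apply Rinv_0_lt_compat. nra. }
    apply Rle_trans with (D * r * / (r * r)).
    + apply Rmult_le_compat_r; auto. left. apply Rinv_0_lt_compat. nra.
    + replace (D * r * / (r * r)) with (D / r) by (field; lra).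
      apply div_le_compat; lra.
Qed.

Lemma Clog_lip (c : R) (w w' : C) : 0 < c -> c <= Re w -> c <= Re w' ->
  Cmod (Clog w - Clog w')%C <= 2 * Cmod (w - w')%C / c.
Proof.
  intros Hc H H'. eapply Rle_trans; [apply Cmod_le_ReIm|].
  assert (A := atan_quot_lip c w w' Hc H H').
  rewrite re_minus, im_minus. simpl Re. simpl Im.
  assert (c <= Cmod w) by (eapply Rle_trans; [|apply re_Cmod]; auto).
  assert (c <= Cmod w') by (eapply Rle_trans; [|apply re_Cmod]; auto).
  assert (B := ln_lip c (Cmod w) (Cmod w') Hc H0 H1).
  assert (E : Rabs (Cmod w - Cmod w') <= Cmod (w - w')%C).
  { apply Rabs_le. assert (T1 := Cmod_le_sub w w'). assert (T2 := Cmod_le_sub w' w).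
    rewrite (Cmod_sub_sym w' w) in T2. lra. }
  assert (Rabs (Cmod w - Cmod w') / c <= Cmod (w - w')%C / c).
  { apply div_le_compat; auto; try lra. apply Rabs_pos. }
  lra.
Qed.

Lemma Clog_1 : Clog 1 = 0%C.
Proof.
  apply Cext; simpl.
  - rewrite Cmod_1. apply ln_1.
  - unfold Rdiv. rewrite Rmult_0_l. apply atan_0.
Qed.

Lemma Clog_small (u : C) : Cmod u <= 1 / 2 -> Cmod (Clog (1 + u)) <= 4 * Cmod u.
Proof.
  intro H. assert (H1 := re_le_Cmod u). apply Rabs_le_between in H1.
  assert (A := Clog_lip (1/2) (1 + u)%C 1%C).
  rewrite Clog_1 in A. replace (Clog (1 + u) - 0)%C with (Clog (1 + u)) in A by ring.
  replace (1 + u - 1)%C with u in A by ring.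
  assert (Cmod (Clog (1 + u)) <= 2 * Cmod u / (1/2)).
  { apply A; rewrite ?re_plus; simpl; lra. }
  lra.
Qed.

(** [Clog w] has imaginary part below [PI / 2] in modulus, so a window of half-width [3 * PI / 2]
    still keeps the discrepancy below one full period. *)
Lemma Cexp_same_log (z w : C) (s : Z) :
  Cexp z = w -> 0 < Re w -> Rabs (Im z - 2 * PI * IZR s) < 3 * PI / 2 ->
  z = (Clog w + (twopii s))%C.
Proof.
  intros H Hw Hs.
  assert (HE : Cexp z = Cexp (Clog w)) by (rewrite Cexp_Clog; auto).
  destruct (Cexp_inj_mod _ _ HE) as [k Hk].
  assert (Hi := im_Clog w).
  assert (Hz : z = (Clog w + (twopii k))%C).
  { rewrite <- Hk. ring. }
  assert (k = s); [|subst; auto].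
  assert (Him : Im z = Im (Clog w) + 2 * PI * IZR k) by (rewrite Hz at 1; reflexivity).
  apply Rabs_lt_between in Hs. assert (HP := PI_RGT_0).
  assert (A : -1 < IZR k - IZR s < 1) by (split; nra).
  rewrite <- minus_IZR in A. destruct A as [A1 A2].
  apply (lt_IZR (-1)) in A1. apply (lt_IZR _ 1) in A2. lia.
Qed.

(** * Second-order expansions and the maximum principle *)

(** Landau's [O(w^k)] at the origin. Hiding the constants lets remainders be combined by sum,
    product and composition without bookkeeping. *)
Definition Ob (k : nat) (r : C -> C) : Prop :=
  exists K d : R, 0 <= K /\ 0 < d /\ forall w, Cmod w < d -> Cmod (r w) <= K * Cmod w ^ k.

Lemma Ob_ext k r r' : (forall w, r w = r' w) -> Ob k r -> Ob k r'.
Proof. intros E (K & d & HK & Hd & H). exists K, d. repeat split; auto. intros; rewrite <- E; auto. Qed.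

Lemma Ob_ext_loc k r r' d0 : 0 < d0 -> (forall w, Cmod w < d0 -> r w = r' w) -> Ob k r -> Ob k r'.
Proof.
  intros Hd0 E (K & d & HK & Hd & H). exists K, (Rmin d d0). repeat split; auto.
  - now apply Rmin_glb_lt.
  - intros w Hw. rewrite <- E. apply H. eapply Rlt_le_trans; [exact Hw|apply Rmin_l].
    eapply Rlt_le_trans; [exact Hw|apply Rmin_r].
Qed.

Lemma Ob_plus k r s : Ob k r -> Ob k s -> Ob k (fun w => r w + s w)%C.
Proof.
  intros (K & d & HK & Hd & H) (K' & d' & HK' & Hd' & H').
  exists (K + K'), (Rmin d d'). repeat split; [lra|now apply Rmin_glb_lt|].
  intros w Hw. assert (A := Rmin_l d d'). assert (B := Rmin_r d d').
  eapply Rle_trans; [apply Cmod_triangle|]. specialize (H w ltac:(lra)). specialize (H' w ltac:(lra)). lra.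
Qed.

Lemma Ob_mult j k r s : Ob j r -> Ob k s -> Ob (j + k) (fun w => r w * s w)%C.
Proof.
  intros (K & d & HK & Hd & H) (K' & d' & HK' & Hd' & H').
  exists (K * K'), (Rmin d d'). repeat split; [nra|now apply Rmin_glb_lt|].
  intros w Hw. assert (A := Rmin_l d d'). assert (B := Rmin_r d d').
  rewrite Cmod_mult, pow_add.
  replace (K * K' * (Cmod w ^ j * Cmod w ^ k)) with ((K * Cmod w ^ j) * (K' * Cmod w ^ k)) by ring.
  apply Rmult_le_compat; try apply Cmod_ge_0; [apply H|apply H']; lra.
Qed.

Lemma Ob_const (c : C) : Ob 0 (fun _ => c).
Proof. exists (Cmod c), 1. repeat split; [apply Cmod_ge_0|lra|]. intros; simpl; lra. Qed.

Lemma Ob_id : Ob 1 (fun w => w).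
Proof. exists 1, 1. repeat split; try lra. intros; simpl; lra. Qed.

Lemma Ob_scal k c r : Ob k r -> Ob k (fun w => c * r w)%C.
Proof. intro H. apply (Ob_mult 0 k (fun _ => c) r); auto using Ob_const. Qed.

Lemma Ob_weak j k r : (k <= j)%nat -> Ob j r -> Ob k r.
Proof.
  intros Hjk (K & d & HK & Hd & H). exists K, (Rmin d 1). repeat split; [lra|apply Rmin_glb_lt; lra|].
  intros w Hw. assert (A := Rmin_l d 1). assert (B := Rmin_r d 1).
  eapply Rle_trans; [apply H; lra|]. apply Rmult_le_compat_l; auto.
  replace j with (k + (j - k))%nat by lia. rewrite pow_add.
  assert (0 <= Cmod w ^ k) by (apply pow_le, Cmod_ge_0).
  assert (Cmod w ^ (j - k) <= 1).
  { rewrite <- (pow1 (j - k)). apply pow_incr. split; [apply Cmod_ge_0|lra]. }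
  nra.
Qed.

Lemma Ob_comp k r v : Ob k r -> Ob 1 v -> Ob k (fun w => r (v w)).
Proof.
  intros (K & d & HK & Hd & H) (L & d' & HL & Hd' & H').
  exists (K * L ^ k), (Rmin d' (d / (L + 1))). repeat split.
  - apply Rmult_le_pos; auto. now apply pow_le.
  - apply Rmin_glb_lt; auto. apply Rdiv_lt_0_compat; lra.
  - intros w Hw. assert (A := Rmin_l d' (d / (L + 1))). assert (B := Rmin_r d' (d / (L + 1))).
    specialize (H' w ltac:(lra)). rewrite pow_1 in H'. assert (P := Cmod_ge_0 w).
    assert (Cmod w * (L + 1) < d).
    { apply Rmult_lt_reg_r with (/ (L + 1)). apply Rinv_0_lt_compat; lra.
      rewrite Rmult_assoc, Rinv_r by lra. lra. }
    eapply Rle_trans; [apply H; nra|].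
    rewrite Rmult_assoc, <- Rpow_mult_distr. apply Rmult_le_compat_l; auto.
    apply pow_incr. split; auto using Cmod_ge_0.
Qed.

(* Stands for holomorphy: such an expansion at every point is all that the
   maximum principle needs. *)
Definition Hol2 (h : C -> C) (a : C) : Prop :=
  exists c1 c2 : C, Ob 3 (fun w => h (a + w) - h a - c1 * w - c2 * w * w)%C.

Lemma Hol2_ext_loc h g a d : 0 < d -> (forall z, Cmod (z - a)%C < d -> h z = g z) -> Hol2 h a -> Hol2 g a.
Proof.
  intros Hd E (c1 & c2 & H). exists c1, c2. revert H. apply (Ob_ext_loc _ _ _ d); auto.
  intros w Hw. rewrite (E (a + w)%C), (E a); auto.
  - replace (a - a)%C with (RtoC 0) by ring. now rewrite Cmod_0.
  - now replace (a + w - a)%C with w by ring.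
Qed.

Lemma Hol2_ext h g a : (forall z, h z = g z) -> Hol2 h a -> Hol2 g a.
Proof. intro E. apply (Hol2_ext_loc h g a 1); auto; lra. Qed.

Lemma Hol2_const c a : Hol2 (fun _ => c) a.
Proof.
  exists 0%C, 0%C. apply (Ob_ext 3 (fun _ => 0%C)). intros; ring.
  exists 0, 1. repeat split; try lra. intros. rewrite Cmod_0. lra.
Qed.

Lemma Hol2_id a : Hol2 (fun z => z) a.
Proof.
  exists 1%C, 0%C. apply (Ob_ext 3 (fun _ => 0%C)). intros; ring.
  exists 0, 1. repeat split; try lra. intros. rewrite Cmod_0. lra.
Qed.

Lemma Hol2_plus h g a : Hol2 h a -> Hol2 g a -> Hol2 (fun z => h z + g z)%C a.
Proof.
  intros (c1 & c2 & H) (e1 & e2 & G). exists (c1 + e1)%C, (c2 + e2)%C.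
  eapply Ob_ext; [|apply Ob_plus; [exact H|exact G]]. intros; simpl; ring.
Qed.

Lemma Ob_lin c1 c2 : Ob 1 (fun w => c1 * w + c2 * w * w)%C.
Proof.
  apply Ob_plus. apply Ob_scal, Ob_id. apply (Ob_weak 2); auto.
  apply (Ob_mult 1 1 (fun w => c2 * w)%C (fun w => w)); auto using Ob_id, Ob_scal.
Qed.

Lemma Ob_cube c : Ob 3 (fun w => c * w * w * w)%C.
Proof.
  apply (Ob_mult 2 1 (fun w => c * w * w)%C (fun w => w)); auto using Ob_id.
  apply (Ob_mult 1 1 (fun w => c * w)%C (fun w => w)); auto using Ob_id, Ob_scal.
Qed.

Lemma Hol2_diff h a c1 c2 : Ob 3 (fun w => h (a + w) - h a - c1 * w - c2 * w * w)%C ->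
  Ob 1 (fun w => h (a + w) - h a)%C.
Proof.
  intro H. eapply Ob_ext; [|apply Ob_plus; [apply (Ob_lin c1 c2)|apply (Ob_weak 3 1); [lia|exact H]]].
  intros; simpl; ring.
Qed.

Lemma Hol2_lip h a : Hol2 h a -> Ob 1 (fun w => h (a + w) - h a)%C.
Proof. intros (c1 & c2 & H). eapply Hol2_diff; eauto. Qed.

Lemma Hol2_mult h g a : Hol2 h a -> Hol2 g a -> Hol2 (fun z => h z * g z)%C a.
Proof.
  intros (c1 & c2 & H) (e1 & e2 & G).
  exists (c1 * g a + e1 * h a)%C, (c2 * g a + c1 * e1 + e2 * h a)%C.
  assert (Hd := Hol2_diff _ _ _ _ H).
  set (r := fun w => (h (a + w) - h a - c1 * w - c2 * w * w)%C) in *.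
  set (s := fun w => (g (a + w) - g a - e1 * w - e2 * w * w)%C) in *.
  eapply Ob_ext; [|
   apply Ob_plus; [apply Ob_plus; [apply (Ob_scal _ (g a) _ H)|apply (Ob_scal _ (h a) _ G)]|
   apply Ob_plus; [apply (Ob_weak 4 3 _ ltac:(lia)); apply (Ob_mult 1 3 _ _ Hd G)|
   apply Ob_plus; [apply (Ob_weak 4 3 _ ltac:(lia)); apply (Ob_mult 3 1 _ _ H (Ob_lin e1 e2))|
   apply Ob_plus; [apply (Ob_cube (c1 * e2 + c2 * e1))|
     apply (Ob_weak 4 3 _ ltac:(lia)); apply (Ob_mult 3 1 _ _ (Ob_cube (c2 * e2)) Ob_id)]]]]].
  intro w. unfold r, s. ring.
Qed.

Lemma Hol2_scal c h a : Hol2 h a -> Hol2 (fun z => c * h z)%C a.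
Proof. intro. apply Hol2_mult; auto using Hol2_const. Qed.

Lemma Hol2_minus h g a : Hol2 h a -> Hol2 g a -> Hol2 (fun z => h z - g z)%C a.
Proof.
  intros H G. apply (Hol2_ext (fun z => h z + (-(1)) * g z)%C). intros; ring.
  apply Hol2_plus; auto using Hol2_scal.
Qed.

Lemma Hol2_comp g h a : Hol2 h a -> Hol2 g (h a) -> Hol2 (fun z => g (h z)) a.
Proof.
  intros (c1 & c2 & H) (e1 & e2 & G).
  exists (e1 * c1)%C, (e1 * c2 + e2 * c1 * c1)%C.
  assert (Hd := Hol2_diff _ _ _ _ H).
  set (v := fun w => (h (a + w) - h a)%C) in *.
  set (r := fun w => (h (a + w) - h a - c1 * w - c2 * w * w)%C) in *.
  (* The quadratic term of [g] leaves [v^2 - (c1 w)^2], which factors; [v - c1 w] is of order 2 and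
     the other factor of order 1. *)
  assert (H2 : Ob 2 (fun w => v w - c1 * w)%C).
  { eapply Ob_ext; [|apply Ob_plus; [apply (Ob_mult 1 1 _ _ (Ob_scal _ c2 _ Ob_id) Ob_id)|apply (Ob_weak 3 2 _ ltac:(lia) H)]].
    intro w. unfold r, v. ring. }
  eapply Ob_ext; [|apply Ob_plus; [apply (Ob_comp _ _ _ G Hd)|
    apply Ob_plus; [apply (Ob_scal _ e1 _ H)|
    apply (Ob_scal _ e2); apply (Ob_mult 2 1 _ _ H2 (Ob_plus _ _ _ Hd (Ob_scal _ c1 _ Ob_id)))]]].
  intro w. simpl. unfold r, v. replace (h a + (h (a + w) - h a))%C with (h (a + w)%C) by ring. ring.
Qed.

Lemma Hol2_Cexp a : Hol2 Cexp a.
Proof.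
  exists (Cexp a), (Cexp a / 2)%C.
  apply (Ob_ext 3 (fun w => Cexp a * (Cexp w - 1 - w - w * w / 2))%C).
  - intro w. rewrite Cexp_plus. field.
  - apply Ob_scal. exists 48, 1. repeat split; try lra. intros. apply Cexp_taylor. lra.
Qed.

Lemma Ob_inv (a : C) : a <> 0%C -> Ob 0 (fun w => / (a + w))%C.
Proof.
  intro Ha. apply Cmod_gt_0 in Ha. exists (2 / Cmod a), (Cmod a / 2). repeat split; [|lra|].
  - left. apply Rdiv_lt_0_compat; lra.
  - intros w Hw. assert (A := Cmod_le_sub a (a + w)%C). replace (a - (a + w))%C with (- w)%C in A by ring.
    rewrite Cmod_opp in A. rewrite Cmod_inv.
    + simpl. rewrite Rmult_1_r. replace (2 / Cmod a) with (/ (Cmod a / 2)) by (field; lra).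
      apply Rinv_le_contravar; lra.
    + apply Cmod_pos_neq. lra.
Qed.

Lemma Hol2_inv (a : C) : a <> 0%C -> Hol2 (fun z => / z)%C a.
Proof.
  intro Ha. exists (- / (a * a))%C, (/ (a * a * a))%C.
  assert (Ha' := Ha). apply Cmod_gt_0 in Ha'.
  apply (Ob_ext_loc 3 (fun w => (- / (a * a * a)) * w * w * w * / (a + w))%C) with (d0 := Cmod a).
  - auto.
  - intros w Hw. field. repeat split; auto. intro E.
    assert (w = - a)%C. { replace w with ((a + w) - a)%C by ring. rewrite E. ring. }
    subst w. rewrite Cmod_opp in Hw. lra.
  - apply (Ob_mult 3 0); auto using Ob_inv, Ob_cube.
Qed.

(** The expansion is bootstrapped from that of [exp]. The increment [v] of the logarithm satisfies
    [exp v = 1 + w / a] and is [O(w)] by [Clog_lip]; solving for [v] gives [v = w / a + O(w^2)], and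
    inserting this once more gives order 3. *)
Lemma Hol2_Clog a : 0 < Re a -> Hol2 Clog a.
Proof.
  intro Ha. assert (Hn : a <> 0%C) by (apply Cmod_pos_neq, Cmod_pos_re; auto).
  exists (/ a)%C, (- / (2 * a * a))%C.
  set (v := fun w => (Clog (a + w) - Clog a)%C).
  assert (Hre : forall w, Cmod w < Re a / 2 -> Re a / 2 <= Re (a + w)%C).
  { intros w Hw. rewrite re_plus. assert (H := re_le_Cmod w). apply Rabs_le_between in H. lra. }
  assert (V1 : Ob 1 v).
  { exists (4 / Re a), (Re a / 2). repeat split.
    - left; apply Rdiv_lt_0_compat; lra.
    - lra.
    - intros w Hw. unfold v. eapply Rle_trans; [apply (Clog_lip (Re a / 2))|]; try lra; auto.
      replace (a + w - a)%C with w by ring. right. field. lra. }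
  assert (E3 : Ob 3 (fun w => Cexp w - 1 - w - w * w / 2)%C).
  { exists 48, 1. repeat split; try lra. intros. apply Cexp_taylor. lra. }
  assert (E3v := Ob_comp _ _ _ E3 V1).
  assert (Hexp : forall w, Cmod w < Re a / 2 -> Cexp (v w) = (1 + w / a)%C).
  { intros w Hw. unfold v. rewrite Cexp_minus, !Cexp_Clog; auto. field; auto. specialize (Hre w Hw). lra. }
  assert (V2 : Ob 2 (fun w => v w - / a * w)%C).
  { apply (Ob_ext_loc 2 (fun w => (-/2 * (v w * v w) + - (1) * (Cexp (v w) - 1 - v w - v w * v w / 2)))%C) with (d0 := Re a / 2).
    - lra.
    - intros w Hw. rewrite Hexp by auto. field. auto.
    - apply Ob_plus. apply Ob_scal. apply (Ob_mult 1 1); auto. apply Ob_scal, (Ob_weak 3 2); auto. }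
  apply (Ob_ext_loc 3 (fun w => (-/2 * ((v w - / a * w) * (v w + / a * w)) + - (1) * (Cexp (v w) - 1 - v w - v w * v w / 2)))%C) with (d0 := Re a / 2).
  - lra.
  - intros w Hw. rewrite Hexp by auto. unfold v. field. auto.
  - apply Ob_plus. apply Ob_scal. apply (Ob_mult 2 1); auto. apply Ob_plus; auto. apply Ob_scal, Ob_id.
    apply Ob_scal; auto.
Qed.

Lemma Hol2_div h g a : Hol2 h a -> Hol2 g a -> g a <> 0%C -> Hol2 (fun z => h z / g z)%C a.
Proof. intros. apply Hol2_mult; auto. apply (Hol2_comp (fun z => / z)%C); auto using Hol2_inv. Qed.

Lemma Hol2_pow h n a : Hol2 h a -> Hol2 (fun z => h z ^ n)%C a.
Proof. intro H. induction n; simpl. apply Hol2_const. now apply Hol2_mult. Qed.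

Definition Ccont (h : C -> C) (a : C) : Prop :=
  forall e, 0 < e -> exists d, 0 < d /\ forall z, Cmod (z - a)%C < d -> Cmod (h z - h a)%C < e.

Lemma Hol2_cont h a : Hol2 h a -> Ccont h a.
Proof.
  intros H e He. destruct (Hol2_lip _ _ H) as (K & d & HK & Hd & A).
  exists (Rmin d (e / (K + 1))). split.
  - apply Rmin_glb_lt; auto. apply Rdiv_lt_0_compat; lra.
  - intros z Hz. assert (B := Rmin_l d (e / (K + 1))). assert (D := Rmin_r d (e / (K + 1))).
    specialize (A (z - a)%C ltac:(lra)). replace (a + (z - a))%C with z in A by ring.
    rewrite pow_1 in A. assert (P := Cmod_ge_0 (z - a)%C).
    assert (Cmod (z - a)%C * (K + 1) < e).
    { apply Rmult_lt_reg_r with (/ (K + 1)). apply Rinv_0_lt_compat; lra.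
      rewrite Rmult_assoc, Rinv_r by lra. lra. }
    nra.
Qed.

(** Subsequences are recorded by [n <= phi n] instead of strict monotonicity, which still sends
    tails to tails and is stable under composition. *)
Lemma bw_R (u : nat -> R) (B : R) : (forall n, Rabs (u n) <= B) ->
  exists (phi : nat -> nat) (l : R), (forall n, (n <= phi n)%nat) /\
    forall e, 0 < e -> exists N, forall n, (N <= n)%nat -> Rabs (u (phi n) - l) < e.
Proof.
  intro H. destruct (Bolzano_Weierstrass u (fun x => -B <= x <= B)) as [l Hl].
  - apply compact_P3.
  - intro n. apply Rabs_le_between. auto.
  - assert (A : forall n, exists p, (n <= p)%nat /\ Rabs (u p - l) < / (INR n + 1)).
    { intro n. assert (Hp : 0 < / (INR n + 1)) by (apply Rinv_0_lt_compat; generalize (pos_INR n); lra).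
      apply (Hl (fun x => Rabs (x - l) < / (INR n + 1)) n).
      exists (mkposreal _ Hp). intros x Hx. exact Hx. }
    apply functional_choice in A. destruct A as [phi Hphi].
    exists phi, l. split. apply Hphi.
    intros e He. destruct (archimed_cor1 e He) as [N [HN HN0]].
    exists N. intros n Hn. eapply Rlt_trans; [apply Hphi|]. eapply Rle_lt_trans; [|exact HN].
    apply Rinv_le_contravar. apply lt_0_INR; lia. apply le_INR in Hn. lra.
Qed.

Definition Ccv (u : nat -> C) (l : C) : Prop :=
  forall e, 0 < e -> exists N, forall n, (N <= n)%nat -> Cmod (u n - l)%C < e.

Lemma bw_C (u : nat -> C) (B : R) : (forall n, Cmod (u n) <= B) ->
  exists (phi : nat -> nat) (l : C), (forall n, (n <= phi n)%nat) /\ Ccv (fun n => u (phi n)) l.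
Proof.
  intro H.
  destruct (bw_R (fun n => Re (u n)) B) as (p & x & Hp & Hx).
  { intro n. eapply Rle_trans; [apply re_le_Cmod|auto]. }
  destruct (bw_R (fun n => Im (u (p n))) B) as (q & y & Hq & Hy).
  { intro n. eapply Rle_trans; [apply im_le_Cmod|auto]. }
  exists (fun n => p (q n)), (x, y). split.
  - intro n. specialize (Hp (q n)). specialize (Hq n). lia.
  - intros e He. destruct (Hx (e/2) ltac:(lra)) as [N1 H1]. destruct (Hy (e/2) ltac:(lra)) as [N2 H2].
    exists (N1 + N2)%nat. intros n Hn.
    eapply Rle_lt_trans; [apply Cmod_le_ReIm|]. rewrite re_minus, im_minus. simpl Re at 2; simpl Im at 2.
    assert (A := Hq n). specialize (H1 (q n) ltac:(lia)). specialize (H2 n ltac:(lia)). simpl in *. lra.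
Qed.

Lemma Ccv_sub u l phi : (forall n, (n <= phi n)%nat) -> Ccv u l -> Ccv (fun n => u (phi n)) l.
Proof. intros Hp H e He. destruct (H e He) as [N HN]. exists N. intros n Hn. apply HN. specialize (Hp n). lia. Qed.

Lemma Ccv_mod_le u l B : Ccv u l -> (forall n, Cmod (u n) <= B) -> Cmod l <= B.
Proof.
  intros H HB. apply Rnot_lt_le. intro A. destruct (H (Cmod l - B) ltac:(lra)) as [N HN].
  specialize (HN N (Nat.le_refl N)). specialize (HB N). assert (T := Cmod_le_sub l (u N)). rewrite Cmod_sub_sym in T. lra.
Qed.

Lemma Ccv_const_sub u l a : Ccv u l -> Ccv (fun n => u n - a)%C (l - a)%C.
Proof.
  intros H e He. destruct (H e He) as [N HN]. exists N. intros n Hn.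
  replace (u n - a - (l - a))%C with (u n - l)%C by ring. auto.
Qed.

Lemma disc_max (a : C) (r : R) (phi : C -> R) : 0 <= r ->
  (forall z, Cmod (z - a)%C <= r -> forall e, 0 < e -> exists d, 0 < d /\
     forall w, Cmod (w - a)%C <= r -> Cmod (w - z)%C < d -> Rabs (phi w - phi z) < e) ->
  exists z0, Cmod (z0 - a)%C <= r /\ forall z, Cmod (z - a)%C <= r -> phi z <= phi z0.
Proof.
  intros Hr Hc.
  assert (Hbd : forall u : nat -> C, (forall n, Cmod (u n - a)%C <= r) ->
     exists (p : nat -> nat) l, (forall n, (n <= p n)%nat) /\ Ccv (fun n => u (p n)) l /\ Cmod (l - a)%C <= r).
  { intros u Hu. destruct (bw_C u (r + Cmod a)) as (p & l & Hp & Hl).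
    { intro n. specialize (Hu n). assert (T := Cmod_le_sub (u n) a). lra. }
    exists p, l. repeat split; auto.
    apply (Ccv_mod_le (fun n => u (p n) - a)%C); auto using Ccv_const_sub. }
  set (E := fun y => exists z, Cmod (z - a)%C <= r /\ y = phi z).
  assert (Ha0 : Cmod (a - a)%C <= r) by (replace (a - a)%C with (RtoC 0) by ring; rewrite Cmod_0; auto).
  assert (HB : bound E).
  { apply NNPP. intro NB.
    assert (A : forall n : nat, exists z, Cmod (z - a)%C <= r /\ INR n < phi z).
    { intro n. apply NNPP. intro Q. apply NB. exists (INR n). intros y [z [Hz Hy]]. subst y.
      apply Rnot_lt_le. intro L. apply Q. eauto. }
    apply functional_choice in A. destruct A as [u Hu].
    destruct (Hbd u) as (p & l & Hp & Hl & Hla). { intro; apply Hu. }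
    destruct (Hc l Hla 1 Rlt_0_1) as (d & Hd & Hcd).
    destruct (Hl d Hd) as [N HN].
    destruct (nfloor_ex (Rabs (phi l) + 2)) as [m Hm]. { generalize (Rabs_pos (phi l)); lra. }
    set (n := (N + m + 1)%nat).
    specialize (Hcd (u (p n)) (proj1 (Hu (p n))) (HN n ltac:(lia))).
    assert (B := proj2 (Hu (p n))). assert (D := Hp n). apply le_INR in D.
    unfold n in D at 1. rewrite !plus_INR in D. simpl in D. assert (Q := pos_INR N).
    apply Rabs_lt_between in Hcd. assert (S := Rle_abs (phi l)). lra. }
  destruct (completeness E HB) as [M [HM1 HM2]]. { exists (phi a), a. auto. }
  assert (A : forall n : nat, exists z, Cmod (z - a)%C <= r /\ M - / (INR n + 1) < phi z).
  { intro n. apply NNPP. intro Q.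
    assert (Hp : 0 < / (INR n + 1)) by (apply Rinv_0_lt_compat; generalize (pos_INR n); lra).
    assert (M <= M - / (INR n + 1)); [|lra]. apply HM2.
    intros y [z [Hz Hy]]. subst y. apply Rnot_lt_le. intro L. apply Q. eauto. }
  apply functional_choice in A. destruct A as [u Hu].
  destruct (Hbd u) as (p & l & Hp & Hl & Hla). { intro; apply Hu. }
  exists l. split; auto. intros z Hz. apply Rle_trans with M. { apply HM1. exists z; auto. }
  apply Rnot_lt_le. intro L. set (e := (M - phi l) / 2).
  destruct (Hc l Hla e ltac:(unfold e; lra)) as (d & Hd & Hcd).
  destruct (Hl d Hd) as [N HN]. destruct (archimed_cor1 e ltac:(unfold e; lra)) as [m [Hm Hm0]].
  set (n := (N + m)%nat).
  specialize (Hcd (u (p n)) (proj1 (Hu (p n))) (HN n ltac:(lia))).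
  assert (B := proj2 (Hu (p n))). assert (D := Hp n).
  assert (/ (INR (p n) + 1) <= / INR m).
  { apply Rinv_le_contravar. apply lt_0_INR; lia. assert (INR m <= INR (p n)) by (apply le_INR; lia). lra. }
  apply Rabs_lt_between in Hcd. unfold e in *. lra.
Qed.

Lemma Cmod_cont_abs (h : C -> C) a : Ccont h a ->
  forall e, 0 < e -> exists d, 0 < d /\ forall z, Cmod (z - a)%C < d -> Rabs (Cmod (h z) - Cmod (h a)) < e.
Proof.
  intros H e He. destruct (H e He) as (d & Hd & A). exists d. split; auto. intros z Hz. specialize (A z Hz).
  assert (T1 := Cmod_le_sub (h z) (h a)). assert (T2 := Cmod_le_sub (h a) (h z)).
  rewrite (Cmod_sub_sym (h a)) in T2. apply Rabs_lt_between. lra.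
Qed.

Lemma Cmod_sq_lower (a b : C) :
  Cmod a ^ 2 + 2 * (Re a * (Re b - Re a) + Im a * (Im b - Im a)) <= Cmod b ^ 2.
Proof.
  rewrite !Cmod2_alt. assert (A := pow2_ge_0 (Re b - Re a)). assert (B := pow2_ge_0 (Im b - Im a)). simpl in *. lra.
Qed.

Lemma Cinner_le (a b : C) : - (Cmod a * Cmod b) <= Re a * Re b + Im a * Im b.
Proof.
  assert (H := re_le_Cmod (Cconj a * b)%C). rewrite Cmod_mult, Cmod_conj, re_mult in H.
  apply Rabs_le_between in H. simpl in H. change (fst a) with (Re a) in H. change (snd a) with (Im a) in H.
  change (Re (Cconj a)) with (Re a) in H. lra.
Qed.

Lemma Cmod_translate_sum (z : C) (x : R) :
  Cmod (z + x)%C ^ 2 + Cmod (z + - x)%C ^ 2 + Cmod (z + x * Ci)%C ^ 2 + Cmod (z + - x * Ci)%C ^ 2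
  = 4 * Cmod z ^ 2 + 4 * x ^ 2.
Proof. rewrite !Cmod2_alt. destruct z. unfold Re, Im. simpl. ring. Qed.

(* [z -> |h z|^2 + eps |z-a|^2] has no interior maximum: averaging over four
   points [z + i^k x] kills the terms of order 1 and 2 of [h]. *)
Lemma max_principle (h : C -> C) (a : C) (r M : R) : 0 < r -> 0 <= M ->
  (forall z, Cmod (z - a)%C <= r -> Ccont h z) ->
  (forall z, Cmod (z - a)%C < r -> Hol2 h z \/ h z = 0%C) ->
  (forall z, Cmod (z - a)%C = r -> Cmod (h z) <= M) ->
  forall z, Cmod (z - a)%C <= r -> Cmod (h z) <= M.
Proof.
  intros Hr HM Hc Hh Hb z1 Hz1. apply Rnot_lt_le. intro L.
  set (m := Cmod (h z1)) in *.
  (* On the disc the added term [ep * |z - a|^2] is at most half of the supposed excess [m^2 - M^2],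
     so the maximum of the perturbed function cannot lie on the circle. *)
  set (ep := (m ^ 2 - M ^ 2) / (2 * r ^ 2)).
  assert (Hep : 0 < ep). { unfold ep. apply Rdiv_lt_0_compat; nra. }
  assert (Her : ep * r ^ 2 = (m ^ 2 - M ^ 2) / 2) by (unfold ep; field; nra).
  destruct (disc_max a r (fun z => Cmod (h z) ^ 2 + ep * Cmod (z - a)%C ^ 2)) as (z0 & Hz0 & Hmax).
  - lra.
  - intros z Hz e He.
    set (A := Cmod (h z)). assert (HA : 0 <= A) by apply Cmod_ge_0.
    set (e1 := Rmin 1 (e / (2 * (2 * A + 1)))).
    assert (He1 : 0 < e1). { apply Rmin_glb_lt; [lra|]. apply Rdiv_lt_0_compat; lra. }
    assert (He1a : e1 <= 1) by apply Rmin_l.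
    assert (He1b : e1 * (2 * A + 1) <= e / 2).
    { assert (H := Rmin_r 1 (e / (2 * (2 * A + 1)))). fold e1 in H.
      apply Rmult_le_compat_r with (r := 2 * A + 1) in H; [|lra].
      replace (e / (2 * (2 * A + 1)) * (2 * A + 1)) with (e / 2) in H by (field; lra). lra. }
    destruct (Cmod_cont_abs h z (Hc z Hz) e1 He1) as (d & Hd & Hdd).
    set (d2 := e / (4 * ep * (r + 1))).
    assert (Hd2 : 0 < d2) by (apply Rdiv_lt_0_compat; nra).
    exists (Rmin d d2). split. now apply Rmin_glb_lt.
    intros w Hw Hwz. assert (Q1 := Rmin_l d d2). assert (Q2 := Rmin_r d d2).
    specialize (Hdd w ltac:(lra)). fold A in Hdd. apply Rabs_lt_between in Hdd.
    set (D := Cmod (w - z)%C) in *.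
    assert (T1 := Cmod_sub_triangle w z a). assert (T2 := Cmod_sub_triangle z w a).
    rewrite (Cmod_sub_sym z w) in T2. fold D in T1, T2.
    assert (P1 := Cmod_ge_0 (w - a)%C). assert (P2 := Cmod_ge_0 (z - a)%C).
    set (X := Cmod (w - a)%C) in *. set (Y := Cmod (z - a)%C) in *.
    set (U := Cmod (h w)) in *. assert (HU : 0 <= U) by apply Cmod_ge_0.
    assert (Hd2' : ep * d2 * (2 * (r+1)) = e / 2) by (unfold d2; field; lra).
    assert (I1 : Rabs (U ^ 2 - A ^ 2) < e / 2).
    { replace (U ^ 2 - A ^ 2) with ((U - A) * (U + A)) by ring. rewrite Rabs_mult.
      rewrite (Rabs_pos_eq (U + A)) by lra.
      assert (Rabs (U - A) < e1) by (apply Rabs_lt_between; lra).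
      assert (0 <= Rabs (U - A)) by apply Rabs_pos. nra. }
    assert (I2 : Rabs (ep * X ^ 2 - ep * Y ^ 2) <= e / 2).
    { replace (ep * X ^ 2 - ep * Y ^ 2) with (ep * ((X - Y) * (X + Y))) by ring.
      rewrite !Rabs_mult, (Rabs_pos_eq ep), (Rabs_pos_eq (X + Y)) by lra.
      assert (Rabs (X - Y) <= d2) by (apply Rabs_le; lra).
      assert (0 <= Rabs (X - Y)) by apply Rabs_pos.
      rewrite <- Hd2'. assert (Rabs (X - Y) * (X + Y) <= d2 * (2 * (r + 1))) by nra. nra. }
    replace (U ^ 2 + ep * X ^ 2 - (A ^ 2 + ep * Y ^ 2)) with ((U ^ 2 - A ^ 2) + (ep * X ^ 2 - ep * Y ^ 2)) by ring.
    eapply Rle_lt_trans; [apply Rabs_triang|]. lra.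
  - simpl in Hmax. assert (H1 := Hmax z1 Hz1). fold m in H1.
    assert (P0 := Cmod_ge_0 (z0 - a)%C). assert (Pm : 0 <= m) by apply Cmod_ge_0.
    assert (Q1 : 0 <= ep * (Cmod (z1 - a)%C * (Cmod (z1 - a)%C * 1))).
    { assert (0 <= Cmod (z1 - a)%C * (Cmod (z1 - a)%C * 1)) by (generalize (Cmod_ge_0 (z1 - a)%C); nra). nra. }
    assert (Q0 : ep * (Cmod (z0 - a)%C * (Cmod (z0 - a)%C * 1)) <= ep * r ^ 2).
    { apply Rmult_le_compat_l; [lra|]. nra. }
    assert (Ph := Cmod_ge_0 (h z0)).
    destruct (Rle_lt_or_eq_dec _ _ Hz0) as [Hi|He].
    2:{ specialize (Hb z0 He). nra. }
    destruct (Hh z0 Hi) as [Hol|Hz].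
    2:{ rewrite Hz, Cmod_0 in H1. nra. }
    destruct Hol as (c1 & c2 & K & d & HK & Hd & HR).
    set (h0 := h z0) in *. set (D := r - Cmod (z0 - a)%C).
    (* Summed over the four points, the remainders of order 3 contribute at most [8 |h0| K x^3]
       while the added term gains exactly [4 ep x^2]; this [x] makes the gain win. *)
    set (x := Rmin (d / 2) (Rmin D (ep / (4 * Cmod h0 * K + 1)))).
    assert (HKK : 0 < 4 * Cmod h0 * K + 1) by nra.
    assert (Hx : 0 < x).
    { unfold x. apply Rmin_glb_lt; [lra|]. apply Rmin_glb_lt; [unfold D; lra|]. apply Rdiv_lt_0_compat; lra. }
    assert (Hxd : x < d). { unfold x. eapply Rle_lt_trans; [apply Rmin_l|lra]. }
    assert (HxD : x <= D). { unfold x. eapply Rle_trans; [apply Rmin_r|apply Rmin_l]. }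
    assert (Hxe : x * (4 * Cmod h0 * K + 1) <= ep).
    { assert (x <= ep / (4 * Cmod h0 * K + 1)) by (unfold x; eapply Rle_trans; [apply Rmin_r|apply Rmin_r]).
      apply Rmult_le_compat_r with (r := 4 * Cmod h0 * K + 1) in H; [|lra].
      replace (ep / (4 * Cmod h0 * K + 1) * (4 * Cmod h0 * K + 1)) with ep in H by (field; lra). lra. }
    set (w1 := RtoC x). set (w2 := (- x)%C : C). set (w3 := (x * Ci)%C). set (w4 := (- x * Ci)%C).
    assert (M1 : Cmod w1 = x) by (unfold w1; rewrite Cmod_R, Rabs_pos_eq; lra).
    assert (M2 : Cmod w2 = x) by (unfold w2; rewrite Cmod_opp; exact M1).
    assert (M3 : Cmod w3 = x) by (unfold w3; rewrite Cmod_mult, Cmod_Ci, Rmult_1_r; exact M1).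
    assert (M4 : Cmod w4 = x) by (unfold w4; rewrite Cmod_mult, Cmod_Ci, Rmult_1_r; exact M2).
    assert (HX : forall w, Cmod w = x -> Cmod (h (z0 + w)%C) ^ 2 + ep * Cmod ((z0 - a) + w)%C ^ 2
                 <= Cmod h0 ^ 2 + ep * Cmod (z0 - a)%C ^ 2).
    { intros w Hw. replace (z0 - a + w)%C with (z0 + w - a)%C by ring. apply Hmax.
      replace (z0 + w - a)%C with ((z0 - a) + w)%C by ring. eapply Rle_trans; [apply Cmod_triangle|].
      rewrite Hw. unfold D in HxD. lra. }
    assert (X1 := HX w1 M1). assert (X2 := HX w2 M2). assert (X3 := HX w3 M3). assert (X4 := HX w4 M4).
    assert (R1 := HR w1 ltac:(lra)). assert (R2 := HR w2 ltac:(lra)).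
    assert (R3 := HR w3 ltac:(lra)). assert (R4 := HR w4 ltac:(lra)).
    rewrite M1 in R1. rewrite M2 in R2. rewrite M3 in R3. rewrite M4 in R4.
    assert (L1 := Cmod_sq_lower h0 (h (z0 + w1)%C)). assert (L2 := Cmod_sq_lower h0 (h (z0 + w2)%C)).
    assert (L3 := Cmod_sq_lower h0 (h (z0 + w3)%C)). assert (L4 := Cmod_sq_lower h0 (h (z0 + w4)%C)).
    set (h1 := h (z0 + w1)%C) in *. set (h2 := h (z0 + w2)%C) in *.
    set (h3 := h (z0 + w3)%C) in *. set (h4 := h (z0 + w4)%C) in *.
    set (S := (h1 + h2 + h3 + h4 - 4 * h0)%C).
    assert (HS : Cmod S <= 4 * (K * x ^ 3)).
    { replace S with ((h1 - h0 - c1 * w1 - c2 * w1 * w1) + (h2 - h0 - c1 * w2 - c2 * w2 * w2)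
        + ((h3 - h0 - c1 * w3 - c2 * w3 * w3) + (h4 - h0 - c1 * w4 - c2 * w4 * w4)))%C.
      - eapply Rle_trans; [apply Cmod_triangle|].
        assert (T1 := Cmod_triangle (h1 - h0 - c1 * w1 - c2 * w1 * w1)%C (h2 - h0 - c1 * w2 - c2 * w2 * w2)%C).
        assert (T2 := Cmod_triangle (h3 - h0 - c1 * w3 - c2 * w3 * w3)%C (h4 - h0 - c1 * w4 - c2 * w4 * w4)%C).
        lra.
      - unfold S, w1, w2, w3, w4. apply Cext; simpl; ring. }
    assert (HI := Cinner_le h0 S).
    assert (HSr : Re S = Re h1 + Re h2 + Re h3 + Re h4 - 4 * Re h0).
    { unfold S. rewrite re_minus, !re_plus, re_scal_l. reflexivity. }
    assert (HSi : Im S = Im h1 + Im h2 + Im h3 + Im h4 - 4 * Im h0).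
    { unfold S. rewrite im_minus, !im_plus, im_scal. reflexivity. }
    rewrite HSr, HSi in HI.
    assert (HT := Cmod_translate_sum (z0 - a)%C x).
    change (RtoC x) with w1 in HT. 
    change (z0 - a + - w1)%C with (z0 - a + w2)%C in HT. 
    change (- w1 * Ci)%C with w4 in HT. change (w1 * Ci)%C with w3 in HT.
    assert (HF : 4 * ep * x ^ 2 <= 2 * (Cmod h0 * Cmod S)) by nra.
    assert (Cmod h0 * Cmod S <= Cmod h0 * (4 * (K * x ^ 3))) by (apply Rmult_le_compat_l; auto).
    assert (4 * ep * x ^ 2 <= (8 * Cmod h0 * K * x) * x ^ 2) by (simpl in *; lra).
    assert (0 < x ^ 2) by (apply pow_lt; auto).
    assert (4 * ep <= 8 * Cmod h0 * K * x) by (apply Rmult_le_reg_r with (x ^ 2); auto).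
    nra.
Qed.

Lemma pow_growth (c x M B : R) : 0 < c -> 0 < M -> M < x -> ~ (forall n, c * x ^ n <= B * M ^ n).
Proof.
  intros Hc HM Hx H. set (y := x / M - 1).
  assert (Hy : 0 < y). { unfold y. replace (x / M - 1) with ((x - M) / M) by (field; lra). apply Rdiv_lt_0_compat; lra. }
  assert (HB : 0 < B). { specialize (H O). simpl in H. lra. }
  destruct (nfloor_ex (B / (c * y))) as [n Hn]. { apply Rlt_le, Rdiv_lt_0_compat; nra. }
  specialize (H (n + 1)%nat). assert (P := poly (n + 1) y Hy).
  rewrite plus_INR in P. simpl INR in P.
  replace (1 + y) with (x / M) in P by (unfold y; ring).
  assert (HMn : 0 < M ^ (n + 1)) by (apply pow_lt; auto).
  assert (E : x ^ (n + 1) = (x / M) ^ (n + 1) * M ^ (n + 1)).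
  { rewrite <- Rpow_mult_distr. f_equal. field. lra. }
  rewrite E in H. rewrite <- Rmult_assoc in H. apply Rmult_le_reg_r in H; auto.
  assert (B < c * y * (INR n + 1)).
  { destruct Hn as [_ Hn]. apply Rmult_lt_compat_r with (r := c * y) in Hn; [|nra].
    replace (B / (c * y) * (c * y)) with B in Hn by (field; split; lra). lra. }
  nra.
Qed.

(* Apply the maximum principle to [e q^n] and let [n] tend to infinity. *)
Lemma max_removable (e q : C -> C) (a : C) (r M B : R) : 0 < r -> 0 < M ->
  (forall z, Cmod (z - a)%C <= r -> Hol2 e z) ->
  (forall z, Cmod (z - a)%C <= r -> Cmod (e z) <= B) ->
  (forall z, Cmod (z - a)%C <= r -> e z <> 0%C -> Hol2 q z) ->
  (forall z, Cmod (z - a)%C <= r -> e z = 0%C ->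
     exists L d, 0 < d /\ forall w, Cmod (w - z)%C < d -> Cmod (q w) <= L) ->
  (forall z, Cmod (z - a)%C = r -> Cmod (q z) <= M) ->
  forall z, Cmod (z - a)%C <= r -> e z <> 0%C -> Cmod (q z) <= M.
Proof.
  intros Hr HM He HB Hq Hz Hb z Hzr Hez. apply Rnot_lt_le. intro L.
  apply Cmod_gt_0 in Hez.
  apply (pow_growth (Cmod (e z)) (Cmod (q z)) M B Hez HM L). intro n.
  rewrite <- Cmod_pow, <- Cmod_mult.
  assert (HBp : 0 <= B). { eapply Rle_trans; [apply Cmod_ge_0|apply (HB z Hzr)]. }
  assert (HMn : 0 < M ^ n) by (now apply pow_lt).
  apply (max_principle (fun z => e z * q z ^ n)%C a r (B * M ^ n)); auto.
  - nra.
  - intros w Hw. destruct (classic (e w = 0%C)) as [E|E].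
    (* At a zero of [e] the product tends to 0 because [q] stays bounded nearby, whatever value [q]
       takes at the point itself. *)
    + destruct (Hz w Hw E) as (L0 & d & Hd & HL).
      assert (HL0 : 0 <= L0).
      { eapply Rle_trans; [apply Cmod_ge_0|apply (HL w)]. replace (w - w)%C with (RtoC 0) by ring. rewrite Cmod_0; auto. }
      intros ep Hep. assert (HLn : 0 <= L0 ^ n) by (now apply pow_le).
      destruct (Hol2_cont _ _ (He w Hw) (ep / (L0 ^ n + 1))) as (d' & Hd' & Hc).
      { apply Rdiv_lt_0_compat; lra. }
      exists (Rmin d d'). split. now apply Rmin_glb_lt.
      intros v Hv. assert (Q1 := Rmin_l d d'). assert (Q2 := Rmin_r d d').
      specialize (HL v ltac:(lra)). specialize (Hc v ltac:(lra)). rewrite E in *.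
      replace (e v * q v ^ n - 0 * q w ^ n)%C with (e v * q v ^ n)%C by ring.
      replace (e v - 0)%C with (e v) in Hc by ring.
      rewrite Cmod_mult, Cmod_pow.
      assert (Cmod (q v) ^ n <= L0 ^ n) by (apply pow_incr; split; auto using Cmod_ge_0).
      assert (0 <= Cmod (q v) ^ n) by (apply pow_le, Cmod_ge_0).
      assert (P := Cmod_ge_0 (e v)).
      apply Rmult_lt_compat_r with (r := L0 ^ n + 1) in Hc; [|lra].
      replace (ep / (L0 ^ n + 1) * (L0 ^ n + 1)) with ep in Hc by (field; lra).
      nra.
    + apply Hol2_cont. apply Hol2_mult; auto. apply Hol2_pow; auto.
  - intros w Hw. destruct (classic (e w = 0%C)) as [E|E].
    + right. rewrite E. ring.
    + left. apply Hol2_mult. apply He; lra. apply Hol2_pow. apply Hq; auto; lra.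
  - intros w Hw. rewrite Cmod_mult, Cmod_pow. apply Rmult_le_compat; auto using Cmod_ge_0.
    + apply pow_le, Cmod_ge_0.
    + apply HB; lra.
    + apply pow_incr. split; auto using Cmod_ge_0.
Qed.

(** * Schwarz's lemma, Cauchy estimates and limits *)

(** The quotient of [g] by [(z - a)^k] stays bounded at [a], so [max_removable] estimates it by its
    values on the circle. *)
Lemma schwarz_k (k : nat) (g : C -> C) (a : C) (r N : R) : 0 < r -> 0 < N ->
  (forall z, Cmod (z - a)%C <= r -> Hol2 g z) ->
  Ob k (fun w => g (a + w)%C) ->
  (forall z, Cmod (z - a)%C = r -> Cmod (g z) <= N) ->
  forall z, Cmod (z - a)%C <= r -> z <> a -> Cmod (g z) <= N / r ^ k * Cmod (z - a)%C ^ k.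
Proof.
  intros Hr HN Hg HO Hb z Hz Hza.
  assert (Hrk : 0 < r ^ k) by (now apply pow_lt).
  assert (Hne : forall w, w <> a -> (w - a)%C <> 0%C).
  { intros w Hw E. apply Hw. now apply Csub_eq. }
  assert (Hnk : forall w, w <> a -> ((w - a) ^ k)%C <> 0%C).
  { intros w Hw. apply Cmod_pos_neq. rewrite Cmod_pow. apply pow_lt. apply Cmod_gt_0. auto. }
  assert (Hid : forall w, Hol2 (fun z => z - a)%C w).
  { intro w. apply Hol2_minus; auto using Hol2_id, Hol2_const. }
  assert (H : Cmod (g z / (z - a) ^ k)%C <= N / r ^ k).
  { apply (max_removable (fun z => z - a)%C (fun z => g z / (z - a) ^ k)%C a r (N / r ^ k) r); auto.
    - now apply Rdiv_lt_0_compat.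
    - intros w Hw E. assert (w <> a) by (intro; subst; apply E; ring).
      apply Hol2_div; auto. now apply Hol2_pow.
    - intros w Hw E. apply Csub_eq in E. subst w. destruct HO as (K & d & HK & Hd & HO).
      exists (Rmax K (Cmod (g a / (a - a) ^ k)%C)), d. split; auto. intros w Hwd.
      destruct (classic (w = a)) as [->|Hwa]. { apply Rmax_r. }
      eapply Rle_trans; [|apply Rmax_l]. rewrite Cmod_div by auto. rewrite Cmod_pow.
      specialize (HO (w - a)%C Hwd). replace (a + (w - a))%C with w in HO by ring.
      assert (0 < Cmod (w - a)%C ^ k) by (apply pow_lt, Cmod_gt_0; auto).
      apply Rmult_le_reg_r with (Cmod (w - a)%C ^ k); auto.
      unfold Rdiv. rewrite Rmult_assoc, Rinv_l by lra. lra.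
    - intros w Hw. assert (w <> a). { intro; subst w. replace (a - a)%C with (RtoC 0) in Hw by ring. rewrite Cmod_0 in Hw. lra. }
      rewrite Cmod_div by auto. rewrite Cmod_pow, Hw. apply Rmult_le_compat_r; auto.
      left. now apply Rinv_0_lt_compat. }
  rewrite Cmod_div, Cmod_pow in H by auto.
  assert (0 < Cmod (z - a)%C ^ k) by (apply pow_lt, Cmod_gt_0; auto).
  apply Rmult_le_compat_r with (r := Cmod (z - a)%C ^ k) in H; [|lra].
  replace (Cmod (g z) / Cmod (z - a)%C ^ k * Cmod (z - a)%C ^ k) with (Cmod (g z)) in H by (field; lra).
  exact H.
Qed.

Lemma coeff_bound (k : nat) (g : C -> C) (c : C) (A d : R) : 0 < d ->
  Ob (S k) (fun w => g w - c * w ^ k)%C ->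
  (forall w : C, w <> 0%C -> Cmod w < d -> Cmod (g w) <= A * Cmod w ^ k) -> Cmod c <= A.
Proof.
  intros Hd (K & d' & HK & Hd' & HO) HA. apply Rnot_lt_le. intro L.
  set (x := Rmin (d / 2) (Rmin (d' / 2) ((Cmod c - A) / (2 * (K + 1))))).
  assert (Hx : 0 < x).
  { unfold x. repeat apply Rmin_glb_lt; try lra. apply Rdiv_lt_0_compat; lra. }
  assert (Hx1 : x <= d / 2) by apply Rmin_l.
  assert (Hx2 : x <= d' / 2) by (unfold x; eapply Rle_trans; [apply Rmin_r|apply Rmin_l]).
  assert (Hx3 : x * (2 * (K + 1)) <= Cmod c - A).
  { assert (H : x <= (Cmod c - A) / (2 * (K + 1))) by (unfold x; eapply Rle_trans; [apply Rmin_r|apply Rmin_r]).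
    apply Rmult_le_compat_r with (r := 2 * (K + 1)) in H; [|lra].
    replace ((Cmod c - A) / (2 * (K + 1)) * (2 * (K + 1))) with (Cmod c - A) in H by (field; lra). lra. }
  assert (Hm : Cmod x = x) by (rewrite Cmod_R, Rabs_pos_eq; lra).
  assert (H : RtoC x <> RtoC 0) by (apply Cmod_pos_neq; lra).
  specialize (HO x ltac:(lra)). specialize (HA x H ltac:(lra)). rewrite Hm in *.
  assert (T := Cmod_le_sub (c * x ^ k)%C (g x)). rewrite Cmod_sub_sym in T.
  rewrite Cmod_mult, Cmod_pow, Hm in T. simpl in HO.
  assert (0 < x ^ k) by (now apply pow_lt). nra.
Qed.

(** No contour integral is involved: Schwarz's lemma for [h - h a] bounds the first coefficient,
    subtracting its term allows the lemma of order 2, and so on. Every subtraction doubles the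
    bound, hence 2, 4 and 8 times [M]. *)
Lemma cauchy_est (h : C -> C) (a : C) (r M : R) (c1 c2 : C) : 0 < r -> 0 < M ->
  (forall z, Cmod (z - a)%C <= r -> Hol2 h z) ->
  (forall z, Cmod (z - a)%C <= r -> Cmod (h z) <= M) ->
  Ob 3 (fun w => h (a + w) - h a - c1 * w - c2 * w * w)%C ->
  Cmod c1 <= 2 * M / r /\ Cmod c2 <= 4 * M / r ^ 2 /\
  forall z, Cmod (z - a)%C <= r ->
    Cmod (h z - h a - c1 * (z - a) - c2 * (z - a) * (z - a))%C <= 8 * M / r ^ 3 * Cmod (z - a)%C ^ 3.
Proof.
  intros Hr HM Hh Hb HO.
  assert (Hza : Cmod (a - a)%C <= r) by (replace (a - a)%C with (RtoC 0) by ring; rewrite Cmod_0; lra).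
  assert (Hlin : forall c w, Hol2 (fun z => c * (z - a))%C w).
  { intros. apply Hol2_scal, Hol2_minus; auto using Hol2_id, Hol2_const. }
  assert (Hqd : forall c w, Hol2 (fun z => c * (z - a) * (z - a))%C w).
  { intros. apply Hol2_mult; auto. apply Hol2_minus; auto using Hol2_id, Hol2_const. }
  assert (B1 : forall z, Cmod (z - a)%C <= r -> Cmod (h z - h a)%C <= 2 * M).
  { intros z Hz. eapply Rle_trans; [apply Cmod_sub_le|]. assert (A1 := Hb z Hz). assert (A2 := Hb a Hza). lra. }
  assert (S1 := schwarz_k 1 (fun z => h z - h a)%C a r (2 * M) Hr ltac:(lra)
    (fun z Hz => Hol2_minus _ _ _ (Hh z Hz) (Hol2_const _ _)) (Hol2_diff _ _ _ _ HO)
    (fun z Hz => B1 z (Req_le _ _ Hz))).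
  assert (C1 : Cmod c1 <= 2 * M / r).
  { apply (coeff_bound 1 (fun w => h (a + w) - h a)%C c1 (2 * M / r) r Hr).
    - eapply Ob_ext; [|apply Ob_plus; [apply (Ob_weak 3 2 _ ltac:(lia) HO)|
        apply (Ob_mult 1 1 _ _ (Ob_scal _ c2 _ Ob_id) Ob_id)]].
      intro w. simpl. ring.
    - intros w Hw Hwr. assert (E : (a + w - a)%C = w) by ring.
      specialize (S1 (a + w)%C). rewrite E, !pow_1 in S1. rewrite pow_1. apply S1. lra.
      intro Q. apply Hw. rewrite <- E, Q. ring. }
  assert (L1 : forall z, Cmod (z - a)%C <= r -> Cmod (c1 * (z - a))%C <= 2 * M).
  { intros z Hz. rewrite Cmod_mult. apply Rle_trans with (2 * M / r * r).
    apply Rmult_le_compat; auto using Cmod_ge_0. right. field. lra. }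
  assert (B2 : forall z, Cmod (z - a)%C <= r -> Cmod (h z - h a - c1 * (z - a))%C <= 4 * M).
  { intros z Hz. eapply Rle_trans; [apply Cmod_sub_le|]. specialize (B1 z Hz). specialize (L1 z Hz). lra. }
  assert (O2 : Ob 2 (fun w => h (a + w) - h a - c1 * w)%C).
  { eapply Ob_ext; [|apply Ob_plus; [apply (Ob_weak 3 2 _ ltac:(lia) HO)|
        apply (Ob_mult 1 1 _ _ (Ob_scal _ c2 _ Ob_id) Ob_id)]]. intro w. simpl. ring. }
  assert (S2 := schwarz_k 2 (fun z => h z - h a - c1 * (z - a))%C a r (4 * M) Hr ltac:(lra)
    (fun z Hz => Hol2_minus _ _ _ (Hol2_minus _ _ _ (Hh z Hz) (Hol2_const _ _)) (Hlin _ _))).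
  assert (O2' : Ob 2 (fun w => h (a + w) - h a - c1 * (a + w - a))%C).
  { eapply Ob_ext; [|exact O2]. intro w. simpl. ring. }
  specialize (S2 O2' (fun z Hz => B2 z (Req_le _ _ Hz))).
  cbv beta in S2.
  assert (C2 : Cmod c2 <= 4 * M / r ^ 2).
  { apply (coeff_bound 2 (fun w => h (a + w) - h a - c1 * w)%C c2 (4 * M / r ^ 2) r Hr).
    - eapply Ob_ext; [|exact HO]. intro w. simpl. ring.
    - intros w Hw Hwr. assert (E : (a + w - a)%C = w) by ring.
      specialize (S2 (a + w)%C). rewrite E in S2. apply S2. lra.
      intro Q. apply Hw. rewrite <- E, Q. ring. }
  split; auto. split; auto.
  assert (B3 : forall z, Cmod (z - a)%C <= r -> Cmod (h z - h a - c1 * (z - a) - c2 * (z - a) * (z - a))%C <= 8 * M).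
  { intros z Hz. eapply Rle_trans; [apply Cmod_sub_le|]. specialize (B2 z Hz).
    assert (Cmod (c2 * (z - a) * (z - a))%C <= 4 * M); [|lra].
    rewrite !Cmod_mult. apply Rle_trans with (4 * M / r ^ 2 * r * r).
    - apply Rmult_le_compat; auto using Cmod_ge_0. apply Rmult_le_pos; apply Cmod_ge_0.
      apply Rmult_le_compat; auto using Cmod_ge_0.
    - right. field. lra. }
  intros z Hz. destruct (classic (z = a)) as [->|Hza'].
  { replace (h a - h a - c1 * (a - a) - c2 * (a - a) * (a - a))%C with (RtoC 0) by ring.
    rewrite Cmod_0. apply Rmult_le_pos. apply Rlt_le, Rdiv_lt_0_compat; [lra|now apply pow_lt]. apply pow_le, Cmod_ge_0. }
  apply (schwarz_k 3 (fun z => h z - h a - c1 * (z - a) - c2 * (z - a) * (z - a))%C a r (8 * M)); auto.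
  - lra.
  - intros w Hw. apply Hol2_minus; auto. apply Hol2_minus; auto. apply Hol2_minus; auto using Hol2_const.
  - eapply Ob_ext; [|exact HO]. intro w. simpl. ring.
  - intros w Hw. apply B3. lra.
Qed.

Lemma Cmod_le_of_Ccv (u : nat -> C) l B : Ccv u l -> (exists N, forall n, (N <= n)%nat -> Cmod (u n) <= B) -> Cmod l <= B.
Proof.
  intros H [N HN]. apply (Ccv_mod_le (fun n => u (n + N)%nat)).
  - apply (Ccv_sub u l (fun n => (n + N)%nat)); auto. intro; lia.
  - intro n. apply HN. lia.
Qed.

Lemma Ccv_minus u v l m : Ccv u l -> Ccv v m -> Ccv (fun n => u n - v n)%C (l - m)%C.
Proof.
  intros H G e He. destruct (H (e/2) ltac:(lra)) as [N HN]. destruct (G (e/2) ltac:(lra)) as [N' HN'].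
  exists (N + N')%nat. intros n Hn. specialize (HN n ltac:(lia)). specialize (HN' n ltac:(lia)).
  replace (u n - v n - (l - m))%C with ((u n - l) - (v n - m))%C by ring.
  eapply Rle_lt_trans; [apply Cmod_sub_le|]. lra.
Qed.

Lemma Ccv_mult_const u l c : Ccv u l -> Ccv (fun n => u n * c)%C (l * c)%C.
Proof.
  intros H e He. destruct (H (e / (Cmod c + 1))) as [N HN].
  { apply Rdiv_lt_0_compat; auto. generalize (Cmod_ge_0 c). lra. }
  exists N. intros n Hn. specialize (HN n Hn). replace (u n * c - l * c)%C with ((u n - l) * c)%C by ring.
  rewrite Cmod_mult. assert (P := Cmod_ge_0 c). assert (Q := Cmod_ge_0 (u n - l)%C).
  apply Rmult_lt_compat_r with (r := Cmod c + 1) in HN; [|lra].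
  replace (e / (Cmod c + 1) * (Cmod c + 1)) with e in HN by (field; lra). nra.
Qed.

(* The Cauchy estimates make the expansions of the [u n] uniform, so they
   survive a pointwise limit along a subsequence. *)
Lemma Hol2_lim (u : nat -> C -> C) (h : C -> C) (a : C) (r M : R) : 0 < r -> 0 < M ->
  (forall n z, Cmod (z - a)%C <= r -> Hol2 (u n) z) ->
  (forall n z, Cmod (z - a)%C <= r -> Cmod (u n z) <= M) ->
  (forall z, Cmod (z - a)%C <= r -> Ccv (fun n => u n z) (h z)) -> Hol2 h a.
Proof.
  intros Hr HM Hu Hb Hl.
  assert (Hza : Cmod (a - a)%C <= r) by (replace (a - a)%C with (RtoC 0) by ring; rewrite Cmod_0; lra).
  assert (HC : forall n, exists c : C * C, Cmod (fst c) <= 2 * M / r /\ Cmod (snd c) <= 4 * M / r ^ 2 /\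
    forall z, Cmod (z - a)%C <= r ->
    Cmod (u n z - u n a - fst c * (z - a) - snd c * (z - a) * (z - a))%C <= 8 * M / r ^ 3 * Cmod (z - a)%C ^ 3).
  { intro n. destruct (Hu n a Hza) as (c1 & c2 & HO). exists (c1, c2).
    apply (cauchy_est (u n) a r M c1 c2); auto. }
  apply functional_choice in HC. destruct HC as [c Hc].
  destruct (bw_C (fun n => fst (c n)) (2 * M / r)) as (p & c1 & Hp & H1). { intro; apply Hc. }
  destruct (bw_C (fun n => snd (c (p n))) (4 * M / r ^ 2)) as (q & c2 & Hq & H2). { intro; apply Hc. }
  exists c1, c2, (8 * M / r ^ 3), r. repeat split; auto.
  - apply Rlt_le, Rdiv_lt_0_compat; [lra|now apply pow_lt].
  - intros w Hw. assert (E : (a + w - a)%C = w) by ring.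
    set (f := fun n => p (q n)).
    assert (Hf : forall n, (n <= f n)%nat) by (intro n; unfold f; specialize (Hp (q n)); specialize (Hq n); lia).
    apply (Ccv_mod_le (fun n => u (f n) (a + w) - u (f n) a - fst (c (f n)) * w - snd (c (f n)) * w * w)%C).
    + apply Ccv_minus; [apply Ccv_minus; [apply Ccv_minus|]|].
      * apply (Ccv_sub (fun n => u n (a + w)%C)); auto. apply Hl. rewrite E. lra.
      * apply (Ccv_sub (fun n => u n a)); auto.
      * apply Ccv_mult_const. apply (Ccv_sub (fun n => fst (c (p n))) c1 q); auto.
      * apply Ccv_mult_const. apply Ccv_mult_const. exact H2.
    + intro n. destruct (Hc (f n)) as (_ & _ & A). specialize (A (a + w)%C). rewrite E in A. apply A. lra.
Qed.

(** * Continuation of zeros of holomorphic functions *)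

(** Connectedness of the interval, in the form behind all continuation arguments here: a locally
    constant property cannot change. The supremum of the points up to which it holds must be [b]. *)
Lemma conn (P : R -> Prop) (a b : R) : a <= b ->
  (forall x, a <= x <= b -> exists d, 0 < d /\ forall y, a <= y <= b -> Rabs (y - x) < d -> (P x <-> P y)) ->
  P a -> P b.
Proof.
  intros Hab Hloc Ha.
  set (E := fun x => a <= x <= b /\ forall y, a <= y <= x -> P y).
  assert (EA : E a). { split; [lra|]. intros y Hy. replace y with a by lra. auto. }
  destruct (completeness E) as [c [Hc1 Hc2]].
  - exists b. intros x [Hx _]. lra.
  - exists a; auto.
  - assert (Hac : a <= c) by (apply Hc1; auto).
    assert (Hcb : c <= b) by (apply Hc2; intros x [Hx _]; lra).
    destruct (Hloc c ltac:(lra)) as (d & Hd & HP).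
    assert (exists x, E x /\ c - d < x) as (x & [Hx HEx] & Hxd).
    { apply NNPP. intro Q. assert (c <= c - d); [|lra]. apply Hc2. intros x Hx.
      apply Rnot_lt_le. intro L. apply Q. eauto. }
    assert (Hxc : x <= c) by (apply Hc1; split; auto).
    assert (Pc : P c). { apply (HP x); [lra| |apply HEx; lra]. apply Rabs_lt_between. lra. }
    assert (HE : E (Rmin b (c + d / 2))).
    { assert (M1 := Rmin_l b (c + d/2)). assert (M2 := Rmin_r b (c + d/2)).
      split. { split; [apply Rmin_glb; lra|lra]. }
      intros y Hy. destruct (Rle_dec y x). apply HEx; lra.
      apply (HP y); [lra| |auto]. apply Rabs_lt_between. lra. }
    assert (Hle := Hc1 _ HE).
    destruct (Rle_dec b (c + d/2)).
    + rewrite Rmin_left in HE by lra. destruct HE as [_ HE]. apply HE. lra.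
    + rewrite Rmin_right in Hle by lra. lra.
Qed.

Lemma conn_back (P : R -> Prop) (a b : R) : a <= b ->
  (forall x, a <= x <= b -> exists d, 0 < d /\ forall y, a <= y <= b -> Rabs (y - x) < d -> (P x <-> P y)) ->
  P b -> P a.
Proof.
  intros Hab H Hb. apply NNPP. intro Ha.
  assert (~ P b); [|contradiction]. apply (conn (fun x => ~ P x) a b); auto.
  intros x Hx. destruct (H x Hx) as (d & Hd & A). exists d. split; auto. intros y Hy Hyx.
  specialize (A y Hy Hyx). tauto.
Qed.

(** A linear lower bound stands in for a nonzero derivative: it mentions no derivative and, once its
    constants are uniform, passes to limits. *)
Definition simple_zero (h : C -> C) (a : C) : Prop :=
  exists c d, 0 < c /\ 0 < d /\ forall z, Cmod (z - a)%C < d -> c * Cmod (z - a)%C <= Cmod (h z).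

Lemma Cmod_diag (a : C) : Cmod (a - a)%C = 0.
Proof. replace (a - a)%C with (RtoC 0) by ring. apply Cmod_0. Qed.

Lemma Hol2_shift (a w : C) : Hol2 (fun z => z - a)%C w.
Proof. apply Hol2_minus; auto using Hol2_id, Hol2_const. Qed.

(** Were [g] without zeros, [1 / g] would obey the maximum principle and be at most [2 / m] at [a];
    but [|g a| <= m / 4]. *)
Lemma rouche_zero (h g : C -> C) (a : C) (r m : R) : 0 < r -> 0 < m ->
  (forall z, Cmod (z - a)%C <= r -> Hol2 g z) ->
  (forall z, Cmod (z - a)%C = r -> m <= Cmod (h z)) ->
  (forall z, Cmod (z - a)%C <= r -> Cmod (g z - h z)%C <= m / 4) ->
  h a = 0%C -> exists z, Cmod (z - a)%C < r /\ g z = 0%C.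
Proof.
  intros Hr Hm Hg Hh Hd Ha. apply NNPP. intro Q.
  assert (Hc : forall z, Cmod (z - a)%C = r -> m / 2 <= Cmod (g z)).
  { intros z Hz. assert (A := Hh z Hz). assert (B := Hd z (Req_le _ _ Hz)).
    assert (T := Cmod_le_sub (h z) (g z)). rewrite Cmod_sub_sym in T. lra. }
  assert (Hn : forall z, Cmod (z - a)%C <= r -> g z <> 0%C).
  { intros z Hz E. destruct (Rle_lt_or_eq_dec _ _ Hz) as [L|L]. apply Q; eauto.
    specialize (Hc z L). rewrite E, Cmod_0 in Hc. lra. }
  assert (Ha0 : Cmod (a - a)%C <= r) by (rewrite Cmod_diag; lra).
  assert (B : Cmod (/ g a)%C <= / (m / 2)).
  { apply (max_principle (fun z => / g z)%C a r); auto.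
    - left. apply Rinv_0_lt_compat. lra.
    - intros z Hz. apply Hol2_cont. apply (Hol2_comp (fun z => / z)%C); auto. apply Hol2_inv; auto.
    - intros z Hz. left. apply (Hol2_comp (fun z => / z)%C); [|apply Hol2_inv]; [apply Hg|apply Hn]; lra.
    - intros z Hz. rewrite Cmod_inv by (apply Hn; lra). apply Rinv_le_contravar; [lra|auto]. }
  rewrite Cmod_inv in B by auto. assert (D := Hd a Ha0). rewrite Ha in D.
  replace (g a - 0)%C with (g a) in D by ring.
  assert (0 < Cmod (g a)) by (apply Cmod_gt_0; auto).
  assert (/ (m / 4) <= / Cmod (g a)) by (apply Rinv_le_contravar; lra).
  assert (/ (m / 2) < / (m / 4)) by (apply Rinv_lt_contravar; nra). lra.
Qed.

(** The maximum principle for [(z - p) / g z], whose singularity at the simple zero [p] is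
    removable. The constant depends on [r] and [m] only, and not on how simple the zero is; this
    uniformity lets simplicity survive a limit. *)
Lemma simple_zero_lower (h g : C -> C) (a p : C) (r m : R) : 0 < r -> 0 < m ->
  (forall z, Cmod (z - a)%C <= r -> Hol2 g z) ->
  (forall z, Cmod (z - a)%C = r -> m <= Cmod (h z)) ->
  (forall z, Cmod (z - a)%C <= r -> Cmod (g z - h z)%C <= m / 4) ->
  Cmod (p - a)%C < r -> simple_zero g p -> g p = 0%C ->
  (forall z, Cmod (z - a)%C <= r -> g z = 0%C -> z = p) ->
  forall z, Cmod (z - a)%C <= r -> Cmod (z - p)%C <= 4 * r / m * Cmod (g z).
Proof.
  intros Hr Hm Hg Hh Hd Hp (c & d & Hc & Hd0 & Hs) Hgp Hu z Hz.
  assert (Hcirc : forall z, Cmod (z - a)%C = r -> m / 2 <= Cmod (g z)).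
  { intros w Hw. assert (A := Hh w Hw). assert (B := Hd w (Req_le _ _ Hw)).
    assert (T := Cmod_le_sub (h w) (g w)). rewrite Cmod_sub_sym in T. lra. }
  destruct (classic (z = p)) as [->|Hzp].
  { rewrite Cmod_diag, Hgp, Cmod_0. lra. }
  assert (Hdist : forall z, Cmod (z - a)%C <= r -> Cmod (z - p)%C <= 2 * r).
  { intros w Hw. assert (T := Cmod_sub_triangle w a p). rewrite (Cmod_sub_sym a p) in T. lra. }
  assert (Hne : (z - p)%C <> 0%C) by (intro E; apply Hzp, Csub_eq; auto).
  assert (B : Cmod ((z - p) / g z)%C <= 4 * r / m).
  { apply (max_removable (fun z => z - p)%C (fun z => (z - p) / g z)%C a r (4 * r / m) (2 * r)); auto.
    - apply Rdiv_lt_0_compat; lra.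
    - intros. apply Hol2_shift.
    - intros w Hw E. apply Hol2_div; auto. apply Hol2_shift.
      intro E0. apply E. rewrite (Hu w Hw E0). ring.
    - intros w Hw E. apply Csub_eq in E. subst w. exists (/ c), d. split; auto.
      intros w Hwd. specialize (Hs w Hwd). assert (0 < / c) by (apply Rinv_0_lt_compat; auto).
      destruct (classic (w = p)) as [->|E].
      + replace (p - p)%C with (RtoC 0) by ring. unfold Cdiv. rewrite Cmult_0_l, Cmod_0. lra.
      + assert (0 < Cmod (w - p)%C). { apply Cmod_gt_0. intro E2. apply E, Csub_eq; auto. }
        assert (0 < Cmod (g w)) by nra.
        rewrite Cmod_div by (apply Cmod_gt_0; auto).
        apply Rmult_le_reg_r with (c * Cmod (g w)). nra. field_simplify; try lra.
    - intros w Hw. assert (G := Hcirc w Hw). rewrite Cmod_div by (apply Cmod_pos_neq; lra).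
      replace (4 * r / m) with (2 * r / (m / 2)) by (field; lra).
      apply div_le_compat; auto using Cmod_ge_0; try lra. apply Hdist. lra. }
  assert (Hgz : g z <> 0%C) by (intro E; apply Hzp; auto).
  rewrite Cmod_div in B by auto. apply Cmod_gt_0 in Hgz.
  apply Rmult_le_compat_r with (r := Cmod (g z)) in B; [|lra].
  unfold Rdiv at 1 in B. rewrite Rmult_assoc, Rinv_l, Rmult_1_r in B by lra. exact B.
Qed.

Lemma simple_or_double (h : C -> C) (a : C) : Hol2 h a -> h a = 0%C ->
  simple_zero h a \/ exists K d, 0 < d /\ forall z, Cmod (z - a)%C < d -> Cmod (h z) <= K * Cmod (z - a)%C ^ 2.
Proof.
  intros (c1 & c2 & H) Ha.
  assert (O2 : Ob 2 (fun w => h (a + w) - c1 * w)%C).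
  { eapply Ob_ext; [|apply Ob_plus; [apply (Ob_weak 3 2 _ ltac:(lia) H)|
        apply (Ob_mult 1 1 _ _ (Ob_scal _ c2 _ Ob_id) Ob_id)]].
    intro w. simpl. rewrite Ha. ring. }
  destruct O2 as (K & d & HK & Hd & HO).
  assert (HO' : forall z, Cmod (z - a)%C < d -> Cmod (h z - c1 * (z - a))%C <= K * Cmod (z - a)%C ^ 2).
  { intros z Hz. specialize (HO (z - a)%C Hz). replace (a + (z - a))%C with z in HO by ring. auto. }
  destruct (classic (c1 = 0%C)) as [E|E].
  - right. exists K, d. split; auto. intros z Hz. specialize (HO' z Hz). rewrite E in HO'.
    replace (h z - 0 * (z - a))%C with (h z) in HO' by ring. auto.
  - left. apply Cmod_gt_0 in E. exists (Cmod c1 / 2), (Rmin d (Cmod c1 / (2 * (K + 1)))).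
    split; [lra|]. split. { apply Rmin_glb_lt; auto. apply Rdiv_lt_0_compat; lra. }
    intros z Hz. assert (M1 := Rmin_l d (Cmod c1 / (2 * (K + 1)))). assert (M2 := Rmin_r d (Cmod c1 / (2 * (K + 1)))).
    specialize (HO' z ltac:(lra)). set (x := Cmod (z - a)%C) in *.
    assert (Hx : 0 <= x) by apply Cmod_ge_0.
    assert (x * (2 * (K + 1)) < Cmod c1).
    { assert (H0 : x < Cmod c1 / (2 * (K + 1))) by lra.
      apply Rmult_lt_compat_r with (r := 2 * (K + 1)) in H0; [|lra].
      replace (Cmod c1 / (2 * (K + 1)) * (2 * (K + 1))) with (Cmod c1) in H0 by (field; lra). lra. }
    assert (T := Cmod_le_sub (c1 * (z - a))%C (h z)). rewrite Cmod_sub_sym, Cmod_mult in T. fold x in T.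
    simpl in HO'. nra.
Qed.

(** [g] divided by [(z - p) (z - q)] has removable singularities, also for [p = q], where failure of
    simplicity means vanishing to second order. The resulting quadratic smallness between two close
    zeros is what contradicts a simple zero in the limit. *)
Lemma two_zeros_bound (g : C -> C) (a p q : C) (r M : R) : 0 < r -> 0 < M ->
  (forall z, Cmod (z - a)%C <= r -> Hol2 g z) ->
  (forall z, Cmod (z - a)%C <= r -> Cmod (g z) <= M) ->
  Cmod (p - a)%C <= r / 4 -> Cmod (q - a)%C <= r / 4 -> g p = 0%C -> g q = 0%C ->
  (p = q -> ~ simple_zero g p) ->
  forall z, Cmod (z - a)%C <= r -> z <> p -> z <> q ->
    Cmod (g z) <= 4 * M / r ^ 2 * (Cmod (z - p)%C * Cmod (z - q)%C).
Proof.
  intros Hr HM Hg Hb Hp Hq Hgp Hgq Hs z Hz Hzp Hzq.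
  assert (Hne : forall u v : C, u <> v -> 0 < Cmod (u - v)%C).
  { intros u v E. apply Cmod_gt_0. intro F. apply E, Csub_eq; auto. }
  assert (Hfar : forall u v, Cmod (u - a)%C <= r / 4 -> Cmod (v - a)%C = r -> r / 2 <= Cmod (v - u)%C).
  { intros u v Hu Hv. assert (T := Cmod_sub_triangle v u a). lra. }
  assert (Hdist : forall u w, Cmod (u - a)%C <= r / 4 -> Cmod (w - a)%C <= r -> Cmod (w - u)%C <= 2 * r).
  { intros u w Hu Hw. assert (T := Cmod_sub_triangle w a u). rewrite (Cmod_sub_sym a u) in T. lra. }
  assert (HL : forall u v, Cmod (u - a)%C <= r / 4 -> g u = 0%C -> u <> v ->
     exists L d, 0 < d /\ forall w, Cmod (w - u)%C < d -> Cmod (g w / ((w - u) * (w - v)))%C <= L).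
  { intros u v Hu Hgu Huv. destruct (Hol2_lip g u) as (K & d & HK & Hd & HO). { apply Hg. lra. }
    set (D := Cmod (u - v)%C). assert (HD : 0 < D) by (apply Hne; auto).
    exists (K / (D / 2)), (Rmin d (D / 2)). split. { apply Rmin_glb_lt; lra. }
    intros w Hw. assert (M1 := Rmin_l d (D/2)). assert (M2 := Rmin_r d (D/2)).
    assert (Hwv : D / 2 <= Cmod (w - v)%C).
    { assert (T := Cmod_sub_triangle u w v). rewrite (Cmod_sub_sym u w) in T. fold D in T. lra. }
    destruct (classic (w = u)) as [->|Hwu].
    - rewrite Hgu. unfold Cdiv. rewrite Cmult_0_l, Cmod_0. apply Rdiv_le_0_compat; lra.
    - specialize (HO (w - u)%C ltac:(lra)). replace (u + (w - u))%C with w in HO by ring.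
      rewrite Hgu, pow_1 in HO. replace (g w - 0)%C with (g w) in HO by ring.
      assert (P := Hne w u Hwu).
      rewrite Cmod_div, Cmod_mult by (apply Cmod_pos_neq; rewrite Cmod_mult; nra).
      apply Rle_trans with (K * Cmod (w - u)%C / (Cmod (w - u)%C * Cmod (w - v)%C)).
      + apply Rmult_le_compat_r; auto. left. apply Rinv_0_lt_compat. nra.
      + replace (K * Cmod (w - u)%C / (Cmod (w - u)%C * Cmod (w - v)%C)) with (K / Cmod (w - v)%C) by (field; lra).
        apply div_le_compat; lra. }
  assert (B : Cmod (g z / ((z - p) * (z - q)))%C <= 4 * M / r ^ 2).
  { apply (max_removable (fun z => (z - p) * (z - q))%C (fun z => g z / ((z - p) * (z - q)))%C a r (4 * M / r ^ 2) (2 * r * (2 * r))); auto.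
    - apply Rdiv_lt_0_compat; [lra|nra].
    - intros w Hw. apply Hol2_mult; apply Hol2_shift.
    - intros w Hw. rewrite Cmod_mult. apply Rmult_le_compat; auto using Cmod_ge_0.
    - intros w Hw E. apply Hol2_div; auto. apply Hol2_mult; apply Hol2_shift.
    - intros w Hw E. assert (w = p \/ w = q) as [Ewp|Ewq].
      { apply NNPP. intro N. apply not_or_and in N. destruct N as [N1 N2].
        assert (A1 := Hne _ _ N1). assert (A2 := Hne _ _ N2).
        assert (E2 := f_equal Cmod E). rewrite Cmod_mult, Cmod_0 in E2. nra. }
      + subst w. destruct (classic (p = q)) as [Epq|Npq].
        * subst q. destruct (simple_or_double g p) as [S|(K & d & Hd & HK)]; auto.
          { exfalso. now apply Hs. }
          exists (Rmax K 0), d. split; auto. intros w Hwd.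
          destruct (classic (w = p)) as [->|Hwp].
          { rewrite Hgp. unfold Cdiv. rewrite Cmult_0_l, Cmod_0. apply Rmax_r. }
          eapply Rle_trans; [|apply Rmax_l]. assert (P := Hne _ _ Hwp). specialize (HK w Hwd).
          rewrite Cmod_div, Cmod_mult by (apply Cmod_pos_neq; rewrite Cmod_mult; nra).
          apply Rle_trans with (K * Cmod (w - p)%C ^ 2 / (Cmod (w - p)%C * Cmod (w - p)%C)).
          { apply Rmult_le_compat_r; auto. left. apply Rinv_0_lt_compat. nra. }
          right. field. lra.
        * apply HL; auto.
      + subst w. destruct (classic (p = q)) as [Epq|Npq].
        * subst q. destruct (simple_or_double g p) as [S|(K & d & Hd & HK)]; auto.
          { exfalso. now apply Hs. }
          exists (Rmax K 0), d. split; auto. intros w Hwd.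
          destruct (classic (w = p)) as [->|Hwp].
          { rewrite Hgp. unfold Cdiv. rewrite Cmult_0_l, Cmod_0. apply Rmax_r. }
          eapply Rle_trans; [|apply Rmax_l]. assert (P := Hne _ _ Hwp). specialize (HK w Hwd).
          rewrite Cmod_div, Cmod_mult by (apply Cmod_pos_neq; rewrite Cmod_mult; nra).
          apply Rle_trans with (K * Cmod (w - p)%C ^ 2 / (Cmod (w - p)%C * Cmod (w - p)%C)).
          { apply Rmult_le_compat_r; auto. left. apply Rinv_0_lt_compat. nra. }
          right. field. lra.
        * destruct (HL q p) as (L & d & Hd & HLd); auto. exists L, d. split; auto.
          intros w Hw'. rewrite (Cmult_comm (w - p)). auto.
    - intros w Hw. assert (A1 := Hfar p w Hp Hw). assert (A2 := Hfar q w Hq Hw).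
      rewrite Cmod_div, Cmod_mult by (apply Cmod_pos_neq; rewrite Cmod_mult; nra).
      replace (4 * M / r ^ 2) with (M / (r / 2 * (r / 2))) by (field; lra).
      apply div_le_compat; auto using Cmod_ge_0. apply Hb; lra. nra.
      apply Rmult_le_compat; lra.
    - intro E. assert (E2 := f_equal Cmod E). rewrite Cmod_mult, Cmod_0 in E2.
      assert (A1 := Hne _ _ Hzp). assert (A2 := Hne _ _ Hzq). nra. }
  assert (A1 := Hne _ _ Hzp). assert (A2 := Hne _ _ Hzq).
  assert (A3 : 0 < Cmod (z - p)%C * Cmod (z - q)%C) by nra.
  rewrite Cmod_div, Cmod_mult in B by (apply Cmod_pos_neq; rewrite Cmod_mult; auto).
  apply Rmult_le_compat_r with (r := Cmod (z - p)%C * Cmod (z - q)%C) in B; [|lra].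
  unfold Rdiv at 1 in B. rewrite Rmult_assoc, Rinv_l, Rmult_1_r in B by lra. exact B.
Qed.

Lemma small_geom (c x e : R) : 0 <= x < 1 -> 0 < e -> exists k : nat, c * x ^ k < e.
Proof.
  intros Hx He. destruct (Rle_dec c 0).
  { exists O. simpl. lra. }
  destruct (pow_lt_1_zero x) with (y := e / c) as [N HN].
  - rewrite Rabs_pos_eq; lra.
  - apply Rdiv_lt_0_compat; lra.
  - exists N. specialize (HN N (Nat.le_refl N)). rewrite Rabs_pos_eq in HN by (apply pow_le; lra).
    apply Rmult_lt_compat_l with (r := c) in HN; [|lra].
    replace (c * (e / c)) with e in HN by (field; lra). lra.
Qed.

(* Dividing [h/(z-a)^k] by [z-b], for zeros [b] tending to [a], raises the order of vanishing. *)
Lemma identity_theorem (h : C -> C) (a : C) (r M : R) : 0 < r -> 0 < M ->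
  (forall z, Cmod (z - a)%C <= r -> Hol2 h z) ->
  (forall z, Cmod (z - a)%C <= r -> Cmod (h z) <= M) ->
  (forall e, 0 < e -> exists b, b <> a /\ Cmod (b - a)%C < e /\ h b = 0%C) ->
  forall z, Cmod (z - a)%C < r -> h z = 0%C.
Proof.
  intros Hr HM Hh Hb Hacc.
  assert (Hne : forall u v : C, u <> v -> 0 < Cmod (u - v)%C).
  { intros u v E. apply Cmod_gt_0. intro F. apply E, Csub_eq; auto. }
  assert (HK : forall k z, Cmod (z - a)%C <= r -> z <> a -> Cmod (h z) <= 2 * M / r ^ k * Cmod (z - a)%C ^ k).
  { induction k.
    - intros z Hz Hza. simpl. specialize (Hb z Hz). lra.
    - intros z Hz Hza.
      assert (Hrk : 0 < r ^ k) by (now apply pow_lt).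
      assert (HQ : forall b, b <> a -> Cmod (b - a)%C < r / 2 -> h b = 0%C -> z <> b ->
         Cmod (h z) <= 2 * M / r ^ S k * (Cmod (z - a)%C ^ k * Cmod (z - b)%C)).
      { intros b Hba Hbr Hhb Hzb.
        assert (Hden : forall w, w <> a -> w <> b -> 0 < Cmod ((w - a) ^ k * (w - b))%C).
        { intros w W1 W2. rewrite Cmod_mult, Cmod_pow. apply Rmult_lt_0_compat; auto. apply pow_lt; auto. }
        assert (Hprod : forall w, ((w - a) * (w - b))%C <> 0%C -> w <> a /\ w <> b).
        { intros w E. split; intro; subst w; apply E; ring. }
        assert (B : Cmod (h z / ((z - a) ^ k * (z - b)))%C <= 2 * M / r ^ S k).
        { apply (max_removable (fun z => (z - a) * (z - b))%C (fun z => h z / ((z - a) ^ k * (z - b)))%C a r (2 * M / r ^ S k) (r * (2 * r))); auto.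
          - apply Rdiv_lt_0_compat; [lra|]. simpl. nra.
          - intros. apply Hol2_mult; apply Hol2_shift.
          - intros w Hw. rewrite Cmod_mult. apply Rmult_le_compat; auto using Cmod_ge_0.
            assert (T := Cmod_sub_triangle w a b). rewrite (Cmod_sub_sym a b) in T. lra.
          - intros w Hw E. destruct (Hprod w E). apply Hol2_div; auto.
            apply Hol2_mult. apply Hol2_pow. apply Hol2_shift. apply Hol2_shift.
            apply Cmod_pos_neq; auto.
          - intros w Hw E. set (D := Cmod (b - a)%C). assert (HD : 0 < D) by (apply Hne; auto).
            assert (w = a \/ w = b) as [Ew|Ew].
            { apply NNPP. intro N. apply not_or_and in N. destruct N as [N1 N2].
              assert (A1 := Hne _ _ N1). assert (A2 := Hne _ _ N2).
              assert (E2 := f_equal Cmod E). rewrite Cmod_mult, Cmod_0 in E2. nra. }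
            + subst w. exists (Rmax (2 * M / r ^ k / (D / 2)) (Cmod (h a / ((a - a) ^ k * (a - b)))%C)), (Rmin r (D / 2)).
              split. { apply Rmin_glb_lt; lra. } intros w Hwd.
              assert (M1 := Rmin_l r (D/2)). assert (M2 := Rmin_r r (D/2)).
              destruct (classic (w = a)) as [->|Hwa]. { apply Rmax_r. }
              eapply Rle_trans; [|apply Rmax_l].
              assert (Hwb : D / 2 <= Cmod (w - b)%C).
              { assert (T := Cmod_sub_triangle b w a). rewrite (Cmod_sub_sym b w) in T. fold D in T. lra. }
              assert (Hpk : 0 < Cmod (w - a)%C ^ k) by (apply pow_lt; auto).
              rewrite Cmod_div, Cmod_mult, Cmod_pow by (apply Cmod_pos_neq; rewrite Cmod_mult, Cmod_pow; nra).
              specialize (IHk w ltac:(lra) Hwa).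
              apply Rle_trans with (2 * M / r ^ k * Cmod (w - a)%C ^ k / (Cmod (w - a)%C ^ k * Cmod (w - b)%C)).
              { apply Rmult_le_compat_r; auto. left. apply Rinv_0_lt_compat. nra. }
              replace (2 * M / r ^ k * Cmod (w - a)%C ^ k / (Cmod (w - a)%C ^ k * Cmod (w - b)%C))
                with (2 * M / r ^ k / Cmod (w - b)%C) by (field; lra).
              apply div_le_compat; try lra. apply Rdiv_le_0_compat; lra.
            + subst w. destruct (Hol2_lip h b) as (K & d & HK & Hd & HO). { apply Hh. lra. }
              exists (K / (D / 2) ^ k), (Rmin d (D / 2)). split. { apply Rmin_glb_lt; lra. }
              intros w Hwd. assert (M1 := Rmin_l d (D/2)). assert (M2 := Rmin_r d (D/2)).
              assert (HD2 : 0 < (D / 2) ^ k) by (apply pow_lt; lra).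
              destruct (classic (w = b)) as [->|Hwb].
              { rewrite Hhb. unfold Cdiv. rewrite Cmult_0_l, Cmod_0. apply Rdiv_le_0_compat; lra. }
              assert (Hwa : D / 2 <= Cmod (w - a)%C).
              { assert (T := Cmod_sub_triangle b w a). rewrite (Cmod_sub_sym b w) in T. fold D in T. lra. }
              assert (Hpk : (D / 2) ^ k <= Cmod (w - a)%C ^ k) by (apply pow_incr; lra).
              specialize (HO (w - b)%C ltac:(lra)). replace (b + (w - b))%C with w in HO by ring.
              rewrite Hhb, pow_1 in HO. replace (h w - 0)%C with (h w) in HO by ring.
              assert (P := Hne _ _ Hwb).
              rewrite Cmod_div, Cmod_mult, Cmod_pow by (apply Cmod_pos_neq; rewrite Cmod_mult, Cmod_pow; nra).
              apply Rle_trans with (K * Cmod (w - b)%C / (Cmod (w - a)%C ^ k * Cmod (w - b)%C)).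
              { apply Rmult_le_compat_r; auto. left. apply Rinv_0_lt_compat. nra. }
              replace (K * Cmod (w - b)%C / (Cmod (w - a)%C ^ k * Cmod (w - b)%C)) with (K / Cmod (w - a)%C ^ k) by (field; lra).
              apply div_le_compat; lra.
          - intros w Hw. assert (T := Cmod_sub_triangle w b a).
            assert (r / 2 <= Cmod (w - b)%C) by lra.
            rewrite Cmod_div, Cmod_mult, Cmod_pow, Hw by (apply Cmod_pos_neq; rewrite Cmod_mult, Cmod_pow, Hw; nra).
            replace (2 * M / r ^ S k) with (M / (r ^ k * (r / 2))) by (simpl; field; lra).
            apply div_le_compat; auto using Cmod_ge_0. apply Hb; lra. nra.
            apply Rmult_le_compat_l; lra.
          - intro E. assert (E2 := f_equal Cmod E). rewrite Cmod_mult, Cmod_0 in E2.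
            assert (A1 := Hne _ _ Hza). assert (A2 := Hne _ _ Hzb). nra. }
        assert (A3 := Hden z Hza Hzb).
        rewrite Cmod_div in B by (apply Cmod_pos_neq; auto).
        rewrite Cmod_mult, Cmod_pow in *.
        apply Rmult_le_compat_r with (r := Cmod (z - a)%C ^ k * Cmod (z - b)%C) in B; [|lra].
        unfold Rdiv at 1 in B. rewrite Rmult_assoc, Rinv_l, Rmult_1_r in B by lra. exact B. }
      apply Rnot_lt_le. intro L.
      set (X := Cmod (z - a)%C) in *. assert (HX : 0 < X) by (apply Hne; auto).
      set (A := 2 * M / r ^ S k) in *. assert (HA : 0 < A). { apply Rdiv_lt_0_compat; [lra|now apply pow_lt]. }
      assert (HXk : 0 < X ^ k) by (now apply pow_lt).
      set (gap := Cmod (h z) - A * X ^ S k) in *.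
      (* The zero [b] is taken so close to [a] that replacing [|z - b|] by [|z - a|] in [HQ] costs
         less than [gap]. *)
      destruct (Hacc (Rmin (r / 2) (Rmin X (gap / (A * X ^ k))))) as (b & Hba & Hbe & Hhb).
      { repeat apply Rmin_glb_lt; try lra. apply Rdiv_lt_0_compat; unfold gap in *; nra. }
      set (q1 := gap / (A * X ^ k)) in *.
      assert (M1 := Rmin_l (r/2) (Rmin X q1)). assert (M2 := Rmin_r (r/2) (Rmin X q1)).
      assert (M3 := Rmin_l X q1). assert (M4 := Rmin_r X q1).
      assert (Hzb : z <> b). { intro; subst z. unfold X in *. lra. }
      specialize (HQ b Hba ltac:(lra) Hhb Hzb).
      assert (T := Cmod_sub_triangle z a b). rewrite (Cmod_sub_sym a b) in T. fold X in T.
      assert (q1 * (A * X ^ k) = gap) by (unfold q1; field; lra).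
      assert (A * (X ^ k * Cmod (z - b)%C) <= A * (X ^ k * (X + Cmod (b - a)%C))).
      { apply Rmult_le_compat_l; [lra|]. apply Rmult_le_compat_l; lra. }
      assert (Cmod (b - a)%C * (A * X ^ k) < gap). { rewrite <- H. apply Rmult_lt_compat_r; nra. }
      unfold gap in *. simpl in *. nra. }
  intros z Hz. destruct (classic (z = a)) as [->|Hza].
  - destruct (classic (h a = 0%C)) as [E|E]; auto. exfalso. apply Cmod_gt_0 in E.
    destruct (Hol2_cont h a (Hh a ltac:(rewrite Cmod_diag; lra)) (Cmod (h a)) E) as (d & Hd & Hc).
    destruct (Hacc d Hd) as (b & _ & Hbd & Hb0). specialize (Hc b Hbd). rewrite Hb0 in Hc.
    replace (0 - h a)%C with (- h a)%C in Hc by ring. rewrite Cmod_opp in Hc. lra.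
  - apply Cmod_lt_small. intros e He.
    destruct (small_geom (2 * M) (Cmod (z - a)%C / r) e) as [k Hk]; auto.
    { split. apply Rdiv_le_0_compat; auto using Cmod_ge_0.
      apply Rmult_lt_reg_r with r; auto. unfold Rdiv. rewrite Rmult_assoc, Rinv_l by lra. lra. }
    specialize (HK k z ltac:(lra) Hza). left. eapply Rle_lt_trans; [exact HK|]. eapply Rle_lt_trans; [|exact Hk].
    right. unfold Rdiv. rewrite Rpow_mult_distr, pow_inv. ring.
Qed.

Lemma circle_lower (h : C -> C) (a : C) (r : R) : 0 < r ->
  (forall z, Cmod (z - a)%C = r -> Ccont h z) -> (forall z, Cmod (z - a)%C = r -> h z <> 0%C) ->
  exists m, 0 < m /\ forall z, Cmod (z - a)%C = r -> m <= Cmod (h z).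
Proof.
  intros Hr Hc Hn. apply NNPP. intro Q.
  assert (A : forall n : nat, exists z, Cmod (z - a)%C = r /\ Cmod (h z) < / (INR n + 1)).
  { intro n. apply NNPP. intro N. apply Q. exists (/ (INR n + 1)). split.
    - apply Rinv_0_lt_compat. generalize (pos_INR n). lra.
    - intros z Hz. apply Rnot_lt_le. intro L. apply N. eauto. }
  apply functional_choice in A. destruct A as [u Hu].
  destruct (bw_C u (r + Cmod a)) as (p & l & Hp & Hl).
  { intro n. assert (T := Cmod_le_sub (u n) a). rewrite (proj1 (Hu n)) in T. lra. }
  assert (Hla : Cmod (l - a)%C = r).
  { assert (L1 := Ccv_const_sub _ _ a Hl). apply Rle_antisym.
    - apply (Ccv_mod_le _ _ _ L1). intro n. right. apply Hu.
    - apply Rnot_lt_le. intro L. destruct (Hl (r - Cmod (l - a)%C)) as [N HN]. lra.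
      specialize (HN N (Nat.le_refl N)). assert (T := Cmod_sub_triangle (u (p N)) l a).
      rewrite (proj1 (Hu (p N))) in T. lra. }
  specialize (Hn l Hla). apply Cmod_gt_0 in Hn.
  destruct (Hc l Hla (Cmod (h l) / 2)) as (d & Hd & HC). lra.
  destruct (Hl d Hd) as [N HN]. destruct (archimed_cor1 (Cmod (h l) / 2)) as [k [Hk Hk0]]. lra.
  set (n := (N + k)%nat). specialize (HC (u (p n)) (HN n ltac:(lia))).
  assert (B := proj2 (Hu (p n))). assert (D := Hp n).
  assert (/ (INR (p n) + 1) <= / INR k).
  { apply Rinv_le_contravar. apply lt_0_INR; lia. assert (INR k <= INR (p n)) by (apply le_INR; lia). lra. }
  assert (T := Cmod_le_sub (h l) (h (u (p n)))). rewrite Cmod_sub_sym in T. lra.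
Qed.

Lemma disc_bound (h : C -> C) (a : C) (r : R) : 0 < r ->
  (forall z, Cmod (z - a)%C <= r -> Ccont h z) ->
  exists M, 0 < M /\ forall z, Cmod (z - a)%C <= r -> Cmod (h z) <= M.
Proof.
  intros Hr Hc. destruct (disc_max a r (fun z => Cmod (h z))) as (z0 & Hz0 & Hm). lra.
  - intros z Hz e He. destruct (Cmod_cont_abs h z (Hc z Hz) e He) as (d & Hd & A). exists d. split; auto.
  - exists (Cmod (h z0) + 1). split. generalize (Cmod_ge_0 (h z0)); lra.
    intros z Hz. specialize (Hm z Hz). lra.
Qed.

Definition good_at (Sol : R -> C -> Prop) (H : R -> C -> C) (t : R) : Prop :=
  exists k, Sol t k /\ (forall k', Sol t k' -> k' = k) /\ simple_zero (H t) k.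

(* A unique simple zero persists (two nearby zeros would merge into a double
   one) and survives limits (Hurwitz), so it can be followed along [t]. *)
Lemma zero_continuation (Sol : R -> C -> Prop) (H : R -> C -> C) (t1 t2 L : R) :
  t1 <= t2 ->
  (forall t k, t1 <= t <= t2 -> Sol t k -> Cmod k <= L) ->
  (forall t k, t1 <= t <= t2 ->
     (forall e, 0 < e -> exists t' k', t1 <= t' <= t2 /\ Rabs (t' - t) < e /\ Cmod (k' - k)%C < e /\ Sol t' k') ->
     Sol t k) ->
  (forall t k, t1 <= t <= t2 -> Cmod k < L + 1 -> Hol2 (H t) k) ->
  (forall t e, t1 <= t <= t2 -> 0 < e -> exists d, 0 < d /\ forall t' k, t1 <= t' <= t2 -> Rabs (t' - t) < d ->
     Cmod k < L + 1 -> Cmod (H t' k - H t k)%C <= e) ->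
  (forall t k, t1 <= t <= t2 -> Sol t k -> H t k = 0%C) ->
  (forall t k, t1 <= t <= t2 -> Sol t k -> exists d, 0 < d /\ forall t' k', t1 <= t' <= t2 ->
     Rabs (t' - t) < d -> Cmod (k' - k)%C < d -> H t' k' = 0%C -> Sol t' k') ->
  good_at Sol H t2 -> good_at Sol H t1.
Proof.
  intros Ht HL Hcl Hhol Hcont Hz Hop.
  assert (Hne : forall u v : C, u <> v -> 0 < Cmod (u - v)%C).
  { intros u v E. apply Cmod_gt_0. intro F. apply E, Csub_eq; auto. }
  assert (Hdom : forall t a z r, t1 <= t <= t2 -> Sol t a -> r <= 1 / 2 -> Cmod (z - a)%C <= r -> Cmod z < L + 1).
  { intros t a z r It Ha Hr Hza. specialize (HL t a It Ha). assert (T := Cmod_le_sub z a). lra. }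
  assert (Hself : forall x d, 0 < d -> Rabs (x - x) < d) by (intros; replace (x - x) with 0 by ring; rewrite Rabs_R0; auto).
  (* Zeros of [H t] cannot accumulate at a solution. Otherwise the identity theorem makes [H t]
     vanish around it, and the set [W] of such solutions is open and closed along a horizontal half
     line, so it contains solutions of modulus beyond [L]. *)
  assert (Hiso : forall t a, t1 <= t <= t2 -> Sol t a ->
     exists r, 0 < r /\ forall z, Cmod (z - a)%C < r -> z <> a -> H t z <> 0%C).
  { intros t a It Ha. apply NNPP. intro Q.
    set (W := fun z => Sol t z /\ forall e, 0 < e -> exists b, b <> z /\ Cmod (b - z)%C < e /\ H t b = 0%C).
    assert (HWa : W a).
    { split; auto. intros e He. apply NNPP. intro N. apply Q. exists e. split; auto.
      intros z Hze Hza E. apply N. exists z. auto. }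
    assert (HWall : forall X, 0 <= X -> W (a + RtoC X)%C).
    { intros X HX. apply (conn (fun x => W (a + RtoC x)%C) 0 X HX).
      - intros x Hx. set (z := (a + RtoC x)%C).
        assert (Hzy : forall y, (a + RtoC y - z)%C = RtoC (y - x)).
        { intro y. unfold z. rewrite RtoC_minus. ring. }
        destruct (classic (W z)) as [Wz|Wz].
        + destruct Wz as [Sz Az]. destruct (Hop t z It Sz) as (d & Hd & HO).
          assert (HZ : forall w, Cmod (w - z)%C < 1 / 2 -> H t w = 0%C).
          { destruct (disc_bound (H t) z (1/2)) as (M & HM & HMb). lra.
            { intros w Hw. apply Hol2_cont, Hhol; auto. apply (Hdom t z w (1/2)); auto; lra. }
            apply (identity_theorem (H t) z (1/2) M); auto. lra.
            intros w Hw. apply Hhol; auto. apply (Hdom t z w (1/2)); auto; lra. }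
          exists (Rmin d (1 / 4)). split. { apply Rmin_glb_lt; lra. }
          intros y Hy Hyx. assert (M1 := Rmin_l d (1/4)). assert (M2 := Rmin_r d (1/4)).
          split; intros _; [|split; auto].
          assert (Hyz : Cmod (a + RtoC y - z)%C = Rabs (y - x)) by (rewrite Hzy, Cmod_R; auto).
          split.
          * apply HO; auto; try (rewrite Hyz; lra). apply HZ. rewrite Hyz. lra.
          * intros e He. set (x0 := Rmin (e / 2) (1 / 8)). assert (Hx0 : 0 < x0) by (apply Rmin_glb_lt; lra).
            assert (Hx1 : x0 <= e / 2) by apply Rmin_l. assert (Hx2 : x0 <= 1 / 8) by apply Rmin_r.
            assert (Hm : Cmod (a + RtoC y + RtoC x0 - (a + RtoC y))%C = x0).
            { replace (a + RtoC y + RtoC x0 - (a + RtoC y))%C with (RtoC x0) by ring. rewrite Cmod_R, Rabs_pos_eq; lra. }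
            exists (a + RtoC y + RtoC x0)%C. split; [|split].
            { intro E. rewrite E, Cmod_diag in Hm. lra. }
            { rewrite Hm. lra. }
            { apply HZ. assert (T := Cmod_sub_triangle (a + RtoC y + RtoC x0)%C (a + RtoC y)%C z).
              rewrite Hm, Hyz in T. lra. }
        + assert (exists e, 0 < e /\ forall y, Rabs (y - x) < e -> ~ W (a + RtoC y)%C) as (e & He & HN).
          { apply NNPP. intro N. apply Wz.
            assert (HN : forall e, 0 < e -> exists y, Rabs (y - x) < e /\ W (a + RtoC y)%C).
            { intros e He. apply NNPP. intro N2. apply N. exists e. split; auto. intros y Hy HW. apply N2. eauto. }
            split.
            - apply Hcl; auto. intros e He. destruct (HN e He) as (y & Hy & [HS _]).
              exists t, (a + RtoC y)%C. repeat split; auto; try lra. rewrite Hzy, Cmod_R. auto.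
            - intros e He. destruct (HN (e/2) ltac:(lra)) as (y & Hy & [HS HA]).
              destruct (Req_dec y x) as [->|Hyx]. { apply HA; auto. }
              exists (a + RtoC y)%C. split; [|split].
              + intro E. assert (E2 := Hzy y). rewrite E in E2. assert (E3 := f_equal Cmod E2).
                rewrite Cmod_diag, Cmod_R in E3. symmetry in E3. apply Rabs_eq_0 in E3. lra.
              + rewrite Hzy, Cmod_R. lra.
              + apply Hz; auto. }
          exists e. split; auto. intros y Hy Hyx. specialize (HN y Hyx). split; intro; contradiction.
      - replace (a + RtoC 0)%C with a by ring. auto. }
    set (X := L + Cmod a + 1). assert (HLa := HL t a It Ha). assert (P := Cmod_ge_0 a).
    assert (HX : 0 <= X) by (unfold X; lra). destruct (HWall X HX) as [HS _]. apply HL in HS; auto.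
    assert (T := Cmod_le_sub (RtoC X) (a + RtoC X)%C).
    replace (RtoC X - (a + RtoC X))%C with (- a)%C in T by ring. rewrite Cmod_opp, Cmod_R, Rabs_pos_eq in T by auto.
    unfold X in *. lra. }
  (* Rouche on every small circle around a solution: for [t'] near [t] the disc contains a zero of
     [H t'], and all its zeros there are solutions. The radius stays free for the later steps. *)
  assert (Hrad : forall t a, t1 <= t <= t2 -> Sol t a -> exists r0, 0 < r0 /\ r0 <= 1 / 2 /\
      forall r, 0 < r -> r < r0 -> exists m d, 0 < m /\ 0 < d /\
        (forall z, Cmod (z - a)%C = r -> m <= Cmod (H t z)) /\
        (forall t', t1 <= t' <= t2 -> Rabs (t' - t) < d ->
           (forall z, Cmod (z - a)%C <= r -> Cmod (H t' z - H t z)%C <= m / 4) /\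
           (forall z, Cmod (z - a)%C <= r -> Hol2 (H t') z) /\
           (exists z, Cmod (z - a)%C < r /\ H t' z = 0%C) /\
           (forall z, Cmod (z - a)%C <= r -> H t' z = 0%C -> Sol t' z))).
  { intros t a It Ha. destruct (Hiso t a It Ha) as (ri & Hri & Hi). destruct (Hop t a It Ha) as (d0 & Hd0 & HO).
    exists (Rmin ri (Rmin d0 (1/2))). split. { repeat apply Rmin_glb_lt; lra. }
    split. { eapply Rle_trans; [apply Rmin_r|apply Rmin_r]. }
    intros r Hr Hr0. assert (M1 := Rmin_l ri (Rmin d0 (1/2))). assert (M2 := Rmin_r ri (Rmin d0 (1/2))).
    assert (M3 := Rmin_l d0 (1/2)). assert (M4 := Rmin_r d0 (1/2)).
    assert (Hd1 : forall z, Cmod (z - a)%C <= r -> Cmod z < L + 1).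
    { intros z Hza. apply (Hdom t a z r); auto; lra. }
    destruct (circle_lower (H t) a r Hr) as (m & Hm & Hlow).
    { intros z Hza. apply Hol2_cont, Hhol; auto. apply Hd1; lra. }
    { intros z Hza. apply Hi. lra. intro; subst z. rewrite Cmod_diag in Hza. lra. }
    destruct (Hcont t (m / 4) It ltac:(lra)) as (d & Hd & Hc).
    exists m, (Rmin d d0). split; auto. split. { now apply Rmin_glb_lt. } split; auto.
    intros t' It' Htt. assert (N1 := Rmin_l d d0). assert (N2 := Rmin_r d d0).
    assert (A1 : forall z, Cmod (z - a)%C <= r -> Cmod (H t' z - H t z)%C <= m / 4).
    { intros z Hza. apply Hc; auto; try lra. }
    assert (A2 : forall z, Cmod (z - a)%C <= r -> Hol2 (H t') z).
    { intros z Hza. apply Hhol; auto. }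
    split; auto. split; auto. split.
    - apply (rouche_zero (H t) (H t') a r m); auto.
    - intros z Hza E. apply HO; auto; lra. }
  assert (Hopen : forall t, t1 <= t <= t2 -> good_at Sol H t ->
     exists d, 0 < d /\ forall t', t1 <= t' <= t2 -> Rabs (t' - t) < d -> good_at Sol H t').
  { intros t It (a & Sa & Ua & (c & dc & Hc & Hdc & Hs)).
    destruct (Hrad t a It Sa) as (r0 & Hr0 & Hr0h & HR).
    set (r := r0 / 2). destruct (HR r ltac:(unfold r; lra) ltac:(unfold r; lra)) as (m & d & Hm & Hd & Hlow & HB).
    assert (Hr : 0 < r) by (unfold r; lra).
    assert (Hnear : forall e, 0 < e -> exists d', 0 < d' /\ forall t' z, t1 <= t' <= t2 -> Rabs (t' - t) < d' -> Sol t' z -> Cmod (z - a)%C < e).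
    { intros e He. apply NNPP. intro N.
      assert (A : forall n : nat, exists p : R * C, t1 <= fst p <= t2 /\ Rabs (fst p - t) < / (INR n + 1) /\ Sol (fst p) (snd p) /\ e <= Cmod (snd p - a)%C).
      { intro n. apply NNPP. intro N2. apply N. exists (/ (INR n + 1)). split.
        - apply Rinv_0_lt_compat. generalize (pos_INR n). lra.
        - intros t' z It' Htt Sz. apply Rnot_le_lt. intro Le. apply N2. exists (t', z). simpl. tauto. }
      apply functional_choice in A. destruct A as [p Hp].
      destruct (bw_C (fun n => snd (p n)) L) as (q & l & Hq & Hl).
      { intro n. destruct (Hp n) as (A1 & _ & A2 & _). eapply HL; eauto. }
      assert (Sl : Sol t l).
      { apply Hcl; auto. intros e' He'. destruct (Hl e' He') as [N1 HN1].
        destruct (archimed_cor1 e' He') as [k [Hk Hk0]]. set (n := (N1 + k)%nat).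
        destruct (Hp (q n)) as (A1 & A2 & A3 & _). exists (fst (p (q n))), (snd (p (q n))).
        split; auto. split; [|split; auto; apply HN1; lia].
        eapply Rlt_trans; [exact A2|]. eapply Rle_lt_trans; [|exact Hk].
        apply Rinv_le_contravar. apply lt_0_INR; lia.
        assert (D := Hq n). assert (INR k <= INR (q n)) by (apply le_INR; lia). lra. }
      apply Ua in Sl. subst l. destruct (Hl e He) as [N1 HN1]. specialize (HN1 N1 (Nat.le_refl N1)).
      destruct (Hp (q N1)) as (_ & _ & _ & A4). simpl in *. lra. }
    destruct (disc_bound (H t) a r Hr) as (M & HM & HMb).
    { intros z Hza. apply Hol2_cont, Hhol; auto. apply (Hdom t a z r); auto. unfold r; lra. }
    set (M' := M + m). assert (HM' : 0 < M') by (unfold M'; lra).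
    (* At distance [x] from [a] the simple zero of [H t] forces a size [c x], whereas two zeros of
       [H t'] within [x / 2] of [a] allow only a multiple of [M' x^2 / r^2]. *)
    set (x := Rmin (dc / 2) (Rmin (r / 2) (c * r ^ 2 / (32 * M')))).
    assert (Hr2 : 0 < r ^ 2) by (now apply pow_lt).
    assert (Hx : 0 < x). { unfold x. repeat apply Rmin_glb_lt; try lra. apply Rdiv_lt_0_compat; nra. }
    assert (Hx1 : x <= dc / 2) by apply Rmin_l.
    assert (Hx2 : x <= r / 2) by (unfold x; eapply Rle_trans; [apply Rmin_r|apply Rmin_l]).
    assert (Hx3 : x <= c * r ^ 2 / (32 * M')) by (unfold x; eapply Rle_trans; [apply Rmin_r|apply Rmin_r]).
    assert (Hx4 : x * (32 * M') <= c * r ^ 2).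
    { apply Rmult_le_compat_r with (r := 32 * M') in Hx3; [|lra].
      replace (c * r ^ 2 / (32 * M') * (32 * M')) with (c * r ^ 2) in Hx3 by (field; lra). lra. }
    destruct (Hnear (x / 2) ltac:(lra)) as (d1 & Hd1 & Hn1).
    destruct (Hcont t (c * x / 4) It ltac:(nra)) as (d2 & Hd2 & Hc2).
    exists (Rmin d (Rmin d1 d2)). split. { repeat apply Rmin_glb_lt; auto. }
    intros t' It' Htt. assert (Q1 := Rmin_l d (Rmin d1 d2)). assert (Q2 := Rmin_r d (Rmin d1 d2)).
    assert (Q3 := Rmin_l d1 d2). assert (Q4 := Rmin_r d1 d2).
    destruct (HB t' It' ltac:(lra)) as (B1 & B2 & (p & Hp & Hp0) & B4).
    assert (Sp : Sol t' p) by (apply B4; auto; lra).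
    assert (HMg : forall z, Cmod (z - a)%C <= r -> Cmod (H t' z) <= M').
    { intros z Hza. assert (T := Cmod_le_sub (H t' z) (H t z)). specialize (B1 z Hza). specialize (HMb z Hza). unfold M'. lra. }
    (* Covers both ways of being bad at once: a second solution [q], or [q = p] with [p] not
       simple. *)
    assert (Hcontra : forall q, Sol t' q -> (p = q -> ~ simple_zero (H t') p) -> False).
    { intros q Sq Hpq.
      assert (E1 := Hn1 t' p It' ltac:(lra) Sp). assert (E2 := Hn1 t' q It' ltac:(lra) Sq).
      set (z := (a + RtoC x)%C).
      assert (Hza : Cmod (z - a)%C = x).
      { unfold z. replace (a + RtoC x - a)%C with (RtoC x) by ring. rewrite Cmod_R, Rabs_pos_eq; lra. }
      assert (Hzp : z <> p) by (intro; subst z; rewrite H0 in Hza; lra).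
      assert (Hzq : z <> q) by (intro; subst z; rewrite H0 in Hza; lra).
      assert (G := two_zeros_bound (H t') a p q r M' Hr HM' B2 HMg ltac:(lra) ltac:(lra)
        (Hz t' p It' Sp) (Hz t' q It' Sq) Hpq z ltac:(lra) Hzp Hzq).
      assert (T1 := Cmod_sub_triangle z a p). assert (T2 := Cmod_sub_triangle z a q).
      rewrite (Cmod_sub_sym a p) in T1. rewrite (Cmod_sub_sym a q) in T2.
      assert (S1 := Hs z ltac:(lra)). rewrite Hza in *.
      assert (C1 := Hc2 t' z It' ltac:(lra) ltac:(apply (Hdom t a z r); auto; unfold r in *; lra)).
      assert (T3 := Cmod_le_sub (H t z) (H t' z)). rewrite (Cmod_sub_sym (H t z)) in T3.
      assert (P1 := Cmod_ge_0 (z - p)%C). assert (P2 := Cmod_ge_0 (z - q)%C).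
      assert (G2 : Cmod (z - p)%C * Cmod (z - q)%C <= (3 / 2 * x) * (3 / 2 * x)) by (apply Rmult_le_compat; lra).
      assert (G3 : 0 < 4 * M' / r ^ 2) by (apply Rdiv_lt_0_compat; lra).
      assert (G4 : 4 * M' / r ^ 2 * (Cmod (z - p)%C * Cmod (z - q)%C) <= 4 * M' / r ^ 2 * ((3 / 2 * x) * (3 / 2 * x))) by (apply Rmult_le_compat_l; lra).
      assert (G5 : 4 * M' / r ^ 2 * x <= c / 8).
      { apply Rmult_le_reg_r with (r ^ 2); auto. field_simplify; try lra. }
      nra. }
    exists p. split; auto. split.
    - intros q Sq. apply NNPP. intro Npq. apply (Hcontra q Sq). intro E. subst. contradiction.
    - apply NNPP. intro Ns. apply (Hcontra p Sp). auto. }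
  assert (Hclosed : forall t, t1 <= t <= t2 ->
     (forall e, 0 < e -> exists t', t1 <= t' <= t2 /\ Rabs (t' - t) < e /\ good_at Sol H t') -> good_at Sol H t).
  { intros t It HG.
    assert (Hex : exists a, Sol t a).
    { assert (A : forall n : nat, exists p : R * C, t1 <= fst p <= t2 /\ Rabs (fst p - t) < / (INR n + 1) /\ Sol (fst p) (snd p)).
      { intro n. destruct (HG (/ (INR n + 1))) as (t' & A1 & A2 & (k & A3 & _)).
        { apply Rinv_0_lt_compat. generalize (pos_INR n). lra. }
        exists (t', k). auto. }
      apply functional_choice in A. destruct A as [p Hp].
      destruct (bw_C (fun n => snd (p n)) L) as (q & l & Hq & Hl).
      { intro n. destruct (Hp n) as (A1 & _ & A2). eapply HL; eauto. }
      exists l. apply Hcl; auto. intros e' He'. destruct (Hl e' He') as [N1 HN1].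
      destruct (archimed_cor1 e' He') as [k [Hk Hk0]]. set (n := (N1 + k)%nat).
      destruct (Hp (q n)) as (A1 & A2 & A3). exists (fst (p (q n))), (snd (p (q n))).
      split; auto. split; [|split; auto; apply HN1; lia].
      eapply Rlt_trans; [exact A2|]. eapply Rle_lt_trans; [|exact Hk].
      apply Rinv_le_contravar. apply lt_0_INR; lia.
      assert (D := Hq n). assert (INR k <= INR (q n)) by (apply le_INR; lia). lra. }
    (* Every solution at [t] attracts the unique solutions at nearby [t']; hence there cannot be two
       of them. *)
    assert (Hlim : forall a, Sol t a -> forall e, 0 < e -> exists d, 0 < d /\ forall t' k,
       t1 <= t' <= t2 -> Rabs (t' - t) < d -> (forall k', Sol t' k' -> k' = k) -> Cmod (k - a)%C < e).
    { intros a Sa e He. destruct (Hrad t a It Sa) as (r0 & Hr0 & Hr0h & HR).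
      set (r := Rmin (r0 / 2) (e / 2)). assert (Hr : 0 < r) by (apply Rmin_glb_lt; lra).
      assert (N1 : r <= r0 / 2) by apply Rmin_l. assert (N2 : r <= e / 2) by apply Rmin_r.
      destruct (HR r Hr ltac:(lra)) as (m & d & Hm & Hd & Hlow & HB). exists d. split; auto.
      intros t' k It' Htt Hu. destruct (HB t' It' Htt) as (_ & _ & (p & Hp & Hp0) & B4).
      assert (E : p = k) by (apply Hu, B4; auto; lra). subst p. lra. }
    destruct Hex as [a Sa]. exists a. split; auto. split.
    - intros b Sb. apply NNPP. intro N. apply Hne in N.
      destruct (Hlim a Sa (Cmod (b - a)%C / 2) ltac:(lra)) as (d & Hd & HA).
      destruct (Hlim b Sb (Cmod (b - a)%C / 2) ltac:(lra)) as (d' & Hd' & HB).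
      destruct (HG (Rmin d d')) as (t' & A1 & A2 & (k & A3 & A4 & _)). { now apply Rmin_glb_lt. }
      assert (M1 := Rmin_l d d'). assert (M2 := Rmin_r d d').
      specialize (HA t' k A1 ltac:(lra) A4). specialize (HB t' k A1 ltac:(lra) A4).
      assert (T := Cmod_sub_triangle b k a). rewrite (Cmod_sub_sym b k) in T. lra.
    - destruct (Hrad t a It Sa) as (r0 & Hr0 & Hr0h & HR).
      set (r := r0 / 2). assert (Hr : 0 < r) by (unfold r; lra).
      destruct (HR r Hr ltac:(unfold r; lra)) as (m & d & Hm & Hd & Hlow & HB).
      exists (m / (4 * r)), r. split. { apply Rdiv_lt_0_compat; lra. } split; auto.
      (* The bound of [simple_zero_lower] holds at nearby [t'] with constants independent of [t'],
         so it persists at [t]; a defect [gap] is refuted by coming close enough. *)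
      intros z Hza. apply Rmult_le_reg_l with (4 * r / m). { apply Rdiv_lt_0_compat; lra. }
      replace (4 * r / m * (m / (4 * r) * Cmod (z - a)%C)) with (Cmod (z - a)%C) by (field; lra).
      apply Rnot_lt_le. intro Lt. set (gap := Cmod (z - a)%C - 4 * r / m * Cmod (H t z)).
      assert (Hgap : 0 < gap) by (unfold gap; lra).
      assert (H4 : 0 < 4 * r / m) by (apply Rdiv_lt_0_compat; lra).
      destruct (Hlim a Sa (Rmin r (gap / 4))) as (d1 & Hd1 & HA). { apply Rmin_glb_lt; lra. }
      destruct (Hcont t (gap / 4 / (4 * r / m)) It) as (d2 & Hd2 & Hc2). { apply Rdiv_lt_0_compat; lra. }
      destruct (HG (Rmin d (Rmin d1 d2))) as (t' & A1 & A2 & (k & A3 & A4 & A5)). { repeat apply Rmin_glb_lt; auto. }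
      assert (Q1 := Rmin_l d (Rmin d1 d2)). assert (Q2 := Rmin_r d (Rmin d1 d2)).
      assert (Q3 := Rmin_l d1 d2). assert (Q4 := Rmin_r d1 d2).
      specialize (HA t' k A1 ltac:(lra) A4). assert (Q5 := Rmin_l r (gap / 4)). assert (Q6 := Rmin_r r (gap / 4)).
      destruct (HB t' A1 ltac:(lra)) as (B1 & B2 & _ & B4).
      assert (S := simple_zero_lower (H t) (H t') a k r m Hr Hm B2 Hlow B1 ltac:(lra) A5 (Hz t' k A1 A3)
        (fun w Hw E => A4 w (B4 w Hw E)) z ltac:(lra)).
      assert (C1 := Hc2 t' z A1 ltac:(lra) ltac:(apply (Hdom t a z r); auto; unfold r in *; lra)).
      assert (T := Cmod_sub_triangle z k a). assert (T2 := Cmod_le_sub (H t' z) (H t z)).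
      assert (4 * r / m * Cmod (H t' z) <= 4 * r / m * (Cmod (H t z) + gap / 4 / (4 * r / m))) by (apply Rmult_le_compat_l; lra).
      rewrite Rmult_plus_distr_l in H0.
      replace (4 * r / m * (gap / 4 / (4 * r / m))) with (gap / 4) in H0 by (field; lra).
      unfold gap in *. lra. }
  intro G2. apply (conn_back (good_at Sol H) t1 t2); auto.
  intros x Hx. destruct (classic (good_at Sol H x)) as [G|G].
  - destruct (Hopen x Hx G) as (d & Hd & A). exists d. split; auto. intros y Hy Hyx. specialize (A y Hy Hyx). tauto.
  - assert (exists d, 0 < d /\ forall y, t1 <= y <= t2 -> Rabs (y - x) < d -> ~ good_at Sol H y) as (d & Hd & A).
    { apply NNPP. intro N. apply G. apply Hclosed; auto. intros e He. apply NNPP. intro N2. apply N.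
      exists e. split; auto. intros y Hy Hyx Gy. apply N2. eauto. }
    exists d. split; auto. intros y Hy Hyx. specialize (A y Hy Hyx). tauto.
Qed.

(** * The iterates of [F] and exponential bounds *)

Definition Fn (n : nat) (t : R) : R := Nat.iter n F t.

Lemma Fn_S n t : Fn (S n) t = exp (Fn n t) - 1.
Proof. reflexivity. Qed.

Lemma Fn_add n m t : Fn (n + m) t = Fn n (Fn m t).
Proof. induction n. reflexivity. change (S n + m)%nat with (S (n + m)). now rewrite !Fn_S, IHn. Qed.

Lemma exp_quad (x : R) : 0 <= x -> 1 + x + x ^ 2 / 4 <= exp x.
Proof.
  intro H. replace x with (x / 2 + x / 2) at 3 by field. rewrite exp_plus.
  assert (A := exp_ineq1_le (x / 2)). nra.
Qed.

Lemma Fn_pos n t : 0 < t -> 0 < Fn n t.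
Proof.
  intro H. induction n. exact H. rewrite Fn_S. assert (A := exp_ineq1 (Fn n t)). lra.
Qed.

Lemma Fn_S_gt n t : 0 < t -> Fn n t < Fn (S n) t.
Proof. intro H. rewrite Fn_S. assert (A := Fn_pos n t H). assert (B := exp_ineq1 (Fn n t)). lra. Qed.

Lemma Fn_mono_n n m t : 0 < t -> (n <= m)%nat -> Fn n t <= Fn m t.
Proof.
  intros H L. induction L. lra. assert (A := Fn_S_gt m t H). lra.
Qed.

Lemma Fn_mono n t u : t <= u -> Fn n t <= Fn n u.
Proof. intro H. induction n. exact H. rewrite !Fn_S. apply exp_mono in IHn. lra. Qed.

Lemma Fn_lt n t u : t < u -> Fn n t < Fn n u.
Proof. intro H. induction n. exact H. rewrite !Fn_S. apply exp_increasing in IHn. lra. Qed.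

Lemma Fn_ge_lin n t : 0 < t -> t + INR n * (t ^ 2 / 4) <= Fn n t.
Proof.
  intro H. induction n. simpl. unfold Fn; simpl. lra.
  rewrite Fn_S, S_INR. assert (A := Fn_pos n t H). assert (B := exp_quad (Fn n t) ltac:(lra)).
  assert (C := Fn_mono_n 0 n t H ltac:(lia)). unfold Fn in C at 1; simpl in C. nra.
Qed.

Lemma Fn_unbounded t M : 0 < t -> exists N, forall n, (N <= n)%nat -> M < Fn n t.
Proof.
  intro H. destruct (INR_unbounded (M / (t ^ 2 / 4))) as [N HN]. exists N. intros n Hn.
  assert (A := Fn_ge_lin N t H). assert (B := Fn_mono_n N n t H Hn).
  assert (0 < t ^ 2 / 4) by nra.
  apply Rmult_gt_compat_r with (r := t ^ 2 / 4) in HN; auto.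
  replace (M / (t ^ 2 / 4) * (t ^ 2 / 4)) with M in HN by (field; lra). lra.
Qed.

Lemma Fn_gap_S n t u : t <= u -> exp (Fn n t) * (Fn n u - Fn n t) <= Fn (S n) u - Fn (S n) t.
Proof.
  intro H. rewrite !Fn_S. set (x := Fn n t). set (y := Fn n u).
  replace (exp y) with (exp x * exp (y - x)) by (rewrite <- exp_plus; f_equal; ring).
  assert (A := exp_ineq1_le (y - x)). assert (B := exp_pos x). nra.
Qed.

Lemma Fn_gap t u M : 0 < t -> t < u -> exists N, forall n, (N <= n)%nat -> M < Fn n u - Fn n t.
Proof.
  intros Ht Hu. set (g := u - t).
  assert (A : forall n, g <= Fn n u - Fn n t).
  { induction n. unfold Fn, g; simpl; lra.
    assert (B := Fn_gap_S n t u ltac:(lra)). assert (C := Fn_pos n t Ht). assert (D := exp_ineq1 (Fn n t)).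
    unfold g in *. assert (0 < Fn n u - Fn n t) by lra. nra. }
  destruct (Fn_unbounded t (M / g) Ht) as [N HN]. exists (S N). intros n Hn. destruct n; [lia|].
  assert (B := Fn_gap_S n t u ltac:(lra)). specialize (HN n ltac:(lia)). specialize (A n).
  assert (D := exp_ineq1_le (Fn n t)). assert (Hg : 0 < g) by (unfold g; lra).
  apply Rmult_lt_compat_r with (r := g) in HN; auto.
  replace (M / g * g) with M in HN by (field; lra).
  assert (P := Fn_pos n t Ht).
  assert (Fn n t * g <= exp (Fn n t) * (Fn n u - Fn n t)) by (apply Rmult_le_compat; unfold g in *; lra). lra.
Qed.

Lemma exp_2_ge_4 : 4 <= exp 2.
Proof. replace 2 with (1 + 1) by ring. rewrite exp_plus. assert (A := exp_ineq1_le 1). nra. Qed.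

Lemma Fn_ratio b t1 : 0 < b -> b < t1 -> exists m0, forall m t, (m0 <= m)%nat -> t1 <= t -> 4 * Fn m b <= Fn m t.
Proof.
  intros Hb H. destruct (Fn_gap b t1 2 Hb H) as [N HN]. exists (S N). intros m t Hm Ht. destruct m; [lia|].
  specialize (HN m ltac:(lia)). assert (A := Fn_mono m t1 t Ht). rewrite !Fn_S.
  set (x := Fn m b) in *. assert (E : exp (x + 2) <= exp (Fn m t)) by (apply exp_mono; lra).
  rewrite exp_plus in E. assert (B := exp_2_ge_4). assert (C := exp_pos x). nra.
Qed.

Lemma pow4_exp (v : R) : 0 <= v -> (exp v - 1) ^ 4 <= exp (4 * v) - 1.
Proof.
  intro H. replace (4 * v) with (v + v + (v + v)) by ring. rewrite !exp_plus.
  assert (A := exp_ineq1_le v). set (E := exp v) in *. assert (B : 1 <= E) by lra.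
  replace (E * E * (E * E) - 1) with ((E - 1) ^ 4 + (E - 1) * (4 * E ^ 2 - 2 * E + 2)) by ring.
  assert (0 <= 4 * E ^ 2 - 2 * E + 2) by nra. nra.
Qed.

Lemma Fn_pow4_S m b t : 0 < b -> 4 * Fn m b <= Fn m t -> Fn (S m) b ^ 4 <= Fn (S m) t.
Proof.
  intros Hb H. rewrite !Fn_S. eapply Rle_trans; [apply pow4_exp|].
  left; now apply Fn_pos. apply exp_mono in H. lra.
Qed.

(** Under [F] a gap of 2 becomes a factor 4, and a factor 4 becomes a fourth power. The threshold
    concerns the value [Fn m t] and not the level, so that a large [t] qualifies already at level
    0. *)
Lemma Fn_pow4 b t1 : 0 < b -> b < t1 -> exists X0, 0 < X0 /\ forall m t, t1 <= t -> X0 <= Fn m t -> Fn m b ^ 4 <= Fn m t.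
Proof.
  intros Hb H. destruct (Fn_ratio b t1 Hb H) as [m0 Hm0].
  exists (Fn m0 b ^ 4). split. { apply pow_lt. now apply Fn_pos. }
  intros m t Ht HX. destruct (Nat.le_gt_cases m m0) as [L|L].
  - eapply Rle_trans; [|exact HX]. apply pow_incr. split. left; now apply Fn_pos. now apply Fn_mono_n.
  - destruct m; [lia|]. apply Fn_pow4_S; auto. apply Hm0; auto. lia.
Qed.

Lemma is_lim_seq_0 (u : nat -> R) : is_lim_seq u 0 <-> forall e, 0 < e -> exists N, forall n, (N <= n)%nat -> Rabs (u n) < e.
Proof.
  rewrite <- (is_lim_seq_spec u 0). split.
  - intros H e He. destruct (H (mkposreal e He)) as [N HN]. exists N. intros n Hn. specialize (HN n Hn).
    simpl in HN. now rewrite Rminus_0_r in HN.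
  - intros H e. destruct (H e (cond_pos e)) as [N HN]. exists N. intros n Hn. rewrite Rminus_0_r. auto.
Qed.

(* Equivalent to [dominates] up to enlarging [b]. *)
Definition Dom (s : address) (b A : R) : Prop := 0 < b /\ 1 <= A /\ forall n, Rabs (IZR (s n)) <= A * Fn n b.

Lemma prefix_bound (u v : nat -> R) : (forall n, 0 < v n) -> forall N, exists A, 1 <= A /\ forall n, (n < N)%nat -> Rabs (u n) <= A * v n.
Proof.
  intros Hv N. induction N. { exists 1. split. lra. intros; lia. }
  destruct IHN as (A & HA & H). exists (A + Rabs (u N) / v N). 
  assert (P : 0 <= Rabs (u N) / v N) by (apply Rdiv_le_0_compat; auto using Rabs_pos). split. lra.
  intros n Hn. specialize (Hv n). destruct (Nat.eq_dec n N) as [->|Ne].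
  - rewrite Rmult_plus_distr_r. unfold Rdiv. rewrite Rmult_assoc, Rinv_l by lra. assert (0 <= A * v N) by nra. lra.
  - specialize (H n ltac:(lia)). nra.
Qed.

Lemma dominates_Dom s b : dominates s b -> exists A, Dom s b A.
Proof.
  intros [Hb H]. destruct (proj1 (is_lim_seq_0 _) H 1 Rlt_0_1) as [N HN].
  destruct (prefix_bound (fun n => IZR (s n)) (fun n => Fn n b) (fun n => Fn_pos n b Hb) N) as (A & HA & HP).
  exists A. split; auto. split; auto. intro n. assert (P := Fn_pos n b Hb).
  destruct (Nat.lt_ge_cases n N) as [L|L]. { apply HP; auto. }
  specialize (HN n L). fold (Fn n b) in HN. unfold Rdiv in HN. rewrite Rabs_mult, Rabs_inv, (Rabs_pos_eq (Fn n b)) in HN by lra.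
  apply Rmult_lt_compat_r with (r := Fn n b) in HN; auto. rewrite Rmult_assoc, Rinv_l in HN by lra. nra.
Qed.

Lemma Dom_dominates s b A u : Dom s b A -> b < u -> dominates s u.
Proof.
  intros (Hb & HA & H) Hu. split. lra. apply is_lim_seq_0. intros e He.
  destruct (Fn_pow4 b u Hb Hu) as (X0 & HX0 & HX).
  destruct (Fn_unbounded u X0 ltac:(lra)) as [N1 HN1]. destruct (Fn_unbounded b (Rmax 1 (A / e)) Hb) as [N2 HN2].
  exists (N1 + N2)%nat. intros n Hn. specialize (HN1 n ltac:(lia)). specialize (HN2 n ltac:(lia)).
  specialize (HX n u ltac:(lra) ltac:(lra)). specialize (H n). fold (Fn n u).
  assert (P := Fn_pos n u ltac:(lra)). set (x := Fn n b) in *. set (y := Fn n u) in *.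
  assert (M1 := Rmax_l 1 (A / e)). assert (M2 := Rmax_r 1 (A / e)).
  assert (HAe : A < e * x). { assert (L : A / e < x) by lra. apply Rmult_lt_compat_r with (r := e) in L; auto.
    replace (A / e * e) with A in L by (field; lra). lra. }
  unfold Rdiv. rewrite Rabs_mult, Rabs_inv, (Rabs_pos_eq y) by lra.
  apply Rmult_lt_reg_r with y; auto. rewrite Rmult_assoc, Rinv_l by lra. rewrite Rmult_1_r.
  eapply Rle_lt_trans; [exact H|]. apply Rlt_le_trans with (e * x ^ 4); [|nra].
  simpl. assert (1 < x) by lra. assert (x <= x * (x * (x * 1))) by nra. assert (0 < x * x) by nra. nra.
Qed.

Lemma min_potential_lt s t : Rbar_lt (min_potential s) (Finite t) <-> exists b, b < t /\ dominates s b.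
Proof.
  unfold min_potential. destruct (Glb_Rbar_correct (dominates s)) as [H1 H2]. split.
  - intro H. apply NNPP. intro N. assert (Q : is_lb_Rbar (dominates s) (Finite t)).
    { intros x Hx. simpl. apply Rnot_lt_le. intro L. apply N. eauto. }
    specialize (H2 _ Q). apply (Rbar_lt_not_le _ _ H H2).
  - intros (b & Hb & Hd). eapply Rbar_le_lt_trans; [apply (H1 b Hd)|]. exact Hb.
Qed.

Lemma Dom_between s t : Rbar_lt (min_potential s) (Finite t) -> exists b A, b < t /\ Dom s b A.
Proof.
  intro H. apply min_potential_lt in H. destruct H as (b & Hb & Hd). destruct (dominates_Dom s b Hd) as [A HA]. eauto.
Qed.

(** * Rays near infinity *)

Definition base (s : address) (tau : R) (m : nat) : C := (Fn m tau, 2 * PI * IZR (s m))%R.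

(* Approximate inverse orbits: start at [base] and pull back [j] times by the
   branch of the logarithm prescribed by the address. *)
Fixpoint app (s : address) (k : C) (tau : R) (j m : nat) : C :=
  match j with
  | O => base s tau m
  | S j' => (Clog (app s k tau j' (S m) - k) + twopii (s m))%C
  end.

(** For [|k| <= K], a point within 1 of [base] at level [m + 1], minus [k], differs from
    [exp (Fn m tau)] by at most an eighth of that number. The logarithms are then taken well inside
    the right half plane, where they contract. *)
Definition St (s : address) (K : R) (N : nat) (tau : R) : Prop :=
  forall m, (N <= m)%nat -> K + 3 + 2 * PI * Rabs (IZR (s (S m))) <= exp (Fn m tau) / 8.

(** Error of one logarithm step given by [Clog_lip], with 16/7 rounded up to 4. The inequality in
    [St] says precisely that it is at most 1/2. *)
Definition err (s : address) (K tau : R) (m : nat) : R :=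
  4 * (K + 3 + 2 * PI * Rabs (IZR (s (S m)))) / exp (Fn m tau).

Lemma PI_pos : 0 < PI. Proof. apply PI_RGT_0. Qed.
Lemma PI_le_4 : PI <= 4. Proof. apply PI_4. Qed.
Lemma PI_gt_3 : 3 < PI. Proof. assert (A := PI2_3_2). lra. Qed.

Lemma St_mono s K N tau tau' : St s K N tau -> tau <= tau' -> St s K N tau'.
Proof.
  intros H L m Hm. specialize (H m Hm). assert (A := Fn_mono m tau tau' L). apply exp_mono in A. lra.
Qed.

Lemma St_N s K N N' tau : St s K N tau -> (N <= N')%nat -> St s K N' tau.
Proof. intros H L m Hm. apply H. lia. Qed.

Lemma St_K s K K' N tau : St s K N tau -> K' <= K -> St s K' N tau.
Proof. intros H L m Hm. specialize (H m Hm). lra. Qed.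

Lemma err_le_half s K N tau m : St s K N tau -> (N <= m)%nat -> err s K tau m <= 1 / 2.
Proof.
  intros H Hm. specialize (H m Hm). unfold err. assert (P := exp_pos (Fn m tau)).
  apply Rmult_le_reg_r with (exp (Fn m tau)); auto. unfold Rdiv at 1. rewrite Rmult_assoc, Rinv_l by lra. lra.
Qed.

Lemma base_exp s tau m : Cmod (base s tau (S m) - exp (Fn m tau))%C <= 1 + 2 * PI * Rabs (IZR (s (S m))).
Proof.
  eapply Rle_trans; [apply Cmod_le_ReIm|]. rewrite re_minus, im_minus.
  change (Re (base s tau (S m))) with (Fn (S m) tau). rewrite Fn_S.
  change (Im (base s tau (S m))) with (2 * PI * IZR (s (S m))). simpl Re. simpl Im.
  replace (exp (Fn m tau) - 1 - exp (Fn m tau)) with (-(1)) by ring.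
  rewrite Rabs_Ropp, Rabs_R1, Rminus_0_r, Rabs_mult, (Rabs_pos_eq (2 * PI)). lra.
  assert (A := PI_pos). lra.
Qed.

Lemma log_re s K N tau k v m : 0 <= K -> St s K N tau -> (N <= m)%nat -> Cmod k <= K ->
  Cmod (v - base s tau (S m))%C <= 1 -> 7 / 8 * exp (Fn m tau) <= Re (v - k)%C /\
  Cmod (v - k - exp (Fn m tau))%C <= K + 2 + 2 * PI * Rabs (IZR (s (S m))).
Proof.
  intros HK HS Hm Hk Hv. specialize (HS m Hm).
  assert (D : Cmod (v - k - exp (Fn m tau))%C <= K + 2 + 2 * PI * Rabs (IZR (s (S m)))).
  { replace (v - k - exp (Fn m tau))%C with ((v - base s tau (S m)) + (base s tau (S m) - exp (Fn m tau)) - k)%C by ring.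
    eapply Rle_trans; [apply Cmod_sub_le|]. assert (T := Cmod_triangle (v - base s tau (S m))%C (base s tau (S m) - exp (Fn m tau))%C).
    assert (B := base_exp s tau m). lra. }
  split; auto. assert (R := re_le_Cmod (v - k - exp (Fn m tau))%C). apply Rabs_le_between in R.
  rewrite re_minus in R. simpl (Re (RtoC _)) in R. lra.
Qed.

Lemma Clog_RtoC_exp x : Clog (exp x) = (x : C).
Proof.
  apply Cext.
  - rewrite re_Clog, Cmod_R, Rabs_pos_eq by (left; apply exp_pos). apply ln_exp.
  - change (atan (0 / exp x) = 0). unfold Rdiv. rewrite Rmult_0_l. apply atan_0.
Qed.

(** [base s tau m] is itself the branch number [s m] of the logarithm of [exp (Fn m tau)], so two
    logarithms of nearby points are being compared. *)
Lemma log_step s K N tau k v m : 0 <= K -> St s K N tau -> (N <= m)%nat -> Cmod k <= K ->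
  Cmod (v - base s tau (S m))%C <= 1 ->
  Cmod (Clog (v - k) + twopii (s m) - base s tau m)%C <= err s K tau m.
Proof.
  intros HK HS Hm Hk Hv. destruct (log_re s K N tau k v m HK HS Hm Hk Hv) as [H1 H2].
  replace (Clog (v - k) + twopii (s m) - base s tau m)%C with (Clog (v - k) - Clog (exp (Fn m tau)))%C.
  2:{ rewrite Clog_RtoC_exp. apply Cext; simpl; ring. }
  assert (P := exp_pos (Fn m tau)).
  eapply Rle_trans.
  { apply (Clog_lip (7 / 8 * exp (Fn m tau))); [lra|lra|]. rewrite re_RtoC. lra. }
  unfold err. apply Rmult_le_reg_r with (exp (Fn m tau)); auto.
  assert (Q : 0 <= 2 * PI * Rabs (IZR (s (S m)))).
  { apply Rmult_le_pos; [|apply Rabs_pos]. assert (A := PI_pos). lra. }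
  field_simplify; lra.
Qed.

(** Both arguments have real part at least 8, where [Clog_lip] gives the constant 2/8. *)
Lemma log_contract s K N tau tau' k k' v v' m : 0 <= K -> St s K N tau -> St s K N tau' -> (N <= m)%nat ->
  Cmod k <= K -> Cmod k' <= K -> Cmod (v - base s tau (S m))%C <= 1 -> Cmod (v' - base s tau' (S m))%C <= 1 ->
  Cmod (Clog (v - k) + twopii (s m) - (Clog (v' - k') + twopii (s m)))%C <= 1 / 4 * (Cmod (v - v')%C + Cmod (k - k')%C).
Proof.
  intros HK HS HS' Hm Hk Hk' Hv Hv'.
  destruct (log_re s K N tau k v m HK HS Hm Hk Hv) as [H1 _].
  destruct (log_re s K N tau' k' v' m HK HS' Hm Hk' Hv') as [H2 _].
  specialize (HS m Hm). specialize (HS' m Hm).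
  assert (Q : 0 <= 2 * PI * Rabs (IZR (s (S m)))).
  { apply Rmult_le_pos; [|apply Rabs_pos]. assert (A := PI_pos). lra. }
  replace (Clog (v - k) + twopii (s m) - (Clog (v' - k') + twopii (s m)))%C with (Clog (v - k) - Clog (v' - k'))%C by ring.
  eapply Rle_trans; [apply (Clog_lip 8); lra|].
  replace (v - k - (v' - k'))%C with ((v - v') - (k - k'))%C by ring.
  assert (T := Cmod_sub_le (v - v')%C (k - k')%C). lra.
Qed.

Lemma app_base s K N tau k j : 0 <= K -> St s K N tau -> Cmod k <= K ->
  forall m, (N <= m)%nat -> Cmod (app s k tau j m - base s tau m)%C <= 1 / 2.
Proof.
  intros HK HS Hk. induction j; intros m Hm; simpl app.
  - rewrite Cmod_diag. lra.
  - eapply Rle_trans; [apply (log_step s K N); auto|apply (err_le_half s K N); auto].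
    specialize (IHj (S m) ltac:(lia)). lra.
Qed.

Lemma app_succ s K N tau k j : 0 <= K -> St s K N tau -> Cmod k <= K ->
  forall m, (N <= m)%nat -> Cmod (app s k tau (S j) m - app s k tau j m)%C <= (1 / 2) ^ j.
Proof.
  intros HK HS Hk. induction j; intros m Hm.
  - simpl (app s k tau 0 m). assert (A := app_base s K N tau k 1 HK HS Hk m Hm). simpl pow. lra.
  - change (app s k tau (S (S j)) m) with (Clog (app s k tau (S j) (S m) - k) + twopii (s m))%C.
    change (app s k tau (S j) m) with (Clog (app s k tau j (S m) - k) + twopii (s m))%C.
    assert (A1 := app_base s K N tau k (S j) HK HS Hk (S m) ltac:(lia)).
    assert (A2 := app_base s K N tau k j HK HS Hk (S m) ltac:(lia)).
    eapply Rle_trans; [apply (log_contract s K N tau tau); auto; lra|].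
    rewrite Cmod_diag. specialize (IHj (S m) ltac:(lia)). simpl pow. assert (0 < (1/2)^j) by (apply pow_lt; lra). lra.
Qed.

Lemma pow_half_le N n : (N <= n)%nat -> (1 / 2) ^ n <= (1 / 2) ^ N.
Proof.
  intro H. induction H. lra. simpl. assert (0 < (1 / 2) ^ m) by (apply pow_lt; lra). lra.
Qed.

Definition Clim (u : nat -> C) : C := (real (Lim_seq (fun j => Re (u j))), real (Lim_seq (fun j => Im (u j)))).

Lemma Ccv_Clim u l : Ccv u l -> Clim u = l.
Proof.
  intro H. apply Cext; simpl.
  - rewrite (is_lim_seq_unique _ (Re l)); auto. apply is_lim_seq_spec. intro e.
    destruct (H e (cond_pos e)) as [N HN]. exists N. intros n Hn.
    eapply Rle_lt_trans; [|apply (HN n Hn)]. rewrite <- re_minus. apply re_le_Cmod.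
  - rewrite (is_lim_seq_unique _ (Im l)); auto. apply is_lim_seq_spec. intro e.
    destruct (H e (cond_pos e)) as [N HN]. exists N. intros n Hn.
    eapply Rle_lt_trans; [|apply (HN n Hn)]. rewrite <- im_minus. apply im_le_Cmod.
Qed.

Lemma Clim_geom (u : nat -> C) : (forall j, Cmod (u (S j) - u j)%C <= (1 / 2) ^ j) ->
  forall j, Cmod (u j - Clim u)%C <= 2 * (1 / 2) ^ j.
Proof.
  intro H.
  assert (A : forall i j, Cmod (u j - u (i + j)%nat)%C <= 2 * (1 / 2) ^ j - 2 * (1 / 2) ^ (i + j)).
  { induction i; intro j. { change (0 + j)%nat with j. rewrite Cmod_diag. lra. }
    change (S i + j)%nat with (S (i + j)).
    eapply Rle_trans; [apply (Cmod_sub_triangle _ (u (i + j)%nat))|]. specialize (IHi j). specialize (H (i + j)%nat).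
    rewrite Cmod_sub_sym in H. simpl pow. lra. }
  assert (Hb : forall j, 0 < (1 / 2) ^ j) by (intro; apply pow_lt; lra).
  assert (B : forall i j, Cmod (u j - u (i + j)%nat)%C <= 2 * (1 / 2) ^ j).
  { intros i j. specialize (A i j). specialize (Hb (i + j)%nat). lra. }
  destruct (bw_C u (Cmod (u O) + 2)) as (p & l & Hp & Hl).
  { intro n. assert (T := Cmod_le_sub (u n) (u O)). rewrite Cmod_sub_sym in T. specialize (B n O).
    rewrite Nat.add_0_r in B. simpl pow in B. lra. }
  assert (L : forall j, Cmod (u j - l)%C <= 2 * (1 / 2) ^ j).
  { intro j. rewrite Cmod_sub_sym. 
    apply (Cmod_le_of_Ccv (fun n => u (p n) - u j)%C); [now apply Ccv_const_sub|].
    exists j. intros n Hn. specialize (Hp n). specialize (B (p n - j)%nat j).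
    replace (p n - j + j)%nat with (p n) in B by lia. now rewrite Cmod_sub_sym. }
  rewrite (Ccv_Clim u l); auto.
  intros e He. destruct (small_geom 2 (1/2) e ltac:(lra) He) as [N HN]. exists N. intros n Hn.
  eapply Rle_lt_trans; [apply L|]. eapply Rle_lt_trans; [|exact HN].
  apply Rmult_le_compat_l; [lra|]. now apply pow_half_le.
Qed.

(** The point of the ray at level [m], with [tau] the potential at level 0. As a total function it
    is meaningful only where [St] makes the pullbacks converge. *)
Definition G (s : address) (k : C) (tau : R) (m : nat) : C := Clim (fun j => app s k tau j m).

Lemma G_app s K N tau k m j : 0 <= K -> St s K N tau -> Cmod k <= K -> (N <= m)%nat ->
  Cmod (app s k tau j m - G s k tau m)%C <= 2 * (1 / 2) ^ j.
Proof. intros HK HS Hk Hm. apply (Clim_geom (fun j => app s k tau j m)). intro i. apply (app_succ s K N); auto. Qed.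

Lemma le_of_geom (x y : R) : (forall j : nat, x <= y + 8 * (1 / 2) ^ j) -> x <= y.
Proof.
  intro H. apply Rnot_lt_le. intro L. destruct (small_geom 8 (1/2) (x - y)) as [j Hj]; try lra.
  specialize (H j). lra.
Qed.

Lemma G_base s K N tau k m : 0 <= K -> St s K N tau -> Cmod k <= K -> (N <= m)%nat ->
  Cmod (G s k tau m - base s tau m)%C <= err s K tau m.
Proof.
  intros HK HS Hk Hm. apply le_of_geom. intro j.
  assert (A := G_app s K N tau k m (S j) HK HS Hk Hm).
  assert (B : Cmod (app s k tau (S j) m - base s tau m)%C <= err s K tau m).
  { simpl app. apply (log_step s K N); auto. assert (C := app_base s K N tau k j HK HS Hk (S m) ltac:(lia)). lra. }
  assert (T := Cmod_sub_triangle (G s k tau m) (app s k tau (S j) m) (base s tau m)).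
  rewrite (Cmod_sub_sym (G s k tau m) (app s k tau (S j) m)) in T. simpl pow in A. assert (0 < (1/2)^j) by (apply pow_lt; lra). lra.
Qed.

Lemma G_base_half s K N tau k m : 0 <= K -> St s K N tau -> Cmod k <= K -> (N <= m)%nat ->
  Cmod (G s k tau m - base s tau m)%C <= 1 / 2.
Proof. intros. eapply Rle_trans; [apply (G_base s K N); auto|apply (err_le_half s K N); auto]. Qed.

Lemma G_log s K N tau k m : 0 <= K -> St s K N tau -> Cmod k <= K -> (N <= m)%nat ->
  G s k tau m = (Clog (G s k tau (S m) - k) + twopii (s m))%C.
Proof.
  intros HK HS Hk Hm. apply Csub_eq. apply Cmod_lt_small. intros e He.
  apply Rle_trans with 0; [|lra]. apply le_of_geom. intro j.
  assert (A := G_app s K N tau k m (S j) HK HS Hk Hm).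
  assert (B := G_app s K N tau k (S m) j HK HS Hk ltac:(lia)).
  assert (C1 := app_base s K N tau k j HK HS Hk (S m) ltac:(lia)).
  assert (C2 := G_base_half s K N tau k (S m) HK HS Hk ltac:(lia)).
  assert (D := log_contract s K N tau tau k k _ _ m HK HS HS Hm Hk Hk (Rle_trans _ _ 1 C1 ltac:(lra)) (Rle_trans _ _ 1 C2 ltac:(lra))).
  change (Clog (app s k tau j (S m) - k) + twopii (s m))%C with (app s k tau (S j) m) in D.
  rewrite Cmod_diag in D.
  assert (T := Cmod_sub_triangle (G s k tau m) (app s k tau (S j) m) (Clog (G s k tau (S m) - k) + twopii (s m))%C).
  rewrite (Cmod_sub_sym (G s k tau m) (app s k tau (S j) m)) in T. simpl pow in A. assert (0 < (1/2)^j) by (apply pow_lt; lra). lra.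
Qed.

Lemma twopii_exp (z : C) (n : Z) : Cexp (z + twopii n)%C = Cexp z.
Proof. rewrite Cexp_plus, Cexp_2PI. ring. Qed.

Lemma G_f s K N tau k m : 0 <= K -> St s K N tau -> Cmod k <= K -> (N <= m)%nat ->
  expmap k (G s k tau m) = G s k tau (S m).
Proof.
  intros HK HS Hk Hm. unfold expmap. rewrite (G_log s K N) by auto. rewrite twopii_exp, Cexp_Clog.
  - ring.
  - assert (C2 := G_base_half s K N tau k (S m) HK HS Hk ltac:(lia)).
    destruct (log_re s K N tau k (G s k tau (S m)) m HK HS Hm Hk ltac:(lra)) as [H _].
    assert (P := exp_pos (Fn m tau)). lra.
Qed.

(** The constant 1/2 reproduces itself, since [(1/2 + 1) / 4 <= 1/2]. Being less than 1, it later
    makes [k -> G s k tau 0] a contraction. *)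
Lemma app_lip s K N tau k k' j : 0 <= K -> St s K N tau -> Cmod k <= K -> Cmod k' <= K ->
  forall m, (N <= m)%nat -> Cmod (app s k tau j m - app s k' tau j m)%C <= 1 / 2 * Cmod (k - k')%C.
Proof.
  intros HK HS Hk Hk'. assert (P := Cmod_ge_0 (k - k')%C). induction j; intros m Hm; simpl app.
  - rewrite Cmod_diag. lra.
  - assert (A1 := app_base s K N tau k j HK HS Hk (S m) ltac:(lia)).
    assert (A2 := app_base s K N tau k' j HK HS Hk' (S m) ltac:(lia)).
    eapply Rle_trans; [apply (log_contract s K N tau tau); auto; lra|]. specialize (IHj (S m) ltac:(lia)). lra.
Qed.

Lemma G_lip s K N tau k k' m : 0 <= K -> St s K N tau -> Cmod k <= K -> Cmod k' <= K -> (N <= m)%nat ->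
  Cmod (G s k tau m - G s k' tau m)%C <= 1 / 2 * Cmod (k - k')%C.
Proof.
  intros HK HS Hk Hk' Hm. apply le_of_geom. intro j.
  assert (A := G_app s K N tau k m j HK HS Hk Hm). assert (B := G_app s K N tau k' m j HK HS Hk' Hm).
  assert (D := app_lip s K N tau k k' j HK HS Hk Hk' m Hm).
  assert (T := Cmod_sub_triangle (G s k tau m) (app s k tau j m) (G s k' tau m)).
  assert (T2 := Cmod_sub_triangle (app s k tau j m) (app s k' tau j m) (G s k' tau m)).
  rewrite (Cmod_sub_sym (G s k tau m) (app s k tau j m)) in T. assert (0 < (1/2)^j) by (apply pow_lt; lra). lra.
Qed.

Lemma app_tau s K N tau tau' k j : 0 <= K -> St s K N tau -> St s K N tau' -> Cmod k <= K ->
  forall m, (N <= m)%nat -> Cmod (app s k tau j m - app s k tau' j m)%C <= Rabs (Fn (j + m) tau - Fn (j + m) tau').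
Proof.
  intros HK HS HS' Hk. induction j; intros m Hm.
  - simpl app. simpl plus. eapply Rle_trans; [apply Cmod_le_ReIm|]. rewrite re_minus, im_minus. simpl.
    replace (2 * PI * IZR (s m) - 2 * PI * IZR (s m)) with 0 by ring. rewrite Rabs_R0. lra.
  - simpl app. assert (A1 := app_base s K N tau k j HK HS Hk (S m) ltac:(lia)).
    assert (A2 := app_base s K N tau' k j HK HS' Hk (S m) ltac:(lia)).
    eapply Rle_trans; [apply (log_contract s K N tau tau'); auto; lra|]. rewrite Cmod_diag.
    specialize (IHj (S m) ltac:(lia)). replace (j + S m)%nat with (S j + m)%nat in IHj by lia.
    assert (P := Rabs_pos (Fn (S j + m) tau - Fn (S j + m) tau')). lra.
Qed.

(** The last term is huge but continuous for each fixed [j]: choosing [j] first and then [tau']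
    yields continuity in the potential, uniformly in [k]. *)
Lemma G_tau s K N tau tau' k m j : 0 <= K -> St s K N tau -> St s K N tau' -> Cmod k <= K -> (N <= m)%nat ->
  Cmod (G s k tau m - G s k tau' m)%C <= 4 * (1 / 2) ^ j + Rabs (Fn (j + m) tau - Fn (j + m) tau').
Proof.
  intros HK HS HS' Hk Hm.
  assert (A := G_app s K N tau k m j HK HS Hk Hm). assert (B := G_app s K N tau' k m j HK HS' Hk Hm).
  assert (D := app_tau s K N tau tau' k j HK HS HS' Hk m Hm).
  assert (T := Cmod_sub_triangle (G s k tau m) (app s k tau j m) (G s k tau' m)).
  assert (T2 := Cmod_sub_triangle (app s k tau j m) (app s k tau' j m) (G s k tau' m)).
  rewrite (Cmod_sub_sym (G s k tau m) (app s k tau j m)) in T. lra.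
Qed.

Lemma Fn_cont n t : forall e, 0 < e -> exists d, 0 < d /\ forall u, Rabs (u - t) < d -> Rabs (Fn n u - Fn n t) < e.
Proof.
  induction n; intros e He. { exists e. split; auto. }
  assert (C : continuity_pt exp (Fn n t)) by (apply derivable_continuous_pt, derivable_pt_exp).
  destruct (C e He) as (d & Hd & H). destruct (IHn d Hd) as (d' & Hd' & H'). exists d'. split; auto. intros u Hu.
  rewrite !Fn_S. replace (exp (Fn n u) - 1 - (exp (Fn n t) - 1)) with (exp (Fn n u) - exp (Fn n t)) by ring.
  destruct (Req_dec (Fn n u) (Fn n t)) as [->|Ne].
  - replace (exp (Fn n t) - exp (Fn n t)) with 0 by ring. rewrite Rabs_R0. auto.
  - apply H. split. { split. exact I. auto. } apply H'; auto.
Qed.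

Lemma G_tau_cont s K N t0 tau m e : 0 <= K -> St s K N t0 -> t0 <= tau -> (N <= m)%nat -> 0 < e ->
  exists d, 0 < d /\ forall tau' k, t0 <= tau' -> Rabs (tau' - tau) < d -> Cmod k <= K ->
    Cmod (G s k tau' m - G s k tau m)%C < e.
Proof.
  intros HK HS Ht Hm He. destruct (small_geom 4 (1/2) (e/2)) as [j Hj]; try lra.
  destruct (Fn_cont (j + m) tau (e/2) ltac:(lra)) as (d & Hd & H). exists d. split; auto.
  intros tau' k Ht' Htt Hk. specialize (H tau' Htt).
  eapply Rle_lt_trans; [apply (G_tau s K N tau' tau k m j); auto; eapply St_mono; eauto|]. lra.
Qed.

Lemma app_hol s K N tau j : 0 <= K -> St s K N tau -> forall m, (N <= m)%nat ->
  forall k, Cmod k <= K -> Hol2 (fun k => app s k tau j m) k.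
Proof.
  intros HK HS. induction j; intros m Hm k Hk; simpl app.
  - apply Hol2_const.
  - apply Hol2_plus; [|apply Hol2_const].
    apply (Hol2_comp Clog (fun k => app s k tau j (S m) - k)%C).
    + apply Hol2_minus; [apply IHj; auto; lia|apply Hol2_id].
    + apply Hol2_Clog. assert (A := app_base s K N tau k j HK HS Hk (S m) ltac:(lia)).
      destruct (log_re s K N tau k _ m HK HS Hm Hk (Rle_trans _ _ 1 A ltac:(lra))) as [H _].
      assert (P := exp_pos (Fn m tau)). lra.
Qed.

Lemma G_hol s K N tau k m : 0 <= K -> St s K N tau -> Cmod k < K -> (N <= m)%nat -> Hol2 (fun k => G s k tau m) k.
Proof.
  intros HK HS Hk Hm. set (r := K - Cmod k).
  assert (D : forall z, Cmod (z - k)%C <= r -> Cmod z <= K).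
  { intros z Hz. assert (T := Cmod_le_sub z k). unfold r in Hz. lra. }
  apply (Hol2_lim (fun j k => app s k tau j m) _ k r (Cmod (base s tau m) + 1)).
  - unfold r; lra.
  - assert (A := Cmod_ge_0 (base s tau m)). lra.
  - intros n z Hz. apply (app_hol s K N tau n HK HS m Hm). auto.
  - intros n z Hz. assert (A := app_base s K N tau z n HK HS (D z Hz) m Hm).
    assert (T := Cmod_le_sub (app s z tau n m) (base s tau m)). lra.
  - intros z Hz e He. destruct (small_geom 2 (1/2) e ltac:(lra) He) as [J HJ]. exists J. intros n Hn.
    eapply Rle_lt_trans; [apply (G_app s K N); auto|]. eapply Rle_lt_trans; [|exact HJ].
    apply Rmult_le_compat_l; [lra|]. now apply pow_half_le.
Qed.

Lemma St_exists s b A a K c : Dom s b A -> b < a -> 0 < c -> exists N, forall m tau, (N <= m)%nat -> a <= tau ->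
  K + 3 + 2 * PI * Rabs (IZR (s (S m))) <= c * exp (Fn m tau).
Proof.
  intros (Hb & HA & H) Ha Hc. destruct (Fn_pow4 b a Hb Ha) as (X0 & HX0 & HX).
  destruct (Fn_unbounded a X0 ltac:(lra)) as [N1 HN1].
  set (Y := Rmax 1 ((Rabs K + 3 + 8 * A) / c)).
  destruct (Fn_unbounded b Y Hb) as [N2 HN2]. exists (N1 + N2)%nat. intros m tau Hm Ht.
  specialize (HN1 (S m) ltac:(lia)). specialize (HN2 (S m) ltac:(lia)). specialize (H (S m)).
  specialize (HX (S m) a ltac:(lra) ltac:(lra)).
  assert (Mo := Fn_mono (S m) a tau Ht). rewrite (Fn_S m tau) in Mo.
  set (x := Fn (S m) b) in *.
  assert (M1 := Rmax_l 1 ((Rabs K + 3 + 8 * A) / c)). assert (M2 := Rmax_r 1 ((Rabs K + 3 + 8 * A) / c)). fold Y in M1, M2.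
  assert (Hcx : Rabs K + 3 + 8 * A < c * x).
  { assert (L : (Rabs K + 3 + 8 * A) / c < x) by lra. apply Rmult_lt_compat_r with (r := c) in L; auto.
    replace ((Rabs K + 3 + 8 * A) / c * c) with (Rabs K + 3 + 8 * A) in L by (field; lra). lra. }
  assert (P := PI_pos). assert (P4 := PI_le_4). assert (PK := Rle_abs K). assert (PK2 := Rabs_pos K).
  assert (2 * PI * Rabs (IZR (s (S m))) <= 8 * (A * x)).
  { apply Rmult_le_compat; try lra. apply Rabs_pos. }
  assert (x * x <= x ^ 4). { replace (x ^ 4) with (x * x * (x * x)) by ring. assert (1 <= x * x) by nra. nra. }
  assert ((Rabs K + 3 + 8 * A) * x <= c * x * x) by nra. nra.
Qed.

Lemma St_of_Dom s b A a K : Dom s b A -> b < a -> exists N, St s K N a.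
Proof.
  intros HD Ha. destruct (St_exists s b A a K (1/8) HD Ha) as [N HN]. lra.
  exists N. intros m Hm. specialize (HN m a Hm ltac:(lra)). lra.
Qed.

Lemma err_small s b A a K e : Dom s b A -> b < a -> 0 < e -> exists N, forall m tau, (N <= m)%nat -> a <= tau -> err s K tau m <= e.
Proof.
  intros HD Ha He. destruct (St_exists s b A a K (e/4) HD Ha) as [N HN]. lra.
  exists N. intros m tau Hm Ht. specialize (HN m tau Hm Ht). unfold err. assert (P := exp_pos (Fn m tau)).
  apply Rmult_le_reg_r with (exp (Fn m tau)); auto. unfold Rdiv. rewrite Rmult_assoc, Rinv_l by lra. lra.
Qed.

(** * Continuous curves and lifts under [exp] *)

Definition ccont (D : R -> Prop) (c : R -> C) : Prop :=
  forall x, D x -> forall e, 0 < e -> exists d, 0 < d /\ forall y, D y -> Rabs (y - x) < d -> Cmod (c y - c x)%C < e.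

Definition from (a : R) (x : R) : Prop := a <= x.

Lemma ccont_const D z : ccont D (fun _ => z).
Proof. intros x _ e He. exists 1. split. lra. intros. rewrite Cmod_diag. auto. Qed.

Lemma ccont_plus D c c' : ccont D c -> ccont D c' -> ccont D (fun x => c x + c' x)%C.
Proof.
  intros H H' x Dx e He. destruct (H x Dx (e/2) ltac:(lra)) as (d & Hd & A). destruct (H' x Dx (e/2) ltac:(lra)) as (d' & Hd' & A').
  exists (Rmin d d'). split. now apply Rmin_glb_lt. intros y Dy Hy. assert (M1 := Rmin_l d d'). assert (M2 := Rmin_r d d').
  specialize (A y Dy ltac:(lra)). specialize (A' y Dy ltac:(lra)).
  replace (c y + c' y - (c x + c' x))%C with ((c y - c x) + (c' y - c' x))%C by ring.
  eapply Rle_lt_trans; [apply Cmod_triangle|]. lra.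
Qed.

Lemma ccont_comp D (h : C -> C) c : ccont D c -> (forall x, D x -> Ccont h (c x)) -> ccont D (fun x => h (c x)).
Proof.
  intros H Hh x Dx e He. destruct (Hh x Dx e He) as (d & Hd & A). destruct (H x Dx d Hd) as (d' & Hd' & B).
  exists d'. split; auto.
Qed.

Lemma ccont_minus D c c' : ccont D c -> ccont D c' -> ccont D (fun x => c x - c' x)%C.
Proof.
  intros H H'. apply ccont_plus; auto. apply (ccont_comp D Copp); auto.
  intros x Dx e He. exists e. split; auto. intros z Hz. replace (- z - - c' x)%C with (-(z - c' x))%C by ring.
  now rewrite Cmod_opp.
Qed.

Lemma ccont_reparam D D' c (f : R -> R) : ccont D' c -> (forall x, D x -> D' (f x)) ->
  (forall x, D x -> forall e, 0 < e -> exists d, 0 < d /\ forall y, D y -> Rabs (y - x) < d -> Rabs (f y - f x) < e) ->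
  ccont D (fun x => c (f x)).
Proof.
  intros H Hf Hc x Dx e He. destruct (H (f x) (Hf x Dx) e He) as (d & Hd & A). destruct (Hc x Dx d Hd) as (d' & Hd' & B).
  exists d'. split; auto.
Qed.

Lemma ccont_lip D D' c (f : R -> R) : ccont D' c -> (forall x, D x -> D' (f x)) ->
  (forall x y, Rabs (f y - f x) <= Rabs (y - x)) -> ccont D (fun x => c (f x)).
Proof.
  intros H Hf Hl. apply (ccont_reparam D D'); auto. intros x _ e He. exists e. split; auto.
  intros y _ Hy. specialize (Hl x y). lra.
Qed.

Lemma ccont_sub D D' c : (forall x, D x -> D' x) -> ccont D' c -> ccont D c.
Proof. intros H Hc. apply (ccont_lip D D' c (fun x => x)); auto. intros; lra. Qed.

Lemma ccont_ext D c c' : (forall x, D x -> c x = c' x) -> ccont D c -> ccont D c'.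
Proof.
  intros H Hc x Dx e He. destruct (Hc x Dx e He) as (d & Hd & A). exists d. split; auto.
  intros y Dy Hy. rewrite <- !H; auto.
Qed.

Lemma ccont_f D k c : ccont D c -> ccont D (fun x => expmap k (c x)).
Proof.
  intro H. apply (ccont_comp D (expmap k)); auto. intros x _. apply Hol2_cont. unfold expmap.
  apply Hol2_plus. apply Hol2_Cexp. apply Hol2_const.
Qed.

Lemma Rmin_lip a x y : Rabs (Rmin y a - Rmin x a) <= Rabs (y - x).
Proof. unfold Rmin. destruct (Rle_dec y a), (Rle_dec x a); unfold Rabs; repeat destruct Rcase_abs; lra. Qed.
Lemma Rmax_lip a x y : Rabs (Rmax y a - Rmax x a) <= Rabs (y - x).
Proof. unfold Rmax. destruct (Rle_dec y a), (Rle_dec x a); unfold Rabs; repeat destruct Rcase_abs; lra. Qed.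

Lemma Cmod_twopii (n : Z) : Cmod (twopii n) = 2 * PI * Rabs (IZR n).
Proof.
  assert (P := PI_pos). replace (twopii n) with (RtoC (2 * PI * IZR n) * Ci)%C by (apply Cext; simpl; ring).
  rewrite Cmod_mult, Cmod_Ci, Cmod_R, Rabs_mult, (Rabs_pos_eq (2 * PI)) by lra. ring.
Qed.

(** 6 is below [2 * PI], the least modulus of a nonzero period. *)
Lemma twopii_sub_small (n m : Z) : Cmod (twopii n - twopii m)%C < 6 -> n = m.
Proof.
  intro H. replace (twopii n - twopii m)%C with (twopii (n - m)) in H.
  2:{ apply Cext; unfold twopii; simpl; rewrite ?minus_IZR; ring. }
  rewrite Cmod_twopii in H. assert (P := PI_gt_3).
  destruct (Z.eq_dec (n - m) 0) as [E|E]. lia.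
  assert (1 <= Rabs (IZR (n - m))). { rewrite <- abs_IZR. apply (IZR_le 1). lia. } nra.
Qed.

(** The difference of two lifts takes values in the discrete set of periods, so it is locally
    constant, and [conn] makes it constant. *)
Lemma lift_unique (D : R -> Prop) (c c' : R -> C) : (forall x y z, D x -> D y -> x <= z <= y -> D z) ->
  ccont D c -> ccont D c' -> (forall x, D x -> Cexp (c x) = Cexp (c' x)) ->
  forall x y, D x -> D y -> (c x - c' x = c y - c' y)%C.
Proof.
  intros Hc H H' He. assert (Hd := ccont_minus D c c' H H'). set (d := fun x => (c x - c' x)%C) in *.
  assert (Hk : forall x, D x -> exists n, d x = twopii n) by (intros x Dx; apply Cexp_inj_mod; auto).
  assert (Hloc : forall x, D x -> exists e, 0 < e /\ forall y, D y -> Rabs (y - x) < e -> d y = d x).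
  { intros x Dx. destruct (Hd x Dx 1 Rlt_0_1) as (e & He0 & A). exists e. split; auto. intros y Dy Hy.
    specialize (A y Dy Hy). destruct (Hk x Dx) as [n En]. destruct (Hk y Dy) as [m Em].
    rewrite En, Em in *. rewrite (twopii_sub_small m n); auto. lra. }
  assert (Hle : forall x y, D x -> D y -> x <= y -> d y = d x).
  { intros x y Dx Dy Hxy. apply (conn (fun z => d z = d x) x y Hxy); auto.
    intros z Hz. destruct (Hloc z (Hc x y z Dx Dy Hz)) as (e & He0 & A). exists e. split; auto.
    intros w Hw Hwz. rewrite (A w); auto. tauto. apply (Hc x y); auto. }
  intros x y Dx Dy. change (d x = d y). destruct (Rle_dec x y).
  - symmetry. apply Hle; auto.
  - apply Hle; auto; lra.
Qed.

Lemma from_convex a : forall x y z, from a x -> from a y -> x <= z <= y -> from a z.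
Proof. unfold from. intros; lra. Qed.

Lemma Cexp_surj (z : C) : z <> 0%C -> exists w, Cexp w = z.
Proof.
  intro Hz.
  assert (E1 : Cexp (0, PI) = (- (1))%C).
  { apply Cext; rewrite ?re_Cexp, ?im_Cexp; simpl; rewrite exp_0, ?cos_PI, ?sin_PI; ring. }
  assert (E2 : Cexp (0, PI / 2)%R = Ci).
  { apply Cext; rewrite ?re_Cexp, ?im_Cexp; simpl; rewrite exp_0, ?cos_PI2, ?sin_PI2; ring. }
  assert (E3 : (Ci * Ci = - (1))%C) by (apply Cext; simpl; ring).
  destruct (Rtotal_order (Re z) 0) as [H|[H|H]].
  - exists (Clog (- z) + (0, PI))%C. rewrite Cexp_plus, E1, Cexp_Clog. ring. rewrite re_opp. lra.
  - destruct (Rtotal_order (Im z) 0) as [H'|[H'|H']].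
    + exists (Clog (z * Ci) + (0, PI) + (0, PI / 2)%R)%C. rewrite !Cexp_plus, E1, E2, Cexp_Clog.
      transitivity (- (Ci * Ci) * z)%C. ring. rewrite E3. ring. rewrite re_mult_Ci. lra.
    + exfalso. apply Hz. apply Cext; auto.
    + exists (Clog (z * - Ci) + (0, PI / 2)%R)%C. rewrite !Cexp_plus, E2, Cexp_Clog.
      transitivity (- (Ci * Ci) * z)%C. ring. rewrite E3. ring.
      replace (z * - Ci)%C with (- (z * Ci))%C by ring. rewrite re_opp, re_mult_Ci. lra.
  - exists (Clog z). now apply Cexp_Clog.
Qed.

Lemma Ccont_Clog z : 0 < Re z -> Ccont Clog z.
Proof. intro H. apply Hol2_cont. now apply Hol2_Clog. Qed.

Lemma Cmod_re_lower (z w : C) : Re z - Cmod (w - z)%C <= Re w.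
Proof. assert (H := re_le_Cmod (w - z)%C). apply Rabs_le_between in H. rewrite re_minus in H. lra. Qed.

(** Near [x0] the curve varies by less than a quarter of [|p x0|], so quotients of its values lie in
    the right half plane, and a lift up to [x] is prolonged by the principal logarithm of
    [p u / p x]. *)
Lemma lift_exists (p : R -> C) (a b : R) : a <= b -> ccont (fun x => a <= x <= b) p ->
  (forall x, a <= x <= b -> p x <> 0%C) ->
  exists l, ccont (fun x => a <= x <= b) l /\ forall x, a <= x <= b -> Cexp (l x) = p x.
Proof.
  intros Hab Hp Hn.
  set (P := fun x => exists l, ccont (fun u => a <= u <= x) l /\ forall u, a <= u <= x -> Cexp (l u) = p u).
  apply (conn P a b Hab).
  - intros x0 Hx0. assert (Hm := Hn x0 Hx0). apply Cmod_gt_0 in Hm. set (m := Cmod (p x0)) in *.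
    destruct (Hp x0 Hx0 (m / 8) ltac:(lra)) as (d & Hd & A). exists d. split; auto.
    assert (Q : forall x y, a <= x <= b -> a <= y <= b -> Rabs (x - x0) < d -> Rabs (y - x0) < d -> P x -> P y).
    { intros x y Hx Hy Hxd Hyd (l & Hl & El). destruct (Rle_dec y x) as [L|L].
      - exists l. split. apply (ccont_sub _ (fun u => a <= u <= x)); auto. intros; lra. intros; apply El; lra.
      - set (q := fun u => (p (Rmax u x) / p x)%C).
        assert (Hpx := Hn x Hx).
        assert (Hq : forall u, a <= u <= y -> 0 < Re (q u)).
        { intros u Hu. set (v := Rmax u x).
          assert (Hv : a <= v <= b /\ Rabs (v - x0) < d).
          { apply Rabs_lt_between in Hxd. apply Rabs_lt_between in Hyd. unfold v, Rmax. destruct (Rle_dec u x).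
            - split. lra. apply Rabs_lt_between. lra.
            - split. lra. apply Rabs_lt_between. lra. }
          assert (A1 := A x Hx Hxd). assert (A2 := A v (proj1 Hv) (proj2 Hv)).
          assert (T1 := Cmod_le_sub (p x0) (p x)). rewrite (Cmod_sub_sym (p x0)) in T1. fold m in T1.
          assert (T2 := Cmod_sub_triangle (p v) (p x0) (p x)). rewrite (Cmod_sub_sym (p x0) (p x)) in T2.
          assert (E : Cmod (q u - 1)%C < 1).
          { unfold q. fold v. replace (p v / p x - 1)%C with ((p v - p x) / p x)%C by (field; auto).
            rewrite Cmod_div by auto. apply Rmult_lt_reg_r with (Cmod (p x)). lra.
            unfold Rdiv. rewrite Rmult_assoc, Rinv_l by lra. lra. }
          assert (R := Cmod_re_lower 1 (q u)). simpl (Re (RtoC 1)) in R. lra. }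
        exists (fun u => l (Rmin u x) + Clog (q u))%C. split.
        + apply ccont_plus.
          * apply (ccont_lip _ (fun u => a <= u <= x)); auto.
            { intros u Hu. split. apply Rmin_glb; lra. apply Rmin_r. }
            intros; apply Rmin_lip.
          * apply (ccont_comp _ Clog q).
            { apply (ccont_comp _ (fun z => z / p x)%C (fun u => p (Rmax u x))).
              - apply (ccont_lip _ (fun u => a <= u <= b)); auto.
                + intros u Hu. split. eapply Rle_trans; [|apply Rmax_r]; lra. apply Rmax_lub; lra.
                + intros; apply Rmax_lip.
              - intros u Hu. apply Hol2_cont. apply Hol2_div; auto using Hol2_id, Hol2_const. }
            intros u Hu. apply Ccont_Clog. auto.
        + intros u Hu. rewrite Cexp_plus, Cexp_Clog by auto. unfold q.
          destruct (Rle_dec u x).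
          * rewrite Rmin_left, Rmax_right by lra. rewrite El by lra. field. auto.
          * rewrite Rmin_right, Rmax_left by lra. rewrite El by lra. field. auto. }
    intros y Hy Hyx. assert (Hself : Rabs (x0 - x0) < d) by (replace (x0 - x0) with 0 by ring; rewrite Rabs_R0; auto).
    split; apply Q; auto.
  - destruct (Cexp_surj (p a)) as [w Hw]. apply Hn; lra. exists (fun _ => w). split. apply ccont_const.
    intros u Hu. replace u with a by lra. auto.
Qed.

Lemma ccont_bounded_below (c : R -> C) (a X : R) : ccont (from a) c -> (forall x, a <= x -> c x <> 0%C) ->
  (forall x, X <= x -> a <= x -> 1 <= Cmod (c x)) -> exists m, 0 < m /\ forall x, a <= x -> m <= Cmod (c x).
Proof.
  intros Hc Hn HX.
  set (P := fun x => exists m, 0 < m /\ forall u, a <= u <= x -> m <= Cmod (c u)).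
  assert (HP : P (Rmax a X)).
  { apply (conn P a); [apply Rmax_l| |].
    - intros x0 Hx0. assert (H0 := Hn x0 ltac:(lra)). apply Cmod_gt_0 in H0.
      destruct (Hc x0 (proj1 Hx0) (Cmod (c x0) / 2) ltac:(lra)) as (d & Hd & A). exists d. split; auto.
      assert (Q : forall x y, a <= x -> a <= y -> Rabs (x - x0) < d -> Rabs (y - x0) < d -> P x -> P y).
      { intros x y Hx Hy Hxd Hyd (m & Hm & B). exists (Rmin m (Cmod (c x0) / 2)). split. { apply Rmin_glb_lt; lra. }
        intros u Hu. destruct (Rle_dec u x). { eapply Rle_trans; [apply Rmin_l|apply B; lra]. }
        eapply Rle_trans; [apply Rmin_r|].
        assert (Rabs (u - x0) < d). { apply Rabs_lt_between in Hxd. apply Rabs_lt_between in Hyd. apply Rabs_lt_between. lra. }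
        specialize (A u ltac:(unfold from; lra) H). assert (T := Cmod_le_sub (c x0) (c u)). rewrite Cmod_sub_sym in T. lra. }
      assert (Hself : Rabs (x0 - x0) < d) by (replace (x0 - x0) with 0 by ring; rewrite Rabs_R0; auto).
      intros y Hy Hyx. split; apply Q; lra.
    - exists (Cmod (c a)). split. apply Cmod_gt_0, Hn; lra. intros u Hu. replace u with a by lra. lra. }
  destruct HP as (m & Hm & B). exists (Rmin m 1). split. apply Rmin_glb_lt; lra.
  intros x Hx. destruct (Rle_dec x (Rmax a X)).
  - eapply Rle_trans; [apply Rmin_l|apply B; lra].
  - eapply Rle_trans; [apply Rmin_r|apply HX; auto]. assert (A := Rmax_r a X). lra.
Qed.

(** * Systems of rays *)

(* [Gam n] parametrises, by the potential [tau] of the level-0 point, the ray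
   of address [sigma^n s]; its potentials are [F^n tau]. The last clause fixes
   the branch of the lift at level [n], hence the entry [s n]. *)
Definition Ray (N : nat) (k : C) (s : address) (a : R) (Gam : nat -> R -> C) : Prop :=
  (forall n, (N <= n)%nat -> ccont (from a) (Gam n)) /\
  (forall n tau, (N <= n)%nat -> a <= tau -> expmap k (Gam n tau) = Gam (S n) tau) /\
  (exists M, forall n tau, (M <= n)%nat -> (N <= n)%nat -> a <= tau -> Cmod (Gam n tau - base s tau n)%C <= 1) /\
  (forall n, (N <= n)%nat -> exists T, forall tau, T <= tau -> a <= tau -> Cmod (Gam n tau - base s tau n)%C <= 1).

Lemma Ray_G s K N k a : 0 <= K -> St s K N a -> Cmod k <= K -> Ray N k s a (fun n tau => G s k tau n).
Proof.
  intros HK HS Hk. split; [|split; [|split]].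
  - intros n Hn x Hx e He. destruct (G_tau_cont s K N a x n e HK HS Hx Hn He) as (d & Hd & A). exists d. split; auto.
  - intros n tau Hn Ht. apply (G_f s K N); auto. eapply St_mono; eauto.
  - exists N. intros n tau Hn _ Ht. eapply Rle_trans; [apply (G_base_half s K N); auto; eapply St_mono; eauto|]. lra.
  - intros n Hn. exists a. intros tau Ht _. eapply Rle_trans; [apply (G_base_half s K N); auto; eapply St_mono; eauto|]. lra.
Qed.

Lemma Ray_sub N N' k s a a' Gam : (N <= N')%nat -> a <= a' -> Ray N k s a Gam -> Ray N' k s a' Gam.
Proof.
  intros HN Ha (H1 & H2 & (M & H3) & H4). split; [|split; [|split]].
  - intros n Hn. apply (ccont_sub _ (from a)); auto. unfold from; intros; lra. apply H1; lia.
  - intros n tau Hn Ht. apply H2; [lia|lra].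
  - exists M. intros n tau Hn Hn' Ht. apply H3; auto; [lia|lra].
  - intros n Hn. destruct (H4 n ltac:(lia)) as [T HT]. exists T. intros tau A B. apply HT; lra.
Qed.

Lemma im_near_base s z tau m : Cmod (z - base s tau m)%C <= 2 -> Rabs (Im z - 2 * PI * IZR (s m)) <= 2.
Proof. intro H. eapply Rle_trans; [|exact H]. apply (im_le_Cmod (z - base s tau m)%C). Qed.

Lemma log_of_near s K N tau k z w m : 0 <= K -> St s K N tau -> Cmod k <= K -> (N <= m)%nat ->
  expmap k z = w -> Cmod (z - base s tau m)%C <= 2 -> Cmod (w - base s tau (S m))%C <= 1 ->
  z = (Clog (w - k) + twopii (s m))%C.
Proof.
  intros HK HS Hk Hm Hf Hz Hw. apply Cexp_same_log.
  - rewrite <- Hf. unfold expmap. ring.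
  - destruct (log_re s K N tau k w m HK HS Hm Hk Hw) as [A _]. assert (P := exp_pos (Fn m tau)). lra.
  - apply im_near_base in Hz. assert (P := PI_gt_3). lra.
Qed.

(** Both orbits are within 2 of each other at arbitrarily high levels, and every pullback at least
    halves the distance. *)
Lemma orbit_unique s K N tau k (z w : nat -> C) : 0 <= K -> St s K N tau -> Cmod k <= K ->
  (forall n, (N <= n)%nat -> expmap k (z n) = z (S n)) -> (forall n, (N <= n)%nat -> expmap k (w n) = w (S n)) ->
  (forall n, (N <= n)%nat -> Cmod (z n - base s tau n)%C <= 1) ->
  (forall n, (N <= n)%nat -> Cmod (w n - base s tau n)%C <= 1) ->
  forall n, (N <= n)%nat -> z n = w n.
Proof.
  intros HK HS Hk Fz Fw Bz Bw.
  assert (A : forall j n, (N <= n)%nat -> Cmod (z n - w n)%C <= 2 * (1 / 2) ^ j).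
  { induction j; intros n Hn.
    - assert (T := Cmod_sub_triangle (z n) (base s tau n) (w n)). rewrite (Cmod_sub_sym (base s tau n)) in T.
      specialize (Bz n Hn). specialize (Bw n Hn). simpl pow. lra.
    - assert (B1 := Bz n Hn). assert (B2 := Bw n Hn). assert (B3 := Bz (S n) ltac:(lia)). assert (B4 := Bw (S n) ltac:(lia)).
      rewrite (log_of_near s K N tau k (z n) (z (S n)) n) by (auto; lra).
      rewrite (log_of_near s K N tau k (w n) (w (S n)) n) by (auto; lra).
      eapply Rle_trans; [apply (log_contract s K N tau tau); auto|]. rewrite Cmod_diag.
      specialize (IHj (S n) ltac:(lia)). simpl pow. assert (0 < (1/2)^j) by (apply pow_lt; lra). lra. }
  intros n Hn. apply Csub_eq, Cmod_lt_small. intros e He. destruct (small_geom 2 (1/2) e) as [j Hj]; try lra.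
  specialize (A j n Hn). lra.
Qed.

(** Downward induction: rays and orbits are controlled at all high levels, and properties are pulled
    back one level at a time. *)
Lemma desc_ind (P : nat -> Prop) N M : (forall n, (M <= n)%nat -> (N <= n)%nat -> P n) ->
  (forall n, (N <= n)%nat -> P (S n) -> P n) -> forall n, (N <= n)%nat -> P n.
Proof.
  intros HM HS n Hn. destruct (Nat.le_gt_cases M n) as [L|L]. auto.
  assert (A : forall j, (j <= M - N)%nat -> (N <= M)%nat -> P (M - j)%nat).
  { induction j; intros Hj HNM. rewrite Nat.sub_0_r. apply HM; lia.
    apply HS. lia. replace (S (M - S j))%nat with (M - j)%nat by lia. apply IHj; lia. }
  replace n with (M - (M - n))%nat by lia. apply A; lia.
Qed.

(** High levels are settled by [orbit_unique]. One level down the two curves lift the same curve and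
    differ by a constant period, which is 0 because both approach [base] at large potentials. *)
Lemma Ray_unique N k s b A a Gam Gam' : Dom s b A -> b < a -> Ray N k s a Gam -> Ray N k s a Gam' ->
  forall n tau, (N <= n)%nat -> a <= tau -> Gam n tau = Gam' n tau.
Proof.
  intros HD Hb (H1 & H2 & (M & H3) & H4) (H1' & H2' & (M' & H3') & H4').
  destruct (St_of_Dom s b A a (Cmod k) HD Hb) as [N0 HS].
  assert (Q : forall n, (N <= n)%nat -> forall tau, a <= tau -> Gam n tau = Gam' n tau).
  { apply (desc_ind (fun n => forall tau, a <= tau -> Gam n tau = Gam' n tau) N (N0 + M + M' + N)%nat).
    - intros n Hn HnN tau Ht.
      apply (orbit_unique s (Cmod k) (N0 + M + M' + N)%nat tau k (fun n => Gam n tau) (fun n => Gam' n tau)); auto using Cmod_ge_0; try lra.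
      + apply (St_N s _ N0); [eapply St_mono; eauto|lia].
      + intros m Hm. apply H2; auto. lia.
      + intros m Hm. apply H2'; auto. lia.
      + intros m Hm. apply H3; auto; lia.
      + intros m Hm. apply H3'; auto; lia.
    - intros n Hn IH.
      assert (E : forall x, from a x -> Cexp (Gam n x) = Cexp (Gam' n x)).
      { intros x Hx. assert (E1 := H2 n x Hn Hx). assert (E2 := H2' n x Hn Hx). rewrite IH in E1 by auto. unfold expmap in *.
        replace (Cexp (Gam n x)) with (Cexp (Gam n x) + k - k)%C by ring. rewrite E1, <- E2. ring. }
      assert (L := lift_unique (from a) (Gam n) (Gam' n) (from_convex a) (H1 n Hn) (H1' n Hn) E).
      destruct (H4 n Hn) as [T HT]. destruct (H4' n Hn) as [T' HT'].
      set (x := Rmax a (Rmax T T')). assert (M1 := Rmax_l a (Rmax T T')). assert (M2 := Rmax_r a (Rmax T T')).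
      assert (M3 := Rmax_l T T'). assert (M4 := Rmax_r T T'). fold x in M1, M2.
      destruct (Cexp_inj_mod _ _ (E x M1)) as [m Em].
      assert (B : Cmod (Gam n x - Gam' n x)%C <= 2).
      { assert (B1 := HT x ltac:(lra) M1). assert (B2 := HT' x ltac:(lra) M1).
        assert (T0 := Cmod_sub_triangle (Gam n x) (base s x n) (Gam' n x)). rewrite (Cmod_sub_sym (base s x n)) in T0. lra. }
      rewrite Em in B. assert (m = 0)%Z.
      { apply twopii_sub_small. replace (twopii m - twopii 0)%C with (twopii m); [lra|]. apply Cext; unfold twopii; simpl; ring. }
      subst m. intros tau Ht. apply Csub_eq. rewrite (L tau x Ht M1), Em. apply Cext; unfold twopii; simpl; ring. }
  auto.
Qed.

(** The admissible size of [k] grows with the potential as [exp tau / 32], which is also the bound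
    in [param_bound]: at large potentials every candidate parameter has its whole ray given by [G],
    from level 0 on. *)
Lemma St_large s b A : Dom s b A -> exists X, b < X /\ forall tau, X <= tau -> St s (exp tau / 32) 0 tau.
Proof.
  intros (Hb & HA & H). destruct (Fn_unbounded 1 (32 * (3 + 8 * A)) Rlt_0_1) as [N HN].
  set (g := Fn (S N) 1). assert (Hg1 : 0 < g) by (apply Fn_pos; lra).
  assert (Hg : 32 * (3 + 8 * A) <= exp g). { specialize (HN (S N) ltac:(lia)). fold g in HN. assert (E := exp_ineq1_le g). lra. }
  exists (b + g). split. lra. intros tau Ht.
  assert (Q : forall m, g <= Fn m tau - Fn m b).
  { induction m. unfold Fn; simpl; lra. assert (B := Fn_gap_S m b tau ltac:(lra)).
    assert (P := Fn_pos m b Hb). assert (E := exp_ineq1 (Fn m b)). assert (0 < Fn m tau - Fn m b) by lra. nra. }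
  intros m _. specialize (Q m). specialize (H (S m)).
  assert (E : exp (Fn m b + g) <= exp (Fn m tau)) by (apply exp_mono; lra). rewrite exp_plus in E.
  rewrite Fn_S in H. set (y := exp (Fn m b)) in *.
  assert (Hy : 1 <= y). { assert (E1 := exp_ineq1_le (Fn m b)). assert (P := Fn_pos m b Hb). unfold y. lra. }
  assert (E2 : exp tau <= exp (Fn m tau)). { apply exp_mono. apply (Fn_mono_n 0 m tau); [lra|lia]. }
  assert (P := PI_pos). assert (P4 := PI_le_4).
  assert (2 * PI * Rabs (IZR (s (S m))) <= 8 * (A * (y - 1))) by (apply Rmult_le_compat; try lra; apply Rabs_pos).
  assert (0 <= A * (y - 1)) by nra. nra.
Qed.

Lemma St_large_K s b A K a : Dom s b A -> exists X, a <= X /\ forall tau, X <= tau -> St s K 0 tau.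
Proof.
  intro HD. destruct (St_large s b A HD) as (X & HX & H). exists (Rmax a (Rmax X (32 * K))). split. apply Rmax_l.
  intros tau Ht. assert (M2 := Rmax_r a (Rmax X (32 * K))). assert (M3 := Rmax_l X (32 * K)). assert (M4 := Rmax_r X (32 * K)).
  apply (St_K s (exp tau / 32)). apply H; lra. assert (E := exp_ineq1_le tau). lra.
Qed.

Lemma near_base_re s z tau m : 0 < tau -> Cmod (z - base s tau m)%C <= 1 -> tau - 1 <= Re z.
Proof.
  intros Ht H. assert (R := Cmod_re_lower (base s tau m) z). change (Re (base s tau m)) with (Fn m tau) in R.
  assert (M := Fn_mono_n 0 m tau Ht ltac:(lia)). unfold Fn in M at 1. simpl in M. lra.
Qed.

Lemma Ray_extend n k s b A a Gam : Dom s b A -> b < a -> Ray (S n) k s a Gam ->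
  (forall tau, a <= tau -> Gam (S n) tau <> k) ->
  exists Gam', Ray n k s a Gam' /\ forall m, (S n <= m)%nat -> Gam' m = Gam m.
Proof.
  intros HD Hb (H1 & H2 & (M & H3) & H4) Hk.
  destruct (St_large_K s b A (Cmod k) a HD) as (X1 & HX1 & HS1). destruct (H4 (S n) (Nat.le_refl _)) as [T HT].
  set (X := Rmax X1 T). assert (Q1 := Rmax_l X1 T). assert (Q2 := Rmax_r X1 T). fold X in Q1, Q2.
  assert (HaX : a <= X) by lra.
  assert (HS : forall tau, X <= tau -> St s (Cmod k) 0 tau) by (intros; apply HS1; lra).
  set (p := fun tau => (Gam (S n) tau - k)%C).
  assert (Hp : ccont (from a) p). { apply ccont_minus. apply H1; lia. apply ccont_const. }
  assert (Hpn : forall x, a <= x -> p x <> 0%C). { intros x Hx E. apply (Hk x Hx). now apply Csub_eq. }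
  destruct (lift_exists p a X HaX) as (l & Hl & El).
  { apply (ccont_sub _ (from a)); auto. unfold from; intros; lra. } { intros; apply Hpn; lra. }
  assert (Hre : forall tau, X <= tau -> 0 < Re (p tau)).
  { intros tau Ht. destruct (log_re s (Cmod k) 0 tau k (Gam (S n) tau) n) as [R _]; auto using Cmod_ge_0; try lra; try lia.
    apply HT; lra. assert (P := exp_pos (Fn n tau)). unfold p. lra. }
  (* Up to [X] an abstract lift, beyond [X] the explicit logarithm with the branch [s n];
     subtracting [l X] makes the pieces fit at [X]. *)
  set (g := fun tau => (l (Rmin tau X) - l X + Clog (p (Rmax tau X)) + twopii (s n))%C).
  assert (Eg : forall tau, a <= tau -> Cexp (g tau) = p tau).
  { intros tau Ht. unfold g. rewrite twopii_exp, Cexp_plus, Cexp_minus, Cexp_Clog by (apply Hre, Rmax_r).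
    rewrite (El X) by lra. destruct (Rle_dec tau X).
    - rewrite Rmin_left, Rmax_right, El by lra. field. apply Hpn; lra.
    - rewrite Rmin_right, Rmax_left, El by lra. field. apply Hpn; lra. }
  exists (fun m => if Nat.eq_dec m n then g else Gam m). split; [split; [|split; [|split]]|].
  - intros m Hm. destruct (Nat.eq_dec m n) as [->|Ne]; [|apply H1; lia].
    unfold g. apply ccont_plus; [|apply ccont_const]. apply ccont_plus.
    + apply ccont_minus; [|apply ccont_const]. apply (ccont_lip _ (fun x => a <= x <= X)); auto.
      { intros x Hx. split. apply Rmin_glb; auto. apply Rmin_r. } intros; apply Rmin_lip.
    + apply (ccont_comp _ Clog (fun tau => p (Rmax tau X))).
      * apply (ccont_lip _ (from a)); auto. { intros x Hx. unfold from. eapply Rle_trans; [|apply Rmax_r]; auto. }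
        intros; apply Rmax_lip.
      * intros x Hx. apply Ccont_Clog, Hre, Rmax_r.
  - intros m tau Hm Ht. destruct (Nat.eq_dec m n) as [->|Ne].
    + destruct (Nat.eq_dec (S n) n); [lia|]. unfold expmap. rewrite Eg by auto. unfold p. ring.
    + destruct (Nat.eq_dec (S m) n); [lia|]. apply H2; auto. lia.
  - exists (M + S n)%nat. intros m tau Hm _ Ht. destruct (Nat.eq_dec m n); [lia|]. apply H3; auto; lia.
  - intros m Hm. destruct (Nat.eq_dec m n) as [->|Ne]; [|apply H4; lia].
    exists X. intros tau Ht _. unfold g. rewrite Rmin_right, Rmax_left by lra.
    replace (l X - l X + Clog (p tau) + twopii (s n))%C with (Clog (p tau) + twopii (s n))%C by ring.
    eapply Rle_trans; [apply (log_step s (Cmod k) 0); auto using Cmod_ge_0; try lra; try lia|].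
    + apply HT; lra.
    + eapply Rle_trans; [apply (err_le_half s (Cmod k) 0); auto; lia|]. lra.
  - intros m Hm. destruct (Nat.eq_dec m n); [lia|]. auto.
Qed.

Lemma iter_S f n z : Defs.iter f (S n) z = f (Defs.iter f n z).
Proof. reflexivity. Qed.

Lemma iter_add f n m z : Defs.iter f (n + m) z = Defs.iter f n (Defs.iter f m z).
Proof. induction n. reflexivity. change (S n + m)%nat with (S (n + m)). now rewrite !iter_S, IHn. Qed.

(* [k] has potential [t] and eventually the address [s], as seen from its orbit only. *)
Definition tracks (k : C) (s : address) (t : R) : Prop :=
  exists N, forall n, (N <= n)%nat -> Cmod (Defs.iter (expmap k) n k - base s t n)%C <= 1.

Lemma Ray_orbit N k s a Gam n tau j : Ray N k s a Gam -> (N <= n)%nat -> a <= tau ->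
  Defs.iter (expmap k) j (Gam n tau) = Gam (j + n)%nat tau.
Proof.
  intros (_ & H2 & _) Hn Ht. induction j. reflexivity. rewrite iter_S, IHj. apply H2; auto. lia.
Qed.

Lemma base_im_close s s' tau tau' n m z w : Cmod (z - base s tau n)%C <= 1 -> Cmod (w - base s' tau' m)%C <= 1 ->
  z = w -> s n = s' m.
Proof.
  intros Hz Hw E. subst w.
  assert (A := im_near_base s z tau n ltac:(lra)). assert (B := im_near_base s' z tau' m ltac:(lra)).
  assert (A' : Rabs (Im z - 2 * PI * IZR (s n)) <= 1) by (eapply Rle_trans; [apply (im_le_Cmod (z - base s tau n)%C)|auto]).
  assert (B' : Rabs (Im z - 2 * PI * IZR (s' m)) <= 1) by (eapply Rle_trans; [apply (im_le_Cmod (z - base s' tau' m)%C)|auto]).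
  apply Rabs_le_between in A'. apply Rabs_le_between in B'. assert (P := PI_gt_3).
  assert (C1 : -1 < IZR (s n) - IZR (s' m) < 1) by (split; nra).
  rewrite <- minus_IZR in C1. destruct C1 as [C1 C2]. apply (lt_IZR (-1)) in C1. apply (lt_IZR _ 1) in C2. lia.
Qed.

(** A point on the ray at level [n + 1] eventually shows the entries [s (i + n + 1)], whereas [k]
    eventually shows [s i]; if they coincide, [s] has eventual period [n + 1]. *)
Lemma Ray_avoids n k s a t Gam : ~ preperiodic s -> tracks k s t -> Ray (S n) k s a Gam ->
  forall tau, a <= tau -> Gam (S n) tau <> k.
Proof.
  intros Hnp [N HN] HR tau Ht E. destruct HR as (H1 & H2 & (M & H3) & H4). apply Hnp.
  exists (N + M)%nat, (S n). split. lia. intro i.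
  assert (O := Ray_orbit (S n) k s a Gam (S n) tau (N + M + i) (conj H1 (conj H2 (conj (ex_intro _ M H3) H4))) (Nat.le_refl _) Ht).
  rewrite E in O.
  assert (B1 := HN (N + M + i)%nat ltac:(lia)). assert (B2 := H3 (N + M + i + S n)%nat tau ltac:(lia) ltac:(lia) Ht).
  replace (N + M + S n + i)%nat with (N + M + i + S n)%nat by lia.
  symmetry. apply (base_im_close s s t tau _ _ _ _ B1 B2 O).
Qed.

Lemma Ray_exists k s b A a t : Dom s b A -> b < a -> ~ preperiodic s -> tracks k s t -> exists Gam, Ray 0 k s a Gam.
Proof.
  intros HD Hb Hnp Htr. destruct (St_of_Dom s b A a (Cmod k) HD Hb) as [N HS].
  assert (Q : forall j, (j <= N)%nat -> exists Gam, Ray (N - j) k s a Gam).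
  { induction j; intro Hj.
    - rewrite Nat.sub_0_r. eexists. apply (Ray_G s (Cmod k)); auto using Cmod_ge_0. lra.
    - destruct IHj as [Gam HG]. lia. replace (N - j)%nat with (S (N - S j)) in HG by lia.
      destruct (Ray_extend (N - S j) k s b A a Gam HD Hb HG) as (Gam' & HG' & _).
      { apply (Ray_avoids _ k s a t); auto. } eauto. }
  specialize (Q N (Nat.le_refl N)). rewrite Nat.sub_diag in Q. auto.
Qed.

(** The rays of nearby parameters exist down to level 0 without any assumption on their orbits, and
    are close uniformly in level and potential. High levels follow from [G_lip]; each of the
    finitely many lifts below loses a factor governed by the distance of the old ray from [k0]. *)
Lemma Ray_continuity k0 s b A a Gam0 : Dom s b A -> b < a -> Ray 0 k0 s a Gam0 ->
  forall e, 0 < e -> exists d, 0 < d /\ forall k, Cmod (k - k0)%C < d -> exists Gam, Ray 0 k s a Gam /\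
    forall n tau, a <= tau -> Cmod (Gam n tau - Gam0 n tau)%C <= e.
Proof.
  intros HD Hb HR0. assert (HR0' := HR0). destruct HR0' as (H1 & H2 & (M & H3) & H4).
  set (K := Cmod k0 + 1). assert (HK : 0 <= K) by (unfold K; generalize (Cmod_ge_0 k0); lra).
  destruct (St_of_Dom s b A a K HD Hb) as [N HS].
  assert (Ha : 0 < a) by (destruct HD; lra).
  assert (Hkk : forall k d, d <= 1 -> Cmod (k - k0)%C < d -> Cmod k <= K).
  { intros k d Hd Hk. assert (T := Cmod_le_sub k k0). unfold K. lra. }
  set (D := fun n => forall e, 0 < e -> exists d, 0 < d /\ forall k, Cmod (k - k0)%C < d -> exists Gam, Ray n k s a Gam /\
    forall m tau, (n <= m)%nat -> a <= tau -> Cmod (Gam m tau - Gam0 m tau)%C <= e).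
  assert (HD0 : forall n, (0 <= n)%nat -> D n).
  { apply (desc_ind D 0 N).
    - intros n Hn _ e He. exists (Rmin 1 e). split. apply Rmin_glb_lt; lra.
      intros k Hk. assert (M1 := Rmin_l 1 e). assert (M2 := Rmin_r 1 e).
      assert (HkK := Hkk k 1 ltac:(lra) ltac:(lra)). assert (Hk0K : Cmod k0 <= K) by (unfold K; lra).
      assert (RG := Ray_G s K N k a HK HS HkK). assert (RG0 := Ray_G s K N k0 a HK HS Hk0K).
      exists (fun n tau => G s k tau n). split. { apply (Ray_sub N n k s a a); auto. lra. }
      intros m tau Hm Ht.
      rewrite <- (Ray_unique N k0 s b A a (fun n tau => G s k0 tau n) Gam0 HD Hb RG0 (Ray_sub 0 N k0 s a a Gam0 ltac:(lia) ltac:(lra) HR0) m tau) by (auto; lia).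
      eapply Rle_trans; [apply (G_lip s K N); auto; [eapply St_mono; eauto|lia]|].
      assert (P := Cmod_ge_0 (k - k0)%C). lra.
    - intros n _ IH e0 He0. set (e := Rmin e0 (1/2)). assert (He : 0 < e) by (apply Rmin_glb_lt; lra).
      assert (Hee : e <= e0) by apply Rmin_l. assert (Hee2 : e <= 1/2) by apply Rmin_r.
      set (c0 := fun tau => (Gam0 (S n) tau - k0)%C).
      assert (E0 : forall tau, a <= tau -> Cexp (Gam0 n tau) = c0 tau).
      { intros tau Ht. unfold c0. rewrite <- (H2 n tau ltac:(lia) Ht). unfold expmap. ring. }
      destruct (H4 (S n) ltac:(lia)) as [T HT].
      (* The old ray at level [n + 1] has positive distance from [k0]: it never hits [k0], being
         obtained from level [n] by [exp] plus [k0], and it tends to infinity. *)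
      destruct (ccont_bounded_below c0 a (Rmax T (K + 3))) as (m0 & Hm0 & Hlow).
      { apply ccont_minus. apply H1; lia. apply ccont_const. }
      { intros x Hx. rewrite <- E0 by auto. apply Cexp_neq_0. }
      { intros x Hx Hax. assert (M1 := Rmax_l T (K + 3)). assert (M2 := Rmax_r T (K + 3)).
        assert (R := near_base_re s _ x (S n) ltac:(lra) (HT x ltac:(lra) Hax)).
        assert (R2 := re_Cmod (c0 x)). unfold c0 in R2 at 1. rewrite re_minus in R2. assert (R3 := re_Cmod k0). unfold K in *. lra. }
      (* Ray and parameter each move by [e'], so [c0] changes by a relative error of at most
         [e / 8], and [Clog_small] multiplies this by 4. *)
      set (e' := Rmin e (e * m0 / 16)). assert (He' : 0 < e'). { apply Rmin_glb_lt; nra. }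
      assert (He'1 : e' <= e * m0 / 16) by apply Rmin_r. assert (He'2 : e' <= e) by apply Rmin_l.
      destruct (IH e' He') as (d & Hd & HI).
      exists (Rmin d e'). split. { apply Rmin_glb_lt; auto. }
      intros k Hk. assert (M1 := Rmin_l d e'). assert (M2 := Rmin_r d e').
      assert (HkK := Hkk k 1 ltac:(lra) ltac:(lra)).
      destruct (HI k ltac:(lra)) as (Gam & HG & Hcl). assert (HG' := HG). destruct HG' as (G1 & G2 & (MG & G3) & G4).
      set (u := fun tau => ((Gam (S n) tau - k - c0 tau) / c0 tau)%C).
      assert (Hc0n : forall tau, a <= tau -> c0 tau <> 0%C).
      { intros tau Ht. apply Cmod_pos_neq. specialize (Hlow tau Ht). lra. }
      assert (Hu : forall tau, a <= tau -> Cmod (u tau) <= e / 8).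
      { intros tau Ht. unfold u. rewrite Cmod_div by auto.
        assert (B : Cmod (Gam (S n) tau - k - c0 tau)%C <= 2 * e').
        { unfold c0. replace (Gam (S n) tau - k - (Gam0 (S n) tau - k0))%C with ((Gam (S n) tau - Gam0 (S n) tau) - (k - k0))%C by ring.
          eapply Rle_trans; [apply Cmod_sub_le|]. specialize (Hcl (S n) tau (Nat.le_refl _) Ht). lra. }
        specialize (Hlow tau Ht). apply Rmult_le_reg_r with (Cmod (c0 tau)). lra.
        unfold Rdiv at 1. rewrite Rmult_assoc, Rinv_l by lra. nra. }
      assert (Hre : forall tau, a <= tau -> 0 < Re (1 + u tau)%C).
      { intros tau Ht. assert (R := Cmod_re_lower 1 (1 + u tau)%C). simpl (Re (RtoC 1)) in R.
        replace (1 + u tau - 1)%C with (u tau) in R by ring. specialize (Hu tau Ht). lra. }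
      set (g := fun tau => (Gam0 n tau + Clog (1 + u tau))%C).
      assert (Eg : forall tau, a <= tau -> Cexp (g tau) = (Gam (S n) tau - k)%C).
      { intros tau Ht. unfold g. rewrite Cexp_plus, E0, Cexp_Clog by auto. unfold u. field. auto. }
      assert (Hgc : forall tau, a <= tau -> Cmod (g tau - Gam0 n tau)%C <= e).
      { intros tau Ht. unfold g. replace (Gam0 n tau + Clog (1 + u tau) - Gam0 n tau)%C with (Clog (1 + u tau)) by ring.
        specialize (Hu tau Ht). eapply Rle_trans; [apply Clog_small; lra|]. lra. }
      exists (fun m => if Nat.eq_dec m n then g else Gam m). split; [split; [|split; [|split]]|].
      + intros m Hm. destruct (Nat.eq_dec m n) as [->|Ne]; [|apply G1; lia].
        unfold g. apply ccont_plus. apply H1; lia. apply (ccont_comp _ Clog (fun tau => 1 + u tau)%C).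
        * apply ccont_plus. apply ccont_const. unfold u.
          assert (Cc0 : ccont (from a) c0) by (apply ccont_minus; [apply H1; lia|apply ccont_const]).
          assert (Cnum : ccont (from a) (fun tau => Gam (S n) tau - k - c0 tau)%C).
          { apply ccont_minus; auto. apply ccont_minus. apply G1; lia. apply ccont_const. }
          intros x Hx ee Hee0.
          assert (Cinv : ccont (from a) (fun tau => / c0 tau)%C).
          { apply (ccont_comp _ (fun z => / z)%C c0); auto. intros y Hy. apply Hol2_cont, Hol2_inv. auto. }
          set (B := Cmod (/ c0 x)%C + 1). assert (HB : 0 < B) by (unfold B; generalize (Cmod_ge_0 (/ c0 x)%C); lra).
          set (v := fun tau => (Gam (S n) tau - k - c0 tau)%C) in *.
          set (BV := Cmod (v x) + 1). assert (HBV : 0 < BV) by (unfold BV; generalize (Cmod_ge_0 (v x)); lra).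
          destruct (Cnum x Hx (Rmin 1 (ee / (2 * B)))) as (d1 & Hd1 & A1). { apply Rmin_glb_lt. lra. apply Rdiv_lt_0_compat; lra. }
          destruct (Cinv x Hx (ee / (2 * BV))) as (d2 & Hd2 & A2). { apply Rdiv_lt_0_compat; lra. }
          exists (Rmin d1 d2). split. now apply Rmin_glb_lt. intros y Hy Hyx.
          assert (Q1 := Rmin_l d1 d2). assert (Q2 := Rmin_r d1 d2).
          specialize (A1 y Hy ltac:(lra)). specialize (A2 y Hy ltac:(lra)). fold (v y) in A1. fold (v x) in A1.
          assert (Q3 := Rmin_l 1 (ee / (2 * B))). assert (Q4 := Rmin_r 1 (ee / (2 * B))).
          change (Gam (S n) y - k - c0 y)%C with (v y). change (Gam (S n) x - k - c0 x)%C with (v x).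
          replace (v y / c0 y - v x / c0 x)%C with (v y * (/ c0 y - / c0 x) + (v y - v x) * / c0 x)%C by (unfold Cdiv; ring).
          eapply Rle_lt_trans; [apply Cmod_triangle|]. rewrite !Cmod_mult.
          assert (Tv := Cmod_le_sub (v y) (v x)). assert (Hvy : Cmod (v y) <= BV) by (unfold BV; lra).
          assert (P1 := Cmod_ge_0 (v y)). assert (P2 := Cmod_ge_0 (/ c0 y - / c0 x)%C). assert (P3 := Cmod_ge_0 (v y - v x)%C).
          assert (P4 := Cmod_ge_0 (/ c0 x)%C).
          assert (S1 : Cmod (v y) * Cmod (/ c0 y - / c0 x)%C <= BV * Cmod (/ c0 y - / c0 x)%C) by (apply Rmult_le_compat_r; auto).
          assert (S2 : BV * Cmod (/ c0 y - / c0 x)%C < ee / 2).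
          { apply Rmult_lt_compat_l with (r := BV) in A2; auto. replace (BV * (ee / (2 * BV))) with (ee / 2) in A2 by (field; lra). auto. }
          assert (S3 : Cmod (v y - v x)%C * B <= ee / 2).
          { assert (A1' : Cmod (v y - v x)%C <= ee / (2 * B)) by lra. apply Rmult_le_compat_r with (r := B) in A1'; [|lra].
            replace (ee / (2 * B) * B) with (ee / 2) in A1' by (field; lra). auto. }
          assert (S4 : Cmod (v y - v x)%C * Cmod (/ c0 x)%C <= Cmod (v y - v x)%C * B) by (apply Rmult_le_compat_l; auto; unfold B; lra).
          lra.
        * intros x Hx. apply Ccont_Clog. auto.
      + intros m tau Hm Ht. destruct (Nat.eq_dec m n) as [->|Ne].
        * destruct (Nat.eq_dec (S n) n); [lia|]. unfold expmap. rewrite Eg by auto. ring.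
        * destruct (Nat.eq_dec (S m) n); [lia|]. apply G2; auto. lia.
      + exists (MG + S n)%nat. intros m tau Hm _ Ht. destruct (Nat.eq_dec m n); [lia|]. apply G3; auto; lia.
      + intros m Hm. destruct (Nat.eq_dec m n) as [->|Ne]; [|apply G4; lia].
        destruct (St_large_K s b A K a HD) as (X & HX & HSX). destruct (G4 (S n) (Nat.le_refl _)) as [TG HTG].
        destruct (H4 n ltac:(lia)) as [T0 HT0].
        exists (Rmax X (Rmax TG T0)). intros tau Ht Hat. assert (Q1 := Rmax_l X (Rmax TG T0)). assert (Q2 := Rmax_r X (Rmax TG T0)).
        assert (Q3 := Rmax_l TG T0). assert (Q4 := Rmax_r TG T0).
        assert (B1 := HTG tau ltac:(lra) Hat). assert (B2 := HT0 tau ltac:(lra) Hat). assert (B3 := Hgc tau Hat).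
        rewrite (log_of_near s K 0 tau k (g tau) (Gam (S n) tau) n); auto; try lia.
        * eapply Rle_trans; [apply (log_step s K 0); auto; try lia; apply HSX; lra|].
          eapply Rle_trans; [apply (err_le_half s K 0); [apply HSX; lra|lia]|]. lra.
        * apply HSX; lra.
        * unfold expmap. rewrite Eg by auto. ring.
        * eapply Rle_trans; [apply (Cmod_sub_triangle _ (Gam0 n tau))|]. lra.
      + intros m tau Hm Ht. destruct (Nat.eq_dec m n) as [->|Ne].
        * specialize (Hgc tau Ht). lra.
        * specialize (Hcl m tau ltac:(lia) Ht). lra. }
  intros e He. destruct (HD0 O (Nat.le_refl 0) e He) as (d & Hd & H). exists d. split; auto.
  intros k Hk. destruct (H k Hk) as (Gam & HG & HC). exists Gam. split; auto. intros n tau Ht. apply HC; auto. lia.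
Qed.

(** * Ray tails and potentials *)

Lemma continuous_on_ccont (D : R -> Prop) (c : R -> C) : continuous_on D c <-> ccont D c.
Proof.
  split.
  - intros H x Dx e He. specialize (H x Dx).
    assert (He2 : 0 < e / 2) by lra.
    destruct (H (ball (c x) (mkposreal _ He2)) (locally_ball (c x) (mkposreal _ He2))) as [d Hd].
    exists d. split. apply cond_pos. intros y Dy Hy.
    specialize (Hd y Hy Dy). destruct Hd as [B1 B2].
    eapply Rle_lt_trans; [apply Cmod_le_ReIm|].
    change (Rabs (Re (c y) - Re (c x)) < e / 2) in B1. change (Rabs (Im (c y) - Im (c x)) < e / 2) in B2.
    rewrite re_minus, im_minus. lra.
  - intros H x Dx P [e He]. destruct (H x Dx e (cond_pos e)) as (d & Hd & A).
    exists (mkposreal d Hd). intros y Hy Dy. apply He. specialize (A y Dy Hy). split.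
    + change (Rabs (Re (c y) - Re (c x)) < e). rewrite <- re_minus. eapply Rle_lt_trans; [apply re_le_Cmod|auto].
    + change (Rabs (Im (c y) - Im (c x)) < e). rewrite <- im_minus. eapply Rle_lt_trans; [apply im_le_Cmod|auto].
Qed.

Lemma is_lim_pp (g : R -> R) : is_lim g p_infty p_infty <-> forall M, exists T, forall x, T <= x -> M < g x.
Proof.
  rewrite <- (is_lim_spec g p_infty p_infty). split.
  - intros H M. destruct (H M) as [T HT]. exists (T + 1). intros x Hx. apply HT. lra.
  - intros H M. destruct (H M) as [T HT]. exists T. intros x Hx. apply HT. lra.
Qed.

Lemma is_lim_seq_pp (u : nat -> R) : is_lim_seq u p_infty <-> forall M, exists N, forall n, (N <= n)%nat -> M < u n.
Proof. rewrite <- (is_lim_seq_spec u p_infty). reflexivity. Qed.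

Definition Tail (k : C) (c : R -> C) : Prop :=
  ccont (from 0) c /\
  (forall n M, exists T, forall v, T <= v -> M < Cmod (Defs.iter (expmap k) n (c v))) /\
  (forall n u v, 0 <= u -> 0 <= v -> Defs.iter (expmap k) n (c u) = Defs.iter (expmap k) n (c v) -> u = v) /\
  (forall M, exists N, forall n v, (N <= n)%nat -> 0 <= v -> M < Cmod (Defs.iter (expmap k) n (c v))).

Lemma Tail_iff k c : is_ray_tail (expmap k) c <-> Tail k c.
Proof.
  unfold is_ray_tail, Tail. split.
  - intros (H1 & _ & H3 & H4). split; [|split; [|split]].
    + now apply continuous_on_ccont in H1.
    + intros n M. destruct (H3 n) as [_ H]. now apply (proj1 (is_lim_pp _) H).
    + intros n u v Hu Hv E. destruct (H3 n) as [H _]. apply H; auto.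
    + intro M. destruct (H4 M) as [N HN]. exists N. intros. apply HN; auto.
  - intros (H1 & H2 & H3 & H4). split; [|split; [|split]].
    + now apply continuous_on_ccont.
    + intros t Ht. apply is_lim_seq_pp. intro M. destruct (H4 M) as [N HN]. exists N. intros. apply HN; auto.
    + intro n. split. intros u v Hu Hv E. apply (H3 n); auto. apply is_lim_pp. apply H2.
    + intro M. destruct (H4 M) as [N HN]. exists N. intros. apply HN; auto.
Qed.

Lemma Tail_shift k c v0 : 0 <= v0 -> Tail k c -> Tail k (fun v => c (v0 + v)).
Proof.
  intros Hv (H1 & H2 & H3 & H4). split; [|split; [|split]].
  - apply (ccont_lip _ (from 0) c (fun v => v0 + v)); auto.
    + unfold from. intros; lra.
    + intros x y. right. f_equal. ring.
  - intros n M. destruct (H2 n M) as [T HT]. exists T. intros v Hv'. apply HT. lra.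
  - intros n u v Hu Hv' E. assert (v0 + u = v0 + v) by (apply (H3 n); auto; lra). lra.
  - intro M. destruct (H4 M) as [N HN]. exists N. intros. apply HN; auto. lra.
Qed.

(** * Orbits far to the right and their order by speed *)

(** An orbit confined to the strips of [a], before any potential is known. The threshold makes [k]
    negligible against every point of the orbit. *)
Definition far (k : C) (N : nat) (a : address) (z : nat -> C) : Prop :=
  forall n, (N <= n)%nat -> z (S n) = expmap k (z n) /\ z n = (Clog (z (S n) - k) + twopii (a n))%C /\
    100 * (Cmod k + 1) ^ 2 < Re (z n).

Lemma far_N k N N' a z : (N <= N')%nat -> far k N a z -> far k N' a z.
Proof. intros H F n Hn. apply F. lia. Qed.

Lemma far_im k N a z n : far k N a z -> (N <= n)%nat -> Rabs (Im (z n) - 2 * PI * IZR (a n)) < PI / 2.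
Proof.
  intros F Hn. destruct (F n Hn) as (_ & E & _). rewrite E, im_plus.
  assert (I := im_Clog (z (S n) - k)%C). apply Rabs_lt_between.
  change (Im (twopii (a n))) with (2 * PI * IZR (a n)). lra.
Qed.

Lemma far_im2 k N a z w n : far k N a z -> far k N a w -> (N <= n)%nat -> Rabs (Im (z n) - Im (w n)) < 4.
Proof.
  intros F F' Hn. assert (A := far_im k N a z n F Hn). assert (B := far_im k N a w n F' Hn).
  apply Rabs_lt_between in A. apply Rabs_lt_between in B. apply Rabs_lt_between. assert (P := PI_le_4). lra.
Qed.

Lemma far_mod k N a z n : far k N a z -> (N <= n)%nat -> Cmod (z (S n) - k)%C = exp (Re (z n)).
Proof.
  intros F Hn. destruct (F n Hn) as (E & _ & _). rewrite E. unfold expmap.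
  replace (Cexp (z n) + k - k)%C with (Cexp (z n)) by ring. apply Cmod_Cexp.
Qed.

(** Orbits in the same strips are within 4 in imaginary part; if the real parts also stay within 4
    at all levels, the contracting logarithms identify them. So distinct orbits must separate in
    speed, which gives the dichotomy of [tail_order]. *)
Lemma far_equal k N a z w : far k N a z -> far k N a w ->
  (forall n, (N <= n)%nat -> Rabs (Re (z n) - Re (w n)) <= 4) -> forall n, (N <= n)%nat -> z n = w n.
Proof.
  intros F F' H.
  assert (A : forall j n, (N <= n)%nat -> Cmod (z n - w n)%C <= 8 * (1 / 2) ^ j).
  { induction j; intros n Hn.
    - eapply Rle_trans; [apply Cmod_le_ReIm|]. rewrite re_minus, im_minus.
      assert (B := far_im2 k N a z w n F F' Hn). specialize (H n Hn). simpl pow. lra.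
    - destruct (F n Hn) as (_ & E & _). destruct (F' n Hn) as (_ & E' & _).
      destruct (F (S n) ltac:(lia)) as (_ & _ & R). destruct (F' (S n) ltac:(lia)) as (_ & _ & R').
      rewrite E, E'. replace (Clog (z (S n) - k) + twopii (a n) - (Clog (w (S n) - k) + twopii (a n)))%C
        with (Clog (z (S n) - k) - Clog (w (S n) - k))%C by ring.
      assert (Rk := re_Cmod k). assert (Pk := Cmod_ge_0 k).
      eapply Rle_trans; [apply (Clog_lip 4); [lra| |]; rewrite re_minus; nra|].
      replace (z (S n) - k - (w (S n) - k))%C with (z (S n) - w (S n))%C by ring.
      specialize (IHj (S n) ltac:(lia)). simpl pow. lra. }
  intros n Hn. apply Csub_eq, Cmod_lt_small. intros e He. destruct (small_geom 8 (1/2) e) as [j Hj]; try lra.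
  specialize (A j n Hn). lra.
Qed.

Lemma exp_4_ge_16 : 16 <= exp 4.
Proof. replace 4 with (2 + 2) by ring. rewrite exp_plus. assert (A := exp_2_ge_4). nra. Qed.

Lemma Cmod_le_re_im2 (w : C) (y : R) : 0 <= Re w -> Rabs (Im w) <= y -> Cmod w <= Re w + y.
Proof.
  intros H H'. eapply Rle_trans; [apply Cmod_le_ReIm|]. rewrite (Rabs_pos_eq (Re w)) by auto. lra.
Qed.

(** A lead of 4 in real part becomes a factor 16 in modulus. Since both points lie in the same
    strip, the larger modulus cannot come from the imaginary part, so it is again a lead in real
    part. *)
Lemma faster_step k N a z w n : far k N a z -> far k N a w -> (N <= n)%nat ->
  Re (z n) + 4 < Re (w n) -> 5 * Cmod (z (S n)) <= Re (w (S n)).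
Proof.
  intros F F' Hn H.
  assert (M := far_mod k N a z n F Hn). assert (M' := far_mod k N a w n F' Hn).
  destruct (F (S n) ltac:(lia)) as (_ & _ & R). destruct (F' (S n) ltac:(lia)) as (_ & _ & R').
  assert (I := far_im2 k N a z w (S n) F F' ltac:(lia)).
  set (Z := z (S n)) in *. set (W := w (S n)) in *. set (K := Cmod k) in *.
  assert (HK : 0 <= K) by apply Cmod_ge_0.
  assert (HZ := re_Cmod Z). assert (HZK : 100 * (K + 1) <= Cmod Z) by nra.
  assert (T1 := Cmod_le_sub Z (Z - k)%C). replace (Z - (Z - k))%C with k in T1 by ring. fold K in T1.
  assert (T2 := Cmod_sub_le W k). fold K in T2.
  assert (E : 16 * Cmod (Z - k)%C <= Cmod (W - k)%C).
  { rewrite M, M'. assert (E1 : exp (Re (z n) + 4) <= exp (Re (w n))) by (apply exp_mono; lra).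
    rewrite exp_plus in E1. assert (E2 := exp_4_ge_16). assert (E3 := exp_pos (Re (z n))). nra. }
  assert (HW : 10 * Cmod Z <= Cmod W) by lra.
  assert (IZ := im_le_Cmod Z). assert (IW : Rabs (Im W) <= Cmod Z + 4).
  { apply Rabs_lt_between in I. apply Rabs_le_between in IZ. apply Rabs_le. lra. }
  assert (L := Cmod_le_re_im2 W _ ltac:(nra) IW). lra.
Qed.

Lemma faster_persists k N a z w n m : far k N a z -> far k N a w -> (N <= n)%nat -> (n <= m)%nat ->
  Re (z n) + 4 < Re (w n) -> Re (z m) + 4 < Re (w m).
Proof.
  intros F F' Hn Hm H. induction Hm; auto.
  assert (S1 := faster_step k N a z w m F F' ltac:(lia) IHHm).
  destruct (F (S m) ltac:(lia)) as (_ & _ & R). assert (P := re_Cmod (z (S m))).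
  assert (Pk := Cmod_ge_0 k). assert (1 <= (Cmod k + 1) ^ 2) by nra. lra.
Qed.

(* The margin 4 lets the condition, up to constants, pass to other orbits in the same strips. *)
Definition thin (N : nat) (z : nat -> C) : Prop :=
  forall n, (N <= n)%nat -> 16 * (Rabs (Im (z n)) + 4) ^ 2 <= Re (z n).

Lemma pow_exp (x : R) n : exp x ^ n = exp (INR n * x).
Proof.
  induction n. simpl. rewrite Rmult_0_l, exp_0. auto.
  rewrite S_INR, <- tech_pow_Rmult, IHn, <- exp_plus. f_equal. ring.
Qed.

(** After one step the real part of [w] is five times the modulus of [z], so one step later
    [|w - k|] is at least the fifth power of [|z - k|]. The imaginary part of [w] is at most
    [|z| + 4], hence negligible even when squared. *)
Lemma faster_thin k N a z w n0 : far k N a z -> far k N a w -> (N <= n0)%nat ->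
  Re (z n0) + 4 < Re (w n0) -> thin (S (S n0)) w.
Proof.
  intros F F' Hn H n Hnn. destruct n; [lia|].
  assert (P1 := faster_persists k N a z w n0 (n - 1) F F' Hn ltac:(lia) H).
  assert (S1 := faster_step k N a z w (n - 1) F F' ltac:(lia) P1). replace (S (n - 1)) with n in S1 by lia.
  assert (M := far_mod k N a z n F ltac:(lia)). assert (M' := far_mod k N a w n F' ltac:(lia)).
  destruct (F (S n) ltac:(lia)) as (_ & _ & R). destruct (F' (S n) ltac:(lia)) as (_ & _ & R').
  assert (I := far_im2 k N a z w (S n) F F' ltac:(lia)).
  assert (RZ := re_Cmod (z n)).
  set (Z := z (S n)) in *. set (W := w (S n)) in *. set (K := Cmod k) in *.
  assert (HK : 0 <= K) by apply Cmod_ge_0.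
  assert (HZ := re_Cmod Z). assert (HZK : 100 * (K + 1) <= Cmod Z) by nra.
  assert (T1 := Cmod_le_sub Z (Z - k)%C). replace (Z - (Z - k))%C with k in T1 by ring. fold K in T1.
  assert (T2 := Cmod_sub_le W k). fold K in T2.
  assert (E : Cmod (Z - k)%C ^ 5 <= Cmod (W - k)%C).
  { rewrite M, M', pow_exp. apply exp_mono. simpl INR. lra. }
  assert (IZ := im_le_Cmod Z). assert (IW : Rabs (Im W) <= Cmod Z + 4).
  { apply Rabs_lt_between in I. apply Rabs_le_between in IZ. apply Rabs_le. lra. }
  assert (L := Cmod_le_re_im2 W _ ltac:(nra) IW).
  set (x := Cmod (Z - k)%C) in *. assert (Hx : 99 <= x) by lra.
  assert (Hxz : Cmod Z <= 2 * x) by lra.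
  assert (x ^ 3 <= x ^ 5 / 9000).
  { replace (x ^ 5) with (x ^ 3 * (x * x)) by ring. assert (0 < x ^ 3) by (apply pow_lt; lra). assert (9000 <= x * x) by nra. nra. }
  assert (x ^ 2 * 99 <= x ^ 3). { replace (x ^ 3) with (x ^ 2 * x) by ring. assert (0 < x ^ 2) by (apply pow_lt; lra). nra. }
  assert (x * 99 <= x ^ 2) by nra.
  assert (PI0 := Rabs_pos (Im W)).
  assert ((Rabs (Im W) + 4) ^ 2 <= (2 * x + 8) ^ 2) by (apply pow_incr; lra).
  assert (16 * (2 * x + 8) ^ 2 <= 100 * x ^ 2 + 1000 * x + 2000) by nra.
  lra.
Qed.

Lemma cross_both k N a z w n m : far k N a z -> far k N a w -> (N <= n)%nat -> (N <= m)%nat ->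
  Re (z n) + 4 < Re (w n) -> Re (w m) + 4 < Re (z m) -> False.
Proof.
  intros F F' Hn Hm A B. assert (A' := faster_persists k N a z w n (n + m) F F' Hn ltac:(lia) A).
  assert (B' := faster_persists k N a w z m (n + m) F' F Hm ltac:(lia) B). lra.
Qed.

(** A large [f(z)] requires a large real part of [z], so uniform escape sends the whole tail to the
    right from one common level on. There the branch of the logarithm is constant along the curve by
    [lift_unique]. *)
Lemma tail_far k c : Tail k c -> exists N a, forall v, 0 <= v -> far k N a (fun n => Defs.iter (expmap k) n (c v)).
Proof.
  intros (H1 & H2 & H3 & H4).
  set (M := 100 * (Cmod k + 1) ^ 2). assert (Pk := Cmod_ge_0 k).
  destruct (H4 (exp M + Cmod k)) as [N HN].
  set (z := fun n v => Defs.iter (expmap k) n (c v)).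
  assert (Hz : forall n, ccont (from 0) (z n)).
  { induction n. exact H1. apply (ccont_f _ k (z n)). auto. }
  assert (HR : forall n v, (N <= n)%nat -> 0 <= v -> M < Re (z n v)).
  { intros n v Hn Hv. assert (A := HN (S n) v ltac:(lia) Hv). rewrite iter_S in A. unfold expmap in A at 1.
    assert (T := Cmod_triangle (Cexp (z n v)) k). fold (z n v) in A. rewrite Cmod_Cexp in T.
    assert (exp M < exp (Re (z n v))) by lra. now apply exp_lt_inv. }
  assert (Hpos : forall n v, (N <= n)%nat -> 0 <= v -> 0 < Re (z n v - k)%C).
  { intros n v Hn Hv. rewrite re_minus. specialize (HR n v Hn Hv). assert (R := re_Cmod k). unfold M in HR. nra. }
  assert (HA : forall n, exists a : Z, (N <= n)%nat -> forall v, 0 <= v -> z n v = (Clog (z (S n) v - k) + twopii a)%C).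
  { intro n. destruct (Nat.le_gt_cases N n) as [L|L]; [|exists 0%Z; intro; lia].
    assert (E : forall v, from 0 v -> Cexp (z n v) = Cexp (Clog (z (S n) v - k))).
    { intros v Hv. rewrite Cexp_Clog by (apply Hpos; auto). unfold z at 2. rewrite iter_S. unfold expmap at 1. fold (z n v). ring. }
    assert (LU := lift_unique (from 0) (z n) (fun v => Clog (z (S n) v - k)) (from_convex 0) (Hz n)).
    destruct (Cexp_inj_mod _ _ (E 0 (Rle_refl 0))) as [a Ha]. exists a. intros _ v Hv.
    assert (Q : (z n v - Clog (z (S n) v - k) = z n 0 - Clog (z (S n) 0 - k))%C).
    { apply LU; auto; try (unfold from; lra).
      apply (ccont_comp _ Clog (fun v => z (S n) v - k)%C).
      - apply ccont_minus; auto. apply ccont_const.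
      - intros x Hx. apply Ccont_Clog. apply Hpos; auto. }
    rewrite Ha in Q. rewrite <- Q. ring. }
  apply functional_choice in HA. destruct HA as [a Ha]. exists N, a. intros v Hv n Hn. split; [reflexivity|]. split.
  - apply (Ha n Hn v Hv).
  - apply (HR n v Hn Hv).
Qed.

(* Speed of escape increases along a ray tail: comparison with a fixed point is
   locally constant by injectivity, and far out the points are faster. *)
Lemma tail_order k c N a : Tail k c -> (forall v, 0 <= v -> far k N a (fun n => Defs.iter (expmap k) n (c v))) ->
  forall u v, 0 <= u -> u < v -> exists n, (N <= n)%nat /\
    Re (Defs.iter (expmap k) n (c u)) + 4 < Re (Defs.iter (expmap k) n (c v)).
Proof.
  intros (H1 & H2 & H3 & H4) HF u v Hu Huv.
  set (z := fun n v => Defs.iter (expmap k) n (c v)) in *.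
  assert (Hz : forall n, ccont (from 0) (z n)).
  { induction n. exact H1. apply (ccont_f _ k (z n)). auto. }
  set (P := fun x => exists n, (N <= n)%nat /\ Re (z n u) + 4 < Re (z n x)).
  set (Q := fun x => exists n, (N <= n)%nat /\ Re (z n x) + 4 < Re (z n u)).
  assert (PQ : forall x, u < x -> P x \/ Q x).
  { intros x Hx. apply NNPP. intro NN. apply not_or_and in NN. destruct NN as [NP NQ].
    assert (E := far_equal k N a (fun n => z n x) (fun n => z n u) (HF x ltac:(lra)) (HF u Hu)).
    assert (x = u); [|lra]. apply (H3 N); try lra. apply E; auto. intros n Hn.
    apply Rabs_le. split; apply Rnot_lt_le; intro L; [apply NQ|apply NP]; exists n; split; auto; lra. }
  assert (nPQ : forall x, u < x -> P x -> Q x -> False).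
  { intros x Hx (n & Hn & A) (m & Hm & B). apply (cross_both k N a (fun n => z n u) (fun n => z n x) n m (HF u Hu) (HF x ltac:(lra)) Hn Hm A B). }
  assert (OP : forall x, u < x -> P x -> exists d, 0 < d /\ forall y, u < y -> Rabs (y - x) < d -> P y).
  { intros x Hx (n & Hn & A). destruct (Hz n x ltac:(unfold from; lra) (Re (z n x) - Re (z n u) - 4) ltac:(lra)) as (d & Hd & B).
    exists d. split; auto. intros y Hy Hyx. exists n. split; auto. specialize (B y ltac:(unfold from; lra) Hyx).
    assert (R := Cmod_re_lower (z n x) (z n y)). lra. }
  assert (OQ : forall x, u < x -> Q x -> exists d, 0 < d /\ forall y, u < y -> Rabs (y - x) < d -> Q y).
  { intros x Hx (n & Hn & A). destruct (Hz n x ltac:(unfold from; lra) (Re (z n u) - Re (z n x) - 4) ltac:(lra)) as (d & Hd & B).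
    exists d. split; auto. intros y Hy Hyx. exists n. split; auto. specialize (B y ltac:(unfold from; lra) Hyx).
    assert (R := Cmod_re_lower (z n y) (z n x)). rewrite Cmod_sub_sym in R. lra. }
  assert (far_out : exists V, v <= V /\ P V).
  { destruct (H2 N (Cmod (z N u) + Cmod (z N u) + 8)) as [T HT]. exists (Rmax v T). split. apply Rmax_l.
    exists N. split; auto. assert (HV := Rmax_l v T). specialize (HT (Rmax v T) (Rmax_r v T)). fold (z N (Rmax v T)) in HT.
    assert (I := far_im2 k N a _ _ N (HF (Rmax v T) ltac:(lra)) (HF u Hu) (Nat.le_refl N)). simpl in I.
    destruct (HF (Rmax v T) ltac:(lra) N (Nat.le_refl N)) as (_ & _ & R).
    assert (IZ := im_le_Cmod (z N u)). assert (RZ := re_Cmod (z N u)).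
    assert (IW : Rabs (Im (z N (Rmax v T))) <= Cmod (z N u) + 4).
    { apply Rabs_lt_between in I. fold (z N (Rmax v T)) in I. fold (z N u) in I. apply Rabs_le_between in IZ. apply Rabs_le. lra. }
    assert (0 <= (Cmod k + 1) ^ 2) by apply pow2_ge_0.
    fold (z N (Rmax v T)) in R.
    assert (L := Cmod_le_re_im2 (z N (Rmax v T)) _ ltac:(lra) IW). lra. }
  destruct far_out as (V & HV & PV).
  apply (conn_back P v V HV); auto. intros x Hx. destruct (PQ x ltac:(lra)) as [Px|Qx].
  - destruct (OP x ltac:(lra) Px) as (d & Hd & A). exists d. split; auto. intros y Hy Hyx. specialize (A y ltac:(lra) Hyx). tauto.
  - destruct (OQ x ltac:(lra) Qx) as (d & Hd & A). exists d. split; auto. intros y Hy Hyx. specialize (A y ltac:(lra) Hyx).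
    split; intro B; exfalso; [apply (nPQ x)|apply (nPQ y)]; auto; lra.
Qed.

Definition wthin (N : nat) (z : nat -> C) : Prop := forall n, (N <= n)%nat -> 8 * Rabs (Im (z n)) ^ 2 <= Re (z n).

(** With small imaginary parts, modulus and real part differ by at most 1, so the real parts satisfy
    [x (n+1) = exp (x n)] up to a bounded error. Margins of 1 above or below [F^n(tau)] then
    persist, and the potential is the cut between the two kinds of [tau]. *)
Lemma potential_exists k N a w : far k N a w -> wthin N w ->
  exists t, 0 < t /\ forall n, (N <= n)%nat -> Cmod (w n - base a t n)%C <= 1.
Proof.
  intros F Th. set (x := fun n => Re (w n)). set (K := Cmod k). assert (HK : 0 <= K) by apply Cmod_ge_0.
  assert (Hx : forall n, (N <= n)%nat -> 100 * (K + 1) ^ 2 < x n) by (intros n Hn; apply F; auto).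
  assert (Hx1 : forall n, (N <= n)%nat -> 100 * (K + 1) < x n) by (intros n Hn; specialize (Hx n Hn); nra).
  assert (Hmod : forall n, (N <= n)%nat -> x n <= Cmod (w n) <= x n + 1).
  { intros n Hn. split. apply re_Cmod. specialize (Th n Hn). specialize (Hx1 n Hn). fold (x n) in Th.
    assert (E := Cmod2_alt (w n)). fold (x n) in E. rewrite pow2_abs in Th. assert (P := Cmod_ge_0 (w n)). nra. }
  assert (Hrec : forall n, (N <= n)%nat -> Rabs (x (S n) - exp (x n)) <= K + 1).
  { intros n Hn. unfold x at 2. rewrite <- (far_mod k N a w n F Hn). destruct (Hmod (S n) ltac:(lia)) as [M1 M2].
    assert (T1 := Cmod_le_sub (w (S n)) (w (S n) - k)%C). replace (w (S n) - (w (S n) - k))%C with k in T1 by ring.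
    assert (T2 := Cmod_sub_le (w (S n)) k). fold K in T1, T2. apply Rabs_le. lra. }
  assert (Hlow : forall n tau, (N <= n)%nat -> Fn n tau + 1 <= x n -> Fn (S n) tau + 1 <= x (S n)).
  { intros n tau Hn H. rewrite Fn_S. specialize (Hrec n Hn). apply Rabs_le_between in Hrec.
    assert (E : exp (Fn n tau + 1) <= exp (x n)) by (now apply exp_mono). rewrite exp_plus in E.
    assert (E1 := exp_ineq1_le 1). assert (E2 := exp_pos (Fn n tau)). assert (E3 := exp_ineq1_le (x n)).
    specialize (Hx1 n Hn). nra. }
  assert (Hup : forall n tau, (N <= n)%nat -> x n + 1 <= Fn n tau -> x (S n) + 1 <= Fn (S n) tau).
  { intros n tau Hn H. rewrite Fn_S. specialize (Hrec n Hn). apply Rabs_le_between in Hrec.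
    assert (E : exp (x n + 1) <= exp (Fn n tau)) by (now apply exp_mono). rewrite exp_plus in E.
    assert (E1 := exp_ineq1_le 1). assert (E2 := exp_pos (x n)). assert (E3 := exp_ineq1_le (x n)).
    specialize (Hx1 n Hn). nra. }
  assert (Hlow' : forall n m tau, (N <= n)%nat -> (n <= m)%nat -> Fn n tau + 1 <= x n -> Fn m tau + 1 <= x m).
  { intros n m tau Hn Hm H. induction Hm; auto. apply Hlow; auto. lia. }
  assert (Hup' : forall n m tau, (N <= n)%nat -> (n <= m)%nat -> x n + 1 <= Fn n tau -> x m + 1 <= Fn m tau).
  { intros n m tau Hn Hm H. induction Hm; auto. apply Hup; auto. lia. }
  set (E := fun tau => 0 < tau /\ exists n, (N <= n)%nat /\ Fn n tau + 1 <= x n).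
  assert (HE0 : exists tau, E tau).
  { destruct (Fn_cont N 0 1 Rlt_0_1) as (d & Hd & A). exists (d / 2). split. lra. exists N. split; auto.
    assert (Z : Fn N 0 = 0). { clear. induction N. reflexivity. rewrite Fn_S, IHN, exp_0. ring. }
    specialize (A (d / 2)). rewrite Z in A. specialize (A ltac:(rewrite Rminus_0_r, Rabs_pos_eq; lra)).
    apply Rabs_lt_between in A. specialize (Hx1 N (Nat.le_refl N)). nra. }
  assert (HEb : bound E).
  { exists (x N + 1). intros tau (Ht & n & Hn & A). apply Rnot_lt_le. intro L.
    assert (M := Fn_mono_n 0 N tau Ht ltac:(lia)). unfold Fn in M at 1. simpl in M.
    assert (B := Hup' N n tau (Nat.le_refl N) Hn ltac:(lra)). lra. }
  destruct (completeness E HEb HE0) as [t [Ht1 Ht2]].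
  assert (Ht : 0 < t). { destruct HE0 as [tau Etau]. assert (B := Ht1 tau Etau). destruct Etau. lra. }
  assert (Hclose : forall n, (N <= n)%nat -> Rabs (x n - Fn n t) <= 1).
  { intros n Hn. apply Rabs_le. split; apply Rnot_lt_le; intro L.
    - destruct (Fn_cont n t (Fn n t - x n - 1) ltac:(lra)) as (d & Hd & A).
      assert (exists tau', E tau' /\ t - d < tau') as (tau' & Etau' & Htau').
      { apply NNPP. intro Q. assert (t <= t - d); [|lra]. apply Ht2. intros y Ey. apply Rnot_lt_le. intro L'. apply Q. eauto. }
      assert (Htt := Ht1 tau' Etau'). destruct Etau' as (_ & m & Hm & B).
      specialize (A tau' ltac:(apply Rabs_lt_between; lra)). apply Rabs_lt_between in A.
      assert (C1 := Hup' n (n + m)%nat tau' Hn ltac:(lia) ltac:(lra)).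
      assert (C2 := Hlow' m (n + m)%nat tau' Hm ltac:(lia) B). lra.
    - destruct (Fn_cont n t (x n - 1 - Fn n t) ltac:(lra)) as (d & Hd & A).
      specialize (A (t + d / 2) ltac:(apply Rabs_lt_between; lra)). apply Rabs_lt_between in A.
      assert (E (t + d / 2)). { split. lra. exists n. split; auto. lra. }
      apply Ht1 in H. lra. }
  exists t. split; auto. intros n Hn.
  (* So far only the real parts agree up to 1. One logarithm from level [n + 1] improves both
     coordinates to 1/4. *)
  set (p := (w (S n) - k)%C). destruct (F n Hn) as (_ & Eq & _). fold p in Eq.
  destruct (Hmod (S n) ltac:(lia)) as [M1 M2]. assert (X := Hx1 (S n) ltac:(lia)).
  assert (Rk := re_Cmod k). fold K in Rk.
  assert (Hp : 98 * (K + 1) <= Re p /\ 98/100 * x (S n) <= Re p).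
  { unfold p. rewrite re_minus. fold (x (S n)). lra. }
  assert (Pm := re_Cmod p).
  eapply Rle_trans; [apply Cmod_le_ReIm|]. rewrite re_minus, im_minus.
  change (Re (base a t n)) with (Fn n t). change (Im (base a t n)) with (2 * PI * IZR (a n)).
  assert (R1 : Rabs (Re (w n) - Fn n t) <= 1 / 4).
  { replace (Re (w n)) with (ln (Cmod p)).
    2:{ rewrite Eq, re_plus, re_Clog. simpl. ring. }
    replace (Fn n t) with (ln (1 + Fn (S n) t)).
    2:{ rewrite Fn_S. replace (1 + (exp (Fn n t) - 1)) with (exp (Fn n t)) by ring. apply ln_exp. }
    assert (C1 := Hclose (S n) ltac:(lia)). apply Rabs_le_between in C1.
    eapply Rle_trans; [apply (ln_lip (98 * (K + 1))); nra|].
    assert (T1 := Cmod_le_sub (w (S n)) p). unfold p in T1 at 2. replace (w (S n) - (w (S n) - k))%C with k in T1 by ring.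
    assert (T2 := Cmod_sub_le (w (S n)) k). fold K p in T1, T2.
    assert (Rabs (Cmod p - (1 + Fn (S n) t)) <= K + 3) by (apply Rabs_le; lra).
    apply Rmult_le_reg_r with (98 * (K + 1)). lra. unfold Rdiv at 1. rewrite Rmult_assoc, Rinv_l by lra. lra. }
  assert (R2 : Rabs (Im (w n) - 2 * PI * IZR (a n)) <= 1 / 4).
  { replace (Im (w n) - 2 * PI * IZR (a n)) with (Im (Clog p)).
    2:{ rewrite Eq, im_plus. unfold twopii. simpl. ring. }
    assert (L := Clog_lip (Re p) p (Re p) ltac:(lra) ltac:(lra) ltac:(rewrite re_RtoC; lra)).
    assert (I0 : Im (Clog (RtoC (Re p))) = 0). { simpl. unfold Rdiv. rewrite Rmult_0_l. apply atan_0. }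
    assert (I1 := im_le_Cmod (Clog p - Clog (RtoC (Re p)))%C). rewrite im_minus, I0, Rminus_0_r in I1.
    assert (D : Cmod (p - RtoC (Re p))%C <= Rabs (Im p)).
    { eapply Rle_trans; [apply Cmod_le_ReIm|]. rewrite re_minus, im_minus, re_RtoC. simpl (Im (RtoC _)).
      replace (Re p - Re p) with 0 by ring. rewrite Rabs_R0, Rminus_0_r. lra. }
    assert (D2 : Rabs (Im p) <= x (S n) / 20 + K).
    { unfold p. rewrite im_minus. eapply Rle_trans; [apply (Rabs_minus_le _ _ (x (S n) / 20) K)|lra]; [|apply im_le_Cmod].
      specialize (Th (S n) ltac:(lia)). fold (x (S n)) in Th. assert (P := Rabs_pos (Im (w (S n)))). nra. }
    eapply Rle_trans; [exact I1|]. eapply Rle_trans; [exact L|].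
    apply Rmult_le_reg_r with (Re p). lra. unfold Rdiv at 1. rewrite Rmult_assoc, Rinv_l by lra. lra. }
  lra.
Qed.

(** The entries are of order at most the square root of [F^n(t)]. *)
Lemma wthin_dominates a t N w : 0 < t -> wthin N w ->
  (forall n, (N <= n)%nat -> Cmod (w n - base a t n)%C <= 1) -> dominates a t.
Proof.
  intros Ht Th Hb. split; auto. apply is_lim_seq_0. intros e He.
  destruct (Fn_unbounded t (Rmax 1 (4 / (e * e))) Ht) as [N1 HN1]. exists (N + N1)%nat. intros n Hn.
  specialize (HN1 n ltac:(lia)). specialize (Hb n ltac:(lia)). specialize (Th n ltac:(lia)). fold (Fn n t).
  assert (M1 := Rmax_l 1 (4 / (e * e))). assert (M2 := Rmax_r 1 (4 / (e * e))).
  set (f := Fn n t) in *. set (y := Rabs (IZR (a n))).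
  assert (Hee : 0 < e * e) by nra.
  assert (Hf2 : 4 < f * (e * e)).
  { assert (L : 4 / (e * e) < f) by lra. apply Rmult_lt_compat_r with (r := e * e) in L; auto.
    replace (4 / (e * e) * (e * e)) with 4 in L by (field; lra). lra. }
  assert (R := re_le_Cmod (w n - base a t n)%C). assert (I := im_le_Cmod (w n - base a t n)%C).
  rewrite re_minus in R. rewrite im_minus in I. change (Re (base a t n)) with f in R.
  change (Im (base a t n)) with (2 * PI * IZR (a n)) in I.
  assert (Hy : 2 * PI * y <= Rabs (Im (w n)) + 1).
  { unfold y. assert (P := PI_pos). rewrite <- (Rabs_pos_eq (2 * PI)) at 1 by lra. rewrite <- Rabs_mult.
    assert (T := Rabs_triang_inv (2 * PI * IZR (a n)) (Im (w n))). rewrite Rabs_minus_sym in T. lra. }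
  apply Rabs_le_between in R. assert (Py : 0 <= y) by apply Rabs_pos. assert (PI3 := PI_gt_3).
  assert (Pi := Rabs_pos (Im (w n))).
  assert (Hyf : y ^ 2 <= f).
  { assert (6 * y <= Rabs (Im (w n)) + 1) by nra. assert (36 * y ^ 2 <= (Rabs (Im (w n)) + 1) ^ 2) by nra. nra. }
  unfold Rdiv. rewrite Rabs_mult, Rabs_inv, (Rabs_pos_eq f) by lra. fold y.
  apply Rmult_lt_reg_r with f. lra. rewrite Rmult_assoc, Rinv_l, Rmult_1_r by lra.
  assert (Hef : 4 * f < (e * f) ^ 2) by (replace ((e * f) ^ 2) with (f * (f * (e * e))) by ring; nra).
  assert (Pef : 0 < e * f) by nra.
  apply Rnot_le_lt. intro Ly. assert ((e * f) ^ 2 <= y ^ 2) by (apply pow_incr; lra). lra.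
Qed.

Lemma base_thin s b A t N z : Dom s b A -> b < t -> (forall n, (N <= n)%nat -> Cmod (z n - base s t n)%C <= 1) ->
  exists N', thin N' z.
Proof.
  intros (Hb & HA & H) Ht Hz. destruct (Fn_pow4 b t Hb Ht) as (X0 & HX0 & HX).
  destruct (Fn_unbounded t X0 ltac:(lra)) as [N1 HN1]. destruct (Fn_unbounded b (40 * (A + 1)) Hb) as [N2 HN2].
  exists (N + N1 + N2)%nat. intros n Hn. specialize (HN1 n ltac:(lia)). specialize (HN2 n ltac:(lia)).
  specialize (HX n t ltac:(lra) ltac:(lra)). specialize (H n). specialize (Hz n ltac:(lia)).
  assert (R := re_le_Cmod (z n - base s t n)%C). assert (I := im_le_Cmod (z n - base s t n)%C).
  rewrite re_minus in R. rewrite im_minus in I. change (Re (base s t n)) with (Fn n t) in R.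
  change (Im (base s t n)) with (2 * PI * IZR (s n)) in I.
  set (x := Fn n b) in *. assert (P := PI_pos). assert (P4 := PI_le_4).
  assert (Hy : Rabs (Im (z n)) <= 8 * (A * x) + 1).
  { assert (T := Rabs_triang_inv (Im (z n)) (2 * PI * IZR (s n))).
    assert (Rabs (2 * PI * IZR (s n)) <= 8 * (A * x)).
    { rewrite Rabs_mult, (Rabs_pos_eq (2 * PI)) by lra. apply Rmult_le_compat; try lra. apply Rabs_pos. } lra. }
  apply Rabs_le_between in R. assert (Py := Rabs_pos (Im (z n))).
  assert (Hq : Rabs (Im (z n)) + 4 <= 9 * ((A + 1) * x)) by nra.
  assert (Hq2 : (Rabs (Im (z n)) + 4) ^ 2 <= (9 * ((A + 1) * x)) ^ 2) by (apply pow_incr; lra).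
  assert (16 * (9 * ((A + 1) * x)) ^ 2 + 1 <= x ^ 4).
  { replace (x ^ 4) with (x ^ 2 * (x * x)) by ring. replace (16 * (9 * ((A + 1) * x)) ^ 2) with (x ^ 2 * (1296 * ((A + 1) * (A + 1)))) by ring.
    assert (1600 * ((A + 1) * (A + 1)) <= x * x) by nra. assert (1 <= x ^ 2) by nra. nra. }
  lra.
Qed.

Lemma tail_potential k c N a : Tail k c -> (forall v, 0 <= v -> far k N a (fun n => Defs.iter (expmap k) n (c v))) ->
  thin N (fun n => Defs.iter (expmap k) n (c 0)) ->
  exists tau : R -> R,
    (forall v, 0 <= v -> 0 < tau v /\ dominates a (tau v) /\
       forall n, (N <= n)%nat -> Cmod (Defs.iter (expmap k) n (c v) - base a (tau v) n)%C <= 1) /\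
    (forall u v, 0 <= u -> u < v -> tau u < tau v) /\
    (forall v, 0 <= v -> forall e, 0 < e -> exists d, 0 < d /\ forall u, 0 <= u -> Rabs (u - v) < d -> Rabs (tau u - tau v) < e).
Proof.
  intros HT HF Th. set (z := fun n v => Defs.iter (expmap k) n (c v)).
  assert (HO := tail_order k c N a HT HF).
  assert (Hre : forall v n, 0 <= v -> (N <= n)%nat -> Re (z n 0) - 4 <= Re (z n v)).
  { intros v n Hv Hn. destruct (Req_dec v 0) as [->|Ne]. lra. apply Rnot_lt_le. intro L.
    destruct (HO 0 v ltac:(lra) ltac:(lra)) as (m & Hm & B).
    apply (cross_both k N a _ _ m n (HF 0 ltac:(lra)) (HF v Hv) Hm Hn B). unfold z in L. lra. }
  assert (HW : forall v, 0 <= v -> wthin N (fun n => z n v)).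
  { intros v Hv n Hn. specialize (Th n Hn). specialize (Hre v n Hv Hn).
    assert (I := far_im2 k N a _ _ n (HF v Hv) (HF 0 ltac:(lra)) Hn). simpl in I. fold (z n v) (z n 0) in I, Th.
    destruct (HF v Hv n Hn) as (_ & _ & R). fold (z n v) in R.
    assert (I2 : Rabs (Im (z n v)) <= Rabs (Im (z n 0)) + 4).
    { assert (T := Rabs_triang_inv (Im (z n v)) (Im (z n 0))). lra. }
    assert (P := Rabs_pos (Im (z n v))). assert (Pk : 1 <= (Cmod k + 1) ^ 2) by (generalize (Cmod_ge_0 k); nra).
    change (8 * Rabs (Im (z n v)) ^ 2 <= Re (z n v)).
    assert (I3 : Rabs (Im (z n v)) ^ 2 <= (Rabs (Im (z n 0)) + 4) ^ 2) by (apply pow_incr; lra). 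
    change (16 * (Rabs (Im (z n 0)) + 4) ^ 2 <= Re (z n 0)) in Th. change (100 * (Cmod k + 1) ^ 2 < Re (z n v)) in R. lra. }
  assert (Hex : forall v, exists t, 0 <= v -> 0 < t /\ forall n, (N <= n)%nat -> Cmod (z n v - base a t n)%C <= 1).
  { intro v. destruct (Rle_dec 0 v) as [Hv|Hv]; [|exists 0; lra].
    destruct (potential_exists k N a (fun n => z n v) (HF v Hv) (HW v Hv)) as (t & Ht & B). exists t. auto. }
  apply functional_choice in Hex. destruct Hex as [tau Htau]. exists tau.
  assert (Hcl : forall v n, 0 <= v -> (N <= n)%nat -> Rabs (Re (z n v) - Fn n (tau v)) <= 1).
  { intros v n Hv Hn. destruct (Htau v Hv) as [_ B]. eapply Rle_trans; [|apply (B n Hn)].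
    change (Fn n (tau v)) with (Re (base a (tau v) n)). rewrite <- re_minus. apply re_le_Cmod. }
  split; [|split].
  - intros v Hv. destruct (Htau v Hv) as [A B]. split; auto. split; auto.
    apply (wthin_dominates a (tau v) N (fun n => z n v)); auto.
  - intros u v Hu Huv. apply Rnot_le_lt. intro L. destruct (HO u v Hu Huv) as (n & Hn & B).
    assert (B1 := Hcl u n Hu Hn). assert (B2 := Hcl v n ltac:(lra) Hn). apply Rabs_le_between in B1. apply Rabs_le_between in B2.
    assert (M := Fn_mono n _ _ L). fold (z n u) (z n v) in B. lra.
  - intros v Hv e He. destruct (Htau v Hv) as [Ht _]. set (e' := Rmin e (tau v / 2)).
    assert (He' : 0 < e') by (apply Rmin_glb_lt; lra). assert (E1 : e' <= e) by apply Rmin_l. assert (E2 : e' <= tau v / 2) by apply Rmin_r.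
    (* Continuity is tested at one level where potentials [e'] apart are more than 4 apart: a
       displacement below 1 and two errors of 1 total less than that. *)
    destruct (Fn_gap (tau v) (tau v + e') 4 Ht ltac:(lra)) as [N1 HN1].
    destruct (Fn_gap (tau v - e') (tau v) 4 ltac:(lra) ltac:(lra)) as [N2 HN2].
    set (n := (N + N1 + N2)%nat). specialize (HN1 n ltac:(lia)). specialize (HN2 n ltac:(lia)).
    assert (Hz : forall m, ccont (from 0) (z m)).
    { destruct HT as [H1 _]. induction m. exact H1. apply (ccont_f _ k (z m)). auto. }
    destruct (Hz n v Hv 1 Rlt_0_1) as (d & Hd & A). exists d. split; auto. intros u Hu Huv.
    specialize (A u Hu Huv). assert (R := re_le_Cmod (z n u - z n v)%C). rewrite re_minus in R.
    assert (B1 := Hcl u n Hu ltac:(lia)). assert (B2 := Hcl v n Hv ltac:(lia)).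
    apply Rabs_le_between in B1. apply Rabs_le_between in B2. apply Rabs_le_between in R.
    apply Rlt_le_trans with e'; auto. apply Rabs_lt_between. split; apply Rnot_le_lt; intro L.
    + assert (M := Fn_mono n (tau u) (tau v - e') ltac:(lra)). lra.
    + assert (M := Fn_mono n (tau v + e') (tau u) ltac:(lra)). lra.
Qed.

(** Inverse of [F^n] on positive numbers; it converts potentials measured at level [n] to level
    0. *)
Definition Finv (n : nat) (x : R) : R := Nat.iter n (fun y => ln (1 + y)) x.

Lemma Finv_pos n x : 0 < x -> 0 < Finv n x.
Proof.
  intro H. induction n. exact H. change (Finv (S n) x) with (ln (1 + Finv n x)). rewrite <- ln_1. apply ln_increasing; lra.
Qed.

Lemma Fn_S' n x : Fn (S n) x = Fn n (exp x - 1).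
Proof. replace (S n) with (n + 1)%nat by lia. rewrite Fn_add. reflexivity. Qed.

Lemma Fn_Finv n x : 0 < x -> Fn n (Finv n x) = x.
Proof.
  intro H. induction n. reflexivity. rewrite Fn_S'. change (Finv (S n) x) with (ln (1 + Finv n x)).
  assert (P := Finv_pos n x H). rewrite exp_ln by lra. replace (1 + Finv n x - 1) with (Finv n x) by ring. auto.
Qed.

Lemma Finv_lip n x y : 0 < x -> 0 < y -> Rabs (Finv n x - Finv n y) <= Rabs (x - y).
Proof.
  intros Hx Hy. induction n. simpl. unfold Finv; simpl; lra.
  change (Finv (S n) x) with (ln (1 + Finv n x)). change (Finv (S n) y) with (ln (1 + Finv n y)).
  assert (P := Finv_pos n x Hx). assert (Q := Finv_pos n y Hy).
  eapply Rle_trans; [apply (ln_lip 1); lra|]. replace (1 + Finv n x - (1 + Finv n y)) with (Finv n x - Finv n y) by ring. lra.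
Qed.

Lemma base_level s p t j : 0 < t -> base s (Finv p t) (j + p) = base (fun i => s (i + p)%nat) t j.
Proof. intro H. unfold base. now rewrite Fn_add, Fn_Finv. Qed.

(* Far up the two orbits agree, because orbits close to [base] are unique; one
   level down they differ by periods of [exp], which are constant by continuity. *)
Lemma tail_follow L k s b A a Gam p c (tau : R -> R) v0 : Dom s b A -> b < a -> Ray L k s a Gam -> (L <= p)%nat ->
  ccont (from 0) c -> (forall v, 0 <= v -> a <= tau v) ->
  (forall v, 0 <= v -> forall e, 0 < e -> exists d, 0 < d /\ forall u, 0 <= u -> Rabs (u - v) < d -> Rabs (tau u - tau v) < e) ->
  (exists J, forall j v, (J <= j)%nat -> 0 <= v -> Cmod (Defs.iter (expmap k) j (c v) - base s (tau v) (j + p))%C <= 1) ->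
  0 <= v0 -> (forall j, (1 <= j)%nat -> Defs.iter (expmap k) j (c v0) = Gam (j + p)%nat (tau v0)) ->
  forall v, 0 <= v -> (c v - Gam p (tau v) = c v0 - Gam p (tau v0))%C.
Proof.
  intros HD Hb HR HL Hc Htau Hct (J & HJ) Hv0 Heq.
  assert (HR' := HR). destruct HR' as (H1 & H2 & (M & H3) & H4).
  destruct (St_of_Dom s b A a (Cmod k) HD Hb) as [N0 HS].
  assert (Hz : forall m, ccont (from 0) (fun v => Defs.iter (expmap k) m (c v))).
  { induction m. exact Hc. apply (ccont_f _ k (fun v => Defs.iter (expmap k) m (c v))). auto. }
  assert (Hg : forall m, (L <= m)%nat -> ccont (from 0) (fun v => Gam m (tau v))).
  { intros m Hm. apply (ccont_reparam _ (from a)); auto. }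
  assert (Q : forall j, (1 <= j)%nat -> forall v, 0 <= v -> Defs.iter (expmap k) j (c v) = Gam (j + p)%nat (tau v)).
  { apply (desc_ind (fun j => forall v, 0 <= v -> Defs.iter (expmap k) j (c v) = Gam (j + p)%nat (tau v)) 1 (N0 + M + J)%nat).
    - intros j Hj _ v Hv.
      assert (E := orbit_unique s (Cmod k) (N0 + M + J + p) (tau v) k
        (fun m => Defs.iter (expmap k) (m - p) (c v)) (fun m => Gam m (tau v)) (Cmod_ge_0 k)).
      specialize (E ltac:(apply (St_N s _ N0); [eapply St_mono; [exact HS|auto]|lia]) (Rle_refl _)).
      replace (Defs.iter (expmap k) j (c v)) with (Defs.iter (expmap k) (j + p - p) (c v)) by (f_equal; lia).
      apply E; [| | | |lia].
      + intros n Hn. replace (S n - p)%nat with (S (n - p)) by lia. reflexivity.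
      + intros n Hn. apply H2; auto. lia.
      + intros n Hn. specialize (HJ (n - p)%nat v ltac:(lia) Hv). replace (n - p + p)%nat with n in HJ by lia. auto.
      + intros n Hn. apply H3; auto; lia.
    - intros j Hj IH v Hv.
      assert (E : forall x, from 0 x -> Cexp (Defs.iter (expmap k) j (c x)) = Cexp (Gam (j + p)%nat (tau x))).
      { intros x Hx. specialize (IH x Hx). rewrite iter_S in IH. change (S j + p)%nat with (S (j + p)) in IH.
        rewrite <- H2 in IH by (auto; lia). unfold expmap at 1 3 in IH.
        replace (Cexp (Defs.iter (expmap k) j (c x))) with (Cexp (Defs.iter (expmap k) j (c x)) + k - k)%C by ring.
        rewrite IH. ring. }
      assert (LU := lift_unique (from 0) _ _ (from_convex 0) (Hz j) (Hg (j + p)%nat ltac:(lia)) E v v0 Hv Hv0). simpl in LU.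
      rewrite (Heq j Hj) in LU. apply Csub_eq. rewrite LU. ring. }
  intros v Hv.
  assert (E : forall x, from 0 x -> Cexp (c x) = Cexp (Gam p (tau x))).
  { intros x Hx. assert (IH := Q 1%nat (Nat.le_refl _) x Hx). change (1 + p)%nat with (S p) in IH.
    change (Defs.iter (expmap k) 1 (c x)) with (expmap k (c x)) in IH.
    rewrite <- H2 in IH by auto. unfold expmap in IH.
    replace (Cexp (c x)) with (Cexp (c x) + k - k)%C by ring. rewrite IH. ring. }
  apply (lift_unique (from 0) c (fun v => Gam p (tau v)) (from_convex 0) Hc (Hg p HL) E v v0 Hv Hv0).
Qed.

(** * A priori bound on the parameter *)

(** This is how the fourth power from [Fn_pow4] absorbs constants: [B u] is at most [u^4] or [B^2],
    according to which of the two factors is larger. *)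
Lemma quart (u X B : R) : 0 <= u -> u ^ 4 <= X -> 1 <= B -> B ^ 2 <= X -> B * u <= X.
Proof.
  intros Hu H HB HBX. apply Rnot_lt_le. intro L. destruct (Rle_dec B u) as [Q|Q].
  - assert (u ^ 4 = u * u ^ 3) by ring. assert (B * 1 <= u * u ^ 2).
    { apply Rmult_le_compat; try lra. nra. } assert (u ^ 3 = u * u ^ 2) by ring. nra.
  - nra.
Qed.

(** The gained factor [2^i] pays for the apertures of order [(1/2)^i] demanded by [slit_exists]. *)
Lemma Fn_scaled (C Y y : R) : 4 <= C -> 0 < y -> C * (y + 1) <= Y -> forall i, C * 2 ^ i * (Fn i y + 1) <= Fn i Y.
Proof.
  intros HC Hy H. induction i. { simpl pow. unfold Fn; simpl. lra. }
  rewrite !Fn_S. set (v := Fn i y) in *. assert (Hv : 0 < v) by (apply Fn_pos; auto).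
  assert (H2 : 1 <= 2 ^ i) by (apply pow_R1_Rle; lra). set (D := C * 2 ^ i) in *.
  assert (HD : 4 <= D) by (unfold D; nra).
  assert (E : exp (v + D) <= exp (Fn i Y)) by (apply exp_mono; nra).
  rewrite exp_plus in E. assert (Q := exp_quad D ltac:(lra)). assert (P := exp_ineq1 v ltac:(lra)).
  replace (C * 2 ^ S i) with (2 * D) by (unfold D; simpl; ring).
  assert (1 + 2 * D <= exp D) by nra. nra.
Qed.

(* [w + |w|] bisects the angle of [w], so this is a logarithm off the negative axis. *)
Definition Plog (w : C) : C := (Clog (w + Cmod w) + Clog (w + Cmod w) - Clog (2 * (Cmod w + Re w))%R)%C.

Definition off_slit (w : C) : Prop := 0 < Cmod w + Re w.

Lemma off_slit_iff (w : C) : (forall y, 0 <= y -> w <> RtoC (- y)) -> off_slit w.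
Proof.
  intro H. unfold off_slit. assert (R := re_le_Cmod w). apply Rabs_le_between in R.
  destruct (Req_dec (Cmod w + Re w) 0) as [E|E]; [|lra]. exfalso.
  apply (H (Cmod w)). apply Cmod_ge_0. assert (E2 := Cmod2_alt w). apply Cext; simpl; nra.
Qed.

Lemma Plog_exp w : off_slit w -> Cexp (Plog w) = w.
Proof.
  unfold off_slit. intro H. set (r := Cmod w) in *. unfold Plog. fold r.
  assert (Hv : 0 < Re (w + r)%C) by (rewrite re_plus, re_RtoC; lra).
  assert (Hs : 0 < Re (RtoC (2 * (r + Re w)))) by (rewrite re_RtoC; lra).
  rewrite Cexp_minus, Cexp_plus, !Cexp_Clog by auto.
  assert (E : ((w + r) * (w + r) = RtoC (2 * (r + Re w)) * w)%C).
  { assert (E2 := Cmod2_alt w). fold r in E2. destruct w as [x y]. simpl in *. apply Cext; simpl; nra. }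
  rewrite E. field. apply Cmod_pos_neq, Cmod_pos_re. auto.
Qed.

Lemma Plog_im w : off_slit w -> - PI < Im (Plog w) < PI.
Proof.
  intro H. unfold Plog. rewrite im_minus, im_plus. assert (I := im_Clog (w + Cmod w)%C).
  assert (I0 : Im (Clog (RtoC (2 * (Cmod w + Re w)))) = 0).
  { simpl. unfold Rdiv. rewrite Rmult_0_l. apply atan_0. }
  rewrite I0. lra.
Qed.

Lemma ccont_RtoC D (g : R -> R) : (forall x, D x -> forall e, 0 < e -> exists d, 0 < d /\ forall y, D y -> Rabs (y - x) < d -> Rabs (g y - g x) < e) ->
  ccont D (fun x => RtoC (g x)).
Proof.
  intros H x Dx e He. destruct (H x Dx e He) as (d & Hd & A). exists d. split; auto. intros y Dy Hy.
  rewrite <- RtoC_minus, Cmod_R. auto.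
Qed.

Lemma ccont_Cmod D c : ccont D c -> ccont D (fun x => RtoC (Cmod (c x))).
Proof.
  intro H. apply ccont_RtoC. intros x Dx e He. destruct (H x Dx e He) as (d & Hd & A). exists d. split; auto.
  intros y Dy Hy. specialize (A y Dy Hy). assert (T1 := Cmod_le_sub (c y) (c x)). assert (T2 := Cmod_le_sub (c x) (c y)).
  rewrite (Cmod_sub_sym (c x)) in T2. apply Rabs_lt_between. lra.
Qed.

Lemma ccont_Re D c : ccont D c -> ccont D (fun x => RtoC (Re (c x))).
Proof.
  intro H. apply ccont_RtoC. intros x Dx e He. destruct (H x Dx e He) as (d & Hd & A). exists d. split; auto.
  intros y Dy Hy. specialize (A y Dy Hy). rewrite <- re_minus. eapply Rle_lt_trans; [apply re_le_Cmod|auto].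
Qed.

Lemma ccont_Plog D c : ccont D c -> (forall x, D x -> off_slit (c x)) -> ccont D (fun x => Plog (c x)).
Proof.
  intros H Hs. unfold Plog.
  assert (H1 : ccont D (fun x => Clog (c x + Cmod (c x)))).
  { apply (ccont_comp D Clog (fun x => c x + Cmod (c x))%C). apply ccont_plus; auto using ccont_Cmod.
    intros x Dx. apply Ccont_Clog. rewrite re_plus, re_RtoC. specialize (Hs x Dx). unfold off_slit in Hs. lra. }
  apply ccont_minus. apply ccont_plus; auto.
  apply (ccont_comp D Clog (fun x => RtoC (2 * (Cmod (c x) + Re (c x))))).
  - apply (ccont_ext D (fun x => (RtoC (Cmod (c x)) + RtoC (Re (c x))) + (RtoC (Cmod (c x)) + RtoC (Re (c x))))%C).
    { intros x _. apply Cext; simpl; ring. }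
    assert (A := ccont_plus D _ _ (ccont_Cmod D c H) (ccont_Re D c H)). apply ccont_plus; exact A.
  - intros x Dx. apply Ccont_Clog. rewrite re_RtoC. specialize (Hs x Dx). unfold off_slit in Hs. lra.
Qed.

Lemma ccont_mult D c c' : ccont D c -> ccont D c' -> ccont D (fun x => c x * c' x)%C.
Proof.
  intros H H' x Dx e He. set (B := Cmod (c x) + 1). set (B' := Cmod (c' x) + 1).
  assert (P := Cmod_ge_0 (c x)). assert (P' := Cmod_ge_0 (c' x)).
  destruct (H x Dx (Rmin 1 (e / (2 * B')))) as (d & Hd & A). { apply Rmin_glb_lt; [lra|]. apply Rdiv_lt_0_compat; unfold B'; lra. }
  destruct (H' x Dx (e / (2 * B))) as (d' & Hd' & A'). { apply Rdiv_lt_0_compat; unfold B; lra. }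
  exists (Rmin d d'). split. now apply Rmin_glb_lt. intros y Dy Hy.
  assert (M1 := Rmin_l d d'). assert (M2 := Rmin_r d d'). specialize (A y Dy ltac:(lra)). specialize (A' y Dy ltac:(lra)).
  assert (M3 := Rmin_l 1 (e / (2 * B'))). assert (M4 := Rmin_r 1 (e / (2 * B'))).
  replace (c y * c' y - c x * c' x)%C with (c y * (c' y - c' x) + (c y - c x) * c' x)%C by ring.
  eapply Rle_lt_trans; [apply Cmod_triangle|]. rewrite !Cmod_mult.
  assert (T := Cmod_le_sub (c y) (c x)). assert (P2 := Cmod_ge_0 (c' y - c' x)%C). assert (P3 := Cmod_ge_0 (c y - c x)%C).
  assert (S1 : Cmod (c y) * Cmod (c' y - c' x)%C <= B * Cmod (c' y - c' x)%C) by (apply Rmult_le_compat_r; auto; unfold B; lra).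
  assert (S2 : B * Cmod (c' y - c' x)%C < e / 2).
  { assert (HB : 0 < B) by (unfold B; lra). apply Rmult_lt_compat_l with (r := B) in A'; auto.
    replace (B * (e / (2 * B))) with (e / 2) in A' by (field; lra). auto. }
  assert (S3 : Cmod (c y - c x)%C * Cmod (c' x) <= Cmod (c y - c x)%C * B') by (apply Rmult_le_compat_l; auto; unfold B'; lra).
  assert (S4 : Cmod (c y - c x)%C * B' <= e / 2).
  { assert (HB : 0 < B') by (unfold B'; lra). assert (A0 : Cmod (c y - c x)%C <= e / (2 * B')) by lra.
    apply Rmult_le_compat_r with (r := B') in A0; [|lra].
    replace (e / (2 * B') * B') with (e / 2) in A0 by (field; lra). auto. }
  lra.
Qed.

Lemma ccont_div D c c' : ccont D c -> ccont D c' -> (forall x, D x -> c' x <> 0%C) -> ccont D (fun x => c x / c' x)%C.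
Proof.
  intros H H' Hn. apply ccont_mult; auto. apply (ccont_comp D (fun z => / z)%C c'); auto.
  intros x Dx. apply Hol2_cont, Hol2_inv. auto.
Qed.

(* A curve avoiding the graph of [h] over the positive axis does not wind
   around 0: shear the graph to the axis, where the logarithm is explicit. *)
Lemma slit_winding (D : R -> Prop) (q : R -> C) (h : R -> R) :
  ccont D q -> (forall u v, Rabs (h u - h v) <= Rabs (u - v)) -> h 0 = 0 ->
  (forall x, D x -> 0 <= Re (q x) -> Im (q x) <> h (Re (q x))) ->
  exists l, ccont D l /\ (forall x, D x -> Cexp (l x) = q x) /\ (forall x, D x -> - PI <= Im (l x) <= 3 * PI).
Proof.
  intros Hq Hh H0 Hav.
  set (qs := fun x => (q x - Ci * RtoC (h (Re (q x))))%C).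
  assert (Rqs : forall x, Re (qs x) = Re (q x)). { intro x. unfold qs. destruct (q x). simpl. ring. }
  assert (Iqs : forall x, Im (qs x) = Im (q x) - h (Re (q x))). { intro x. unfold qs. destruct (q x). simpl. ring. }
  assert (Cqs : ccont D qs).
  { apply ccont_minus; auto. apply ccont_mult. apply ccont_const. apply ccont_RtoC.
    intros x Dx e He. destruct (Hq x Dx e He) as (d & Hd & A). exists d. split; auto. intros y Dy Hy.
    eapply Rle_lt_trans; [apply Hh|]. rewrite <- re_minus. eapply Rle_lt_trans; [apply re_le_Cmod|auto]. }
  assert (Hoff : forall x, D x -> off_slit (- qs x)%C).
  { intros x Dx. apply off_slit_iff. intros y Hy E.
    assert (E1 : qs x = RtoC y). { replace (qs x) with (- - qs x)%C by ring. rewrite E. apply Cext; simpl; ring. }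
    assert (E2 := Rqs x). assert (E3 := Iqs x). rewrite E1 in E2, E3. simpl in E2, E3.
    apply (Hav x Dx); lra. }
  assert (Hn : forall x, D x -> qs x <> 0%C).
  { intros x Dx E. specialize (Hoff x Dx). rewrite E in Hoff. unfold off_slit in Hoff.
    rewrite Cmod_opp, Cmod_0, re_opp in Hoff. simpl in Hoff. lra. }
  (* The shear preserves real parts, so a negative quotient forces real part 0; there the shear is
     the identity and the quotient is 1. *)
  assert (Hoff2 : forall x, D x -> off_slit (q x / qs x)%C).
  { intros x Dx. apply off_slit_iff. intros y Hy E.
    assert (E1 : q x = (RtoC (- y) * qs x)%C). { rewrite <- E. field. auto. }
    assert (E2 := f_equal Re E1). rewrite re_scal_l, Rqs in E2. assert (Z : Re (q x) = 0) by nra.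
    assert (E3 : qs x = q x). { apply Cext. apply Rqs. rewrite Iqs, Z, H0. ring. }
    rewrite E3 in E. replace (q x / q x)%C with (RtoC 1) in E by (field; rewrite <- E3; auto).
    apply RtoC_inj in E. lra. }
  assert (EPI : Cexp (0, PI) = (- (1))%C).
  { apply Cext; rewrite ?re_Cexp, ?im_Cexp; simpl; rewrite exp_0, ?cos_PI, ?sin_PI; ring. }
  assert (Cm : ccont D (fun x => - qs x)%C).
  { apply (ccont_ext D (fun x => 0 - qs x)%C). intros; ring. apply ccont_minus; auto. apply ccont_const. }
  exists (fun x => Plog (- qs x) + (0, PI) + Plog (q x / qs x))%C. split; [|split].
  - apply ccont_plus. apply ccont_plus. apply (ccont_Plog D (fun x => - qs x)%C); auto. apply ccont_const.
    apply (ccont_Plog D (fun x => q x / qs x)%C); auto. apply ccont_div; auto.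
  - intros x Dx. rewrite !Cexp_plus, EPI, !Plog_exp by auto. field. auto.
  - intros x Dx. rewrite !im_plus. assert (I1 := Plog_im _ (Hoff x Dx)). assert (I2 := Plog_im _ (Hoff2 x Dx)).
    change (Im (0, PI)) with PI. lra.
Qed.

(** [Gam m] and [l] differ by a constant period, pinned down at large potentials, where [Gam m] is
    within 1 of [base]. Thus any lift of bounded height bounds the height of the ray. *)
Lemma winding_bound N k s a Gam m l lo hi : Ray N k s a Gam -> (N <= m)%nat -> ccont (from a) l ->
  (forall tau, a <= tau -> Cexp (l tau) = (Gam (S m) tau - k)%C) -> (forall tau, a <= tau -> lo <= Im (l tau) <= hi) ->
  forall tau, a <= tau -> Rabs (Im (Gam m tau) - 2 * PI * IZR (s m)) <= hi - lo + 1.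
Proof.
  intros (H1 & H2 & _ & H4) Hm Hl El Hr tau Ht. destruct (H4 m Hm) as [T HT].
  set (x := Rmax a T). assert (Hx : a <= x) by apply Rmax_l.
  assert (B := HT x (Rmax_r a T) Hx). assert (I := im_le_Cmod (Gam m x - base s x m)%C).
  rewrite im_minus in I. change (Im (base s x m)) with (2 * PI * IZR (s m)) in I.
  assert (LU := lift_unique (from a) (Gam m) l (from_convex a) (H1 m Hm) Hl).
  assert (E : forall y, from a y -> Cexp (Gam m y) = Cexp (l y)).
  { intros y Hy. rewrite El by auto. rewrite <- (H2 m y Hm Hy). unfold expmap. ring. }
  specialize (LU E tau x Ht Hx). assert (LI := f_equal Im LU). rewrite !im_minus in LI.
  assert (R1 := Hr tau Ht). assert (R2 := Hr x Hx). apply Rabs_le_between in I. apply Rabs_le. lra.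
Qed.

Lemma winding_right N k s a Gam m : Ray N k s a Gam -> (N <= m)%nat ->
  (forall tau, a <= tau -> 0 < Re (Gam (S m) tau - k)%C) ->
  forall tau, a <= tau -> Rabs (Im (Gam m tau) - 2 * PI * IZR (s m)) <= PI + 1.
Proof.
  intros HR Hm Hp tau Ht. assert (HR' := HR). destruct HR' as (H1 & _).
  replace (PI + 1) with (PI / 2 - - (PI / 2) + 1) by field.
  apply (winding_bound N k s a Gam m (fun x => Clog (Gam (S m) x - k))); auto.
  - apply (ccont_comp _ Clog (fun x => Gam (S m) x - k)%C). apply ccont_minus. apply H1; lia. apply ccont_const.
    intros x Hx. apply Ccont_Clog. auto.
  - intros x Hx. apply Cexp_Clog. auto.
  - intros x Hx. assert (I := im_Clog (Gam (S m) x - k)%C). lra.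
Qed.

(** For a half plane with [k] on its boundary in any direction: [sg] rotates it to the right half
    plane and [th] undoes the rotation in the logarithm. *)
Lemma winding_sign N k s a Gam m (sg : C) (th : R) : Ray N k s a Gam -> (N <= m)%nat -> Cexp (0, th) = (/ sg)%C -> sg <> 0%C ->
  (forall tau, a <= tau -> 0 < Re (sg * (Gam (S m) tau - k))%C) ->
  forall tau, a <= tau -> Rabs (Im (Gam m tau) - 2 * PI * IZR (s m)) <= PI + 1.
Proof.
  intros HR Hm Hsg Hn Hp tau Ht. assert (HR' := HR). destruct HR' as (H1 & _).
  replace (PI + 1) with (PI / 2 + th - (- (PI / 2) + th) + 1) by field.
  apply (winding_bound N k s a Gam m (fun x => Clog (sg * (Gam (S m) x - k)) + (0, th))%C); auto.
  - apply ccont_plus; [|apply ccont_const]. apply (ccont_comp _ Clog (fun x => sg * (Gam (S m) x - k))%C).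
    apply ccont_mult. apply ccont_const. apply ccont_minus. apply H1; lia. apply ccont_const.
    intros x Hx. apply Ccont_Clog. auto.
  - intros x Hx. rewrite Cexp_plus, Hsg, Cexp_Clog by auto. field. auto.
  - intros x Hx. rewrite im_plus. change (Im (0, th)) with th. assert (I := im_Clog (sg * (Gam (S m) x - k))%C). lra.
Qed.

(** * Orbits of large escaping parameters, and slits *)

(** Otherwise the unit disc around [k] lies where [exp] has modulus at most 1, so [f] maps it into
    itself and the orbit of [k] is bounded. *)
Lemma not_left k : (forall M : R, exists n, M < Cmod (Defs.iter (expmap k) n k)) -> -2 <= Re k.
Proof.
  intro H. apply Rnot_lt_le. intro L.
  assert (A : forall n, Cmod (Defs.iter (expmap k) n k - k)%C <= 1).
  { induction n. change (Defs.iter (expmap k) 0 k) with k. rewrite Cmod_diag. lra.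
    rewrite iter_S. unfold expmap at 1. replace (Cexp (Defs.iter (expmap k) n k) + k - k)%C with (Cexp (Defs.iter (expmap k) n k)) by ring.
    rewrite Cmod_Cexp. set (z := Defs.iter (expmap k) n k) in *. assert (R := Cmod_re_lower z k). rewrite Cmod_sub_sym in R.
    rewrite <- exp_0. apply exp_mono. lra. }
  destruct (H (Cmod k + 1)) as [n Hn]. specialize (A n). assert (T := Cmod_le_sub (Defs.iter (expmap k) n k) k). lra.
Qed.

(** [exp 5] swallows the constant 50 of [Cexp_lip], so that derivatives along an orbit multiply to
    the exponential of the sum of [Re z + 5]. *)
Lemma expmap_lip k z w : Cmod (w - z)%C <= 1 -> Cmod (expmap k w - expmap k z)%C <= exp (Re z + 5) * Cmod (w - z)%C.
Proof.
  intro H. unfold expmap. replace (Cexp w + k - (Cexp z + k))%C with (Cexp z * (Cexp (w - z) - 1))%C.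
  2:{ rewrite Cexp_minus. field. apply Cexp_neq_0. }
  rewrite Cmod_mult, Cmod_Cexp, exp_plus. assert (L := Cexp_lip (w - z)%C H).
  assert (E5 : 50 <= exp 5). { replace 5 with (4 + 1) by ring. rewrite exp_plus. assert (A := exp_4_ge_16). assert (B := exp_quad 1). 
    assert (C := exp_quad (1/2)). assert (D : exp 1 = exp (1/2) * exp (1/2)) by (rewrite <- exp_plus; f_equal; field).
    assert (E2 : exp 4 = exp 1 * exp 1 * (exp 1 * exp 1)) by (rewrite <- !exp_plus; f_equal; ring). 
    assert (E1 : 12 / 5 <= exp 1) by (rewrite D; nra).
    assert (E3 : 5 <= exp 1 * exp 1) by nra. rewrite E2. nra. }
  rewrite Rmult_assoc. apply Rmult_le_compat_l. left; apply exp_pos.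
  assert (P := Cmod_ge_0 (w - z)%C). nra.
Qed.

(* If [f^l k] lies far to the left, then [f^(l+1)] maps a small disc around [k] into itself. *)
Lemma not_far_left k l (z : nat -> C) : (forall n, z n = Defs.iter (expmap k) n k) ->
  (forall M : R, exists N, forall n, (N <= n)%nat -> M < Cmod (z n)) ->
  (forall i, (i < l)%nat -> 0 <= Re (z i)) ->
  ~ Re (z l) + 1 <= - sum_f_R0 (fun i => Re (z i) + 5) l + (Re (z l) + 5).
Proof.
  intros Hz Hesc Hpos HL.
  set (Sm := fun i => sum_f_R0 (fun i => Re (z i) + 5) i - (Re (z i) + 5)).
  assert (HS0 : Sm O = 0) by (unfold Sm; simpl; ring).
  assert (HSS : forall i, Sm (S i) = Sm i + (Re (z i) + 5)) by (intro i; unfold Sm; simpl; ring).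
  (* [exp (Sm l)] bounds the expansion of [f^l], so the disc of radius [d] is sent into a unit disc
     around [z l]; one more exponential at this far left place shrinks it back to radius [d] around
     [k]. *)
  set (d := exp (- Sm l)). assert (Hd : 0 < d) by apply exp_pos.
  assert (Hmono : forall i, (i <= l)%nat -> Sm i <= Sm l).
  { intros i Hi. assert (forall j, (i + j <= l)%nat -> Sm i <= Sm (i + j)%nat).
    { induction j; intro Hj. rewrite Nat.add_0_r. lra. rewrite Nat.add_succ_r, HSS.
      assert (A := Hpos (i + j)%nat ltac:(lia)). specialize (IHj ltac:(lia)). lra. }
    replace l with (i + (l - i))%nat by lia. apply H. lia. }
  assert (Hstep : forall w, Cmod (w - k)%C <= d -> Cmod (Defs.iter (expmap k) (S l) w - k)%C <= d).
  { intros w Hw.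
    assert (A : forall i, (i <= l)%nat -> Cmod (Defs.iter (expmap k) i w - z i)%C <= exp (Sm i) * d).
    { induction i; intro Hi. rewrite HS0, exp_0, (Hz O). change (Cmod (w - k)%C <= 1 * d). lra.
      specialize (IHi ltac:(lia)).
      assert (B : exp (Sm i) * d <= 1). { unfold d. rewrite <- exp_plus, <- exp_0. apply exp_mono. specialize (Hmono i ltac:(lia)). lra. }
      rewrite iter_S, (Hz (S i)), iter_S, <- (Hz i). eapply Rle_trans; [apply expmap_lip; lra|].
      rewrite HSS, (Rplus_comm (Sm i)), (exp_plus (Re (z i) + 5)), Rmult_assoc. apply Rmult_le_compat_l; auto. left; apply exp_pos. }
    specialize (A l (Nat.le_refl l)).
    assert (B : exp (Sm l) * d = 1). { unfold d. rewrite <- exp_plus, <- exp_0. f_equal. ring. }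
    rewrite iter_S. unfold expmap at 1. replace (Cexp (Defs.iter (expmap k) l w) + k - k)%C with (Cexp (Defs.iter (expmap k) l w)) by ring.
    rewrite Cmod_Cexp. unfold d. apply exp_mono. assert (R := Cmod_re_lower (Defs.iter (expmap k) l w) (z l)).
    rewrite Cmod_sub_sym in R. unfold Sm. lra. }
  assert (Hall : forall j, Cmod (Defs.iter (expmap k) (j * S l) k - k)%C <= d).
  { induction j. change (Defs.iter (expmap k) (0 * S l) k) with k. rewrite Cmod_diag. lra.
    change (S j * S l)%nat with (S l + j * S l)%nat. rewrite iter_add. apply Hstep. auto. }
  destruct (Hesc (Cmod k + d)) as [N HN]. specialize (HN (N * S l)%nat ltac:(nia)). specialize (Hall N).
  rewrite <- Hz in Hall. assert (T := Cmod_le_sub (z (N * S l)%nat) k). lra.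
Qed.

(* From each of its points the curve stays in a cone around the positive direction;
   in particular it is a Lipschitz graph. *)
Definition cone (a : R) (r : R -> C) : Prop :=
  (forall x y, 0 <= x -> x < y -> 0 < Re (r y - r x)%C /\ Re (r y - r x)%C <= y - x /\
     Rabs (Im (r y - r x)%C) <= a * Re (r y - r x)%C) /\
  (forall M, exists x, 0 <= x /\ M < Re (r x)).

Lemma atan_le u : Rabs (atan u) <= Rabs u.
Proof.
  assert (A := atan_quot_lip 1 (1, u) (1, 0) Rlt_0_1). simpl Re in A. simpl Im in A.
  specialize (A ltac:(lra) ltac:(lra)). unfold Rdiv in A. rewrite Rinv_1, !Rmult_1_r, atan_0, Rminus_0_r in A.
  eapply Rle_trans; [exact A|]. eapply Rle_trans; [apply Cmod_le_ReIm|].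
  rewrite re_minus, im_minus. simpl. replace (1 - 1) with 0 by ring. rewrite Rabs_R0, Rminus_0_r. lra.
Qed.

(** Division by [p] turns the displacement [d] by the argument of [p], whose slope is at most [b];
    the second [b] pays for the quadratic error, as [a + b <= (a + 2 b) (1 - a b)]. The logarithm
    then does not increase the slope. *)
Lemma cone_log (a b : R) (d p : C) : 0 <= a -> a <= 1 / 16 -> 0 <= b -> b <= 1 / 16 -> 2 <= Re p ->
  0 < Re d -> Rabs (Im d) <= a * Re d -> Rabs (Im p) <= b * Re p ->
  let L := Clog (1 + d / p) in 0 < Re L /\ Re L <= Re d /\ Rabs (Im L) <= (a + 2 * b) * Re L /\ 0 < Re (1 + d / p)%C.
Proof.
  intros Ha Ha1 Hb Hb1 Hp Hd HId HIp L.
  assert (Hpn : p <> 0%C) by (apply Cmod_pos_neq, Cmod_pos_re; lra).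
  set (c := (d / p)%C). set (dr := Re d) in *. set (di := Im d) in *. set (pr := Re p) in *. set (pi := Im p) in *.
  set (n := pr ^ 2 + pi ^ 2). assert (Hn : 0 < n) by (unfold n; nra).
  assert (Hrc : Re c = (dr * pr + di * pi) / n).
  { unfold c, dr, di, pr, pi, n, pr, pi. destruct d, p. unfold Cdiv, Cinv. simpl. field. unfold n, pr, pi in Hn. simpl in Hn. lra. }
  assert (Hic : Im c = (di * pr - dr * pi) / n).
  { unfold c, dr, di, pr, pi, n, pr, pi. destruct d, p. unfold Cdiv, Cinv. simpl. field. unfold n, pr, pi in Hn. simpl in Hn. lra. }
  apply Rabs_le_between in HId. apply Rabs_le_between in HIp.
  assert (Hdp : 0 < dr * pr) by nra.
  assert (H1 : - (a * b * (dr * pr)) <= di * pi).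
  { assert (Rabs (di * pi) <= (a * dr) * (b * pr)) by (apply Rabs_mul_le; apply Rabs_le; lra). apply Rabs_le_between in H. nra. }
  assert (H2 : Rabs (di * pr - dr * pi) <= (a + b) * (dr * pr)).
  { apply Rabs_le. split; nra. }
  assert (Hrc0 : (1 - a * b) * (dr * pr) / n <= Re c).
  { rewrite Hrc. apply Rmult_le_compat_r. left; now apply Rinv_0_lt_compat. lra. }
  assert (Hq : 0 < dr * pr / n) by (apply Rdiv_lt_0_compat; auto).
  assert (Hrcp : 0 < Re c). { assert (0 < 1 - a * b) by nra. replace ((1 - a * b) * (dr * pr) / n) with ((1 - a * b) * (dr * pr / n)) in Hrc0 by (field; lra).
    assert (0 < (1 - a * b) * (dr * pr / n)) by (apply Rmult_lt_0_compat; auto). lra. }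
  assert (Hicr : Rabs (Im c) <= (a + 2 * b) * Re c).
  { rewrite Hic. unfold Rdiv at 1. rewrite Rabs_mult, (Rabs_pos_eq (/ n)) by (left; now apply Rinv_0_lt_compat).
    apply Rle_trans with ((a + b) * (dr * pr / n)).
    - unfold Rdiv. rewrite <- Rmult_assoc. apply Rmult_le_compat_r; auto. left; now apply Rinv_0_lt_compat.
    - apply Rle_trans with ((a + 2 * b) * ((1 - a * b) * (dr * pr) / n)); [|apply Rmult_le_compat_l; lra].
      replace ((1 - a * b) * (dr * pr) / n) with ((1 - a * b) * (dr * pr / n)) by (field; lra).
      set (Q := dr * pr / n) in *. replace ((a + 2 * b) * ((1 - a * b) * Q)) with ((a + 2 * b) * (1 - a * b) * Q) by ring. apply Rmult_le_compat_r; [lra|].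
      assert (0 <= b * (1 - a * a - 2 * (a * b))) by (apply Rmult_le_pos; nra). lra. }
  assert (Hre1 : 0 < Re (1 + c)%C). { rewrite re_plus, re_RtoC. lra. }
  assert (HRL : Re L = ln (Cmod (1 + c)%C)) by reflexivity.
  (* [ln u >= 1 - 1/u] yields the denominator [1 + Re c] that also occurs in the argument, so the
     slopes compare directly. *)
  assert (Hge : Re c / (1 + Re c) <= Re L).
  { rewrite HRL. assert (G := re_Cmod (1 + c)%C). rewrite re_plus in G. simpl (Re (RtoC 1)) in G.
    assert (Q := ln_le_sub 1 (Cmod (1 + c)%C) ltac:(lra) ltac:(lra)). rewrite ln_1 in Q.
    apply Rle_trans with (- ((1 - Cmod (1 + c)%C) / Cmod (1 + c)%C)); [|lra].
    replace (- ((1 - Cmod (1 + c)%C) / Cmod (1 + c)%C)) with (1 - / Cmod (1 + c)%C) by (field; lra).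
    replace (Re c / (1 + Re c)) with (1 - / (1 + Re c)) by (field; lra).
    assert (/ Cmod (1 + c)%C <= / (1 + Re c)) by (apply Rinv_le_contravar; lra). lra. }
  assert (Hg0 : 0 < Re c / (1 + Re c)) by (apply Rdiv_lt_0_compat; lra).
  split; [lra|split; [|split; [|exact Hre1]]].
  - rewrite HRL. assert (T := Cmod_triangle 1 c). rewrite Cmod_1 in T.
    assert (G := re_Cmod (1 + c)%C). rewrite re_plus in G. simpl (Re (RtoC 1)) in G.
    assert (Q := ln_le_sub (Cmod (1 + c)%C) 1 ltac:(lra) ltac:(lra)). rewrite ln_1 in Q.
    assert (Hc : Cmod c <= dr).
    { unfold c. rewrite Cmod_div by auto. assert (P1 := re_Cmod p). fold pr in P1.
      assert (P2 : Cmod d <= dr + a * dr). { eapply Rle_trans; [apply Cmod_le_ReIm|]. fold dr di. rewrite (Rabs_pos_eq dr) by lra.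
        assert (Rabs di <= a * dr) by (apply Rabs_le; lra). lra. }
      apply Rmult_le_reg_r with (Cmod p). lra. unfold Rdiv. rewrite Rmult_assoc, Rinv_l by lra. nra. }
    lra.
  - change (Im L) with (atan (Im (1 + c)%C / Re (1 + c)%C)). eapply Rle_trans; [apply atan_le|].
    rewrite im_plus, re_plus. simpl (Im (RtoC 1)). simpl (Re (RtoC 1)). rewrite Rplus_0_l.
    unfold Rdiv. rewrite Rabs_mult, (Rabs_pos_eq (/ (1 + Re c))) by (left; apply Rinv_0_lt_compat; lra).
    apply Rle_trans with ((a + 2 * b) * (Re c / (1 + Re c))).
    + unfold Rdiv. rewrite <- Rmult_assoc. apply Rmult_le_compat_r; auto. left; apply Rinv_0_lt_compat; lra.
    + apply Rmult_le_compat_l; lra.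
Qed.

(** Inverse branch of [f] along [r], starting at [z]. It is explicit because, divided by its initial
    value, the curve [r - k] stays in the right half plane. *)
Lemma cone_pullback (a b : R) (k z : C) (r : R -> C) : 0 <= a -> a <= 1 / 16 -> 0 <= b -> b <= 1 / 16 ->
  cone a r -> Cexp z = (r 0 - k)%C -> 2 <= Re (r 0 - k)%C ->
  (forall x, 0 <= x -> Rabs (Im (r x - k)%C) <= b * Re (r 0 - k)%C) ->
  exists r', r' 0 = z /\ cone (a + 2 * b) r' /\ (forall x, 0 <= x -> expmap k (r' x) = r x) /\
    (forall x, 0 <= x -> Rabs (Im (r' x) - Im z) <= 2).
Proof.
  intros Ha Ha1 Hb Hb1 [HC HU] Hz Hp Hi.
  set (p := fun x => (r x - k)%C).
  assert (Hre : forall x, 0 <= x -> Re (p 0) <= Re (p x)).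
  { intros x Hx. destruct (Req_dec x 0) as [->|Ne]. lra. destruct (HC 0 x ltac:(lra) ltac:(lra)) as (A & _).
    unfold p. rewrite !re_minus in *. lra. }
  assert (Hpn : forall x, 0 <= x -> p x <> 0%C).
  { intros x Hx. apply Cmod_pos_neq, Cmod_pos_re. specialize (Hre x Hx). unfold p in *. lra. }
  assert (HL : forall x y, 0 <= x -> x < y -> let L := Clog (p y / p x) in 0 < Re L /\ Re L <= Re (r y - r x)%C /\ Rabs (Im L) <= (a + 2 * b) * Re L /\ 0 < Re (p y / p x)%C).
  { intros x y Hx Hy. destruct (HC x y Hx Hy) as (A1 & A2 & A3). assert (R := Hre x Hx).
    replace (p y / p x)%C with (1 + (r y - r x) / p x)%C by (unfold p; field; apply (Hpn x Hx)).
    apply cone_log; auto. unfold p in *; lra.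
    eapply Rle_trans; [apply Hi; auto|]. apply Rmult_le_compat_l; auto. }
  assert (Hq0 : forall x, 0 <= x -> 0 < Re (p x / p 0)%C).
  { intros x Hx. destruct (Req_dec x 0) as [->|Ne].
    - replace (p 0 / p 0)%C with (RtoC 1) by (field; apply Hpn; lra). simpl; lra.
    - apply (HL 0 x); lra. }
  set (r' := fun x => (z + Clog (p x / p 0))%C).
  assert (Er : forall x, 0 <= x -> Cexp (r' x) = p x).
  { intros x Hx. unfold r'. rewrite Cexp_plus, Cexp_Clog, Hz by auto. fold (p 0). field. apply Hpn; lra. }
  (* Three principal arguments below [PI / 2] cannot add up to a period, so increments of [r'] are
     single principal logarithms and [cone_log] applies between any two points. *)
  assert (Hdiff : forall x y, 0 <= x -> x < y -> (r' y - r' x)%C = Clog (p y / p x)).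
  { intros x y Hx Hy. destruct (HL x y Hx Hy) as (_ & _ & _ & Hpos).
    assert (E : Cexp (r' y - r' x)%C = Cexp (Clog (p y / p x))).
    { rewrite Cexp_minus, !Er, Cexp_Clog by (auto; lra). auto. }
    destruct (Cexp_inj_mod _ _ E) as [n En].
    assert (n = 0)%Z.
    { assert (In := f_equal Im En). unfold r' in In. rewrite !im_minus, !im_plus in In. change (Im (twopii n)) with (2 * PI * IZR n) in In.
      assert (I1 := im_Clog (p y / p 0)%C). assert (I2 := im_Clog (p x / p 0)%C).
      assert (I3 := im_Clog (p y / p x)%C). assert (P := PI_pos).
      assert (n < 1)%Z by (apply lt_IZR; nra). assert (-1 < n)%Z by (apply lt_IZR; nra). lia. }
    subst n. apply Csub_eq. rewrite En. apply Cext; unfold twopii; simpl; ring. }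
  exists r'. split; [|split; [split|split]].
  - unfold r'. replace (p 0 / p 0)%C with (RtoC 1) by (field; apply Hpn; lra). rewrite Clog_1. ring.
  - intros x y Hx Hy. rewrite (Hdiff x y Hx Hy). destruct (HL x y Hx Hy) as (A1 & A2 & A3 & _).
    destruct (HC x y Hx Hy) as (B1 & B2 & B3). repeat split; auto. lra.
  - intro M. destruct (HU (exp (M - Re z) * Cmod (p 0) + Re k)) as (x & Hx & Hxx). exists x. split; auto.
    unfold r'. rewrite re_plus, re_Clog. apply Rplus_lt_reg_l with (- Re z).
    replace (- Re z + (Re z + ln (Cmod (p x / p 0)%C))) with (ln (Cmod (p x / p 0)%C)) by ring.
    rewrite <- (ln_exp (- Re z + M)). apply ln_increasing. apply exp_pos.
    rewrite Cmod_div by (apply Hpn; lra). assert (P0 : 0 < Cmod (p 0)) by (apply Cmod_gt_0, Hpn; lra).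
    apply Rmult_lt_reg_r with (Cmod (p 0)); auto. unfold Rdiv. rewrite Rmult_assoc, Rinv_l, Rmult_1_r by lra.
    assert (R := re_Cmod (p x)). unfold p in R at 1. rewrite re_minus in R.
    replace (- Re z + M) with (M - Re z) by ring. lra.
  - intros x Hx. unfold expmap. rewrite Er by auto. unfold p. ring.
  - intros x Hx. unfold r'. rewrite im_plus. assert (I := im_Clog (p x / p 0)%C). assert (P := PI_le_4). apply Rabs_le. lra.
Qed.

Lemma cone_mono a a' r : a <= a' -> cone a r -> cone a' r.
Proof.
  intros H [H1 H2]. split; auto. intros x y Hx Hy. destruct (H1 x y Hx Hy) as (A & B & D).
  repeat split; auto. eapply Rle_trans; [exact D|]. apply Rmult_le_compat_r; lra.
Qed.

(** The curve is reparametrised by its real part, which is continuous and increasing by the cone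
    condition. [Rmax 0 u] continues the graph by a constant to the left, so that [h] is Lipschitz on
    the whole line as in [slit_winding]. *)
Lemma cone_graph a r : a <= 1 -> cone a r ->
  exists h : R -> R, (forall u v, Rabs (h u - h v) <= Rabs (u - v)) /\ h 0 = 0 /\
    (forall u, 0 <= u -> exists x, 0 <= x /\ r x = (r 0 + (u, h u))%C).
Proof.
  intros Ha [HC HU].
  assert (Hex : forall u : R, exists x, 0 <= x /\ Re (r x) = Re (r 0) + Rmax 0 u).
  { intro u. set (v := Rmax 0 u). assert (Hv : 0 <= v) by apply Rmax_l.
    destruct (HU (Re (r 0) + v)) as (X & HX & HXX).
    set (g := fun x => Re (r (Rmax 0 x)) - Re (r 0) - v).
    assert (Hg : continuity g).
    { intros x e He. exists e. split; auto. intros w [_ Hw]. change (Rabs (w - x) < e) in Hw. change (Rabs (g w - g x) < e). unfold g.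
      assert (L : forall p q, Rmax 0 p < Rmax 0 q -> Rabs (Re (r (Rmax 0 q)) - Re (r (Rmax 0 p))) <= Rabs (q - p)).
      { intros p q Hpq. destruct (HC (Rmax 0 p) (Rmax 0 q) (Rmax_l 0 p) Hpq) as (A1 & A2 & _). rewrite re_minus in A1, A2.
        rewrite Rabs_pos_eq by lra. eapply Rle_trans; [exact A2|]. unfold Rmax in *. destruct (Rle_dec 0 p), (Rle_dec 0 q); rewrite Rabs_pos_eq; lra. }
      replace (Re (r (Rmax 0 w)) - Re (r 0) - v - (Re (r (Rmax 0 x)) - Re (r 0) - v)) with (Re (r (Rmax 0 w)) - Re (r (Rmax 0 x))) by ring.
      destruct (Rtotal_order (Rmax 0 x) (Rmax 0 w)) as [T|[T|T]].
      - specialize (L _ _ T). lra.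
      - rewrite T, Rminus_diag, Rabs_R0. auto.
      - specialize (L _ _ T). rewrite (Rabs_minus_sym x w), (Rabs_minus_sym (Re _)) in L. lra. }
    destruct (IVT_cor g 0 X Hg HX) as (x & Hx & Ex).
    { unfold g. rewrite (Rmax_left 0 0), (Rmax_right 0 X) by lra. nra. }
    exists x. split. lra. unfold g in Ex. rewrite Rmax_right in Ex by lra. lra. }
  destruct (functional_choice _ Hex) as [xi Hxi].
  assert (Hinj : forall x y, 0 <= x -> 0 <= y -> Re (r x) = Re (r y) -> x = y).
  { intros x y Hx Hy E. destruct (Rtotal_order x y) as [T|[T|T]]; auto; exfalso.
    - destruct (HC x y Hx T) as (A & _). rewrite re_minus in A. lra.
    - destruct (HC y x Hy T) as (A & _). rewrite re_minus in A. lra. }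
  exists (fun u => Im (r (xi u)) - Im (r 0)). split; [|split].
  - intros u v. replace (Im (r (xi u)) - Im (r 0) - (Im (r (xi v)) - Im (r 0))) with (Im (r (xi u) - r (xi v))%C) by (rewrite im_minus; ring).
    destruct (Hxi u) as [Hu Eu]. destruct (Hxi v) as [Hv Ev].
    assert (L : forall p q, Rabs (Rmax 0 p - Rmax 0 q) <= Rabs (p - q)).
    { intros p q. unfold Rmax. destruct (Rle_dec 0 p), (Rle_dec 0 q); unfold Rabs; repeat destruct Rcase_abs; lra. }
    apply Rle_trans with (Rabs (Rmax 0 u - Rmax 0 v)); [|apply L].
    replace (Rmax 0 u - Rmax 0 v) with (Re (r (xi u) - r (xi v))%C) by (rewrite re_minus; lra).
    destruct (Rtotal_order (xi u) (xi v)) as [T|[T|T]].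
    + destruct (HC _ _ Hu T) as (A & _ & B). rewrite re_minus in *. rewrite im_minus in *.
      rewrite (Rabs_minus_sym (Im _)), (Rabs_minus_sym (Re _)), (Rabs_pos_eq (Re _ - _)) by lra.
      eapply Rle_trans; [exact B|]. nra.
    + rewrite T, re_minus, im_minus, !Rminus_diag. lra.
    + destruct (HC _ _ Hv T) as (A & _ & B). rewrite (Rabs_pos_eq (Re _)) by lra.
      eapply Rle_trans; [exact B|]. nra.
  - destruct (Hxi 0) as [H0 E0]. rewrite Rmax_left in E0 by lra. rewrite (Hinj (xi 0) 0); lra.
  - intros u Hu. exists (xi u). destruct (Hxi u) as [H0 E0]. rewrite Rmax_right in E0 by lra. split; auto.
    apply Cext. rewrite re_plus. simpl. lra. rewrite im_plus. simpl. lra.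
Qed.

(** 17 bounds [4 * PI + 1] by means of [PI <= 4]: the range [[- PI, 3 * PI]] of [slit_winding]
    inserted in [winding_bound]. *)
Definition narrow (s : address) (t : R) (Gam : nat -> R -> C) (m : nat) : Prop :=
  forall tau, t <= tau -> Rabs (Im (Gam m tau) - 2 * PI * IZR (s m)) <= 17.

Lemma narrow_of_slit k s t Gam m a r : Ray 0 k s t Gam -> a <= 1 -> cone a r -> r 0 = k ->
  (forall tau x, t <= tau -> 0 <= x -> Gam (S m) tau <> r x) -> narrow s t Gam m.
Proof.
  intros HR Ha Hr H0 Hav tau Ht. destruct (cone_graph a r Ha Hr) as (h & Hh & Hh0 & Hg).
  destruct (slit_winding (from t) (fun x => Gam (S m) x - k)%C h) as (l & Hl & El & Il); auto.
  - apply ccont_minus. apply HR. lia. apply ccont_const.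
  - intros x Hx Hre E. destruct (Hg _ Hre) as (x' & Hx' & E').
    apply (Hav x x' Hx Hx'). rewrite E', H0, <- E. apply Cext; [rewrite re_plus|rewrite im_plus]; cbn [Re Im fst snd]; rewrite ?re_minus, ?im_minus; unfold Re, Im; simpl; ring.
  - eapply Rle_trans; [apply (winding_bound 0 k s t Gam m l (- PI) (3 * PI)); auto; lia|].
    assert (P := PI_le_4). lra.
Qed.

Lemma narrow_im s t Gam m A v : narrow s t Gam m -> Rabs (IZR (s m)) <= A * v ->
  forall tau, t <= tau -> Rabs (Im (Gam m tau)) <= 8 * A * v + 17.
Proof.
  intros H Hs tau Ht. specialize (H tau Ht). assert (P := PI_le_4). assert (P0 := PI_pos).
  assert (Rabs (2 * PI * IZR (s m)) <= 8 * (A * v)).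
  { rewrite Rabs_mult, Rabs_pos_eq by lra. apply Rmult_le_compat; try lra. apply Rabs_pos. }
  apply Rabs_le_between in H. apply Rabs_le_between in H0. apply Rabs_le. lra.
Qed.

(** If [k] were higher than all narrow rays of levels up to [p], each of these would pass on one
    side of [k] and make the next lower one narrow. At level 0 this contradicts that the ray
    contains [k]. *)
Lemma narrow_below k s t Gam p B : Ray 0 k s t Gam -> Gam O t = k ->
  (forall m, (p <= m)%nat -> narrow s t Gam m) ->
  (forall m, (m <= p)%nat -> narrow s t Gam m -> forall tau, t <= tau -> Rabs (Im (Gam m tau)) <= B) ->
  Rabs (Im k) <= B.
Proof.
  intros HR H0 Hp HB. apply Rnot_lt_le. intro L.
  assert (J : forall m, (0 <= m)%nat -> narrow s t Gam m).
  { apply (desc_ind (fun m => narrow s t Gam m) 0 p); auto. intros m _ HJ.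
    destruct (Nat.le_gt_cases p m) as [Q|Q]; auto.
    assert (Hi : forall tau, t <= tau -> Rabs (Im (Gam (S m) tau)) <= B) by (apply HB; auto).
    assert (P := PI_le_4).
    destruct (Rle_dec 0 (Im k)) as [Pk|Pk].
    - rewrite Rabs_pos_eq in L by auto. intros tau Ht.
      apply Rle_trans with (PI + 1); [|lra].
      apply (winding_sign 0 k s t Gam m Ci (- (PI / 2))); auto. lia.
      + apply Cext; rewrite ?re_Cexp, ?im_Cexp; simpl; rewrite ?cos_neg, ?sin_neg, ?cos_PI2, ?sin_PI2, ?exp_0; field.
      + intro E. apply (f_equal Im) in E. simpl in E. lra.
      + intros x Hx. specialize (Hi x Hx). apply Rabs_le_between in Hi. simpl. unfold Im in *. simpl in *. lra.
    - rewrite Rabs_left in L by lra. intros tau Ht.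
      apply Rle_trans with (PI + 1); [|lra].
      apply (winding_sign 0 k s t Gam m (- Ci)%C (PI / 2)); auto. lia.
      + apply Cext; rewrite ?re_Cexp, ?im_Cexp; simpl; rewrite ?cos_PI2, ?sin_PI2, ?exp_0; field.
      + intro E. apply (f_equal Im) in E. simpl in E. lra.
      + intros x Hx. specialize (Hi x Hx). apply Rabs_le_between in Hi. simpl. unfold Im in *. simpl in *. lra. }
  assert (Q := HB O ltac:(lia) (J O ltac:(lia)) t ltac:(lra)). rewrite H0 in Q. lra.
Qed.

(** Near the real direction the real part carries nine tenths of the modulus, so each step is nearly
    a full exponential. The second clause is meant for [not_far_left]: the accumulated expansion of
    the iterates is dwarfed by the present point. *)
Lemma orbit_growth k (z : nat -> C) (M : nat -> R) Y n : z O = k -> (forall i, expmap k (z i) = z (S i)) ->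
  10000 <= Y -> Cmod k = 4 * Y -> (forall i, 100 * M i <= Fn i Y) ->
  (forall i, (i < n)%nat -> 0 < Re (z i) /\ Rabs (Im (z i)) <= M i) ->
  forall i, (i <= n)%nat -> 2 * Fn i Y <= Cmod (z i) /\
    sum_f_R0 (fun i => Re (z i) + 5) i - (Re (z i) + 5) + 1 <= Cmod (z i) / 2 /\
    ((i < n)%nat -> 9 / 10 * Cmod (z i) <= Re (z i)).
Proof.
  intros H0 Hz HY Hk HM HQ.
  assert (Hre : forall i, (i < n)%nat -> 2 * Fn i Y <= Cmod (z i) -> 9 / 10 * Cmod (z i) <= Re (z i)).
  { intros i Hi H. destruct (HQ i Hi) as [A B]. specialize (HM i). assert (T := Cmod_le_ReIm (z i)).
    rewrite (Rabs_pos_eq (Re (z i))) in T by lra. assert (P := Fn_pos i Y ltac:(lra)). lra. }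
  induction i; intro Hi.
  - rewrite H0, Hk. change (Fn 0 Y) with Y. simpl. rewrite H0. split; [lra|]. split; [lra|].
    intro H. specialize (Hre O H). rewrite H0, Hk in Hre. change (Fn 0 Y) with Y in Hre. apply Hre. lra.
  - destruct (IHi ltac:(lia)) as (I1 & I2 & I3). specialize (I3 ltac:(lia)).
    set (V := Fn i Y) in *. assert (HV : Y <= V). { apply (Fn_mono_n 0 i Y); lra || lia. }
    set (w := Cmod (z i)) in *.
    assert (Hexp : exp (Re (z i)) - 4 * Y <= Cmod (z (S i))).
    { rewrite <- Hz. unfold expmap. rewrite <- Cmod_Cexp, <- Hk.
      assert (T := Cmod_le_sub (Cexp (z i)) (Cexp (z i) + k)).
      replace (Cexp (z i) - (Cexp (z i) + k))%C with (- k)%C in T by ring. rewrite Cmod_opp in T. lra. }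
    assert (G1 : 2 * Fn (S i) Y <= Cmod (z (S i))).
    { rewrite Fn_S. fold V. assert (E : exp (V + (8 / 10) * V) <= exp (Re (z i))) by (apply exp_mono; lra).
      rewrite exp_plus in E. assert (E1 := exp_ineq1_le V). assert (E2 := exp_ineq1_le (8 / 10 * V)).
      assert (exp V * 8000 <= exp V * exp (8 / 10 * V)) by (apply Rmult_le_compat_l; lra). lra. }
    split; [auto|split].
    + rewrite tech5. assert (HX : 18000 <= Re (z i)) by lra.
      set (X := Re (z i)) in *. assert (E := exp_quad X ltac:(lra)).
      assert (X * 4000 <= X ^ 2 / 4) by nra. lra.
    + intro H. apply Hre; auto.
Qed.

(* Pull the half line [z (l-1) + [0, oo)] back along the orbit; its image under
   the next iterate is the radial half line from [z l] as seen from [k]. *)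
Lemma slit_exists k (z : nat -> C) d : (forall i, expmap k (z i) = z (S i)) -> forall i,
  (forall j, (i < j)%nat -> (j <= i + d)%nat -> 2 <= Re (z j - k)%C /\
     Rabs (Im (z j)) + 2 + Rabs (Im k) <= (1 / 2) ^ j / 64 * Re (z j - k)%C) ->
  exists r, r 0 = z i /\ cone ((1 / 2) ^ i / 16) r /\
    (forall x, 0 <= x -> Rabs (Im (r x) - Im (z i)) <= 2) /\
    (forall x, 0 <= x -> Defs.iter (expmap k) (S d) (r x) = (exp x * (z (S (i + d))%nat - k) + k)%C).
Proof.
  intros Hz. induction d; intros i Hj.
  - exists (fun x => z i + RtoC x)%C. split; [|split; [|split]].
    + ring.
    + split.
      * intros x y Hx Hy. rewrite re_minus, im_minus, !re_plus, !im_plus, !re_RtoC. simpl (Im (RtoC _)).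
        replace (Im (z i) + 0 - (Im (z i) + 0)) with 0 by ring. rewrite Rabs_R0.
        assert (P := pow_lt (1 / 2) i ltac:(lra)). repeat split; try lra. apply Rmult_le_pos; lra.
      * intro M. exists (Rmax 0 (M - Re (z i) + 1)). split. apply Rmax_l. rewrite re_plus, re_RtoC.
        assert (R := Rmax_r 0 (M - Re (z i) + 1)). lra.
    + intros x Hx. rewrite im_plus. simpl (Im (RtoC _)). replace (Im (z i) + 0 - Im (z i)) with 0 by ring. rewrite Rabs_R0. lra.
    + intros x Hx. change (Defs.iter (expmap k) 1 (z i + x)%C) with (expmap k (z i + x)%C). rewrite Nat.add_0_r, <- Hz. unfold expmap.
      rewrite Cexp_plus. assert (E : Cexp x = exp x). { unfold Cexp. simpl. rewrite cos_0, sin_0. apply Cext; simpl; ring. } rewrite E. ring.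
  - destruct (IHd (S i)) as (r & R0 & R1 & R2 & R3). { intros j H1 H2. apply Hj; lia. }
    destruct (Hj (S i) ltac:(lia) ltac:(lia)) as [J1 J2].
    assert (P := pow_lt (1 / 2) i ltac:(lra)). assert (P1 : (1 / 2) ^ i <= 1). { assert (T := pow_incr (1 / 2) 1 i ltac:(lra)). now rewrite pow1 in T. }
    (* The apertures fit: with [(1/2)^(i+1)] factored out, [1/16 + 2/64] is less than [2/16]. *)
    destruct (cone_pullback ((1 / 2) ^ S i / 16) ((1 / 2) ^ S i / 64) k (z i) r) as (r' & Q0 & Q1 & Q2 & Q3);
      try (simpl pow; lra); auto.
    + rewrite R0, <- Hz. unfold expmap. ring.
    + rewrite R0. auto.
    + intros x Hx. rewrite R0. eapply Rle_trans; [|exact J2]. specialize (R2 x Hx).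
      rewrite im_minus. replace (Im (r x) - Im k) with ((Im (r x) - Im (z (S i))) + Im (z (S i)) - Im k) by ring.
      assert (T1 := Rabs_triang (Im (r x) - Im (z (S i)) + Im (z (S i))) (- Im k)).
      assert (T2 := Rabs_triang (Im (r x) - Im (z (S i))) (Im (z (S i)))). rewrite Rabs_Ropp in T1. unfold Rminus in *. lra.
    + exists r'. split; [auto|split; [|split; [auto|]]].
      * eapply cone_mono; [|exact Q1]. simpl pow. lra.
      * intros x Hx. replace (S (S d)) with (S d + 1)%nat by lia. rewrite iter_add.
        change (Defs.iter (expmap k) 1 (r' x)) with (expmap k (r' x)). rewrite Q2, R3 by auto.
        replace (S i + d)%nat with (i + S d)%nat by lia. auto.
Qed.

(* For large [k] the orbit of [k] grows like [Fn i Y] while it stays close to the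
   real direction; let [l] be the first time it does not. It cannot be far left
   then, since [k] would be attracted to a cycle. If it leaves upwards or
   downwards, pull back a half line from there to a slit at [k]: a ray [Gam m]
   which is narrow [l] levels later misses the slit, hence does not wind around
   [k], and [Gam (m-1)] is narrow too; at level [l] this contradicts the choice of [l]. *)
Lemma param_core s A y t k p Gam : 1 <= A -> 0 < y -> 10000 * A * (y + 1) <= Cmod k / 4 ->
  (forall i m, (m <= p + i)%nat -> Rabs (IZR (s m)) <= A * Fn i y) ->
  Ray 0 k s t Gam -> Gam O t = k -> (forall m, (p <= m)%nat -> narrow s t Gam m) ->
  (forall M, exists N, forall n, (N <= n)%nat -> M < Cmod (Gam n t)) ->
  Cmod (Gam (S p) t) < 2 * Fn (S p) (Cmod k / 4) -> False.
Proof.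
  intros HA Hy HY Hs HR H0 Hp Hesc Hup.
  set (Y := Cmod k / 4) in *. set (z := fun i => Gam i t).
  assert (HAy : 1 <= A * (y + 1)) by nra.
  assert (Hz : forall i, expmap k (z i) = z (S i)). { intro i. apply HR. lia. lra. }
  (* [B i] is the height of a narrow ray of level at most [p + i]. [M i] exceeds it by twice the
     bound for [|Im k|], spent when passing to the direction seen from [k] and back, and by 1 for
     strictness. *)
  set (B := fun i => 8 * A * Fn i y + 17). set (M := fun i => B i + 2 * B O + 1).
  assert (Hv : forall i, y <= Fn i y) by (intro i; apply (Fn_mono_n 0 i y); [auto|lia]).
  assert (HAv : forall i, A * y <= A * Fn i y) by (intro i; apply Rmult_le_compat_l; [lra|apply Hv]).
  assert (HB : forall i m, (m <= p + i)%nat -> narrow s t Gam m -> forall tau, t <= tau -> Rabs (Im (Gam m tau)) <= B i).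
  { intros i m Hm HN tau Ht. unfold B. apply (narrow_im s t Gam m A (Fn i y)); auto. }
  assert (HIk : Rabs (Im k) <= B O).
  { apply (narrow_below k s t Gam p); auto. intros m Hm. apply (HB O m). lia. }
  assert (HF : forall i, 10000 * A * 2 ^ i * (Fn i y + 1) <= Fn i Y) by (apply Fn_scaled; auto; lra).
  assert (HF0 : forall i, 1 <= 2 ^ i) by (intro i; apply pow_R1_Rle; lra).
  assert (HMF : forall i, (M i + B O + 2) * (128 * 2 ^ i) <= Fn i Y).
  { intro i. apply Rle_trans with (72 * A * (Fn i y + 1) * (128 * 2 ^ i)).
    - apply Rmult_le_compat_r. specialize (HF0 i); lra. unfold M, B. change (Fn 0 y) with y. specialize (HAv i). lra.
    - eapply Rle_trans; [|apply HF]. assert (0 <= A * 2 ^ i * (Fn i y + 1)).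
      { specialize (Hv i). specialize (HF0 i). apply Rmult_le_pos; [apply Rmult_le_pos|]; lra. } lra. }
  assert (HBp : forall i, 17 <= B i) by (intro i; unfold B; specialize (Hv i); nra).
  assert (HM : forall i, 100 * M i <= Fn i Y).
  { intro i. eapply Rle_trans; [|apply HMF]. assert (Q := HBp i). assert (Q0 := HBp O). specialize (HF0 i).
    assert (0 <= M i) by (unfold M; lra). nra. }
  assert (HK : Cmod k = 4 * Y) by (unfold Y; field).
  assert (HRk : 0 < Re k).
  { assert (N := not_left k). assert (T := Cmod_le_ReIm k).
    assert (HBY : B O <= Y). { specialize (HM O). change (Fn 0 Y) with Y in HM. assert (Q0 := HBp O). unfold M in HM. lra. }
    assert (L : -2 <= Re k). { apply N. intro X. destruct (Hesc X) as [n Hn]. exists n. rewrite <- H0 at 2.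
      rewrite (Ray_orbit 0 k s t Gam 0 t n HR); [|lia|lra]. apply Hn. lia. }
    assert (3 * Y <= Rabs (Re k)) by lra. revert H. unfold Rabs. destruct Rcase_abs; intro; lra. }
  set (Q := fun i => 0 < Re (z i) /\ Rabs (Im (z i)) <= M i).
  assert (HQ0 : Q O). { unfold Q, z. rewrite H0. split; auto. assert (Q0 := HBp O). unfold M. lra. }
  assert (GR := orbit_growth k z M Y).
  assert (HY1 : 10000 <= Y) by lra.
  (* The orbit does leave by level [p]: otherwise [orbit_growth] up to level [p + 1] contradicts the
     upper bound [Hup]. *)
  assert (Hl : exists l, ~ Q l /\ (l <= p)%nat /\ forall i, (i < l)%nat -> Q i).
  { destruct (classic (exists l, ~ Q l /\ (l <= p)%nat)) as [[l [A1 A2]]|N].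
    - revert A1 A2. induction l as [l IH] using lt_wf_ind. intros A1 A2.
      destruct (classic (exists i, (i < l)%nat /\ ~ Q i)) as [(i & I1 & I2)|N].
      + apply (IH i); auto. lia.
      + exists l. split; [auto|split; auto]. intros i Hi. apply NNPP. intro. apply N. exists i. auto.
    - exfalso. destruct (GR (S p)) with (i := S p) as [G _]; auto.
      + intros i Hi. apply NNPP. intro. apply N. exists i. split; auto. lia.
      + unfold z in G. lra. }
  destruct Hl as (l & HlQ & Hlp & Hlt).
  assert (Hl0 : (0 < l)%nat). { destruct l; [contradiction|lia]. }
  assert (GL := GR l H0 Hz HY1 HK HM Hlt). 
  assert (HRe : forall i, (i < l)%nat -> 9 / 10 * Cmod (z i) <= Re (z i)). { intros i Hi. apply GL; auto. lia. }
  destruct (Rle_dec (Rabs (Im (z l))) (M l)) as [HI|HI].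
  - assert (HRl : Re (z l) <= 0). { apply Rnot_lt_le. intro. apply HlQ. split; auto. }
    destruct (GL l (Nat.le_refl l)) as (G1 & G2 & _). specialize (HM l).
    apply (not_far_left k l z).
    + intro n. unfold z. rewrite <- H0 at 2. rewrite (Ray_orbit 0 k s t Gam 0 t n HR); [|lia|lra]. now rewrite Nat.add_0_r.
    + exact Hesc.
    + intros i Hi. left. apply Hlt; auto.
    + assert (T := Cmod_le_ReIm (z l)). rewrite (Rabs_left1 (Re (z l))) in T by auto.
      assert (Fn 0 Y <= Fn l Y) by (apply Fn_mono_n; [lra|lia]). change (Fn 0 Y) with Y in H. lra.
  - apply Rnot_le_lt in HI.
    destruct (slit_exists k z (l - 1) Hz 0) as (r & R0 & R1 & _ & R3).
    { intros j Hj1 Hj2. assert (Hjl : (j < l)%nat) by lia. destruct (Hlt j Hjl) as [Q1 Q2].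
      destruct (GL j ltac:(lia)) as (G1 & _ & _). specialize (HRe j Hjl).
      assert (FY : Fn 1 Y <= Fn j Y) by (apply Fn_mono_n; [lra|lia]). rewrite Fn_S in FY. change (Fn 0 Y) with Y in FY.
      assert (E := exp_quad Y ltac:(lra)). assert (Y * 2500 <= Y ^ 2 / 4) by nra.
      assert (RK := re_le_Cmod k). assert (RK2 := Rle_abs (Re k)).
      assert (HD : Fn j Y <= Re (z j - k)%C) by (rewrite re_minus; lra).
      split; [lra|]. apply Rle_trans with (M j + B O + 2); [lra|].
      assert (P2 := HF0 j). apply Rmult_le_reg_r with (128 * 2 ^ j); [lra|]. eapply Rle_trans; [apply HMF|].
      replace ((1 / 2) ^ j / 64 * Re (z j - k)%C * (128 * 2 ^ j)) with (((1 / 2) ^ j * 2 ^ j) * (2 * Re (z j - k)%C)) by field.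
      rewrite <- Rpow_mult_distr. replace (1 / 2 * 2) with 1 by field. rewrite pow1. lra. }
    replace (S (l - 1)) with l in R3 by lia. replace (S (0 + (l - 1))) with l in R3 by lia.
    assert (J : forall n, (0 <= n)%nat -> forall m, (n <= m)%nat -> narrow s t Gam m).
    { apply (desc_ind (fun n => forall m, (n <= m)%nat -> narrow s t Gam m) 0 p).
      - intros n Hn _ m Hm. apply Hp. lia.
      - intros n _ IH m Hm. destruct (Nat.eq_dec m n) as [->|Ne]; [|apply IH; lia].
        destruct (Nat.le_gt_cases p n) as [Pn|Pn]; [auto|].
        apply (narrow_of_slit k s t Gam n ((1 / 2) ^ 0 / 16) r); auto. simpl; lra. rewrite R0. exact H0.
        (* A meeting point of ray and slit is carried by [f^l] onto the half line from [z l] leading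
           away from [k], higher than [B l], although it lies on the narrow ray of level
           [l + n + 1]. *)
        intros tau x Ht Hx E.
        assert (E1 : Gam (l + S n)%nat tau = (exp x * (z l - k) + k)%C).
        { rewrite <- (Ray_orbit 0 k s t Gam (S n) tau l HR); auto; [|lia]. rewrite E. apply R3. auto. }
        assert (I1 := HB l (l + S n)%nat ltac:(lia) (IH (l + S n)%nat ltac:(lia)) tau Ht).
        rewrite E1, im_plus, im_scal, im_minus in I1. assert (E2 : 1 <= exp x) by (rewrite <- exp_0; apply exp_mono; auto).
        assert (T1 : Rabs (Im (z l)) - Rabs (Im k) <= Rabs (Im (z l) - Im k)) by apply Rabs_triang_inv.
        assert (T2 := Rabs_triang_inv (exp x * (Im (z l) - Im k)) (- Im k)).
        rewrite Rabs_Ropp, Rabs_mult, (Rabs_pos_eq (exp x)) in T2 by lra.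
        replace (exp x * (Im (z l) - Im k) - - Im k) with (exp x * (Im (z l) - Im k) + Im k) in T2 by ring.
        assert (T3 : 1 * Rabs (Im (z l) - Im k) <= exp x * Rabs (Im (z l) - Im k)) by (apply Rmult_le_compat_r; [apply Rabs_pos|auto]).
        assert (Q0 := HBp O). unfold M in HI. lra. }
    assert (I1 := HB l l ltac:(lia) (J O ltac:(lia) l ltac:(lia)) t ltac:(lra)). fold (z l) in I1.
    assert (Q0 := HBp O). unfold M in HI. lra.
Qed.

Theorem param_bound s b A t1 : Dom s b A -> b < t1 -> exists K0, forall t k Gam,
  t1 <= t -> Ray 0 k s t Gam -> Gam O t = k -> Cmod k <= Rmax K0 (exp t / 32).
Proof.
  intros HD Hb. assert (HD' := HD). destruct HD' as (Hb0 & HA & Hs).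
  destruct (Fn_pow4 b t1 Hb0 Hb) as (X0 & HX0 & H4).
  (* The first summand makes [Fn_pow4] available from level [p] on, the second lets [quart] absorb
     the factor [160000 * A]. *)
  exists (exp X0 + (160000 * A) ^ 2). intros t k Gam Ht HR Hk. apply Rnot_lt_le. intro L.
  set (K := Cmod k) in *.
  assert (LK0 := Rmax_l (exp X0 + (160000 * A) ^ 2) (exp t / 32)). assert (LK1 := Rmax_r (exp X0 + (160000 * A) ^ 2) (exp t / 32)).
  assert (HtK : exp t < 32 * K) by lra. assert (PX := exp_pos X0).
  assert (HKA : (160000 * A) ^ 2 <= K) by lra. assert (HXK : exp X0 <= K). { assert (0 <= (160000 * A) ^ 2) by apply pow2_ge_0. lra. }
  clear L LK0 LK1.
  assert (HK1 : 160000 * A <= K) by nra. assert (HK2 : 160000 <= K) by lra.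
  assert (HtY : t + 1 <= K / 4).
  { apply Rnot_lt_le. intro L. assert (E := exp_quad t ltac:(lra)).
    assert (1 + (K / 4 - 1) + (K / 4 - 1) ^ 2 / 4 <= 32 * K) by nra. nra. }
  (* At level [p] the potential is about to overtake [k]. From [p + 1] on [k] is negligible and the
     rays follow [base]; at level [p] the ray is narrow by [winding_right]. *)
  assert (Hn : exists p, Fn p t < 2 * K /\ 2 * K <= Fn (S p) t).
  { apply NNPP. intro N. assert (H : forall p, Fn p t < 2 * K).
    { induction p. change (Fn 0 t) with t. lra. apply Rnot_le_lt. intro. apply N. exists p. auto. }
    destruct (Fn_unbounded t (2 * K)) as [n Hn]. lra. specialize (Hn n (Nat.le_refl n)). specialize (H n). lra. }
  destruct Hn as (p & Hp1 & Hp2). set (x := Fn p t) in *. rewrite Fn_S in Hp2. fold x in Hp2.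
  assert (Hx0 : X0 <= x). { apply Rnot_lt_le. intro N. apply exp_increasing in N. lra. }
  assert (Ht0 : 0 < t) by lra.
  assert (Hge : forall m, (p <= m)%nat -> X0 <= Fn m t). { intros m Hm. assert (Q := Fn_mono_n p m t Ht0 Hm). fold x in Q. lra. }
  assert (HF4 : forall m, (p <= m)%nat -> Fn m b ^ 4 <= Fn m t) by (intros m Hm; apply H4; auto).
  assert (HFp : forall m, 0 < Fn m b) by (intro m; apply Fn_pos; auto).
  assert (HFs : forall m, (S p <= m)%nat -> 2 * K <= Fn m t).
  { intros m Hm. assert (Q := Fn_mono_n (S p) m t Ht0 Hm). rewrite Fn_S in Q. fold x in Q. lra. }
  assert (HPs : forall m, 2 * PI * Rabs (IZR (s m)) <= 8 * A * Fn m b).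
  { intro m. assert (P := PI_le_4). assert (P0 := PI_pos). specialize (Hs m). assert (Q := Rabs_pos (IZR (s m))). nra. }
  assert (HSt : St s K (S p) t).
  { intros m Hm. assert (E : exp (2 * K) <= exp (Fn m t)) by (apply exp_mono; apply HFs; auto).
    assert (E2 := exp_quad (2 * K) ltac:(lra)).
    assert (Q := quart (Fn (S m) b) (exp (Fn m t)) (128 * A)). specialize (HPs (S m)).
    assert (F4 := HF4 (S m) ltac:(lia)). rewrite (Fn_S m t) in F4.
    assert (128 * A * Fn (S m) b <= exp (Fn m t)).
    { apply Q; try lra. left; auto. nra. }
    nra. }
  assert (HG : forall m tau, (S p <= m)%nat -> t <= tau -> Cmod (Gam m tau - base s tau m)%C <= 1 / 2).
  { intros m tau Hm Htau. assert (HR2 := Ray_G s K (S p) k t (Cmod_ge_0 k) HSt (Rle_refl _)).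
    assert (HR1 : Ray (S p) k s t Gam) by (apply (Ray_sub 0 (S p) k s t t Gam); auto; [lia|lra]).
    rewrite (Ray_unique (S p) k s b A t _ _ HD ltac:(lra) HR1 HR2 m tau Hm Htau).
    apply (G_base_half s K (S p)); auto. apply Cmod_ge_0. apply (St_mono s K (S p) t tau); auto. apply Rle_refl. }
  apply (param_core s A (Fn p b) t k p Gam); auto.
  - assert (Q := quart (Fn p b) (2 * K) (160000 * A)). assert (160000 * A * Fn p b <= 2 * K).
    { apply Q; try lra. left; auto. eapply Rle_trans; [apply HF4; lia|]. fold x. lra. }
    fold K. lra.
  - intros i m Hm. eapply Rle_trans; [apply Hs|]. apply Rmult_le_compat_l; [lra|]. rewrite <- Fn_add. apply Fn_mono_n; auto. lia.
  - assert (J : forall m, (S p <= m)%nat -> narrow s t Gam m).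
    { intros m Hm tau Htau. assert (Q := HG m tau Hm Htau). assert (I := im_le_Cmod (Gam m tau - base s tau m)%C).
      rewrite im_minus in I. change (Im (base s tau m)) with (2 * PI * IZR (s m)) in I. lra. }
    intros m Hm. destruct (Nat.eq_dec m p) as [->|Ne]; [|apply J; lia].
    intros tau Htau. assert (P := PI_le_4). apply Rle_trans with (PI + 1); [|lra].
    apply (winding_right 0 k s t Gam p); auto. lia.
    intros u Hu. assert (Q := HG (S p) u (Nat.le_refl _) Hu). assert (R1 := Cmod_re_lower (base s u (S p)) (Gam (S p) u)).
    change (Re (base s u (S p))) with (Fn (S p) u) in R1. assert (Fn (S p) t <= Fn (S p) u) by (apply Fn_mono; auto).
    assert (W := HFs (S p) (Nat.le_refl _)). rewrite re_minus. assert (RK := re_le_Cmod k). assert (RK2 := Rle_abs (Re k)). fold K in RK. lra.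
  - intro M. destruct (Fn_unbounded t (M + 1) Ht0) as [N HN]. exists (N + S p)%nat. intros n Hn.
    assert (Q := HG n t ltac:(lia) (Rle_refl _)). assert (R1 := Cmod_re_lower (base s t n) (Gam n t)).
    change (Re (base s t n)) with (Fn n t) in R1. specialize (HN n ltac:(lia)). assert (RK := re_le_Cmod (Gam n t)).
    assert (RK2 := Rle_abs (Re (Gam n t))). lra.
  - fold K. assert (Q := HG (S p) t (Nat.le_refl _) (Rle_refl _)). assert (T := Cmod_le_sub (Gam (S p) t) (base s t (S p))).
    assert (T2 := Cmod_le_ReIm (base s t (S p))). change (Re (base s t (S p))) with (Fn (S p) t) in T2.
    change (Im (base s t (S p))) with (2 * PI * IZR (s (S p))) in T2.
    rewrite Rabs_mult, (Rabs_pos_eq (2 * PI)) in T2 by (assert (P := PI_pos); lra). specialize (HPs (S p)).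
    assert (W := HFs (S p) (Nat.le_refl _)). rewrite (Rabs_pos_eq (Fn (S p) t)) in T2 by lra.
    assert (F4 := HF4 (S p) ltac:(lia)).
    assert (Z : 8 * A * Fn (S p) b <= Fn (S p) t). { apply quart; [left; apply HFp|exact F4|lra|nra]. }
    (* The surplus 1 becomes a factor [e] one level up, which leaves room for the error terms. *)
    assert (Hpp : x + 1 <= Fn p (K / 4)).
    { unfold x. destruct p. change (Fn 0 t) with t. change (Fn 0 (K / 4)) with (K / 4). lra.
      apply Rle_trans with (2 * K + 1). unfold x in Hp1. lra.
      apply Rle_trans with (Fn 1 (K / 4)); [|apply Fn_mono_n; [lra|lia]]. rewrite Fn_S. change (Fn 0 (K / 4)) with (K / 4).
      assert (E := exp_quad (K / 4) ltac:(lra)). nra. }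
    rewrite (Fn_S p (K / 4)). rewrite (Fn_S p t) in *. fold x in T2, Z, W, F4.
    apply exp_mono in Hpp. rewrite exp_plus in Hpp. assert (E1 := exp_ineq1_le 1). assert (E2 := exp_pos x).
    assert (2 * exp x <= exp x * exp 1) by nra. lra.
Qed.

(** * Existence and uniqueness of the parameter *)

Lemma orbit_hol n k : Hol2 (fun k => Defs.iter (expmap k) n k) k.
Proof.
  revert k. induction n; intro k.
  - apply Hol2_id.
  - apply (Hol2_ext (fun k => Cexp (Defs.iter (expmap k) n k) + k)%C).
    { intro. reflexivity. }
    apply Hol2_plus; [|apply Hol2_id]. apply (Hol2_comp Cexp (fun k => Defs.iter (expmap k) n k)); auto. apply Hol2_Cexp.
Qed.

Lemma finite_radius (P : nat -> R -> Prop) N : (forall n d d', P n d -> d' <= d -> P n d') ->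
  (forall n, exists d, 0 < d /\ P n d) -> exists d, 0 < d /\ forall n, (n <= N)%nat -> P n d.
Proof.
  intros Hm H. induction N.
  - destruct (H O) as (d & Hd & Q). exists d. split; auto. intros n Hn. replace n with O by lia. auto.
  - destruct IHN as (d & Hd & Q). destruct (H (S N)) as (d' & Hd' & Q'). exists (Rmin d d'). split. now apply Rmin_glb_lt.
    intros n Hn. destruct (Nat.eq_dec n (S N)) as [->|Ne].
    + apply (Hm _ d'); auto. apply Rmin_r.
    + apply (Hm _ d); auto. apply Q. lia. apply Rmin_l.
Qed.

Lemma orbit_cont N k0 e : 0 < e -> exists d, 0 < d /\ forall k, Cmod (k - k0)%C < d -> forall n, (n <= N)%nat ->
  Cmod (Defs.iter (expmap k) n k - Defs.iter (expmap k0) n k0)%C < e.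
Proof.
  intro He. destruct (finite_radius (fun n d => forall k, Cmod (k - k0)%C < d ->
    Cmod (Defs.iter (expmap k) n k - Defs.iter (expmap k0) n k0)%C < e) N) as (d & Hd & A).
  - intros n d d' H L k Hk. apply H. lra.
  - intro n. apply (Hol2_cont _ _ (orbit_hol n k0)). auto.
  - exists d. split; auto.
Qed.

(** * The parameter equation and its solutions *)

Definition on_ray s a t k := exists Gam, Ray 0 k s a Gam /\ Gam O t = k.

Lemma on_ray_tracks s a t k : a <= t -> on_ray s a t k -> tracks k s t.
Proof.
  intros Ht (Gam & HR & H0). assert (HR' := HR). destruct HR' as (_ & _ & [M HM] & _). exists M. intros n Hn.
  rewrite <- H0 at 2. rewrite (Ray_orbit 0 k s a Gam 0 t n HR) by (lia || lra). rewrite Nat.add_0_r. apply HM; auto. lia.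
Qed.

(** Preimages of one point differ by a period, whose modulus exceeds 6 unless it is 0. *)
Lemma orbit_descend k (z w : nat -> C) N : (forall n, expmap k (z n) = z (S n)) -> (forall n, expmap k (w n) = w (S n)) ->
  z N = w N -> (forall n, (n <= N)%nat -> Cmod (z n - w n)%C < 6) -> forall n, (n <= N)%nat -> z n = w n.
Proof.
  intros Hz Hw HN H. assert (A : forall j, (j <= N)%nat -> z (N - j)%nat = w (N - j)%nat).
  { induction j; intro Hj. now rewrite Nat.sub_0_r.
    specialize (IHj ltac:(lia)). set (n := (N - S j)%nat). replace (N - j)%nat with (S n) in IHj by (unfold n; lia).
    rewrite <- Hz, <- Hw in IHj. unfold expmap in IHj.
    assert (E : Cexp (z n) = Cexp (w n)).
    { replace (Cexp (z n)) with (Cexp (z n) + k - k)%C by ring. rewrite IHj. ring. }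
    destruct (Cexp_inj_mod _ _ E) as [m Em]. assert (B := H n ltac:(unfold n; lia)).
    assert (m = 0)%Z. { apply twopii_sub_small. rewrite Em in B. replace (twopii m - twopii 0)%C with (twopii m); auto.
      apply Cext; unfold twopii; simpl; ring. }
    subst m. apply Csub_eq. rewrite Em. apply Cext; unfold twopii; simpl; ring. }
  intros n Hn. specialize (A (N - n)%nat ltac:(lia)). now replace (N - (N - n))%nat with n in A by lia.
Qed.

(** On the first [N] levels rays and orbits move by less than 7/2 in total, well below a period.
    Hence zeros near a genuine solution, and limits of genuine solutions, are genuine. *)
Lemma ray_orbit_near s b A a k0 Gam0 t0 N : Dom s b A -> b < a -> a <= t0 -> Ray 0 k0 s a Gam0 ->
  exists d, 0 < d /\ forall t k Gam, a <= t -> Rabs (t - t0) < d -> Cmod (k - k0)%C < d -> Ray 0 k s a Gam ->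
    forall n, (n <= N)%nat -> Cmod (Gam n t - Gam0 n t0)%C < 5 / 2 /\
      Cmod (Defs.iter (expmap k) n k - Defs.iter (expmap k0) n k0)%C < 1.
Proof.
  intros HD Hb Ht0 HR0.
  destruct (orbit_cont N k0 1 Rlt_0_1) as (d1 & Hd1 & B1).
  destruct (Ray_continuity k0 s b A a Gam0 HD Hb HR0 1 Rlt_0_1) as (d2 & Hd2 & B2).
  destruct (finite_radius (fun n d => forall t, a <= t -> Rabs (t - t0) < d -> Cmod (Gam0 n t - Gam0 n t0)%C < 1) N) as (d3 & Hd3 & B3).
  { intros n d d' H L t Ht Hd. apply H; auto. lra. }
  { intro n. destruct HR0 as (HC & _). destruct (HC n ltac:(lia) t0 Ht0 1 Rlt_0_1) as (d & Hd & Q). exists d. split; auto. }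
  exists (Rmin d1 (Rmin d2 d3)). split. { repeat apply Rmin_glb_lt; auto. }
  intros t k Gam Ht Htd Hk HR n Hn.
  assert (M1 := Rmin_l d1 (Rmin d2 d3)). assert (M2 := Rmin_r d1 (Rmin d2 d3)).
  assert (M3 := Rmin_l d2 d3). assert (M4 := Rmin_r d2 d3). split; [|apply B1; auto; lra].
  destruct (B2 k ltac:(lra)) as (Gam' & HR' & C'). rewrite (Ray_unique 0 k s b A a Gam Gam' HD Hb HR HR' n t ltac:(lia) Ht).
  specialize (C' n t Ht). specialize (B3 n Hn t Ht ltac:(lra)).
  assert (T := Cmod_sub_triangle (Gam' n t) (Gam0 n t) (Gam0 n t0)). lra.
Qed.

Lemma ray_start s a k Gam t N : Ray 0 k s a Gam -> a <= t -> Gam N t = Defs.iter (expmap k) N k ->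
  (forall n, (n <= N)%nat -> Cmod (Gam n t - Defs.iter (expmap k) n k)%C < 6) -> Gam O t = k.
Proof.
  intros HR Ht HN H. apply (orbit_descend k (fun n => Gam n t) (fun n => Defs.iter (expmap k) n k) N); auto; try lia.
  intro n. apply HR; auto. lia.
Qed.

(** A zero of the equation makes [k] track [s], so the ray exists down to level 0. It meets the
    orbit of [k] at level [N], but may still start at another point than [k]. *)
Lemma closed_orbit s b A a t k K N : Dom s b A -> b < a -> ~ preperiodic s -> 0 <= K -> St s K N a -> Cmod k <= K -> a <= t ->
  Defs.iter (expmap k) N k = G s k t N ->
  exists Gam, Ray 0 k s a Gam /\ Gam N t = Defs.iter (expmap k) N k.
Proof.
  intros HD Hb Hnp HK HS Hk Ht HE.
  assert (HSt : St s K N t) by (apply (St_mono s K N a); auto).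
  assert (E : forall n, Defs.iter (expmap k) (n + N) k = G s k t (n + N)).
  { induction n; auto. change (S n + N)%nat with (S (n + N)). rewrite iter_S, IHn. apply (G_f s K N); auto. lia. }
  destruct (Ray_exists k s b A a t HD Hb Hnp) as [Gam HR].
  { exists N. intros n Hn. replace n with ((n - N) + N)%nat by lia. rewrite E.
    eapply Rle_trans; [apply (G_base_half s K N); auto; lia|lra]. }
  exists Gam. split; auto. rewrite HE.
  apply (Ray_unique N k s b A a Gam (fun n tau => G s k tau n) HD Hb); auto.
  - apply (Ray_sub 0 N k s a a); auto. lia. lra.
  - apply (Ray_G s K N); auto.
Qed.

Lemma contraction_fixed (T : C -> C) L k0 : Cmod k0 <= L -> (forall k, Cmod k <= L -> Cmod (T k) <= L) ->
  (forall k k', Cmod k <= L -> Cmod k' <= L -> Cmod (T k - T k')%C <= 1 / 2 * Cmod (k - k')%C) ->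
  Cmod (T k0 - k0)%C <= 1 -> exists k, Cmod k <= L /\ T k = k.
Proof.
  intros H0 HT HL H1. set (u := fun n => Nat.iter n T k0).
  assert (B : forall n, Cmod (u n) <= L). { induction n; simpl; auto. }
  assert (D : forall n, Cmod (u (S n) - u n)%C <= (1 / 2) ^ n).
  { induction n. simpl. auto. change (u (S (S n))) with (T (u (S n))). change (u (S n)) with (T (u n)) at 2.
    eapply Rle_trans; [apply HL; auto|]. simpl pow. lra. }
  assert (Q := Clim_geom u D). set (k := Clim u) in *.
  assert (Hk : Cmod k <= L).
  { apply le_of_geom. intro j. specialize (Q j). specialize (B j). assert (T1 := Cmod_le_sub k (u j)).
    rewrite (Cmod_sub_sym k (u j)) in T1. assert (P := pow_lt (1 / 2) j ltac:(lra)). lra. }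
  exists k. split; auto. apply Csub_eq. apply Cmod_eq_0. apply Rle_antisym; [|apply Cmod_ge_0].
  apply le_of_geom. intro j. assert (Q1 := Q j). assert (Q2 := Q (S j)). simpl pow in Q2.
  assert (T1 := Cmod_sub_triangle (T k) (u (S j)) k). change (u (S j)) with (T (u j)) in T1 at 1.
  assert (T2 := HL k (u j) Hk (B j)). rewrite (Cmod_sub_sym k (u j)) in T2.
  assert (P := pow_lt (1 / 2) j ltac:(lra)). change (T (u j)) with (u (S j)) in *. lra.
Qed.

Lemma G_start_unique s K t k k' : 0 <= K -> St s K 0 t -> Cmod k <= K -> Cmod k' <= K ->
  G s k t 0 = k -> G s k' t 0 = k' -> k = k'.
Proof.
  intros HK HS Hk Hk' E E'. assert (L := G_lip s K 0 t k k' 0 HK HS Hk Hk' (Nat.le_refl _)). rewrite E, E' in L.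
  apply Csub_eq, Cmod_eq_0. assert (P := Cmod_ge_0 (k - k')%C). lra.
Qed.

(** [k -> G s k t 0] has Lipschitz constant 1/2, so [k - G s k t 0] grows at least like half the
    distance from its zero [k0]. Pulling back from level [N] to 0 only shrinks differences, so the
    difference at level [N] is no smaller. *)
Lemma start_simple s K t k0 N : 0 <= K -> St s K 0 t -> Cmod k0 <= K - 1 -> G s k0 t 0 = k0 ->
  simple_zero (fun k => (Defs.iter (expmap k) N k - G s k t N)%C) k0.
Proof.
  intros HK HS Hk E0.
  assert (EN : forall n, Defs.iter (expmap k0) n k0 = G s k0 t n).
  { induction n. rewrite E0. auto. rewrite iter_S, IHn. apply (G_f s K 0); auto. lra. lia. }
  destruct (orbit_cont N k0 (1 / 2) ltac:(lra)) as (d & Hd & B).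
  exists (1 / 2), (Rmin d 1). split; [lra|]. split. { apply Rmin_glb_lt; lra. }
  intros k Hkd. assert (M1 := Rmin_l d 1). assert (M2 := Rmin_r d 1).
  assert (HkK : Cmod k <= K). { assert (T := Cmod_le_sub k k0). lra. }
  set (p := fun n => Defs.iter (expmap k) n k). set (g := fun n => G s k t n).
  assert (Hp : forall n, (n <= N)%nat -> Cmod (p n - base s t n)%C <= 1).
  { intros n Hn. specialize (B k ltac:(lra) n Hn). rewrite EN in B.
    assert (Q := G_base_half s K 0 t k0 n HK HS ltac:(lra) ltac:(lia)).
    assert (T := Cmod_sub_triangle (p n) (G s k0 t n) (base s t n)). unfold p in *. lra. }
  assert (Hg : forall n, Cmod (g n - base s t n)%C <= 1).
  { intro n. eapply Rle_trans; [apply (G_base_half s K 0); auto; lia|lra]. }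
  assert (D : forall j, (j <= N)%nat -> Cmod (p (N - j)%nat - g (N - j)%nat)%C <= Cmod (p N - g N)%C).
  { induction j; intro Hj. rewrite Nat.sub_0_r. lra. specialize (IHj ltac:(lia)). eapply Rle_trans; [|exact IHj].
    set (n := (N - S j)%nat). replace (N - j)%nat with (S n) by (unfold n; lia).
    assert (Ep : p n = (Clog (p (S n) - k) + twopii (s n))%C).
    { apply (log_of_near s K 0 t); auto. lia. assert (Q := Hp n ltac:(unfold n; lia)). lra. apply Hp. unfold n; lia. }
    assert (Eg : g n = (Clog (g (S n) - k) + twopii (s n))%C). { apply (G_log s K 0); auto. lia. }
    rewrite Ep, Eg. eapply Rle_trans; [apply (log_contract s K 0 t t k k); auto; try lia|].
    - apply Hp. unfold n; lia.
    - rewrite (Cmod_diag k). assert (P := Cmod_ge_0 (p (S n) - g (S n))%C). lra. }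
  specialize (D N (Nat.le_refl N)). rewrite Nat.sub_diag in D. unfold p, g in D. change (Defs.iter (expmap k) 0 k) with k in D.
  assert (Q := G_lip s K 0 t k k0 0 HK HS HkK ltac:(lra) (Nat.le_refl _)). rewrite E0 in Q.
  assert (T := Cmod_sub_triangle k (G s k t 0) k0). fold (g N) in D. lra.
Qed.

(** The starting potential: with [L = exp t2 / 32], the bound [param_bound] reduces to [L], and the
    fixed point map sends the disc of radius [L] into that of radius [L - 1]. *)
Lemma large_start s b A t1 K0 : Dom s b A -> exists t2, t1 <= t2 /\ K0 <= exp t2 / 32 /\ St s (exp t2 / 32) 0 t2 /\
  t2 + 2 * PI * Rabs (IZR (s O)) + 1 <= exp t2 / 32 - 1.
Proof.
  intros HD. destruct (St_large s b A HD) as (X & _ & HX). set (S0 := 2 * PI * Rabs (IZR (s O))).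
  assert (HS0 : 0 <= S0). { unfold S0. assert (P := PI_pos). assert (Q := Rabs_pos (IZR (s O))). nra. }
  exists (Rabs X + Rabs t1 + 32 * Rabs K0 + S0 + 300). set (t2 := Rabs X + Rabs t1 + 32 * Rabs K0 + S0 + 300).
  assert (R1 := Rle_abs X). assert (R2 := Rle_abs t1). assert (R3 := Rle_abs K0).
  assert (P1 := Rabs_pos X). assert (P2 := Rabs_pos t1). assert (P3 := Rabs_pos K0).
  assert (HE := exp_quad t2 ltac:(unfold t2; lra)). assert (Ht2 : 300 <= t2) by (unfold t2; lra).
  assert (HE2 : 70 * t2 <= t2 ^ 2 / 4) by nra.
  split; [unfold t2; lra|]. split; [unfold t2 in *; lra|]. split; [apply HX; unfold t2; lra|].
  unfold t2 in *. lra.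
Qed.

Theorem param_exists_unique s b A a t : Dom s b A -> b < a -> a < t -> ~ preperiodic s ->
  exists k, on_ray s a t k /\ forall k', on_ray s a t k' -> k' = k.
Proof.
  intros HD Hb Ha Hnp. assert (Hbt : b < t) by lra.
  destruct (param_bound s b A t HD Hbt) as (K0 & HK0).
  destruct (large_start s b A t K0 HD) as (t2 & Ht2 & HKt & HSt2 & Hbig). set (L := exp t2 / 32) in *.
  assert (PL : 0 < L) by (unfold L; assert (P := exp_pos t2); lra).
  destruct (St_of_Dom s b A a (L + 1) HD Hb) as [N HSN].
  set (H := fun t k => (Defs.iter (expmap k) N k - G s k t N)%C).
  assert (HbL : forall u k, t <= u <= t2 -> on_ray s a u k -> Cmod k <= L).
  { intros u k Hu (Gam & HR & H0). assert (Q := HK0 u k Gam ltac:(lra)). 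
    assert (E : exp u / 32 <= L). { unfold L. assert (exp u <= exp t2) by (apply exp_mono; lra). lra. }
    eapply Rle_trans; [apply Q; auto|]. apply (Ray_sub 0 0 k s a u); auto; lra. apply Rmax_lub; auto. }
  assert (HSol0 : forall u k, t <= u <= t2 -> on_ray s a u k -> H u k = 0%C).
  { intros u k Hu HSol. assert (HkL := HbL u k Hu HSol). destruct HSol as (Gam & HR & H0). unfold H. rewrite <- H0 at 2.
    rewrite (Ray_orbit 0 k s a Gam 0 u N HR) by (lia || lra). rewrite Nat.add_0_r.
    rewrite (Ray_unique N k s b A a Gam (fun n tau => G s k tau n) HD Hb). ring.
    apply (Ray_sub 0 N k s a a); auto; lia || lra. apply (Ray_G s (L + 1) N); auto; lra. lia. lra. }
  assert (HHol : forall u k, t <= u <= t2 -> Cmod k < L + 1 -> Hol2 (H u) k).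
  { intros u k Hu Hk. unfold H. apply Hol2_minus. apply orbit_hol. apply (G_hol s (L + 1) N); auto. lra.
    apply (St_mono s _ N a); auto. lra. }
  assert (HTc : forall u e, t <= u <= t2 -> 0 < e -> exists d, 0 < d /\ forall u' k, t <= u' <= t2 -> Rabs (u' - u) < d ->
    Cmod k < L + 1 -> Cmod (H u' k - H u k)%C <= e).
  { intros u e Hu He. destruct (G_tau_cont s (L + 1) N a u N e ltac:(lra) HSN ltac:(lra) (Nat.le_refl N) He) as (d & Hd & Q).
    exists d. split; auto. intros u' k Hu' Hd' Hk. specialize (Q u' k ltac:(lra) Hd' ltac:(lra)).
    unfold H. replace (Defs.iter (expmap k) N k - G s k u' N - (Defs.iter (expmap k) N k - G s k u N))%C with (G s k u N - G s k u' N)%C by ring.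
    rewrite (Cmod_sub_sym (G s k u N) (G s k u' N)). lra. }
  assert (HH0 : forall u k, t <= u <= t2 -> Cmod k < L + 1 -> H u k = 0%C -> exists Gam, Ray 0 k s a Gam /\ Gam N u = Defs.iter (expmap k) N k).
  { intros u k Hu Hk HE. apply (closed_orbit s b A a u k (L + 1) N); auto; try lra. apply Csub_eq. exact HE. }
  assert (Hgood : good_at (on_ray s a) H t).
  { apply (zero_continuation (on_ray s a) H t t2 L); auto.
    (* Closedness: the limit is a zero by continuity, and the comparison with nearby solutions shows
       that its ray starts at [k]. *)
    - intros u k Hu Hcl.
      assert (HkL : Cmod k <= L).
      { apply Rnot_lt_le. intro X. destruct (Hcl (Cmod k - L) ltac:(lra)) as (u' & k' & Hu' & _ & Hk' & HS').
        specialize (HbL u' k' Hu' HS'). assert (T := Cmod_le_sub k k'). rewrite (Cmod_sub_sym k k') in T. lra. }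
      assert (HE : H u k = 0%C).
      { apply Cmod_eq_0. apply Rle_antisym; [|apply Cmod_ge_0]. apply Rnot_lt_le. intro X. set (e := Cmod (H u k)) in *.
        destruct (HTc u (e / 4) Hu ltac:(lra)) as (d & Hd & Q).
        destruct (Hol2_cont _ _ (HHol u k Hu ltac:(lra)) (e / 4) ltac:(lra)) as (d' & Hd' & Q').
        destruct (Hcl (Rmin d d')) as (u' & k' & Hu' & Huu & Hk' & HS'). { now apply Rmin_glb_lt. }
        assert (M1 := Rmin_l d d'). assert (M2 := Rmin_r d d'). assert (Lk := HbL u' k' Hu' HS').
        specialize (Q u' k' Hu' ltac:(lra) ltac:(lra)). specialize (Q' k' ltac:(lra)).
        rewrite (HSol0 u' k' Hu' HS') in Q. rewrite (Cmod_sub_sym (RtoC 0) (H u k')) in Q. 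
        replace (H u k' - 0)%C with (H u k') in Q by ring. 
        assert (T := Cmod_le_sub (H u k) (H u k')). rewrite (Cmod_sub_sym (H u k) (H u k')) in T. fold e in T. lra. }
      destruct (HH0 u k Hu ltac:(lra) HE) as (Gam & HR & HN). exists Gam. split; auto.
      apply (ray_start s a k Gam u N); auto. lra.
      destruct (ray_orbit_near s b A a k Gam u N HD Hb ltac:(lra) HR) as (d & Hd & Q).
      destruct (Hcl d Hd) as (u' & k' & Hu' & Huu & Hk' & (Gam' & HR' & H0')).
      intros n Hn. destruct (Q u' k' Gam' ltac:(lra) Huu Hk' HR' n Hn) as [Q1 Q2].
      rewrite <- H0' in Q2 at 2. rewrite (Ray_orbit 0 k' s a Gam' 0 u' n HR') in Q2 by (lia || lra). rewrite Nat.add_0_r in Q2.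
      assert (T := Cmod_sub_triangle (Gam n u) (Gam' n u') (Defs.iter (expmap k) n k)).
      rewrite (Cmod_sub_sym (Gam n u) (Gam' n u')) in T. lra.
    (* Openness: a zero close to a solution has its ray close to that of the solution, so it starts
       at the parameter. *)
    - intros u k Hu HSol. assert (HkL := HbL u k Hu HSol). destruct HSol as (Gam0 & HR0 & H00).
      destruct (ray_orbit_near s b A a k Gam0 u N HD Hb ltac:(lra) HR0) as (d & Hd & Q).
      exists (Rmin d 1). split. { apply Rmin_glb_lt; lra. }
      assert (M1 := Rmin_l d 1). assert (M2 := Rmin_r d 1).
      intros u' k' Hu' Huu Hk' HE. assert (T0 := Cmod_le_sub k' k).
      destruct (HH0 u' k' Hu' ltac:(lra) HE) as (Gam & HR & HN). exists Gam. split; auto.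
      apply (ray_start s a k' Gam u' N); auto. lra.
      intros n Hn. destruct (Q u' k' Gam ltac:(lra) ltac:(lra) ltac:(lra) HR n Hn) as [Q1 Q2].
      rewrite <- H00 in Q2 at 2. rewrite (Ray_orbit 0 k s a Gam0 0 u n HR0) in Q2 by (lia || lra). rewrite Nat.add_0_r in Q2.
      assert (T := Cmod_sub_triangle (Gam n u') (Gam0 n u) (Defs.iter (expmap k') n k')).
      rewrite (Cmod_sub_sym (Gam0 n u) (Defs.iter (expmap k') n k')) in T. lra.
    (* At [t2] the solutions are the fixed points of the contraction [T]. *)
    - assert (HP := PI_pos). set (T := fun k => G s k t2 0). assert (HL0 : 0 <= L) by lra.
      assert (HB : Cmod (base s t2 0) <= L - 2).
      { eapply Rle_trans; [apply Cmod_le_ReIm|]. change (Re (base s t2 0)) with t2. change (Im (base s t2 0)) with (2 * PI * IZR (s O)).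
        rewrite Rabs_mult, (Rabs_pos_eq (2 * PI)), (Rabs_pos_eq t2) by (destruct HD; lra). lra. }
      assert (HT : forall k, Cmod k <= L -> Cmod (T k) <= L - 1 /\ Cmod (T k - base s t2 0)%C <= 1 / 2).
      { intros k Hk. assert (Q := G_base_half s L 0 t2 k 0 HL0 HSt2 Hk (Nat.le_refl _)). fold (T k) in Q. split; auto.
        assert (Q2 := Cmod_le_sub (T k) (base s t2 0)). lra. }
      destruct (contraction_fixed T L (base s t2 0)) as (k & Hk & Ek).
      + lra.
      + intros k Hk. destruct (HT k Hk). lra.
      + intros k k' Hk Hk'. apply (G_lip s L 0); auto.
      + destruct (HT (base s t2 0) ltac:(lra)). lra.
      + assert (HkL1 : Cmod k <= L - 1). { rewrite <- Ek. apply HT. auto. }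
        exists k. split; [|split].
        * assert (EN : forall n, Defs.iter (expmap k) n k = G s k t2 n).
          { induction n. symmetry. exact Ek. rewrite iter_S, IHn. apply (G_f s L 0); auto. lia. }
          destruct (Ray_exists k s b A a t2 HD Hb Hnp) as [Gam HR].
          { exists O. intros n Hn. rewrite EN. eapply Rle_trans; [apply (G_base_half s L 0); auto|lra]. }
          exists Gam. split; auto. rewrite <- Ek. apply (Ray_unique 0 k s b A t2 Gam (fun n tau => G s k tau n)); auto; try lra.
          apply (Ray_sub 0 0 k s a t2); auto; lra. apply (Ray_G s L 0); auto.
        * intros k' HS'. assert (Hk' := HbL t2 k' ltac:(lra) HS'). destruct HS' as (Gam' & HR' & H0').
          apply (G_start_unique s L t2); auto. rewrite <- H0' at 2. symmetry.
          apply (Ray_unique 0 k' s b A t2 Gam' (fun n tau => G s k' tau n)); auto; try lra.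
          apply (Ray_sub 0 0 k' s a t2); auto; lra. apply (Ray_G s L 0); auto.
        * apply (start_simple s L); auto. }
  destruct Hgood as (k & K1 & K2 & _). exists k. auto.
Qed.

(** * Potentials and addresses *)

Lemma half_turn_im z n : strip n z -> 0 < Re (Cexp z) -> Rabs (Im z - 2 * PI * IZR n) < PI / 2.
Proof.
  unfold strip. intros Hs Hp. set (w := (z - twopii n)%C).
  assert (E : Cexp w = Cexp z). { replace z with (w + twopii n)%C by (unfold w; ring). now rewrite twopii_exp. }
  rewrite <- E, re_Cexp in Hp. assert (I : Im w = Im z - 2 * PI * IZR n) by (unfold w; rewrite im_minus; reflexivity).
  rewrite <- I. assert (HI : - PI < Im w < PI) by lra. assert (P := exp_pos (Re w)).
  assert (C0 : 0 < cos (Im w)). { apply Rmult_lt_reg_l with (exp (Re w)); lra. }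
  apply Rabs_lt_between. split; apply Rnot_le_lt; intro L.
  - assert (Q := cos_le_0 (- Im w) ltac:(lra) ltac:(lra)). rewrite cos_neg in Q. lra.
  - assert (Q := cos_le_0 (Im w) ltac:(lra) ltac:(lra)). lra.
Qed.

(** As [k] lies outside the half plane, [f z] inside it means that [exp z] has positive real part,
    which halves the strip. *)
Lemma tract_im k r n z : ~ half_plane r k -> tract k r n z -> Rabs (Im z - 2 * PI * IZR n) < PI / 2.
Proof.
  unfold half_plane. intros Hr (T & (z0 & Hz0 & HT) & HS & Hz). apply half_turn_im. auto.
  apply HT in Hz. destruct Hz as (p & _ & Hp & _ & H1). specialize (Hp 1 ltac:(lra)). rewrite H1 in Hp.
  unfold half_plane, expmap in Hp. rewrite re_plus in Hp. lra.
Qed.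

Lemma potential_unique s N t t' (z : nat -> C) : 0 < t -> 0 < t' ->
  (forall j, (N <= j)%nat -> Cmod (z j - base s t j)%C <= 1) -> (forall j, (N <= j)%nat -> Cmod (z j - base s t' j)%C <= 1) -> t = t'.
Proof.
  assert (A : forall t t', 0 < t -> t < t' -> (forall j, (N <= j)%nat -> Cmod (z j - base s t j)%C <= 1) ->
    (forall j, (N <= j)%nat -> Cmod (z j - base s t' j)%C <= 1) -> False).
  { clear t t'. intros t t' Ht H H1 H2. destruct (Fn_gap t t' 2 Ht H) as [J HJ]. specialize (HJ (J + N)%nat ltac:(lia)).
    specialize (H1 (J + N)%nat ltac:(lia)). specialize (H2 (J + N)%nat ltac:(lia)).
    assert (R1 := re_le_Cmod (z (J + N)%nat - base s t (J + N))%C). assert (R2 := re_le_Cmod (z (J + N)%nat - base s t' (J + N))%C).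
    rewrite re_minus in R1, R2. change (Re (base s t (J + N))) with (Fn (J + N) t) in R1. change (Re (base s t' (J + N))) with (Fn (J + N) t') in R2.
    assert (B1 : Rabs (Re (z (J + N)%nat) - Fn (J + N) t) <= 1) by lra. assert (B2 : Rabs (Re (z (J + N)%nat) - Fn (J + N) t') <= 1) by lra.
    apply Rabs_le_between in B1. apply Rabs_le_between in B2. lra. }
  intros Ht Ht' H1 H2. destruct (Rtotal_order t t') as [L|[L|L]]; auto; exfalso; eauto.
Qed.

Definition increasing_from0 (tau : R -> R) := forall u v, 0 <= u -> u < v -> tau u < tau v.
Definition continuous_from0 (tau : R -> R) := forall v, 0 <= v -> forall e, 0 < e ->
  exists d, 0 < d /\ forall u, 0 <= u -> Rabs (u - v) < d -> Rabs (tau u - tau v) < e.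

Lemma far_ext k N a a' z : (forall n, (N <= n)%nat -> a n = a' n) -> far k N a z -> far k N a' z.
Proof. intros E H n Hn. destruct (H n Hn) as (A & B & D). rewrite <- (E n Hn). auto. Qed.

Lemma far_address k N a s t z : far k N a z -> forall n, (N <= n)%nat -> Cmod (z n - base s t n)%C <= 1 -> a n = s n.
Proof.
  intros H n Hn B. destruct (H n Hn) as (_ & E & _). assert (I := im_le_Cmod (z n - base s t n)%C).
  rewrite im_minus in I. change (Im (base s t n)) with (2 * PI * IZR (s n)) in I.
  assert (J := im_Clog (z (S n) - k)%C). assert (Q := Rle_trans _ _ _ I B). rewrite E, im_plus in Q.
  change (Im (twopii (a n))) with (2 * PI * IZR (a n)) in Q. assert (P := PI_gt_3).
  apply Rabs_le_between in Q. assert (D : IZR (a n - s n) = IZR (a n) - IZR (s n)) by apply minus_IZR.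
  assert (a n - s n < 1)%Z by (apply lt_IZR; rewrite D; nra). assert (-1 < a n - s n)%Z by (apply lt_IZR; rewrite D; nra). lia.
Qed.

Lemma Dom_shift s b A p : Dom s b A -> Dom (fun i => s (i + p)%nat) (Fn p b) A.
Proof.
  intros (H1 & H2 & H3). split; [apply Fn_pos; auto|split; auto]. intro n. rewrite <- Fn_add. apply H3.
Qed.

Lemma base_shift s p t j : base (fun i => s (i + p)%nat) (Fn p t) j = base s t (j + p).
Proof. unfold base. now rewrite Fn_add. Qed.

Lemma tail_unbounded k c a N tau : Tail k c -> (forall v, 0 <= v -> 0 < tau v) ->
  (forall v, 0 <= v -> Cmod (Defs.iter (expmap k) N (c v) - base a (tau v) N)%C <= 1) ->
  forall M, exists V, forall v, V <= v -> 0 <= v -> M <= tau v.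
Proof.
  intros (_ & H & _) Hp HB M. destruct (H N (1 + Cmod (base a (Rmax M 0) N))%R) as [V HV].
  exists V. intros v Hv Hv0. apply Rnot_lt_le. intro L. specialize (HV v Hv). specialize (HB v Hv0). specialize (Hp v Hv0).
  assert (T := Cmod_le_sub (Defs.iter (expmap k) N (c v)) (base a (tau v) N)).
  assert (Cmod (base a (tau v) N) <= Cmod (base a (Rmax M 0) N)); [|lra].
  unfold Cmod. apply sqrt_le_1_alt. unfold base. simpl fst. simpl snd.
  assert (P1 := Fn_pos N (tau v) Hp). assert (P2 : Fn N (tau v) <= Fn N (Rmax M 0)).
  { apply Fn_mono. assert (Q := Rmax_l M 0). lra. } nra.
Qed.

(** A tail starting at a point of known potential runs along the constructed ray up to a constant
    period. The period is determined afterwards from the address, by comparing imaginary parts near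
    infinity. *)
Lemma tail_align s b A a k c p t Gam : Dom s b A -> b < a -> a <= t -> Tail k c ->
  (exists N, forall j, (N <= j)%nat -> Cmod (Defs.iter (expmap k) j (c 0) - base s t (j + p))%C <= 1) ->
  Ray p k s a Gam -> (forall j, (1 <= j)%nat -> Defs.iter (expmap k) j (c 0) = Gam (j + p)%nat t) ->
  exists tau : R -> R, (forall v, 0 <= v -> t <= tau v) /\ (forall M, exists V, forall v, V <= v -> 0 <= v -> M <= tau v) /\
    forall v, 0 <= v -> (c v - Gam p (tau v))%C = (c 0 - Gam p t)%C.
Proof.
  intros HD Hb Ht HT [N0 HN0] HR Hj. assert (Hb0 : 0 < b) by apply HD. assert (Ht0 : 0 < t) by lra.
  set (s' := fun i => s (i + p)%nat).
  assert (HN0' : forall j, (N0 <= j)%nat -> Cmod (Defs.iter (expmap k) j (c 0) - base s' (Fn p t) j)%C <= 1).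
  { intros j Hj0. unfold s'. rewrite base_shift. auto. }
  destruct (tail_far k c HT) as (N1 & a1 & HF1).
  destruct (base_thin s' (Fn p b) A (Fn p t) N0 (fun j => Defs.iter (expmap k) j (c 0))) as [N2 HN2]; auto.
  { apply Dom_shift; auto. } { apply Fn_lt. lra. }
  set (N := (N0 + N1 + N2)%nat).
  assert (HF : forall v, 0 <= v -> far k N s' (fun n => Defs.iter (expmap k) n (c v))).
  { intros v Hv. apply (far_ext k N a1). 2:{ apply (far_N k N1); auto. unfold N; lia. }
    intros n Hn. apply (far_address k N1 a1 s' (Fn p t) (fun n => Defs.iter (expmap k) n (c 0))); auto.
    apply HF1; lra. unfold N in Hn; lia. apply HN0'. unfold N in Hn; lia. }
  destruct (tail_potential k c N s' HT HF) as (tau & B1 & B2 & B3).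
  { intros n Hn. apply HN2. unfold N in Hn; lia. }
  assert (E0 : tau 0 = Fn p t).
  { apply (potential_unique s' N (tau 0) (Fn p t) (fun n => Defs.iter (expmap k) n (c 0))).
    - apply B1; lra. - apply Fn_pos; auto. - apply B1; lra. - intros j Hj0. apply HN0'. unfold N in Hj0; lia. }
  (* [tau] is measured at level [p], the parameter of [Gam] at level 0. *)
  set (ta := fun v => Finv p (tau v)).
  assert (Hp : forall v, 0 <= v -> 0 < tau v) by (intros; apply B1; auto).
  assert (HFt : forall v, 0 <= v -> Fn p (ta v) = tau v) by (intros; apply Fn_Finv; auto).
  assert (Hinj : forall x y, Fn p x <= Fn p y -> x <= y). { intros x y H. apply Rnot_lt_le. intro L. apply (Fn_lt p) in L. lra. }
  assert (Hge : forall v, 0 <= v -> t <= ta v).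
  { intros v Hv. apply Hinj. rewrite HFt by auto. rewrite <- E0. destruct (Req_dec v 0) as [->|Ne]. lra. left. apply B2; lra. }
  assert (Eta0 : ta 0 = t). { apply Rle_antisym; [|apply Hge; lra]. apply Hinj. rewrite HFt by lra. lra. }
  exists ta. split; [auto|split].
  - intro M. destruct (tail_unbounded k c s' N tau HT Hp ltac:(intros; apply B1; auto) (Fn p M)) as [V HV].
    exists V. intros v Hv Hv0. apply Hinj. rewrite HFt by auto. auto.
  - intros v Hv. rewrite <- Eta0. apply (tail_follow p k s b A a Gam p c ta 0); auto; try lra.
    + apply HT.
    + intros u Hu. specialize (Hge u Hu). lra.
    + intros u Hu e He. destruct (B3 u Hu e He) as (d & Hd & Q). exists d. split; auto. intros w Hw Hwu.
      eapply Rle_lt_trans; [apply Finv_lip|]; auto.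
    + exists N. intros j u Hj0 Hu. unfold ta. rewrite base_level by auto. apply B1; auto.
    + intros j Hj0. rewrite Eta0. auto.
Qed.

(* Every point of a ray is preceded by slower ones, so it has a potential. *)
Lemma ray_curve_potential k del u : is_ray_curve (expmap k) del -> 0 < u ->
  exists N a (tau : R -> R) t', Tail k (fun v => del (u + v)) /\
    (forall v, 0 <= v -> 0 < tau v /\ dominates a (tau v) /\
      forall n, (N <= n)%nat -> Cmod (Defs.iter (expmap k) n (del (u + v)%R) - base a (tau v) n)%C <= 1) /\
    increasing_from0 tau /\ continuous_from0 tau /\ dominates a t' /\ t' < tau 0.
Proof.
  intros (_ & _ & _ & HT) Hu.
  assert (T0 : forall x, 0 < x -> Tail k (fun v => del (x + v))) by (intros; apply Tail_iff; auto).
  destruct (tail_far k _ (T0 (u / 4) ltac:(lra))) as (N & a & HF).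
  destruct (tail_order k _ N a (T0 (u / 4) ltac:(lra)) HF 0 (u / 4) ltac:(lra) ltac:(lra)) as (n & Hn & Hord).
  assert (HF0 := HF 0 ltac:(lra)). assert (HF1 := HF (u / 4) ltac:(lra)).
  assert (Hth := faster_thin k N a _ _ n HF0 HF1 Hn Hord).
  set (N' := (N + S (S n))%nat).
  (* The point at [u / 4] is slow, so that at [u / 2] is thin and has a potential [t']; the points
     from [u] on have larger ones. This is how [t' < tau 0] with [t'] dominating comes about. *)
  destruct (tail_potential k (fun v => del (u / 2 + v)) N' a) as (tau & B1 & B2 & B3).
  - apply T0. lra.
  - intros v Hv. apply (far_N k N N'). unfold N'; lia. assert (Q := HF (u / 4 + v) ltac:(lra)). cbv beta in Q.
    replace (u / 4 + (u / 4 + v)) with (u / 2 + v) in Q by field. exact Q.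
  - intros m Hm. replace (u / 2 + 0) with (u / 4 + u / 4) by field. apply Hth. unfold N' in Hm; lia.
  - exists N', a, (fun v => tau (u / 2 + v)), (tau 0). split; [|split; [|split; [|split; [|split]]]].
    + apply T0; auto.
    + intros v Hv. destruct (B1 (u / 2 + v) ltac:(lra)) as (P1 & P2 & P3). split; [auto|split; auto].
      intros m Hm. specialize (P3 m Hm). replace (u / 2 + (u / 2 + v)) with (u + v) in P3 by field. exact P3.
    + intros x y Hx Hy. apply B2; lra.
    + intros v Hv e He. destruct (B3 (u / 2 + v) ltac:(lra) e He) as (d & Hd & Q). exists d. split; auto.
      intros w Hw Hwv. apply Q. lra. replace (u / 2 + w - (u / 2 + v)) with (w - v) by ring. auto.
    + apply B1; lra.
    + apply B2; lra.
Qed.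

Lemma orbit_is_G s b A t k : Dom s b A -> b < t -> tracks k s t -> exists N, St s (Cmod k) N t /\
  forall n, (N <= n)%nat -> Defs.iter (expmap k) n k = G s k t n.
Proof.
  intros HD Hb [N0 H0]. destruct (St_of_Dom s b A t (Cmod k) HD Hb) as [N1 HS].
  exists (N0 + N1)%nat. split. apply (St_N s _ N1); auto; lia. intros n Hn.
  apply (orbit_unique s (Cmod k) (N0 + N1) t k (fun n => Defs.iter (expmap k) n k) (fun n => G s k t n)); auto.
  - apply Cmod_ge_0.
  - apply (St_N s _ N1); auto; lia.
  - lra.
  - intros m Hm. apply (G_f s (Cmod k) N1); auto. apply Cmod_ge_0. lra. lia.
  - intros m Hm. apply H0. lia.
  - intros m Hm. eapply Rle_trans; [apply (G_base_half s (Cmod k) N1); auto; lia || lra || apply Cmod_ge_0|lra].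
Qed.

Lemma base_diff s t n z : (z - RtoC (Nat.iter n F t) - 2 * PI * Ci * IZR (s n))%C = (z - base s t n)%C.
Proof. unfold base, Fn. apply Cext; simpl; ring. Qed.

(** Being within 1 of the base points improves by itself: the orbit eventually coincides with [G],
    whose distance from [base] is at most [err], and this tends to 0. *)
Lemma tracks_limit s b A t k : Dom s b A -> b < t -> tracks k s t ->
  is_lim_seq (fun n => Cmod (Defs.iter (expmap k) n k - RtoC (Nat.iter n F t) - 2 * PI * Ci * IZR (s n))%C) 0.
Proof.
  intros HD Hb HT. destruct (orbit_is_G s b A t k HD Hb HT) as (N & HS & HE).
  apply is_lim_seq_0. intros e He. destruct (err_small s b A t (Cmod k) (e / 2) HD Hb ltac:(lra)) as [N' H'].
  exists (N + N')%nat. intros n Hn. rewrite base_diff, HE by lia. rewrite Rabs_pos_eq by apply Cmod_ge_0.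
  apply Rle_lt_trans with (e / 2); [|lra]. eapply Rle_trans; [apply (G_base s (Cmod k) N); auto; lia || lra || apply Cmod_ge_0|].
  apply H'. lia. lra.
Qed.

Lemma limit_tracks s t k :
  is_lim_seq (fun n => Cmod (Defs.iter (expmap k) n k - RtoC (Nat.iter n F t) - 2 * PI * Ci * IZR (s n))%C) 0 -> tracks k s t.
Proof.
  intro H. destruct (proj1 (is_lim_seq_0 _) H 1 Rlt_0_1) as [N HN]. exists N. intros n Hn. specialize (HN n Hn).
  rewrite base_diff in HN. rewrite Rabs_pos_eq in HN by apply Cmod_ge_0. lra.
Qed.

(** * From systems of rays to dynamic rays and addresses *)

Lemma ray_close N k s a Gam x : Ray N k s a Gam -> a <= x ->
  exists M, (N <= M)%nat /\ forall n tau, (M <= n)%nat -> x <= tau -> Cmod (Gam n tau - base s tau n)%C <= 1.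
Proof.
  intros (_ & _ & [M HM] & _) Hx. exists (M + N)%nat. split. lia. intros n tau Hn Ht. apply HM; lia || lra.
Qed.

Lemma ray_inj N k s a Gam x y : 0 < a -> Ray N k s a Gam -> a <= x -> a <= y -> Gam N x = Gam N y -> x = y.
Proof.
  intros Ha HR Hx Hy E. destruct (ray_close N k s a Gam a HR (Rle_refl a)) as (M & HNM & HM).
  apply (potential_unique s M x y (fun n => Gam n x)); try lra.
  - intros j Hj. apply HM; auto.
  - intros j Hj. replace (Gam j x) with (Gam j y). apply HM; auto.
    replace j with ((j - N) + N)%nat by lia.
    rewrite <- (Ray_orbit N k s a Gam N y (j - N) HR (Nat.le_refl N) Hy).
    rewrite <- (Ray_orbit N k s a Gam N x (j - N) HR (Nat.le_refl N) Hx). now rewrite E.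
Qed.

Lemma ray_tail N k s a Gam x : 0 < a -> Ray N k s a Gam -> a <= x -> Tail k (fun v => Gam N (x + v)).
Proof.
  intros Ha HR Hx. assert (HRN := Ray_sub N N k s a a Gam (Nat.le_refl N) (Rle_refl a) HR).
  assert (HO : forall n v, 0 <= v -> Defs.iter (expmap k) n (Gam N (x + v)) = Gam (n + N)%nat (x + v)).
  { intros n v Hv. apply (Ray_orbit N k s a Gam N (x + v) n HR). lia. lra. }
  assert (Hlow : forall z t n, 0 < t -> Cmod (z - base s t n)%C <= 1 -> Fn n t - 1 <= Cmod z).
  { intros z t n Ht H. assert (R1 := Cmod_re_lower (base s t n) z). change (Re (base s t n)) with (Fn n t) in R1.
    assert (R2 := re_le_Cmod z). assert (R3 := Rle_abs (Re z)). lra. }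
  split; [|split; [|split]].
  - assert (HC : ccont (from a) (Gam N)) by (apply HR; lia).
    intros v Hv e He. unfold from in Hv. destruct (HC (x + v) ltac:(unfold from; lra) e He) as (d & Hd & Q). exists d. split; auto.
    intros w Hw Hwv. apply Q. unfold from in *; lra. replace (x + w - (x + v)) with (w - v) by ring. auto.
  - intros n M. destruct HR as (_ & _ & _ & H4). destruct (H4 (n + N)%nat ltac:(lia)) as [T HT].
    exists (Rabs T + Rabs M + 2). intros v Hv. assert (P1 := Rabs_pos T). assert (P2 := Rabs_pos M).
    assert (Q1 := Rle_abs T). assert (Q2 := Rle_abs M). rewrite HO by lra.
    assert (Q := Hlow _ (x + v) (n + N)%nat ltac:(lra) (HT (x + v) ltac:(lra) ltac:(lra))).
    assert (Q3 := Fn_mono_n 0 (n + N) (x + v) ltac:(lra) ltac:(lia)). change (Fn 0 (x + v)) with (x + v) in Q3. lra.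
  - intros n u v Hu Hv E. rewrite !HO in E by auto.
    assert (x + u = x + v); [|lra]. apply (ray_inj (n + N) k s a Gam); auto; try lra.
    apply (Ray_sub N (n + N) k s a a); auto. lia. lra.
  - intro M. destruct (ray_close N k s a Gam a HR (Rle_refl a)) as (M0 & HNM & HM).
    destruct (Fn_unbounded x (M + 1) ltac:(lra)) as [N1 HN1]. exists (M0 + N1)%nat. intros n v Hn Hv. rewrite HO by auto.
    assert (Q := Hlow _ (x + v) (n + N)%nat ltac:(lra) (HM (n + N)%nat (x + v) ltac:(lia) ltac:(lra))).
    specialize (HN1 (n + N)%nat ltac:(lia)). assert (Q2 := Fn_mono (n + N) x (x + v) ltac:(lra)). lra.
Qed.

Lemma Ray_ext N k s a Gam Gam' : (forall n tau, (N <= n)%nat -> a <= tau -> Gam n tau = Gam' n tau) ->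
  Ray N k s a Gam -> Ray N k s a Gam'.
Proof.
  intros E (H1 & H2 & [M H3] & H4). split; [|split; [|split]].
  - intros n Hn. apply (ccont_ext _ (Gam n)); auto.
  - intros n tau Hn Ht. rewrite <- !E by (lia || auto). auto.
  - exists M. intros n tau Hn Hn' Ht. rewrite <- E by auto. auto.
  - intros n Hn. destruct (H4 n Hn) as [T HT]. exists T. intros tau H Ht. rewrite <- E by auto. auto.
Qed.

(** The ray on [(t_s, oo)] is glued from those on [[a, oo)]: the value at [tau] is taken from the
    ray whose domain begins at [tau], and [Ray_unique] makes the choices compatible. *)
Lemma full_ray k s t : ~ preperiodic s -> tracks k s t -> Rbar_lt (min_potential s) t ->
  exists Gam, forall a : R, Rbar_lt (min_potential s) a -> Ray 0 k s a Gam.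
Proof.
  intros Hnp HT Hlt.
  assert (Hex : forall a : R, exists Gam, Rbar_lt (min_potential s) a -> Ray 0 k s a Gam).
  { intro a. destruct (classic (Rbar_lt (min_potential s) a)) as [Ha|N].
    - destruct (Dom_between s a Ha) as (b & A & Hb & HD). destruct (Ray_exists k s b A a t HD Hb Hnp HT) as [Gam HR].
      exists Gam. auto.
    - exists (fun _ _ => RtoC 0). intro. contradiction. }
  apply functional_choice in Hex. destruct Hex as [g Hg].
  exists (fun n tau => g tau n tau). intros a Ha. apply (Ray_ext 0 k s a (g a)); auto.
  intros n tau _ Ht. destruct (Dom_between s a Ha) as (b & A & Hb & HD).
  assert (Hlt2 : Rbar_lt (min_potential s) tau). { eapply Rbar_lt_le_trans; [exact Ha|exact Ht]. }
  apply (Ray_unique 0 k s b A tau (g a) (g tau) HD); auto; try lra; try lia.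
  apply (Ray_sub 0 0 k s a tau); auto.
Qed.

Lemma min_potential_finite s t : Rbar_lt (min_potential s) t -> exists ts : R, min_potential s = Finite ts /\ 0 <= ts.
Proof.
  unfold min_potential. intro H. destruct (Glb_Rbar_correct (dominates s)) as [_ G].
  assert (L : Rbar_le 0 (Glb_Rbar (dominates s))). { apply G. intros x [Hx _]. left. exact Hx. }
  destruct (Glb_Rbar (dominates s)) as [ts| |]; simpl in *; try contradiction. exists ts. auto.
Qed.

Lemma dominates_ext s s' N t : (forall n, (N <= n)%nat -> s n = s' n) -> dominates s t -> dominates s' t.
Proof.
  intros E [H1 H2]. split; auto. apply (is_lim_seq_ext_loc (fun n => IZR (s n) / Nat.iter n F t)); auto.
  exists N. intros n Hn. now rewrite E.
Qed.

(** Along any ray curve through [k] every point has a potential, and this exceeds [t_s] because a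
    slower point still has a dominating one. Following the curve from [k] in both directions keeps
    it on [Gam 0]. *)
Lemma ray_trace_maximal k s t ts Gam del : min_potential s = Finite ts -> ts < t ->
  (forall a, ts < a -> Ray 0 k s a Gam) -> Gam O t = k -> is_ray_curve (expmap k) del -> on_curve del k ->
  forall z, on_curve del z -> exists x, ts < x /\ Gam O x = z.
Proof.
  intros Hm Htt HR H0 Hdel (u1 & Hu1 & E1) z (u & Hu & Ez).
  (* A tail that contains both [z] and [k]. *)
  set (w := Rmin u u1). assert (Hw : 0 < w) by (apply Rmin_glb_lt; auto).
  assert (Hwu : w <= u) by apply Rmin_l. assert (Hwu1 : w <= u1) by apply Rmin_r.
  destruct (ray_curve_potential k del w Hdel Hw) as (N & a1 & tau & t' & HT & B1 & B2 & B3 & Hd & Ht').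
  assert (Hlt : Rbar_lt (min_potential s) t) by (rewrite Hm; exact Htt).
  destruct (min_potential_finite s t Hlt) as (ts' & Hts' & Hpos). rewrite Hm in Hts'. injection Hts' as <-.
  assert (HRt := HR t Htt). destruct (ray_close 0 k s t Gam t HRt (Rle_refl t)) as (M & _ & HM).
  set (v1 := u1 - w). assert (Hv1 : 0 <= v1) by (unfold v1; lra).
  assert (Ek : del (w + v1) = k) by (unfold v1; now replace (w + (u1 - w)) with u1 by ring).
  assert (HO : forall n, Defs.iter (expmap k) n k = Gam n t).
  { intro n. rewrite <- H0 at 2. rewrite (Ray_orbit 0 k s t Gam 0 t n HRt) by (lia || lra). now rewrite Nat.add_0_r. }
  assert (HB1 : forall n, (N <= n)%nat -> Cmod (Gam n t - base a1 (tau v1) n)%C <= 1).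
  { intros n Hn. destruct (B1 v1 Hv1) as (_ & _ & Q). specialize (Q n Hn). rewrite Ek, HO in Q. auto. }
  assert (Ea : forall n, (N + M <= n)%nat -> a1 n = s n).
  { intros n Hn. apply (base_im_close a1 s (tau v1) t n n (Gam n t) (Gam n t)); auto. apply HB1; lia. apply HM. lia. lra. }
  assert (Eb : forall x n, (N + M <= n)%nat -> base a1 x n = base s x n). { intros x n Hn. unfold base. now rewrite Ea. }
  assert (Et : tau v1 = t).
  { apply (potential_unique s (N + M) (tau v1) t (fun n => Gam n t)).
    - apply B1; auto. - lra. - intros j Hj. rewrite <- Eb by auto. apply HB1. lia. - intros j Hj. apply HM. lia. lra. }
  assert (Hds : dominates s t') by (apply (dominates_ext a1 s (N + M)); auto).
  destruct (dominates_Dom s t' Hds) as [A HD].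
  set (a := (t' + tau 0) / 2).
  assert (Htst' : ts <= t'). { assert (G := proj1 (Glb_Rbar_correct (dominates s)) t' Hds). unfold min_potential in Hm. rewrite Hm in G. exact G. }
  assert (Hge : forall v, 0 <= v -> tau 0 <= tau v). { intros v Hv. destruct (Req_dec v 0) as [->|Ne]. lra. left. apply B2; lra. }
  assert (Hfol := tail_follow 0 k s t' A a Gam 0 (fun v => del (w + v)) tau v1 HD ltac:(unfold a; lra)
    (HR a ltac:(unfold a; lra)) (Nat.le_refl _) ltac:(apply HT)).
  exists (tau (u - w)). split. { assert (Q := Hge (u - w) ltac:(lra)). lra. }
  assert (E := Hfol ltac:(intros v Hv; specialize (Hge v Hv); unfold a; lra) B3).
  cbv beta in E. rewrite Ek, Et, H0 in E.
  assert (E' : (del (w + (u - w))%R - Gam O (tau (u - w)%R))%C = (k - k)%C).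
  { apply E; try lra; auto.
    - exists (N + M)%nat. intros j v Hj Hv. rewrite Nat.add_0_r, <- Eb by auto. apply B1; auto. lia.
    - intros j Hj. rewrite Nat.add_0_r. apply HO. }
  replace (w + (u - w)) with u in E' by ring. rewrite Ez in E'.
  symmetry. apply Csub_eq. rewrite E'. ring.
Qed.

(** A path in the preimage of the half plane cannot cross the boundary lines of the strip: [exp] is
    negative there, so [f] has real part less than that of [k]. *)
Lemma component_in_strip k r n z0 T : ~ half_plane r k -> half_plane r (expmap k z0) ->
  (forall w, T w <-> path_connected_in (fun z => half_plane r (expmap k z)) z0 w) ->
  Rabs (Im z0 - 2 * PI * IZR n) <= 1 -> forall w, T w -> strip n w.
Proof.
  unfold half_plane. intros Hr Hz0 HT HI w Hw. apply HT in Hw. destruct Hw as (p & Hc & Hp & P0 & P1).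
  apply continuous_on_ccont in Hc. assert (Ppi := PI_gt_3).
  set (g := fun u => Im (p (Rmax 0 (Rmin 1 u))) - 2 * PI * IZR n).
  assert (Hcl : forall u, 0 <= Rmax 0 (Rmin 1 u) <= 1).
  { intro u. split. apply Rmax_l. apply Rmax_lub. lra. apply Rmin_l. }
  assert (Hg : continuity g).
  { intros x e He. destruct (Hc _ (Hcl x) e He) as (d & Hd & Q). exists d. split; auto. intros y [_ Hy].
    change (Rabs (y - x) < d) in Hy. change (Rabs (g y - g x) < e). unfold g.
    replace (Im (p (Rmax 0 (Rmin 1 y))) - 2 * PI * IZR n - (Im (p (Rmax 0 (Rmin 1 x))) - 2 * PI * IZR n))
      with (Im (p (Rmax 0 (Rmin 1 y)) - p (Rmax 0 (Rmin 1 x)))%C) by (rewrite im_minus; ring).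
    eapply Rle_lt_trans; [apply im_le_Cmod|]. apply Q; auto. eapply Rle_lt_trans; [|exact Hy].
    unfold Rmax, Rmin. repeat destruct Rle_dec; unfold Rabs; repeat destruct Rcase_abs; lra. }
  assert (Hne : forall u, Rabs (g u) <> PI).
  { intros u E. set (v := Rmax 0 (Rmin 1 u)) in *. specialize (Hp v (Hcl u)). unfold expmap in Hp. rewrite re_plus in Hp.
    assert (E1 : Cexp (p v - twopii n)%C = Cexp (p v)).
    { replace (p v) with ((p v - twopii n) + twopii n)%C at 2 by ring. now rewrite twopii_exp. }
    rewrite <- E1, re_Cexp, im_minus in Hp. change (Im (twopii n)) with (2 * PI * IZR n) in Hp. fold v in E. unfold g in E. fold v in E.
    assert (C : cos (Im (p v) - 2 * PI * IZR n) = -1).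
    { unfold Rabs in E. destruct Rcase_abs. rewrite <- cos_neg, E. apply cos_PI. rewrite E. apply cos_PI. }
    rewrite C in Hp. assert (X := exp_pos (Re (p v - twopii n)%C)). lra. }
  assert (G0 : Rabs (g 0) <= 1). { unfold g. rewrite Rmin_right, Rmax_left by lra. rewrite P0. auto. }
  assert (G1 : g 1 = Im w - 2 * PI * IZR n). { unfold g. rewrite Rmin_left, Rmax_right by lra. now rewrite P1. }
  apply Rabs_le_between in G0.
  assert (A : - PI < g 1 < PI).
  { split; apply Rnot_le_lt; intro L.
    - destruct (IVT_cor (fun u => g u + PI) 0 1) as (u & _ & Eu).
      + apply (continuity_plus g (fun _ => PI)); auto. apply continuity_const. intros ? ?; reflexivity.
      + lra.
      + nra.
      + apply (Hne u). replace (g u) with (- PI) by lra. rewrite Rabs_Ropp. apply Rabs_pos_eq. lra.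
    - destruct (IVT_cor (fun u => g u - PI) 0 1) as (u & _ & Eu).
      + apply (continuity_minus g (fun _ => PI)); auto. apply continuity_const. intros ? ?; reflexivity.
      + lra.
      + nra.
      + apply (Hne u). replace (g u) with PI by lra. apply Rabs_pos_eq. lra. }
  unfold strip. lra.
Qed.

Lemma ray_in_tract k s a Gam t r n : 0 < a -> Ray 0 k s a Gam -> a <= t -> ~ half_plane r k ->
  exists t0, 0 <= t0 /\ forall v, t0 <= v -> tract k r (s n) (Gam n (t + v)).
Proof.
  intros Ha HR Ht Hr. assert (HR' := HR). destruct HR' as (H1 & H2 & _ & H4).
  destruct (H4 n ltac:(lia)) as [T HT]. destruct (H4 (S n) ltac:(lia)) as [T' HT'].
  set (t0 := Rabs T + Rabs T' + Rabs r + 2). exists t0.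
  assert (P1 := Rabs_pos T). assert (P2 := Rabs_pos T'). assert (P3 := Rabs_pos r).
  assert (Q1 := Rle_abs T). assert (Q2 := Rle_abs T'). assert (Q3 := Rle_abs r).
  split; [unfold t0; lra|]. intros v Hv.
  assert (HA : forall x, t0 <= x -> half_plane r (expmap k (Gam n (t + x)))).
  { intros x Hx. rewrite H2 by (lia || (unfold t0 in *; lra)). unfold half_plane.
    assert (B := HT' (t + x) ltac:(unfold t0 in *; lra) ltac:(unfold t0 in *; lra)).
    assert (R1 := Cmod_re_lower (base s (t + x) (S n)) (Gam (S n) (t + x))).
    change (Re (base s (t + x) (S n))) with (Fn (S n) (t + x)) in R1.
    assert (F0 := Fn_mono_n 0 (S n) (t + x) ltac:(unfold t0 in *; lra) ltac:(lia)). change (Fn 0 (t + x)) with (t + x) in F0.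
    unfold t0 in *. lra. }
  set (A := fun z => half_plane r (expmap k z)).
  exists (path_connected_in A (Gam n (t + t0))). split; [|split].
  - exists (Gam n (t + t0)). split. apply HA. lra. intro w. tauto.
  - apply (component_in_strip k r (s n) (Gam n (t + t0))); auto. apply HA; lra. intro w. fold A. tauto.
    assert (B := HT (t + t0) ltac:(unfold t0; lra) ltac:(unfold t0; lra)).
    assert (I := im_le_Cmod (Gam n (t + t0)%R - base s (t + t0)%R n)%C). rewrite im_minus in I.
    change (Im (base s (t + t0) n)) with (2 * PI * IZR (s n)) in I. lra.
  - exists (fun u => Gam n (t + (t0 + u * (v - t0)))). split; [|split; [|split]].
    + apply continuous_on_ccont. intros u Hu e He.
      assert (Hx : from a (t + (t0 + u * (v - t0)))). { unfold from. assert (0 <= u * (v - t0)) by (apply Rmult_le_pos; lra). unfold t0 in *; lra. }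
      destruct (H1 n ltac:(lia) _ Hx e He) as (d & Hd & Q). exists (d / (v - t0 + 1)). split. { apply Rdiv_lt_0_compat; lra. }
      intros y Hy Hyu. apply Q.
      * unfold from. assert (0 <= y * (v - t0)) by (apply Rmult_le_pos; lra). unfold t0 in *; lra.
      * replace (t + (t0 + y * (v - t0)) - (t + (t0 + u * (v - t0)))) with ((y - u) * (v - t0)) by ring.
        rewrite Rabs_mult, (Rabs_pos_eq (v - t0)) by lra.
        apply Rmult_lt_compat_r with (r := v - t0 + 1) in Hyu; [|lra].
        replace (d / (v - t0 + 1) * (v - t0 + 1)) with d in Hyu by (field; lra).
        assert (P := Rabs_pos (y - u)). lra.
    + intros u Hu. apply HA. assert (0 <= u * (v - t0)) by (apply Rmult_le_pos; lra). lra.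
    + f_equal. ring.
    + f_equal. ring.
Qed.

Lemma ray_escapes s b A a t k : Dom s b A -> b < a -> a <= t -> ~ preperiodic s -> on_ray s a t k -> singular_value_escapes k s t.
Proof.
  intros HD Hb Ht Hnp (Gam0 & HR0 & H00).
  assert (HT : tracks k s t) by (apply (on_ray_tracks s a); auto; exists Gam0; auto).
  assert (Ha : Rbar_lt (min_potential s) a). { apply min_potential_lt. exists ((b + a) / 2). split. lra. apply (Dom_dominates s b A); auto; lra. }
  assert (Hlt : Rbar_lt (min_potential s) t) by (eapply Rbar_lt_le_trans; [exact Ha|exact Ht]).
  destruct (full_ray k s t Hnp HT Hlt) as (Gam & HR).
  destruct (min_potential_finite s t Hlt) as (ts & Ets & Hts). rewrite Ets in *. simpl in Ha, Hlt.
  assert (HG0 : Gam O t = k). { rewrite <- H00. apply (Ray_unique 0 k s b A a Gam Gam0); auto. }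
  assert (HR' : forall x, ts < x -> Ray 0 k s x Gam) by (intros x Hx; apply HR; exact Hx).
  assert (HO : forall n, Gam n t = Defs.iter (expmap k) n k).
  { intro n. rewrite <- HG0 at 2. rewrite (Ray_orbit 0 k s t Gam 0 t n (HR' t Hlt)) by (lia || lra). now rewrite Nat.add_0_r. }
  assert (Htail : forall n x, ts < x -> Tail k (fun v => Gam n (x + v))).
  { intros n x Hx. apply (ray_tail n k s x Gam x). lra. apply (Ray_sub 0 n k s x x); auto. lia. lra. lra. }
  (* The dynamic ray comprises all potentials above [t_s], shifted so that the parameter interval is
     [(0, oo)]. *)
  assert (Hcurve : is_ray_curve (expmap k) (fun u => Gam O (ts + u))).
  { split; [|split; [|split]].
    - apply continuous_on_ccont. intros x Hx e He. destruct (HR' (ts + x / 2) ltac:(lra)) as (H1 & _).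
      destruct (H1 O ltac:(lia) (ts + x) ltac:(unfold from; lra) e He) as (d & Hd & Q). exists (Rmin d (x / 2)).
      split. { apply Rmin_glb_lt; lra. } assert (M1 := Rmin_l d (x / 2)). assert (M2 := Rmin_r d (x / 2)).
      intros y Hy Hyx. apply Q. { unfold from. assert (B : Rabs (y - x) < x / 2) by lra. apply Rabs_lt_between in B. lra. }
      replace (ts + y - (ts + x)) with (y - x) by ring. lra.
    - intros x y Hx Hy E. assert (ts + x = ts + y); [|lra]. set (m := Rmin x y).
      assert (M1 : m <= x) by apply Rmin_l. assert (M2 : m <= y) by apply Rmin_r. assert (M3 : 0 < m) by (apply Rmin_glb_lt; auto).
      apply (ray_inj 0 k s (ts + m) Gam); auto; try lra. apply HR'. lra.
    - intros x Hx. destruct (Htail O (ts + x) ltac:(lra)) as (_ & _ & _ & H). apply is_lim_seq_pp.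
      intro M. destruct (H M) as [N HN]. exists N. intros n Hn. specialize (HN n 0 Hn ltac:(lra)).
      replace (ts + x + 0) with (ts + x) in HN by ring. exact HN.
    - intros x Hx. apply Tail_iff. assert (Q := Htail O (ts + x) ltac:(lra)).
      replace (fun v => Gam O (ts + (x + v))) with (fun v => Gam O (ts + x + v)); auto.
      apply functional_extensionality. intro v. f_equal. ring. }
  assert (Hon : on_curve (fun u => Gam O (ts + u)) k).
  { exists (t - ts). split. lra. now replace (ts + (t - ts)) with t by ring. }
  assert (Hesc : escapes_on_rays (expmap k) k).
  { split.
    - destruct Hcurve as (_ & _ & H & _). destruct Hon as (u & Hu & E). rewrite <- E at 2. auto.
    - exists (fun u => Gam O (ts + u)). split; auto. split; auto.
      intros del Hdel Hsub z Hz.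
      destruct (ray_trace_maximal k s t ts Gam del Ets Hlt HR' HG0 Hdel (Hsub k Hon) z Hz) as (x & Hx & E).
      exists (x - ts). split. lra. now replace (ts + (x - ts)) with x by ring. }
  assert (Hadd : has_address k k s).
  { split; auto. intros r Hr n. exists (fun v => Gam n (t + v)). split; [|split].
    - apply Tail_iff. apply Htail. exact Hlt.
    - exists 0. split. lra. rewrite Rplus_0_r. apply HO.
    - apply (ray_in_tract k s t Gam t r n); auto; lra. }
  split; auto. split; auto. split; auto. apply (tracks_limit s b A); auto. lra.
Qed.

Lemma address_tail k z s n : has_address k z s -> exists c, Tail k c /\ c 0 = Defs.iter (expmap k) n z /\
  exists V, forall v, V <= v -> Rabs (Im (c v) - 2 * PI * IZR (s n)) < PI / 2.
Proof.
  (* [Re k] is the least admissible [r]. *)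
  intros [_ H]. destruct (H (Re k) ltac:(unfold half_plane; lra) n) as (gam & HT & (u & Hu & Eu) & (t0 & Ht0 & Htr)).
  exists (fun v => gam (u + v)). split; [|split].
  - apply Tail_shift; auto. apply Tail_iff. auto.
  - now rewrite Rplus_0_r.
  - exists t0. intros v Hv. apply (tract_im k (Re k)). unfold half_plane; lra. apply Htr. lra.
Qed.

(** Tracking determines only the high part of the orbit; the address fixes the rest, level by level
    downwards. The tail through [f^n(k)] runs along [Gam n] up to a period, and as both end in the
    strip of [s n], the period is 0. *)
Lemma escapes_ray s b A a t k : Dom s b A -> b < a -> a <= t -> ~ preperiodic s -> singular_value_escapes k s t -> on_ray s a t k.
Proof.
  intros HD Hb Ht Hnp (_ & [Hadd Hlim] & _). assert (HT := limit_tracks s t k Hlim).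
  destruct (Ray_exists k s b A a t HD Hb Hnp HT) as [Gam HR]. exists Gam. split; auto.
  destruct (orbit_is_G s b A t k HD ltac:(lra) HT) as (N & HS & HE).
  assert (HN : forall n, (N <= n)%nat -> Gam n t = Defs.iter (expmap k) n k).
  { intros n Hn. rewrite HE by auto. apply (Ray_unique N k s b A t Gam (fun n tau => G s k tau n)); auto; try lra.
    apply (Ray_sub 0 N k s a t); auto. lia. apply (Ray_G s (Cmod k) N); auto. apply Cmod_ge_0. lra. }
  assert (D : forall n, (0 <= n)%nat -> forall m, (n <= m)%nat -> Gam m t = Defs.iter (expmap k) m k).
  { apply (desc_ind (fun n => forall m, (n <= m)%nat -> Gam m t = Defs.iter (expmap k) m k) 0 N).
    - intros n Hn _ m Hm. apply HN. lia.
    - intros n _ IH m Hm. destruct (Nat.eq_dec m n) as [->|Ne]; [|apply IH; lia].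
      destruct (address_tail k k s n Hadd) as (c & Hc & Hc0 & V & HV).
      assert (HRn : Ray n k s a Gam) by (apply (Ray_sub 0 n k s a a); auto; lia || lra).
      destruct (tail_align s b A a k c n t Gam HD Hb Ht Hc) as (tau & T1 & T2 & T3); auto.
      + destruct HT as [N0 HN0]. exists N0. intros j Hj. rewrite Hc0, <- iter_add. apply HN0. lia.
      + intros j Hj. rewrite Hc0, <- iter_add. symmetry. apply IH. lia.
      + rewrite Hc0 in T3.
        assert (E : Cexp (Defs.iter (expmap k) n k) = Cexp (Gam n t)).
        { assert (E1 := IH (S n) (Nat.le_refl _)). rewrite iter_S in E1. destruct HR as (_ & H2 & _). rewrite <- H2 in E1 by (lia || lra).
          change (Cexp (Gam n t) + k = Cexp (Defs.iter (expmap k) n k) + k)%C in E1. replace (Cexp (Gam n t)) with (Cexp (Gam n t) + k - k)%C by ring. rewrite E1. ring. }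
        destruct (Cexp_inj_mod _ _ E) as [m Em].
        destruct HR as (_ & _ & _ & H4). destruct (H4 n ltac:(lia)) as [T HTT]. destruct (T2 T) as [V2 HV2].
        set (v := Rmax 0 (Rmax V V2)). assert (L0 := Rmax_l 0 (Rmax V V2)). assert (L1 := Rmax_r 0 (Rmax V V2)).
        assert (L2 := Rmax_l V V2). assert (L3 := Rmax_r V V2). fold v in L0, L1.
        specialize (HV v ltac:(lra)). specialize (HV2 v ltac:(lra) L0). specialize (T1 v L0). specialize (T3 v L0). rewrite Em in T3.
        assert (B := HTT (tau v) HV2 ltac:(lra)). assert (I := im_le_Cmod (Gam n (tau v) - base s (tau v) n)%C).
        rewrite im_minus in I. change (Im (base s (tau v) n)) with (2 * PI * IZR (s n)) in I.
        assert (T4 := f_equal Im T3). rewrite im_minus in T4. change (Im (twopii m)) with (2 * PI * IZR m) in T4.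
        assert (P := PI_gt_3). apply Rabs_lt_between in HV.
        assert (B' : Rabs (Im (Gam n (tau v)) - 2 * PI * IZR (s n)) <= 1) by lra. apply Rabs_le_between in B'.
        assert (m < 1)%Z by (apply lt_IZR; nra). assert (-1 < m)%Z by (apply lt_IZR; nra). assert (m = 0%Z) by lia. subst m.
        symmetry. apply Csub_eq. rewrite Em. apply Cext; unfold twopii; simpl; ring. }
  rewrite (D O ltac:(lia) O ltac:(lia)). reflexivity.
Qed.

(** The ray through [k] provides a potential with respect to some address [a], the ray tails in the
    tracts provide [s]. Aligning each of the latter with [G] for [a] gives [a p = s p] for all large
    [p], and domination and tracking depend on such entries only. *)
Lemma escaping_parameter k s : escapes_on_rays (expmap k) k -> has_address k k s ->
  exists t t', t' < t /\ dominates s t' /\ tracks k s t.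
Proof.
  intros [_ (del & [Hdel _] & (u & Hu & Eu))] Hadd.
  destruct (ray_curve_potential k del u Hdel Hu) as (N & a & tau & t' & _ & B1 & _ & _ & Hd & Ht').
  set (t := tau 0) in *. destruct (dominates_Dom a t' Hd) as [A HD].
  assert (HB : forall n, (N <= n)%nat -> Cmod (Defs.iter (expmap k) n k - base a t n)%C <= 1).
  { intros n Hn. destruct (B1 0 ltac:(lra)) as (_ & _ & Q). specialize (Q n Hn). now rewrite Rplus_0_r, Eu in Q. }
  set (a0 := (t' + t) / 2). assert (Ha0 : t' < a0) by (unfold a0; lra). assert (Ha1 : a0 <= t) by (unfold a0; lra).
  assert (HT : tracks k a t) by (exists N; auto).
  destruct (orbit_is_G a t' A t k HD ltac:(lra) HT) as (N1 & HS1 & HE).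
  destruct (St_of_Dom a t' A a0 (Cmod k) HD Ha0) as [N2 HS2].
  assert (Es : forall p, (N + N1 + N2 <= p)%nat -> a p = s p).
  { intros p Hp. destruct (address_tail k k s p Hadd) as (c & Hc & Hc0 & V & HV).
    assert (HRp : Ray p k a a0 (fun n tau => G a k tau n)).
    { apply (Ray_G a (Cmod k) p). apply Cmod_ge_0. apply (St_N a _ N2); auto; lia. lra. }
    destruct (tail_align a t' A a0 k c p t (fun n tau => G a k tau n) HD Ha0 Ha1 Hc) as (ta & T1 & T2 & T3); auto.
    - exists N. intros j Hj. rewrite Hc0, <- iter_add. apply HB. lia.
    - intros j Hj. rewrite Hc0, <- iter_add. apply HE. lia.
    - destruct HRp as (_ & _ & _ & H4). destruct (H4 p (Nat.le_refl p)) as [T HTT]. destruct (T2 T) as [V2 HV2].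
      set (v := Rmax 0 (Rmax V V2)). assert (L0 := Rmax_l 0 (Rmax V V2)). assert (L1 := Rmax_r 0 (Rmax V V2)).
      assert (L2 := Rmax_l V V2). assert (L3 := Rmax_r V V2). fold v in L0, L1.
      specialize (HV v ltac:(lra)). specialize (HV2 v ltac:(lra) L0). specialize (T1 v L0). specialize (T3 v L0).
      rewrite Hc0, <- HE in T3 by lia. replace (Defs.iter (expmap k) p k - Defs.iter (expmap k) p k)%C with (RtoC 0) in T3 by ring.
      assert (E : c v = G a k (ta v) p) by (apply Csub_eq; auto).
      assert (B := HTT (ta v) HV2 ltac:(lra)). cbv beta in B. rewrite <- E in B. assert (I := im_le_Cmod (c v - base a (ta v) p)%C).
      rewrite im_minus in I. change (Im (base a (ta v) p)) with (2 * PI * IZR (a p)) in I.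
      assert (P := PI_gt_3). apply Rabs_lt_between in HV.
      assert (B' : Rabs (Im (c v) - 2 * PI * IZR (a p)) <= 1) by lra. apply Rabs_le_between in B'.
      assert (D : IZR (a p - s p) = IZR (a p) - IZR (s p)) by apply minus_IZR.
      assert (a p - s p < 1)%Z by (apply lt_IZR; rewrite D; nra). assert (-1 < a p - s p)%Z by (apply lt_IZR; rewrite D; nra). lia. }
  exists t, t'. split; auto. split. apply (dominates_ext a s (N + N1 + N2)); auto.
  exists (N + N1 + N2)%nat. intros n Hn. assert (B := HB n ltac:(lia)). unfold base in *. now rewrite Es in B.
Qed.

Theorem theorem1p1 :
  (forall (s : address) (t : R),
     exponentially_bounded s -> ~ preperiodic s ->
     Rbar_lt (min_potential s) (Finite t) ->
     exists! kappa : C, singular_value_escapes kappa s t)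
  /\
  (forall kappa : C,
     escapes_on_rays (expmap kappa) kappa ->
     (exists s : address, has_address kappa kappa s /\ ~ preperiodic s) ->
     exists (s : address) (t : R),
       exponentially_bounded s /\ ~ preperiodic s /\
       Rbar_lt (min_potential s) (Finite t) /\
       singular_value_escapes kappa s t).
Proof.
  split.
  - intros s t _ Hnp Hlt. destruct (Dom_between s t Hlt) as (b & A & Hb & HD).
    set (a := (b + t) / 2). assert (Ha : b < a) by (unfold a; lra). assert (Hat : a < t) by (unfold a; lra).
    destruct (param_exists_unique s b A a t HD Ha Hat Hnp) as (k & Hk & Hu).
    exists k. split.
    + apply (ray_escapes s b A a t k); auto. lra.
    + intros k' Hk'. symmetry. apply Hu. apply (escapes_ray s b A a t k'); auto. lra.
  - intros k Hesc (s & Hadd & Hnp). destruct (escaping_parameter k s Hesc Hadd) as (t & t' & Ht & Hd & HT).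
    destruct (dominates_Dom s t' Hd) as [A HD].
    exists s, t. split; [exists t'; auto|]. split; [auto|]. split.
    + apply min_potential_lt. exists t'. auto.
    + split; [auto|]. split; [split; [auto|]|auto]. apply (tracks_limit s t' A); auto.
Qed.
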